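(* Fix $\beta>0$. With $\Lambda_0(\beta,a)$ the smallest eigenvalue of $\mathfrak{G}_{\beta,a}$ and $TW_\beta$ the general beta Tracy–Widom law, $$\frac{\eta-\Lambda_0\big(\beta,2\sqrt\eta-\tfrac{2}{\beta}\big)}{\eta^{2/3}}\Rightarrow TW_\beta$$ in distribution as $\eta\to\infty$.
   Context: For $a>-1$, $\Lambda_0(\beta,a)$ is the smallest eigenvalue of the random operator $\mathfrak{G}_{\beta,a}$: with $b$ a standard Brownian motion, $m(dx)=e^{-(a+1)x-\frac{2}{\sqrt\beta}b(x)}dx$ and $s(dx)=e^{ax+\frac{2}{\sqrt\beta}b(x)}dx$ on $[0,\infty)$, $\lambda$ is an eigenvalue iff there is $0\ne\psi\in L^2(\mathbb{R}_+,m)$ with $\psi(x)=\lambda\int_0^\infty(\int_0^{x\wedge y}s(dz))\psi(y)\,m(dy)$. (For $\eta$ large, $a=2\sqrt\eta-2/\beta>-1$.) $TW_\beta$ is the law of the top eigenvalue of the random Schrödinger operator $\frac{d^2}{dx^2}-x+\frac{2}{\sqrt\beta}b'(x)$ on $[0,\infty)$ with Dirichlet condition at $0$; equivalently, $P(TW_\beta<\mu)$ equals the probability that the diffusion $dq(x)=\frac{2}{\sqrt\beta}db(x)+(x+\mu-q^2(x))dx$ started from $+\infty$ at $x=0$ never hits $-\infty$. *)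

(* Defs.v *)
From HB Require Import structures.
From mathcomp Require Import all_boot all_order all_algebra.
From mathcomp Require Import all_classical all_reals all_analysis.
Set Implicit Arguments. Unset Strict Implicit. Unset Printing Implicit Defensive.
Import Order.TTheory GRing.Theory Num.Def Num.Theory.
Import numFieldNormedType.Exports.
Local Open Scope classical_set_scope.
Local Open Scope ring_scope.

Section defs.
Context {R : realType}.
Local Notation mu := (@lebesgue_measure R).
Local Notation Rp := (`[0, +oo[%classic : set R).

Definition is_brownian_motion d (T : measurableType d) (P : probability T R)
    (b : R -> T -> R) : Prop :=
  [/\ (forall w, b 0 w = 0),
      (forall w, {within (`[0, +oo[%classic : set R), continuous (fun x => b x w)}),
      (forall t, measurable_fun setT (b t)),
      (forall s t, 0 <= s -> s < t -> forall A : set R, measurable A ->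
          P [set w | b t w - b s w \in A] = normal_prob 0 (Num.sqrt (t - s)) A) &
      (forall (n : nat) (t : nat -> R) (A : nat -> set R),
          0 <= t 0%N -> (forall i, t i < t i.+1) -> (forall i, measurable (A i)) ->
          P (\bigcap_(i in `I_n) [set w | b (t i.+1) w - b (t i) w \in A i])
          = \big[*%E/1%E]_(i < n) P [set w | b (t i.+1) w - b (t i) w \in A i])].

Definition noise_coef (beta : R) : R := 2 / Num.sqrt beta.

Definition dens_m (beta a : R) (B : R -> R) (x : R) : R :=
  expR (- (a + 1) * x - noise_coef beta * B x).

Definition dens_s (beta a : R) (B : R -> R) (x : R) : R :=
  expR (a * x + noise_coef beta * B x).

Definition scale_fun (beta a : R) (B : R -> R) (x : R) : R :=
  Rintegral mu (`[0, x]%classic : set R) (dens_s beta a B).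

Definition G_integrand (beta a : R) (B : R -> R) (psi : R -> R) (x y : R) : R :=
  scale_fun beta a B (Order.min x y) * psi y * dens_m beta a B y.

Definition is_eigenvalue (beta a : R) (B : R -> R) (lambda : R) : Prop :=
  exists psi : R -> R,
    [/\ measurable_fun Rp psi,
        mu.-integrable Rp (fun y => (psi y ^+ 2 * dens_m beta a B y)%:E),
        0 < Rintegral mu Rp (fun y => psi y ^+ 2 * dens_m beta a B y),
        (forall x, 0 <= x ->
           mu.-integrable Rp (fun y => (G_integrand beta a B psi x y)%:E)) &
        (forall x, 0 <= x ->
           psi x = lambda * Rintegral mu Rp (G_integrand beta a B psi x))].

Definition Lambda0 (beta a : R) (B : R -> R) : R :=
  inf [set lambda | is_eigenvalue beta a B lambda].

(** The diffusion dq = (2/sqrt beta) db + (x + mu - q^2) dx, started from +oo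
    at x = 0, never hits -oo (for the path B): there is a (finite, continuous)
    solution on the whole of (0, oo) which tends to +oo as x -> 0+. *)
Definition TW_survives (beta mu0 : R) (B : R -> R) : Prop :=
  exists q : R -> R,
    [/\ {in `]0, +oo[, continuous q},
        (forall x0 x, 0 < x0 -> x0 <= x ->
           q x = q x0 + noise_coef beta * (B x - B x0)
                 + Rintegral mu (`[x0, x]%classic : set R) (fun t => t + mu0 - q t ^+ 2)) &
        q x @[x --> 0^'+] --> +oo].

End defs.

(* Main.v *)
(* An eigenvalue of G_{beta,a} is a lambda for which the solution of the string equation psi' = s pi,
   pi' = - lambda m psi, psi(0) = 0, pi(0) = 1 has psi in L^2(m) and pi -> 0; the lowest one is the first
   lambda at which pi ceases to be positive. By Brownian scaling b may be replaced by d b(x / d^2) with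
   d = eta^(-1/6). With lambda = eta - mu eta^(2/3), x = d^2 t and the leading exponentials divided out, the
   string equation becomes, path by path, an O(d) perturbation of u' = c b u + w,
   w' = (t + mu - c^2 b^2) u - c b w, whose logarithmic derivative u'/u is the Riccati diffusion: it survives
   iff u > 0 on (0, oo). If u becomes negative, so does pi for small d, hence Lambda0 <= lambda. If u stays
   positive for some mu' < mu, then at mu it eventually dominates an explicit barrier, which keeps pi positive
   up to x = d^(-2), after which the drift takes over, hence Lambda0 > lambda. This uses only the almost sure
   growth bounds b(t)^4 = o(t^3) and o(sqrt t) oscillation on unit intervals. The probabilities are
   therefore squeezed between those of survival at mu' < mu and at mu, which agree in the limit at continuity
   points. Lambda0 is measurable for all paths because the eigenvalue condition can be written with closed
   conditions in lambda. *)
Require Import Defs.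
From HB Require Import structures.
From mathcomp Require Import all_boot all_order all_algebra.
From mathcomp Require Import all_classical all_reals all_analysis.
From mathcomp Require Import measurable_realfun ring lra.
Import Order.TTheory GRing.Theory Num.Def Num.Theory.
Import numFieldNormedType.Exports.
Local Open Scope classical_set_scope.
Local Open Scope ring_scope.
Set Implicit Arguments.
Unset Strict Implicit.
Unset Printing Implicit Defensive.

(** * Calculus on the line *)

(** The noise is additive, so the pair (u, w) with w = u' - c b u needs no stochastic calculus:
    every pathwise statement concerns one continuous path. Convergence on compact windows is not
    enough, because the eigenvalue condition sits at infinity; the exponents decide how the
    half-line is cut. With t = x / d^2, the bound b(t)^4 <= e t^3 gives (d b(t))^4 <= e x^3 / d^2,
    which is at most e x^4 exactly from x = d^(-2) on, while x <= d^(-2) means d^2 sqrt t <= 1,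
    which is what the barrier tolerates. Survival is used at a strictly smaller parameter because at
    a critical one u may be the recessive solution, whose positivity in the limit says nothing about
    small d. Brownian scaling is an identity in law only, so it acts on measurable sets of paths;
    this is why the measurability of Lambda0, an infimum over uncountably many conditions, is
    established for arbitrary continuous paths. *)

HB.lock Definition prim (R : realType) (h : R -> R) (x : R) : R :=
  if 0 <= x then \int[@lebesgue_measure R]_(t in `[0, x]) h t
  else - \int[@lebesgue_measure R]_(t in `[x, 0]) h t.

Section calculus.
Context {R : realType}.
Implicit Types (f g h : R -> R) (x a b l m : R).
Local Notation mu := (@lebesgue_measure R).

(* Wrapping continuity and derivability in records keeps them opaque to unification. *)
Record cts f : Prop := Cts { ctsP : forall x, {for x, continuous f} }.
Record der f x l : Prop := Der { derP : is_derive x (1 : R) (f : R -> R) l }.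

Lemma cts_within f (A : set R) : cts f -> {within A, continuous f}.
Proof. by move=> [cf]; apply: continuous_subspaceT. Qed.

Lemma eq_cts f g : f =1 g -> cts f -> cts g.
Proof. by move=> /funext <-. Qed.

Lemma cts_cst a : cts (fun=> a).
Proof. by split=> x; apply: cst_continuous. Qed.

Lemma cts_id : cts (fun x => x).
Proof. by split=> x; apply: cvg_id. Qed.

Lemma ctsD f g : cts f -> cts g -> cts (fun x => f x + g x).
Proof. by move=> [cf] [cg]; split=> x; apply: continuousD; [apply: cf|apply: cg]. Qed.

Lemma ctsN f : cts f -> cts (fun x => - f x).
Proof. by move=> [cf]; split=> x; apply: continuousN; apply: cf. Qed.

Lemma ctsB f g : cts f -> cts g -> cts (fun x => f x - g x).
Proof. by move=> cf cg; apply: ctsD => //; exact: ctsN. Qed.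

Lemma ctsM f g : cts f -> cts g -> cts (fun x => f x * g x).
Proof. by move=> [cf] [cg]; split=> x; apply: continuousM; [apply: cf|apply: cg]. Qed.

Lemma cts_comp f g : cts f -> cts g -> cts (fun x => g (f x)).
Proof. by move=> [cf] [cg]; split=> x; apply: continuous_comp; [apply: cf|apply: cg]. Qed.

Lemma ctsZ a f : cts f -> cts (fun x => a * f x).
Proof. by move=> cf; apply: ctsM => //; exact: cts_cst. Qed.

Lemma cts_sqr f : cts f -> cts (fun x => f x ^+ 2).
Proof. by move=> cf; apply: eq_cts (ctsM cf cf) => x; rewrite expr2. Qed.

Lemma cts_exp f : cts f -> cts (fun x => expR (f x)).
Proof. by move=> cf; apply: (cts_comp cf); split=> x; apply: continuous_expR. Qed.

Lemma cts_norm f : cts f -> cts (fun x => `|f x|).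
Proof. by move=> cf; apply: (cts_comp cf); split=> x; apply: norm_continuous. Qed.

Lemma ge1_expR x : 0 <= x -> 1 <= expR x.
Proof. by move=> x0; rewrite -expR0 ler_expR. Qed.

Lemma der_eq f x l m : der f x l -> l = m -> der f x m.
Proof. by move=> ? <-. Qed.

Lemma eq_der f g x l : f =1 g -> der f x l -> der g x l.
Proof. by move=> /funext <-. Qed.

Lemma near_eq_der f g x l : (\forall y \near x, f y = g y) -> der f x l -> der g x l.
Proof. by move=> fg [df]; split; apply: near_eq_is_derive fg df. Qed.

Lemma der_cst a x : der (fun=> a) x 0.
Proof. by split; apply: is_derive_cst. Qed.

Lemma der_id x : der (fun y => y) x 1.
Proof. by split; apply: is_derive_id. Qed.

Lemma derD f g x l m : der f x l -> der g x m -> der (fun y => f y + g y) x (l + m).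
Proof. by move=> [df] [dg]; split; apply: is_deriveD. Qed.

Lemma derN f x l : der f x l -> der (fun y => - f y) x (- l).
Proof. by move=> [df]; split; apply: is_deriveN. Qed.

Lemma derB f g x l m : der f x l -> der g x m -> der (fun y => f y - g y) x (l - m).
Proof. by move=> df dg; apply: derD => //; exact: derN. Qed.

Lemma derM f g x l m : der f x l -> der g x m ->
  der (fun y => f y * g y) x (l * g x + f x * m).
Proof.
move=> [df] [dg]; split; apply: (@is_derive_eq _ _ _ _ _ _ _ _ (is_deriveM df dg)).
by rewrite /GRing.scale /= addrC [g x * l]mulrC.
Qed.

Lemma derZ a f x l : der f x l -> der (fun y => a * f y) x (a * l).
Proof. by move=> df; apply: der_eq (derM (der_cst a x) df) _; rewrite mul0r add0r. Qed.

Lemma der_sqr f x l : der f x l -> der (fun y => f y ^+ 2) x (2 * f x * l).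
Proof.
move=> df; apply: (@eq_der (fun y => f y * f y)); first by move=> y; rewrite expr2.
by apply: der_eq (derM df df) _; ring.
Qed.

Lemma der_comp f g x l m : der f x l -> der g (f x) m -> der (fun y => g (f y)) x (l * m).
Proof.
move=> [df] [dg]; split; rewrite mulrC.
exact: (is_derive1_comp dg df).
Qed.

Lemma der_exp f x l : der f x l -> der (fun y => expR (f y)) x (l * expR (f x)).
Proof. by move=> df; apply: (der_comp df); split; apply: is_derive_expR. Qed.

Lemma der_inv f x l : f x != 0 -> der f x l -> der (fun y => (f y)^-1) x (- l / f x ^+ 2).
Proof.
move=> fx [df]; split; apply: (@is_derive_eq _ _ _ _ _ _ _ _ (is_deriveV fx df)).
by rewrite /GRing.scale /= mulNr mulrC -mulNr.
Qed.

Lemma der_continuous f x l : der f x l -> {for x, continuous f}.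
Proof.
move=> [df]; apply/differentiable_continuous/derivable1_diffP.
exact: ex_derive.
Qed.

Lemma der_cts f g : (forall x, der f x (g x)) -> cts f.
Proof. by move=> df; split=> x; exact: der_continuous (df x). Qed.

Lemma der_within f g a b : (forall x, a <= x <= b -> der f x (g x)) ->
  {within `[a, b], continuous f}.
Proof.
move=> df; apply/continuous_in_subspaceT => x; rewrite inE /= in_itv /= => /df.
exact: der_continuous.
Qed.

Lemma mean_value f g a b : a <= b -> (forall x, a <= x <= b -> der f x (g x)) ->
  exists2 c, a <= c <= b & f b - f a = g c * (b - a).
Proof.
move=> ab df; have [||c cab e] := @MVT_segment R f g a b ab.
- by move=> x; rewrite in_itv /= => /andP[ax xb]; have [] := df x; rewrite ?ltW.
- exact: der_within df.
by exists c => //; move: cab; rewrite in_itv.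
Qed.

Lemma der_ge0_le f g a b : a <= b -> (forall x, a <= x <= b -> der f x (g x)) ->
  (forall x, a <= x <= b -> 0 <= g x) -> f a <= f b.
Proof.
move=> ab df g0; have [c cab e] := mean_value ab df.
by rewrite -subr_ge0 e mulr_ge0 ?g0 // subr_ge0.
Qed.

Lemma der_le0_ge f g a b : a <= b -> (forall x, a <= x <= b -> der f x (g x)) ->
  (forall x, a <= x <= b -> g x <= 0) -> f b <= f a.
Proof.
move=> ab df g0; have [c cab e] := mean_value ab df.
by rewrite -subr_le0 e mulr_le0_ge0 ?g0 // subr_ge0.
Qed.

Lemma der0_eq f a b : a <= b -> (forall x, a <= x <= b -> der f x 0) -> f a = f b.
Proof.
move=> ab df; apply/eqP; rewrite eq_le.
rewrite (@der_ge0_le f (fun=> 0) a b) //=.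
exact: (@der_le0_ge f (fun=> 0) a b).
Qed.

Lemma der_le f g f' g' a b : a <= b ->
  (forall x, a <= x <= b -> der f x (f' x)) -> (forall x, a <= x <= b -> der g x (g' x)) ->
  (forall x, a <= x <= b -> f' x <= g' x) -> f b - f a <= g b - g a.
Proof.
move=> ab df dg le.
suff: g a - f a <= g b - f b by lra.
apply: (@der_ge0_le (fun x => g x - f x) (fun x => g' x - f' x) a b) => //.
- by move=> x h; apply: derB; [apply: dg|apply: df].
- by move=> x h; rewrite subr_ge0; apply: le.
Qed.

Lemma cts_bounded f a b : cts f -> a <= b ->
  exists2 C : R, 0 < C & forall x, a <= x <= b -> `|f x| <= C.
Proof.
move=> cf ab.
have [c _ cmax] := EVT_max ab (cts_within (A := `[a, b]%classic) (cts_norm cf)).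
exists (`|f c| + 1); first by rewrite ltr_wpDl.
by move=> x xab; rewrite (le_trans (cmax x _)) ?in_itv // lerDl.
Qed.

Lemma nonvanishing_gt0 f a b : a <= b -> {within `[a, b], continuous f} ->
  (forall x, a <= x <= b -> f x != 0) -> 0 < f a -> 0 < f b.
Proof.
move=> ab cf f0 fa; rewrite ltNge; apply/negP => fb.
have [|c] := IVT (v := 0) ab cf.
  by rewrite ge_min fb orbT le_max (ltW fa).
by rewrite in_itv /= => cab /eqP fc; move: (f0 c cab); rewrite fc.
Qed.

Lemma cts_integrable h a b : cts h -> mu.-integrable `[a, b] (EFin \o h).
Proof.
move=> ch; apply: continuous_compact_integrable; first exact: segment_compact.
exact: (cts_within (A := `[a, b]%classic) ch).
Qed.

Lemma Rintegral_chasles h a b c : a <= b -> b <= c ->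
  mu.-integrable `[a, c] (EFin \o h) ->
  \int[mu]_(t in `[a, c]) h t = \int[mu]_(t in `[a, b]) h t + \int[mu]_(t in `[b, c]) h t.
Proof.
move=> ab bc ih.
have := @Rintegral_itvB R h (BLeft a) (BRight c) b ih.
rewrite !bnd_simp => /(_ ab bc) /eqP.
rewrite subr_eq => /eqP ->; rewrite addrC Rintegral_itv_obnd_cbnd //.
apply: integrableS ih => // x /=; rewrite !in_itv /= => /andP[/ltW bx ->].
by rewrite (le_trans ab bx).
Qed.

Lemma prim_from h a x : cts h -> a <= 0 -> a <= x ->
  prim h x = \int[mu]_(t in `[a, x]) h t - \int[mu]_(t in `[a, 0]) h t.
Proof.
move=> ch a0 ax; rewrite prim.unlock; case: leP => [x0|/ltW x0].
  rewrite (@Rintegral_chasles h a 0 x) //; last exact: cts_integrable.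
  by rewrite [RHS]addrC addKr.
rewrite (@Rintegral_chasles h a x 0) //; last exact: cts_integrable.
by rewrite opprD addrA subrr add0r.
Qed.

Lemma prim0 h : prim h 0 = 0.
Proof. by rewrite prim.unlock lexx set_itv1 Rintegral_set1. Qed.

Lemma der_prim h x : cts h -> der (prim h) x (h x).
Proof.
move=> ch; pose a := Num.min 0 x - 1.
have a0 : a < 0 by rewrite /a ltrBlDr add0r gt_min ltr01.
have ax : a < x by rewrite /a ltrBlDr gt_min ltrDl ltr01 orbT.
apply: (@near_eq_der (fun y => \int[mu]_(t in `[a, y]) h t - \int[mu]_(t in `[a, 0]) h t)).
  near=> y; apply/esym/prim_from => //; first exact: ltW.
  by apply: ltW; near: y; exact: lt_nbhsr.
apply: (@der_eq _ _ (h x - 0)); last by rewrite subr0.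
apply: derB (der_cst _ _).
have xu : x < x + 1 by rewrite ltrDl.
have [|dF eF] := continuous_FTC1 (a := BLeft a) xu (cts_integrable a (x + 1) ch) _ (@ctsP h ch x).
  by [].
split; apply: (@is_derive_eq _ _ _ _ _ _ _ _ (derivableP dF)).
by rewrite -eF derive1E.
Unshelve. all: by end_near. Qed.

Lemma cts_prim h : cts h -> cts (prim h).
Proof. by move=> ch; apply: der_cts => x; exact: der_prim. Qed.

Lemma der_prim_eq F h x : 0 <= x -> cts h -> (forall y, 0 <= y <= x -> der F y (h y)) ->
  F x = F 0 + prim h x.
Proof.
move=> x0 ch dF.
suff: F 0 - prim h 0 = F x - prim h x by rewrite prim0; lra.
apply: (@der0_eq (fun y => F y - prim h y)) => // y y0.
by apply: der_eq (derB (dF y y0) (der_prim y ch)) _; rewrite subrr.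
Qed.

Lemma RintegralE_prim h x : 0 <= x -> \int[mu]_(t in `[0, x]) h t = prim h x.
Proof. by rewrite prim.unlock => ->. Qed.

Lemma eq_prim g h x : (forall y, 0 <= y <= x -> g y = h y) -> 0 <= x -> prim g x = prim h x.
Proof.
move=> gh x0; rewrite prim.unlock x0; apply: eq_Rintegral => y.
by rewrite inE /= in_itv /=; apply: gh.
Qed.

Lemma prim_le g h a b : cts g -> cts h -> a <= b -> (forall y, a <= y <= b -> g y <= h y) ->
  prim g b - prim g a <= prim h b - prim h a.
Proof.
move=> cg ch ab le.
by apply: (der_le (f' := g) (g' := h)) => // x _; exact: der_prim.
Qed.

Lemma primD g h x : cts g -> cts h -> 0 <= x -> prim (fun y => g y + h y) x = prim g x + prim h x.
Proof.
move=> cg ch x0; rewrite (@der_prim_eq (fun y => prim g y + prim h y) (fun y => g y + h y)) //.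
- by rewrite !prim0 !add0r.
- exact: ctsD.
- by move=> y _; apply: derD; exact: der_prim.
Qed.

Lemma primZ a h x : cts h -> 0 <= x -> prim (fun y => a * h y) x = a * prim h x.
Proof.
move=> ch x0; rewrite (@der_prim_eq (fun y => a * prim h y) (fun y => a * h y)) //.
- by rewrite !prim0 mulr0 add0r.
- exact: ctsZ.
- by move=> y _; apply: derZ; exact: der_prim.
Qed.

Lemma prim_norm_le g h x : cts g -> cts h -> 0 <= x ->
  (forall y, 0 <= y <= x -> `|g y| <= h y) -> `|prim g x| <= prim h x.
Proof.
move=> cg ch x0 le; rewrite ler_norml; apply/andP; split.
  have := prim_le (ctsN ch) cg x0; rewrite !prim0 !subr0.
  have -> : prim (fun y => - h y) x = - prim h x.
    by rewrite -(@eq_prim (fun y => -1 * h y)) ?primZ // ?mulN1r // => y _; rewrite mulN1r.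
  by apply=> y /le; rewrite ler_norml => /andP[].
have := prim_le cg ch x0; rewrite !prim0 !subr0.
by apply=> y /le; rewrite ler_norml => /andP[].
Qed.

Lemma prim_ge0 h x : cts h -> 0 <= x -> (forall y, 0 <= y <= x -> 0 <= h y) -> 0 <= prim h x.
Proof.
move=> ch x0 h0; apply: le_trans (prim_norm_le ch ch x0 _); first exact: normr_ge0.
by move=> y /h0 hy; rewrite ger0_norm.
Qed.

Lemma gronwall E E' (K e N : R) : 0 <= K -> 0 <= e -> 0 <= N ->
  (forall x, 0 <= x <= N -> der E x (E' x)) ->
  (forall x, 0 <= x <= N -> E' x <= K * E x + e) ->
  forall x, 0 <= x <= N -> E x <= (E 0 + e * x) * expR (K * x).
Proof.
move=> K0 e0 N0 dE le x /andP[x0 xN].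
suff: E x * expR (- (K * x)) - e * x <= E 0 * expR (- (K * 0)) - e * 0.
  rewrite !mulr0 oppr0 expR0 mulr1 addr0 lerBlDr.
  by rewrite -ler_pdivlMr ?expR_gt0 // expRN invrK.
apply: (@der_le0_ge (fun y => E y * expR (- (K * y)) - e * y)
  (fun y => (E' y * expR (- (K * y)) + E y * (- (K * 1) * expR (- (K * y)))) - e * 1)) => //.
- move=> y /andP[y0 yx]; apply: derB (derZ _ (der_id _)).
  apply: derM; first by apply: dE; rewrite y0 (le_trans yx).
  exact: der_exp (derN (derZ _ (der_id _))).
- move=> y /andP[y0 yx]; have := le y; rewrite y0 (le_trans yx xN) => /(_ isT) hy.
  have e1 : expR (- (K * y)) <= 1 by rewrite -expR0 ler_expR oppr_le0 mulr_ge0.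
  have := expR_gt0 (- (K * y)); set X := expR _ in e1 * => X0.
  have : E' y * X <= (K * E y + e) * X by rewrite ler_pM2r.
  have : e * X <= e by rewrite ler_piMr.
  lra.
Qed.

End calculus.

(** * Uniform limits and weighted bounds *)

Section sequences_of_functions.
Context {R : realType}.
Implicit Types (f g h F : R -> R).

Lemma norm_le_all_eq0 (z E : R) : (forall n : nat, `|z| <= 2^-1 ^+ n * E) -> z = 0.
Proof.
move=> le; apply/eqP; rewrite -normr_eq0 eq_le normr_ge0 andbT.
suff: (2^-1 ^+ n * E @[n --> \oo] --> (0 * E : R)).
  rewrite mul0r => cv; apply: (cvgr_to_ge cv).
  by apply: nearW => n; exact: le.
apply: cvgM; last exact: cvg_cst.
by apply: cvg_expr; rewrite ger0_norm // invf_lt1 // ltr1n.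
Qed.

Lemma locally_uniform_cts (f : nat -> R -> R) F : (forall n, cts (f n)) ->
  (forall X e : R, 0 < X -> 0 < e -> exists n, forall x, `|x| <= X -> `|F x - f n x| <= e) ->
  cts F.
Proof.
move=> cf uF; split=> x; apply/cvgrPdist_le => /= e e0.
have X0 : 0 < `|x| + 1 by rewrite ltr_wpDl.
have e3 : 0 < e / 3 by rewrite divr_gt0.
have [n un] := uF _ _ X0 e3.
have := @ctsP _ _ (cf n) x => /cvgrPdist_le /(_ _ e3) nearf.
have := @ctsP _ _ cts_id x => /cvgrPdist_le /(_ 1 ltr01) near1.
near=> y.
have yX : `|y| <= `|x| + 1.
  have : `|x - y| <= 1 by near: y.
  by move=> h; have := ler_normB x (x - y); rewrite opprB addrCA subrr addr0; lra.
have h1 := un x; have := un y yX; have := h1 _; rewrite lerDl ler01 => /(_ isT).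
have : `|f n x - f n y| <= e / 3 by near: y.
move=> h2 h3 h4.
have -> : F x - F y = (F x - f n x) + (f n x - f n y) - (F y - f n y) by ring.
rewrite (le_trans (ler_normB _ _)) // (le_trans (lerD (ler_normD _ _) (lexx _))) //.
lra.
Unshelve. all: by end_near. Qed.

Lemma series_half_tail (a : nat -> R) (E : R) :
  (forall k, `|a k| <= 2^-1 ^+ k * E) ->
  exists2 l : R, series a @ \oo --> l & forall n, `|l - series a n| <= 2 * 2^-1 ^+ n * E.
Proof.
move=> aE; have E0 : 0 <= E by have := aE 0%N; rewrite expr0 mul1r; apply: le_trans.
have half : `|2^-1 : R| < 1 by rewrite ger0_norm // invf_lt1 // ltr1n.
have cv : cvgn (series a).
  apply: normed_cvg; apply: (@series_le_cvg _ _ (fun k => 2^-1 ^+ k * E)) => //.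
  - by move=> n; exact: normr_ge0.
  - by move=> n; rewrite mulr_ge0 // exprn_ge0.
  - rewrite (_ : (fun k => _) = geometric E 2^-1); first exact: is_cvg_geometric_series.
    by apply/funext => k; rewrite /= mulrC.
exists (limn (series a)) => //= n.
have dist m : (n <= m)%N -> `|series a m - series a n| <= 2 * 2^-1 ^+ n * E.
  move=> nm; suff: `|series a m - series a n| <= 2 * (2^-1 ^+ n - 2^-1 ^+ m) * E.
    move=> h; apply: (le_trans h); rewrite ler_wpM2r // ler_wpM2l //.
    by rewrite gerBl exprn_ge0.
  rewrite -(subnK nm); elim: (m - n)%N => [|j IH].
    by rewrite add0n !subrr normr0 mulr0 mul0r.
  rewrite addSn seriesEnat /= big_nat_recr //= -/(series a _).
  have -> : \sum_(0 <= k < j + n) a k + a (j + n)%N - \sum_(0 <= k < n) a k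
    = (series a (j + n) - series a n) + a (j + n)%N.
    by rewrite !seriesEnat /=; ring.
  rewrite (le_trans (ler_normD _ _)) // (le_trans (lerD IH (aE _))) //.
  rewrite exprS; set X := 2^-1 ^+ (j + n); set Y := 2^-1 ^+ n.
  have -> : 2 * (Y - 2^-1 * X) * E = 2 * (Y - X) * E + X * E by field.
  by [].
have cv2 : `|series a m - series a n| @[m --> \oo] --> `|limn (series a) - series a n|.
  by apply: cvg_norm; apply: cvgB => //; exact: cvg_cst.
apply: (cvgr_to_le cv2).
by exists n => // m /= nm; exact: dist.
Qed.

Lemma der_prim_eqR F h x : cts h -> (forall y, der F y (h y)) -> F x = F 0 + prim h x.
Proof.
move=> ch dF.
suff: F 0 - prim h 0 = F x - prim h x by rewrite prim0; lra.
have d0 y : der (fun y => F y - prim h y) y 0.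
  by apply: der_eq (derB (dF y) (der_prim y ch)) _; rewrite subrr.
have [x0|/ltW x0] := leP 0 x; first exact: (@der0_eq _ (fun y => F y - prim h y)).
by apply/esym; exact: (@der0_eq _ (fun y => F y - prim h y)).
Qed.

(** The exponential weight makes every integration gain a factor [1 / L]. With [L = 4 * C] each
    Picard step halves the bound on any bounded interval, whatever the size [C] of the
    coefficients. *)
Lemma prim_exp_bound h (A L X x : R) : cts h -> 0 < L ->
  (forall y, `|y| <= X -> `|h y| <= A * expR (L * `|y|)) -> `|x| <= X ->
  `|prim h x| <= A / L * expR (L * `|x|).
Proof.
move=> ch L0 hA xX.
have A0 : 0 <= A.
  have := hA 0; rewrite normr0 mulr0 expR0 mulr1 (le_trans (normr_ge0 _) xX) => /(_ isT).
  by apply: le_trans.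
have AL : 0 <= A / L by rewrite divr_ge0 // ltW.
have dexp y : der (fun z => A / L * expR (L * z)) y (A * expR (L * y)).
  apply: der_eq (derZ _ (der_exp (derZ _ (der_id _)))) _.
  by rewrite mulr1 mulrA divfK // gt_eqF.
have dexpN y : der (fun z => - (A / L * expR (- (L * z)))) y (A * expR (- (L * y))).
  apply: der_eq (derN (derZ _ (der_exp (derN (derZ _ (der_id _)))))) _.
  by rewrite mulr1 mulNr mulrN opprK mulrA divfK // gt_eqF.
have [x0|/ltW x0] := leP 0 x.
  rewrite ger0_norm // in xX *.
  have hb y : 0 <= y <= x -> - (A * expR (L * y)) <= h y <= A * expR (L * y).
    move=> /andP[y0 yx]; have := hA y; rewrite ger0_norm // (le_trans yx xX) => /(_ isT).
    by rewrite ler_norml.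
  have up := der_le x0 (fun y _ => der_prim y ch) (fun y _ => dexp y) (fun y hy => proj2 (andP (hb y hy))).
  have lo := der_le x0 (fun y _ => derN (dexp y)) (fun y _ => der_prim y ch) (fun y hy => proj1 (andP (hb y hy))).
  move: up lo; rewrite prim0 mulr0 expR0 mulr1 !subr0 => up lo.
  by rewrite ler_norml; apply/andP; split; lra.
rewrite ler0_norm // in xX *.
have hb y : x <= y <= 0 -> - (A * expR (- (L * y))) <= h y <= A * expR (- (L * y)).
  move=> /andP[y0 yx]; have := hA y; rewrite ler0_norm //.
  have -> : - y <= X by lra.
  by move=> /(_ isT); rewrite ler_norml mulrN.
have up := der_le x0 (fun y _ => der_prim y ch) (fun y _ => dexpN y) (fun y hy => proj2 (andP (hb y hy))).
have lo := der_le x0 (fun y _ => derN (dexpN y)) (fun y _ => der_prim y ch) (fun y hy => proj1 (andP (hb y hy))).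
move: up lo; rewrite prim0 mulr0 oppr0 expR0 mulr1 !sub0r !opprK mulrN => up lo.
by rewrite ler_norml; apply/andP; split; lra.
Qed.

End sequences_of_functions.

(** The increments of the Picard iteration, not the iterates: the system is linear, so they arise by
    iterating the integral operator on the initial value [(0, 1)], and the solution is the sum of
    their series. *)
Fixpoint picard (R : realType) (al be ga de : R -> R) n : (R -> R) * (R -> R) :=
  if n is m.+1 then
    (prim (fun x => al x * (picard al be ga de m).1 x + be x * (picard al be ga de m).2 x),
     prim (fun x => ga x * (picard al be ga de m).1 x + de x * (picard al be ga de m).2 x))
  else (fun=> 0, fun=> 1).

HB.lock Definition sol1 (R : realType) (al be ga de : R -> R) (x : R) : R :=
  limn (series (fun n => (picard al be ga de n).1 x)).
HB.lock Definition sol2 (R : realType) (al be ga de : R -> R) (x : R) : R :=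
  limn (series (fun n => (picard al be ga de n).2 x)).

(** * Solutions of linear systems *)

Section linear_system.
Context {R : realType}.
Implicit Types x y : R.
Variables (al be ga de : R -> R).

Local Notation picard := (picard al be ga de).
Local Notation sol1 := (sol1 al be ga de).
Local Notation sol2 := (sol2 al be ga de).

Hypotheses (cal : cts al) (cbe : cts be) (cga : cts ga) (cde : cts de).

Lemma cts_lin (a b u w : R -> R) : cts a -> cts b -> cts u -> cts w ->
  cts (fun x => a x * u x + b x * w x).
Proof. by move=> ca cb cu cw; apply: ctsD; apply: ctsM. Qed.

Lemma cts_picard n : cts (picard n).1 /\ cts (picard n).2.
Proof.
elim: n => [|n [c1 c2]] /=; first by split; exact: cts_cst.
by split; apply: cts_prim; exact: cts_lin.
Qed.

Lemma coef_bound (X : R) : 0 < X -> exists2 C : R, 0 < C & forall x, `|x| <= X ->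
  [/\ `|al x| <= C, `|be x| <= C, `|ga x| <= C & `|de x| <= C].
Proof.
move=> X0; have nX : - X <= X by lra.
have [C1 C10 h1] := cts_bounded cal nX; have [C2 C20 h2] := cts_bounded cbe nX.
have [C3 C30 h3] := cts_bounded cga nX; have [C4 C40 h4] := cts_bounded cde nX.
exists (C1 + C2 + C3 + C4); first by rewrite !addr_gt0.
move=> x; rewrite ler_norml => xX.
by split; [have := h1 x xX|have := h2 x xX|have := h3 x xX|have := h4 x xX]; lra.
Qed.

Lemma norm_lin_le (a b u w C A : R) : `|a| <= C -> `|b| <= C -> `|u| <= A -> `|w| <= A ->
  `|a * u + b * w| <= 2 * C * A.
Proof.
move=> aC bC uA wA; rewrite (le_trans (ler_normD _ _)) // !normrM.
have : `|a| * `|u| <= C * A by apply: ler_pM.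
have : `|b| * `|w| <= C * A by apply: ler_pM.
lra.
Qed.

Lemma picard_bound (X C : R) : 0 < C -> (forall x, `|x| <= X ->
    [/\ `|al x| <= C, `|be x| <= C, `|ga x| <= C & `|de x| <= C]) ->
  forall n x, `|x| <= X ->
  `|(picard n).1 x| <= 2^-1 ^+ n * expR (4 * C * `|x|) /\
  `|(picard n).2 x| <= 2^-1 ^+ n * expR (4 * C * `|x|).
Proof.
move=> C0 hC; have C4 : 0 < 4 * C by rewrite mulr_gt0.
elim=> [|n IH] x xX /=.
  have e1 : 1 <= expR (4 * C * `|x|) by apply: ge1_expR; rewrite mulr_ge0 // ltW.
  by rewrite expr0 mul1r normr0 normr1; split=> //; exact: ltW (expR_gt0 _).
have [c1 c2] := cts_picard n.
have key a b : cts a -> cts b -> (forall y, `|y| <= X -> `|a y| <= C /\ `|b y| <= C) ->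
  `|prim (fun y => a y * (picard n).1 y + b y * (picard n).2 y) x|
    <= 2^-1 ^+ n.+1 * expR (4 * C * `|x|).
  move=> ca cb hab; rewrite [X in X * _](_ : _ = 2 * C * 2^-1 ^+ n / (4 * C)); last first.
    by rewrite exprS; field; rewrite gt_eqF.
  apply: prim_exp_bound xX => //; first exact: cts_lin.
  move=> y yX; have [h1 h2] := IH y yX; have [ha hb] := hab y yX.
  by rewrite -mulrA; apply: norm_lin_le.
by split; apply: key => // y /hC [].
Qed.

Let psum1 n x := series (fun k => (picard k).1 x) n.
Let psum2 n x := series (fun k => (picard k).2 x) n.

Lemma cts_series (f : nat -> R -> R) : (forall k, cts (f k)) ->
  forall n, cts (fun x => series (fun k => f k x) n).
Proof.
move=> cf; elim=> [|n IH].
  by apply: eq_cts (cts_cst 0) => x; rewrite seriesEnat /= big_nil.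
by apply: eq_cts (ctsD IH (cf n)) => x; rewrite !seriesEnat /= big_nat_recr.
Qed.

Lemma der_psum n x :
  der (psum1 n.+1) x (al x * psum1 n x + be x * psum2 n x) /\
  der (psum2 n.+1) x (ga x * psum1 n x + de x * psum2 n x).
Proof.
rewrite /psum1 /psum2; elim: n => [|n [IH1 IH2]].
  rewrite !seriesEnat /= !big_nil !mulr0 !addr0; split.
    by apply: eq_der (der_cst 0 _) => y; rewrite seriesEnat /= big_nat1.
  by apply: eq_der (der_cst 1 _) => y; rewrite seriesEnat /= big_nat1.
have [c1 c2] := cts_picard n.
split.
  apply: (@eq_der _ (fun y => series (fun k => (picard k).1 y) n.+1 + (picard n.+1).1 y)).
    by move=> y; rewrite !seriesEnat /= [RHS]big_nat_recr.
  apply: der_eq (derD IH1 (der_prim _ (cts_lin cal cbe c1 c2))) _.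
  by rewrite !seriesEnat /= ![in RHS]big_nat_recr //=; ring.
apply: (@eq_der _ (fun y => series (fun k => (picard k).2 y) n.+1 + (picard n.+1).2 y)).
  by move=> y; rewrite !seriesEnat /= [RHS]big_nat_recr.
apply: der_eq (derD IH2 (der_prim _ (cts_lin cga cde c1 c2))) _.
by rewrite !seriesEnat /= ![in RHS]big_nat_recr //=; ring.
Qed.

Lemma psum_at0 n : psum1 n.+1 0 = 0 /\ psum2 n.+1 0 = 1.
Proof.
rewrite /psum1 /psum2; elim: n => [|n]; first by rewrite !seriesEnat /= !big_nat1.
rewrite !seriesEnat /= => -[h1 h2].
by split; rewrite big_nat_recr //= ?h1 ?h2 prim0 addr0.
Qed.

Lemma sol_cvg_tail (X C : R) : 0 < C -> (forall x, `|x| <= X ->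
    [/\ `|al x| <= C, `|be x| <= C, `|ga x| <= C & `|de x| <= C]) ->
  forall x, `|x| <= X ->
  [/\ psum1 n x @[n --> \oo] --> sol1 x, psum2 n x @[n --> \oo] --> sol2 x,
    forall n, `|sol1 x - psum1 n x| <= 2 * 2^-1 ^+ n * expR (4 * C * `|x|) &
    forall n, `|sol2 x - psum2 n x| <= 2 * 2^-1 ^+ n * expR (4 * C * `|x|)].
Proof.
move=> C0 hC x xX; rewrite sol1.unlock sol2.unlock /psum1 /psum2.
have [l1 cv1 t1] := series_half_tail (fun n => proj1 (picard_bound C0 hC n xX)).
have [l2 cv2 t2] := series_half_tail (fun n => proj2 (picard_bound C0 hC n xX)).
by have -> := cvg_lim (@Rhausdorff R) cv1; have -> := cvg_lim (@Rhausdorff R) cv2; split.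
Qed.

Lemma sol_cvg x : psum1 n x @[n --> \oo] --> sol1 x /\ psum2 n x @[n --> \oo] --> sol2 x.
Proof.
have X0 : 0 < `|x| + 1 by rewrite ltr_wpDl.
have [C C0 hC] := coef_bound X0.
by have [] := sol_cvg_tail C0 hC (x := x); rewrite ?lerDl.
Qed.

Lemma cts_sol : cts sol1 /\ cts sol2.
Proof.
have small (X C e : R) : 0 < C -> 0 < e ->
    exists n, forall x : R, `|x| <= X -> 2 * 2^-1 ^+ n * expR (4 * C * `|x|) <= e.
  move=> C0 e0; have E0 := expR_gt0 (4 * C * X).
  have : 2^-1 ^+ n @[n --> \oo] --> (0 : R).
    by apply: cvg_expr; rewrite ger0_norm // invf_lt1 // ltr1n.
  move/cvgrPdist_le => /(_ (e / (2 * expR (4 * C * X)))) [|n _ /(_ n (leqnn n))].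
    by rewrite divr_gt0 // mulr_gt0.
  rewrite /= sub0r normrN ger0_norm ?exprn_ge0 // ler_pdivlMr ?mulr_gt0 // => hn.
  exists n => x xX; apply: le_trans hn.
  rewrite mulrA [2 * _]mulrC ler_wpM2l ?mulr_ge0 ?exprn_ge0 // ler_expR.
  by rewrite ler_pM2l // mulr_gt0.
split.
  apply: (@locally_uniform_cts _ psum1); first exact: cts_series (fun k => proj1 (cts_picard k)).
  move=> X e X0 e0; have [C C0 hC] := coef_bound X0.
  have [n hn] := small X C e C0 e0; exists n => x xX.
  by have [_ _ h _] := sol_cvg_tail C0 hC xX; apply: le_trans (h n) (hn x xX).
apply: (@locally_uniform_cts _ psum2); first exact: cts_series (fun k => proj2 (cts_picard k)).
move=> X e X0 e0; have [C C0 hC] := coef_bound X0.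
have [n hn] := small X C e C0 e0; exists n => x xX.
by have [_ _ _ h] := sol_cvg_tail C0 hC xX; apply: le_trans (h n) (hn x xX).
Qed.

(** One argument for both components. No limit is taken under the integral: the defect of the
    integral equation is rewritten with the partial sums of level [n] and bounded by a multiple of
    [2^-1 ^+ n] for every [n]. *)
Lemma der_sol_aux (a b : R -> R) (psum : nat -> R -> R) (sol : R -> R) (i : R) :
  cts a -> cts b -> (forall n x, der (psum n.+1) x (a x * psum1 n x + b x * psum2 n x)) ->
  (forall n, psum n.+1 0 = i) ->
  (forall X C : R, 0 < C -> (forall x, `|x| <= X ->
    [/\ `|al x| <= C, `|be x| <= C, `|ga x| <= C & `|de x| <= C]) ->
    forall x, `|x| <= X -> forall n, `|sol x - psum n x| <= 2 * 2^-1 ^+ n * expR (4 * C * `|x|)) ->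
  forall x, sol x = i + prim (fun x => a x * sol1 x + b x * sol2 x) x.
Proof.
move=> ca cb dp p0 hs x; have [cs1 cs2] := cts_sol.
have X0 : 0 < `|x| + 1 by rewrite ltr_wpDl.
have [C1 C10 hC1] := coef_bound X0.
have nX : - (`|x| + 1) <= `|x| + 1 by lra.
have [Ca Ca0 hCa] := cts_bounded ca nX; have [Cb Cb0 hCb] := cts_bounded cb nX.
pose C := C1 + Ca + Cb.
have C0 : 0 < C by rewrite /C !addr_gt0.
have hC y : `|y| <= `|x| + 1 -> [/\ `|al y| <= C, `|be y| <= C, `|ga y| <= C & `|de y| <= C].
  by move=> /hC1 [h1 h2 h3 h4]; rewrite /C; split; lra.
have xX : `|x| <= `|x| + 1 by rewrite lerDl.
apply/eqP; rewrite -subr_eq0; apply/eqP.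
apply: (@norm_le_all_eq0 _ _ (2 * expR (4 * C * `|x|))) => n.
have cl1 := cts_lin ca cb cs1 cs2.
have cp1 : cts (psum1 n) := cts_series (fun k => proj1 (cts_picard k)) n.
have cp2 : cts (psum2 n) := cts_series (fun k => proj2 (cts_picard k)) n.
have cl2 := cts_lin ca cb (ctsB cs1 cp1) (ctsB cs2 cp2).
have e1 : prim (fun x => a x * sol1 x + b x * sol2 x) x - psum n.+1 x = - i +
    prim (fun x => a x * (sol1 x - psum1 n x) + b x * (sol2 x - psum2 n x)) x.
  rewrite (der_prim_eqR (F := fun x => prim (fun x => a x * sol1 x + b x * sol2 x) x - psum n.+1 x) _ cl2).
    by rewrite prim0 p0 sub0r.
  move=> y; apply: der_eq (derB (der_prim y cl1) (dp n y)) _; ring.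
have -> : sol x - (i + prim (fun x => a x * sol1 x + b x * sol2 x) x) =
    (sol x - psum n.+1 x) - prim (fun x => a x * (sol1 x - psum1 n x) + b x * (sol2 x - psum2 n x)) x.
  by move: e1; lra.
have b1 := hs _ _ C0 hC x xX n.+1.
have b2 : `|prim (fun x => a x * (sol1 x - psum1 n x) + b x * (sol2 x - psum2 n x)) x| <=
    (2 * C * (2 * 2^-1 ^+ n)) / (4 * C) * expR (4 * C * `|x|).
  apply: prim_exp_bound xX => //; first by rewrite mulr_gt0.
  move=> y yX; have [_ _ t1 t2] := sol_cvg_tail C0 hC yX; rewrite -mulrA.
  apply: norm_lin_le => //.
    by apply: le_trans (hCa y _) _; [rewrite -ler_norml|rewrite /C; lra].
  by apply: le_trans (hCb y _) _; [rewrite -ler_norml|rewrite /C; lra].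
rewrite (le_trans (ler_normB _ _)) // (le_trans (lerD b1 b2)) // exprS.
rewrite le_eqVlt; apply/orP; left; apply/eqP; field.
by rewrite gt_eqF.
Qed.

Lemma sol1_prim x : sol1 x = prim (fun x => al x * sol1 x + be x * sol2 x) x.
Proof.
rewrite -[RHS]add0r; apply: (@der_sol_aux al be psum1) => //.
- by move=> n y; have [] := der_psum n y.
- by move=> n; have [] := psum_at0 n.
- by move=> X C C0 hC y yX n; have [_ _ h _] := sol_cvg_tail C0 hC yX; exact: h.
Qed.

Lemma sol2_prim x : sol2 x = 1 + prim (fun x => ga x * sol1 x + de x * sol2 x) x.
Proof.
apply: (@der_sol_aux ga de psum2) => //.
- by move=> n y; have [] := der_psum n y.
- by move=> n; have [] := psum_at0 n.
- by move=> X C C0 hC y yX n; have [_ _ _ h] := sol_cvg_tail C0 hC yX; exact: h.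
Qed.

Lemma der_sol1 x : der sol1 x (al x * sol1 x + be x * sol2 x).
Proof.
have [c1 c2] := cts_sol; have cl := cts_lin cal cbe c1 c2.
by apply: (@eq_der _ (prim (fun x => al x * sol1 x + be x * sol2 x))) (der_prim x cl) => y; rewrite -sol1_prim.
Qed.

Lemma der_sol2 x : der sol2 x (ga x * sol1 x + de x * sol2 x).
Proof.
have [c1 c2] := cts_sol; have cl := cts_lin cga cde c1 c2.
apply: (@eq_der _ (fun x => 1 + prim (fun x => ga x * sol1 x + de x * sol2 x) x)).
  by move=> y; rewrite -sol2_prim.
by apply: der_eq (derD (der_cst 1 x) (der_prim x cl)) _; rewrite add0r.
Qed.

Lemma sol1_0 : sol1 0 = 0.
Proof. by rewrite sol1_prim prim0. Qed.

Lemma sol2_0 : sol2 0 = 1.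
Proof. by rewrite sol2_prim prim0 addr0. Qed.

End linear_system.

(** * Stability under perturbation of the coefficients *)

Section stability.
Context {R : realType}.
Implicit Types x y : R.

(** Gronwall for the squared distance. The difference of the solutions satisfies the first system
    with a forcing of size at most [2 * e * D], the coefficient errors applied to [U] and [W]; this
    is why the bounds concern the coefficients of the first system and the solution of the
    second. *)
Lemma system_stability (a1 b1 c1 d1 a2 b2 c2 d2 u w U W : R -> R) (N C D e : R) :
  0 <= N -> 0 <= C -> 0 <= D -> 0 <= e ->
  (forall x, 0 <= x <= N -> [/\ `|a1 x| <= C, `|b1 x| <= C, `|c1 x| <= C & `|d1 x| <= C]) ->
  (forall x, 0 <= x <= N -> `|U x| <= D /\ `|W x| <= D) ->
  (forall x, 0 <= x <= N -> [/\ `|a1 x - a2 x| <= e, `|b1 x - b2 x| <= e,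
     `|c1 x - c2 x| <= e & `|d1 x - d2 x| <= e]) ->
  (forall x, 0 <= x <= N -> der u x (a1 x * u x + b1 x * w x)) ->
  (forall x, 0 <= x <= N -> der w x (c1 x * u x + d1 x * w x)) ->
  (forall x, 0 <= x <= N -> der U x (a2 x * U x + b2 x * W x)) ->
  (forall x, 0 <= x <= N -> der W x (c2 x * U x + d2 x * W x)) ->
  u 0 = U 0 -> w 0 = W 0 ->
  forall x, 0 <= x <= N ->
    (u x - U x) ^+ 2 + (w x - W x) ^+ 2 <= 8 * (e * D) ^+ 2 * x * expR ((4 * C + 1) * x).
Proof.
move=> N0 C0 D0 e0 hC hD he du dw dU dW u0 w0 x xN.
pose E y := (u y - U y) ^+ 2 + (w y - W y) ^+ 2.
have E0 : E 0 = 0 by rewrite /E u0 w0 !subrr expr0n addr0.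
have gr := @gronwall _ E (fun y => 2 * (u y - U y) * (a1 y * u y + b1 y * w y - (a2 y * U y + b2 y * W y))
  + 2 * (w y - W y) * (c1 y * u y + d1 y * w y - (c2 y * U y + d2 y * W y))) (4 * C + 1) (8 * (e * D) ^+ 2) N.
have := gr _ _ N0 _ _ x xN; rewrite E0 add0r; apply.
- lra.
- by rewrite mulr_ge0 // sqr_ge0.
- move=> y yN; apply: derD; apply: der_sqr; apply: derB;
    [exact: du|exact: dU|exact: dw|exact: dW].
move=> y yN; rewrite /E.
have [ha hb hc hd] := hC y yN; have [hU hW] := hD y yN; have [ea eb ec ed] := he y yN.
set p := u y - U y; set q := w y - W y.
have -> : a1 y * u y + b1 y * w y - (a2 y * U y + b2 y * W y) =
  a1 y * p + b1 y * q + ((a1 y - a2 y) * U y + (b1 y - b2 y) * W y) by rewrite /p /q; ring.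
have -> : c1 y * u y + d1 y * w y - (c2 y * U y + d2 y * W y) =
  c1 y * p + d1 y * q + ((c1 y - c2 y) * U y + (d1 y - d2 y) * W y) by rewrite /p /q; ring.
have k1 := norm_lin_le ea eb hU hW; have k2 := norm_lin_le ec ed hU hW.
set K1 := _ * U y + _ * W y in k1 *; set K2 := _ * U y + _ * W y in k2 *.
have sq (K : R) : `|K| <= 2 * e * D -> K ^+ 2 <= 4 * (e * D) ^+ 2.
  move=> h; rewrite -[K ^+ 2]real_normK ?num_real // (_ : 4 * _ = (2 * e * D) ^+ 2); last by ring.
  by rewrite ler_sqr ?nnegrE // mulr_ge0 // mulr_ge0.
have s1 := sq _ k1; have s2 := sq _ k2.
have prod (z t : R) : `|z| <= C -> 2 * z * t <= C * (2 * `|t|).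
  move=> zC; rewrite (_ : 2 * z * t = z * (2 * t)); last by ring.
  apply: le_trans (ler_norm _) _; rewrite normrM normrM [`|2|]ger0_norm //.
  by rewrite ler_wpM2r // mulr_ge0.
have pq : 2 * `|p * q| <= p ^+ 2 + q ^+ 2.
  rewrite normrM -[p ^+ 2]real_normK ?num_real // -[q ^+ 2]real_normK ?num_real //.
  by have := sqr_ge0 (`|p| - `|q|); nra.
have h1 := prod (a1 y) (p ^+ 2) ha; have h2 := prod (b1 y) (p * q) hb.
have h3 := prod (c1 y) (p * q) hc; have h4 := prod (d1 y) (q ^+ 2) hd.
rewrite [`|p ^+ 2|]ger0_norm ?sqr_ge0 // in h1; rewrite [`|q ^+ 2|]ger0_norm ?sqr_ge0 // in h4.
have hpq : C * (2 * `|p * q|) <= C * (p ^+ 2 + q ^+ 2) by rewrite ler_wpM2l.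
have := sqr_ge0 (p - K1); have := sqr_ge0 (q - K2).
nra.
Qed.

Lemma system_unique (a b c d u w U W : R -> R) (N : R) :
  cts a -> cts b -> cts c -> cts d -> 0 <= N ->
  (forall x, 0 <= x <= N -> der u x (a x * u x + b x * w x)) ->
  (forall x, 0 <= x <= N -> der w x (c x * u x + d x * w x)) ->
  (forall x, 0 <= x <= N -> der U x (a x * U x + b x * W x)) ->
  (forall x, 0 <= x <= N -> der W x (c x * U x + d x * W x)) ->
  u 0 = U 0 -> w 0 = W 0 -> forall x, 0 <= x <= N -> u x = U x /\ w x = W x.
Proof.
move=> ca cb cc cd N0 du dw dU dW u0 w0 x xN.
have [Ca Ca0 hCa] := cts_bounded ca N0; have [Cb Cb0 hCb] := cts_bounded cb N0.
have [Cc Cc0 hCc] := cts_bounded cc N0; have [Cd Cd0 hCd] := cts_bounded cd N0.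
have := @system_stability a b c d a b c d (fun y => u y - U y) (fun y => w y - W y)
  (fun=> 0) (fun=> 0) N (Ca + Cb + Cc + Cd) 0 0.
have -> // : 0 <= Ca + Cb + Cc + Cd by lra.
move=> /(_ N0 isT (lexx _) (lexx _)) st.
have : (u x - U x - 0) ^+ 2 + (w x - W x - 0) ^+ 2 <= 0.
  apply: le_trans (st _ _ _ _ _ _ _ _ _ x xN) _; last by rewrite mulr0 expr0n mulr0 !mul0r.
  - move=> y yN; have := hCa y yN; have := hCb y yN; have := hCc y yN; have := hCd y yN.
    by split; lra.
  - by move=> y _; rewrite normr0.
  - by move=> y _; rewrite !subrr normr0.
  - by move=> y yN; apply: der_eq (derB (du y yN) (dU y yN)) _; ring.
  - by move=> y yN; apply: der_eq (derB (dw y yN) (dW y yN)) _; ring.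
  - by move=> y yN; rewrite !mulr0 addr0; exact: der_cst.
  - by move=> y yN; rewrite !mulr0 addr0; exact: der_cst.
  - by rewrite u0 subrr.
  - by rewrite w0 subrr.
rewrite !subr0; have := sqr_ge0 (u x - U x); have := sqr_ge0 (w x - W x) => h1 h2 h3.
have e1 : (u x - U x) ^+ 2 = 0 by lra.
have e2 : (w x - W x) ^+ 2 = 0 by lra.
by move/eqP: e1; move/eqP: e2; rewrite !sqrf_eq0 !subr_eq0 => /eqP -> /eqP ->.
Qed.

End stability.

(** * Improper integrals on the half-line *)

Section half_line.
Context {R : realType}.
Implicit Types (f g h : R -> R) (x y l : R).
Local Notation mu := (@lebesgue_measure R).
Local Notation Rp := (`[0, +oo[%classic : set R).

Definition lim_oo f l := forall e : R, 0 < e ->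
  exists2 X : R, 0 <= X & forall x, X <= x -> `|f x - l| <= e.

Lemma lim_ooP f l : lim_oo f l <-> f x @[x --> +oo] --> l.
Proof.
split=> [fl|/cvgrPdist_le fl e /fl [X [_ hX]]].
  apply/cvgrPdist_le => e /fl [X X0 hX]; near=> x.
  rewrite distrC; apply: hX; near: x; apply: nbhs_pinfty_ge; exact: num_real.
exists (Num.max 0 X + 1) => [|x hx]; first by rewrite addr_ge0 // le_max lexx.
rewrite distrC; apply: hX; apply: lt_le_trans hx.
by rewrite ltr_pwDr // le_max lexx orbT.
Unshelve. all: by end_near. Qed.

Lemma lim_oo_unique f l m : lim_oo f l -> lim_oo f m -> l = m.
Proof. by move=> /lim_ooP h1 /lim_ooP h2; exact: cvg_unique h1 h2. Qed.

Lemma monotone_lim_oo f (K : R) : (forall x y, 0 <= x -> x <= y -> f x <= f y) ->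
  (forall x, 0 <= x -> f x <= K) ->
  exists2 l, lim_oo f l & (forall x, 0 <= x -> f x <= l) /\ l <= K.
Proof.
move=> mf fK; pose A := [set f x | x in Rp].
have A0 : A !=set0 by exists (f 0), 0 => //=; rewrite in_itv /= lexx.
have ubK : ubound A K by move=> _ [x + <-]; rewrite /= in_itv /= andbT; exact: fK.
have hs : has_sup A by split=> //; exists K.
have le x : 0 <= x -> f x <= sup A.
  by move=> x0; apply: (ub_le_sup (proj2 hs)); exists x => //=; rewrite in_itv /= x0.
exists (sup A); last by split=> //; exact: ge_sup.
move=> e e0; have [_ [x + <-] hx] := sup_adherent e0 hs.
rewrite /= in_itv /= andbT => x0; exists x => // y xy.
have := mf x y x0 xy; have := le y (le_trans x0 xy) => h1 h2.
by rewrite ler_norml; apply/andP; split; lra.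
Qed.

Lemma prim_monotone g x y : cts g -> (forall z, 0 <= z -> 0 <= g z) -> 0 <= x -> x <= y ->
  prim g x <= prim g y.
Proof.
move=> cg g0 x0 xy; apply: (der_ge0_le xy (fun z _ => der_prim z cg)) => z /andP[xz _].
by apply: g0; exact: le_trans xz.
Qed.

Lemma ge0_integral_lim_oo g l : cts g -> (forall x, 0 <= x -> 0 <= g x) ->
  lim_oo (prim g) l -> (\int[mu]_(x in Rp) (g x)%:E = l%:E)%E.
Proof.
move=> cg g0 /lim_ooP gl.
rewrite (@ge0_continuous_FTC2y R g (prim g) 0 l) //.
- by rewrite prim0 sube0.
- exact: (cts_within (A := `[0, +oo[%classic)).
- by move=> x _; have [d] := der_prim x cg; exact: ex_derive.
- by apply: cvg_at_right_filter; exact: (@ctsP _ _ (cts_prim cg) 0).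
- by move=> x _; have [d] := der_prim x cg; rewrite derive1E; exact: derive_val.
Qed.

Lemma cts_measurable g (D : set R) : measurable D -> cts g -> measurable_fun D g.
Proof.
move=> mD [cg]; apply: measurable_funTS; exact: continuous_measurable_fun.
Qed.

Lemma bounded_integrable g (K : R) : cts g -> (forall x, 0 <= x -> prim (fun y => `|g y|) x <= K) ->
  mu.-integrable Rp (EFin \o g).
Proof.
move=> cg gK; have cn := cts_norm cg.
have [||l ll _] := @monotone_lim_oo (prim (fun y => `|g y|)) K.
- by move=> x y x0 xy; apply: prim_monotone.
- exact: gK.
apply/integrableP; split; first by apply/measurable_EFinP; apply: cts_measurable.
by rewrite [X in (X < _)%E](ge0_integral_lim_oo cn _ ll) ?ltry.
Qed.

Lemma integrable_norm_lim g : cts g -> mu.-integrable Rp (EFin \o g) ->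
  exists2 l, lim_oo (prim (fun y => `|g y|)) l &
    [/\ \int[mu]_(x in Rp) `|g x| = l & forall x, 0 <= x -> prim (fun y => `|g y|) x <= l].
Proof.
move=> cg ig; have cn := cts_norm cg.
have in_ : mu.-integrable Rp (EFin \o (fun y => `|g y|)) by exact: integrable_norm ig.
have [||l ll [hl _]] := @monotone_lim_oo (prim (fun y => `|g y|)) (\int[mu]_(x in Rp) `|g x|).
- by move=> x y x0 xy; apply: prim_monotone.
- move=> x x0; have /eqP := @Rintegral_itvB R (fun y => `|g y|) (BLeft 0) +oo%O x in_ x0 isT.
  rewrite subr_eq => /eqP ->; rewrite RintegralE_prim // lerDr.
  by apply: Rintegral_ge0.
exists l => //; split => //.
by rewrite /Rintegral (ge0_integral_lim_oo cn _ ll).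
Qed.

Lemma integrable_tail g x : mu.-integrable Rp (EFin \o g) -> 0 <= x ->
  \int[mu]_(y in Rp) g y - \int[mu]_(y in `[0, x]) g y = \int[mu]_(y in `]x, +oo[) g y.
Proof. by move=> ig x0; rewrite Rintegral_itvB. Qed.

Lemma integrable_lim_oo g : cts g -> mu.-integrable Rp (EFin \o g) ->
  lim_oo (prim g) (\int[mu]_(x in Rp) g x).
Proof.
move=> cg ig e e0; have [l ll [el _]] := integrable_norm_lim cg ig.
have [X X0 hX] := ll e e0; exists X => // x Xx; have x0 := le_trans X0 Xx.
have := hX x Xx; rewrite -el distrC => h; rewrite distrC -[prim g x]RintegralE_prim //.
rewrite integrable_tail //.
have sub : mu.-integrable `]x, +oo[ (EFin \o g).
  apply: integrableS ig => // y /=; rewrite !in_itv /= !andbT => /ltW; exact: le_trans.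
apply: le_trans (le_normr_Rintegral _ sub) _ => //.
rewrite -integrable_tail //; last exact: integrable_norm ig.
by rewrite RintegralE_prim // (le_trans _ h) // ler_norm.
Qed.

Lemma integrable_bounded g : cts g -> mu.-integrable Rp (EFin \o g) ->
  exists2 K, 0 <= K & forall x, 0 <= x -> prim (fun y => `|g y|) x <= K.
Proof.
move=> cg ig; have [l _ [_ hl]] := integrable_norm_lim cg ig.
by exists l => //; have := hl 0 (lexx _); rewrite prim0.
Qed.

(** Paths are constrained only on the half-line. The even extension turns them into functions
    continuous on the whole line, as [cts] asks. *)
Lemma cts_hat f : (forall n : R, 0 <= n -> {within `[0, n], continuous f}) -> cts (fun x => f `|x|).
Proof.
move=> cf; split=> x; set n := `|x| + 1.
have n0 : 0 <= n by rewrite addr_ge0.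
have /subspace_continuousP /(_ `|x|) := cf n n0.
rewrite /= in_itv /= normr_ge0 lerDl ler01 => /(_ isT) h.
apply: (@cvg_comp _ _ _ (fun y => `|y|) f); last exact: h.
move=> A /= [e /= e0 he].
have := @ctsP _ _ (cts_norm (@cts_id R)) x => /cvgrPdist_lt hx.
have near1 : \forall y \near x, `| `|x| - `|y| | < 1 by exact: hx.
have near2 : \forall y \near x, `| `|x| - `|y| | < e by exact: hx.
near=> y; apply: he => /=; first by near: y.
rewrite in_itv /= normr_ge0 /= /n.
have : `| `|x| - `|y| | < 1 by near: y.
by rewrite ltr_norml => /andP[h1 _]; lra.
Unshelve. all: by end_near. Qed.

Lemma within_Rp_hat f : {within Rp, continuous f} -> cts (fun x => f `|x|).
Proof.
move=> cf; apply: cts_hat => n _; apply: continuous_subspaceW cf.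
by move=> x /=; rewrite !in_itv /= => /andP[->].
Qed.

Lemma integrable_scale g k (D : set R) : measurable D -> mu.-integrable D (EFin \o g) ->
  mu.-integrable D (EFin \o (fun y => k * g y)).
Proof.
move=> mD ig; apply: eq_integrable (@integrableZl _ _ _ mu D mD k (EFin \o g) ig) => // y _.
Qed.

Lemma integrable_add g h (D : set R) : measurable D -> mu.-integrable D (EFin \o g) ->
  mu.-integrable D (EFin \o h) -> mu.-integrable D (EFin \o (fun y => g y + h y)).
Proof.
move=> mD ig ih; apply: eq_integrable (@integrableD _ _ _ mu D mD _ _ ig ih) => // y _.
Qed.

End half_line.

(** * The string equation *)

(* psi' = S pi, pi' = - lam M psi with psi(0) = 0, pi(0) = 1: the string equation, for which lam is an
   eigenvalue iff psi is square integrable against M and pi vanishes at infinity. *)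
HB.lock Definition spsi (R : realType) (S M : R -> R) (lam : R) : R -> R :=
  sol1 (fun=> 0) S (fun x => - lam * M x) (fun=> 0).
HB.lock Definition spi (R : realType) (S M : R -> R) (lam : R) : R -> R :=
  sol2 (fun=> 0) S (fun x => - lam * M x) (fun=> 0).

Section krein_string.
Context {R : realType}.
Implicit Types (x y lam : R).
Local Notation mu := (@lebesgue_measure R).
Local Notation Rp := (`[0, +oo[%classic : set R).
Variables (S M : R -> R).

Local Notation spsi := (spsi S M).
Local Notation spi := (spi S M).

(** The integral form of the eigenvalue problem, with Green kernel [prim S (min x y)], for arbitrary
    densities; the random operator is the case of [dens_s] and [dens_m]. *)
Definition string_eig lam := exists psi : R -> R,
  [/\ measurable_fun Rp psi,
      mu.-integrable Rp (fun y => (psi y ^+ 2 * M y)%:E),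
      0 < \int[mu]_(y in Rp) (psi y ^+ 2 * M y),
      (forall x, 0 <= x -> mu.-integrable Rp (fun y => (prim S (Order.min x y) * psi y * M y)%:E)) &
      (forall x, 0 <= x -> psi x = lam * \int[mu]_(y in Rp) (prim S (Order.min x y) * psi y * M y))].

Hypotheses (cS : cts S) (cM : cts M) (S0 : forall x, 0 < S x) (M0 : forall x, 0 < M x).

Let cs := cts_prim cS.

Lemma der_spsi lam x : der (spsi lam) x (S x * spi lam x).
Proof.
rewrite spsi.unlock spi.unlock; apply: der_eq (der_sol1 (cts_cst 0) cS (ctsZ (- lam) cM) (cts_cst 0) x) _.
by rewrite mul0r add0r.
Qed.

Lemma der_spi lam x : der (spi lam) x (- lam * M x * spsi lam x).
Proof.
rewrite spsi.unlock spi.unlock; apply: der_eq (der_sol2 (cts_cst 0) cS (ctsZ (- lam) cM) (cts_cst 0) x) _.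
by rewrite mul0r addr0.
Qed.

Lemma spsi0 lam : spsi lam 0 = 0.
Proof. rewrite spsi.unlock; exact: sol1_0 (cts_cst 0) cS (ctsZ (- lam) cM) (cts_cst 0). Qed.

Lemma spi0 lam : spi lam 0 = 1.
Proof. rewrite spi.unlock; exact: sol2_0 (cts_cst 0) cS (ctsZ (- lam) cM) (cts_cst 0). Qed.

Lemma cts_spsi lam : cts (spsi lam).
Proof. exact: der_cts (der_spsi lam). Qed.

Lemma cts_spi lam : cts (spi lam).
Proof. exact: der_cts (der_spi lam). Qed.

Lemma prim_S_gt0 x : 0 < x -> 0 < prim S x.
Proof.
move=> x0; have [c _] := mean_value (ltW x0) (fun y _ => der_prim y cS).
by rewrite prim0 !subr0 => ->; rewrite mulr_gt0.
Qed.

Lemma prim_S_le x y : 0 <= x -> x <= y -> prim S x <= prim S y.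
Proof. by apply: prim_monotone => // z _; exact: ltW. Qed.

Lemma prim_S_ge0 x : 0 <= x -> 0 <= prim S x.
Proof. by move=> x0; have := prim_S_le (lexx 0) x0; rewrite prim0. Qed.

Lemma string_unique lam (U W : R -> R) : U 0 = 0 ->
  (forall x, 0 <= x -> der U x (S x * W x)) ->
  (forall x, 0 <= x -> der W x (- lam * M x * U x)) ->
  forall x, 0 <= x -> U x = W 0 * spsi lam x /\ W x = W 0 * spi lam x.
Proof.
move=> U0 dU dW x x0.
apply: (@system_unique _ (fun=> 0) S (fun x => - lam * M x) (fun=> 0) _ _
  (fun x => W 0 * spsi lam x) (fun x => W 0 * spi lam x) x) => //.
- exact: cts_cst.
- exact: ctsZ.
- exact: cts_cst.
- by move=> y /andP[y0 _]; apply: der_eq (dU y y0) _; ring.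
- by move=> y /andP[y0 _]; apply: der_eq (dW y y0) _; ring.
- by move=> y _; apply: der_eq (derZ (W 0) (der_spsi lam y)) _; ring.
- by move=> y _; apply: der_eq (derZ (W 0) (der_spi lam y)) _; ring.
- by rewrite spsi0 mulr0.
- by rewrite spi0 mulr1.
- by rewrite x0 lexx.
Qed.

(** For [lam <= 0] the product [psi * pi] is nondecreasing from 0, hence [pi ^+ 2] is nondecreasing
    from 1. So [pi] cannot tend to 0, which excludes nonpositive eigenvalues. *)
Lemma spsi_spi_nonpos lam x : lam <= 0 -> 0 <= x -> 1 <= spi lam x.
Proof.
move=> l0 x0.
have dp y : der (fun y => spsi lam y * spi lam y) y (S y * spi lam y ^+ 2 - lam * M y * spsi lam y ^+ 2).
  by apply: der_eq (derM (der_spsi lam y) (der_spi lam y)) _; ring.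
have pos y : 0 <= y -> 0 <= spsi lam y * spi lam y.
  move=> y0; have := der_ge0_le y0 (fun z _ => dp z); rewrite spsi0 mul0r; apply=> z _.
  rewrite subr_ge0; apply: (@le_trans _ _ 0); last by rewrite mulr_ge0 ?sqr_ge0 ?ltW.
  by rewrite mulr_le0_ge0 ?sqr_ge0 // mulr_le0_ge0 // ltW.
have l0' : 0 <= - lam by rewrite oppr_ge0.
have sq : 1 <= spi lam x ^+ 2.
  have := der_ge0_le x0 (fun y _ => der_sqr (der_spi lam y)); rewrite spi0 expr1n; apply.
  move=> y /andP[y0 _].
  have -> : 2 * spi lam y * (- lam * M y * spsi lam y) = 2 * (- lam) * M y * (spsi lam y * spi lam y) by ring.
  by rewrite mulr_ge0 ?pos // mulr_ge0 ?(ltW (M0 _)) // mulr_ge0.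
have : 0 < spi lam x.
  apply: (@nonvanishing_gt0 _ (spi lam) 0 x) => //.
  - exact: cts_within (cts_spi lam).
  - move=> y /andP[y0 _]; apply/eqP => e.
    have := der_ge0_le y0 (fun y _ => der_sqr (der_spi lam y)); rewrite spi0 expr1n e expr0n /=.
    move=> h; suff: (1 : R) <= 0 by rewrite ler10.
    apply: h => z /andP[z0 _].
    have -> : 2 * spi lam z * (- lam * M z * spsi lam z) = 2 * (- lam) * M z * (spsi lam z * spi lam z) by ring.
    by rewrite mulr_ge0 ?pos // mulr_ge0 ?(ltW (M0 _)) // mulr_ge0.
  - by rewrite spi0.
by move=> p0; move: sq; rewrite -[X in X <= _](expr1n _ 2) ler_sqr ?nnegrE // ltW.
Qed.

Lemma prim_spsiM lam x : lam != 0 -> 0 <= x ->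
  prim (fun y => spsi lam y * M y) x = lam^-1 * (1 - spi lam x).
Proof.
move=> l0 x0; have c1 := ctsM (cts_spsi lam) cM.
have := @der_prim_eq _ (fun y => lam^-1 * (1 - spi lam y)) (fun y => spsi lam y * M y) x x0 c1.
rewrite spi0 subrr mulr0 add0r => -> // y _.
by apply: der_eq (derZ _ (derB (der_cst _ _) (der_spi lam y))) _; field.
Qed.

Lemma prim_some_gt0 (g : R -> R) c : cts g -> 0 < c -> (forall x, 0 <= x -> 0 <= g x) -> g c != 0 ->
  exists2 x, 0 <= x & 0 < prim g x.
Proof.
move=> cg c0 g0; apply: contra_neqP => nex.
have z x : 0 <= x -> prim g x = 0.
  move=> x0; apply/eqP; rewrite eq_le prim_ge0 ?andbT //; last by move=> y /andP[/g0].
  by rewrite leNgt; apply/negP => px; apply: nex; exists x.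
have [d1] := der_prim c cg.
have [d2] : der (prim g) c 0.
  apply: near_eq_der (der_cst 0 c); near=> y; apply/esym/z.
  by apply: ltW; near: y; exact: lt_nbhsr.
by have := @derive_val _ _ _ _ _ _ _ d1; have := @derive_val _ _ _ _ _ _ _ d2 => -> ->.
Unshelve. all: by end_near. Qed.

(** Since [pi] tends to 0, the tail [lam * int_x^oo psi M] equals [pi x]. Splitting the kernel at
    [y = x] then reduces the integral equation to an integration by parts. *)
Lemma string_eig_of lam : 0 < lam ->
  mu.-integrable Rp (EFin \o (fun y => spsi lam y ^+ 2 * M y)) ->
  mu.-integrable Rp (EFin \o (fun y => spsi lam y * M y)) ->
  lim_oo (spi lam) 0 -> string_eig lam.
Proof.
move=> l0 i2 i1 lim0; exists (spsi lam).
have lN0 : lam != 0 by rewrite gt_eqF.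
have c1 := ctsM (cts_spsi lam) cM; have c2 := ctsM (cts_sqr (cts_spsi lam)) cM.
have cG x : cts (fun y => prim S (Order.min x y) * spsi lam y * M y).
  apply: ctsM cM; apply: ctsM (cts_spsi lam); apply: cts_comp cs.
  apply: (@eq_cts _ (fun y => (x + y - `|x - y|) / 2)); first by move=> y; rewrite minr_absE.
  apply: ctsM (cts_cst _); apply: ctsB; first exact: ctsD (cts_cst _) (@cts_id R).
  by apply: cts_norm; exact: ctsB (cts_cst _) (@cts_id R).
have iG x : 0 <= x -> mu.-integrable Rp (EFin \o (fun y => prim S (Order.min x y) * spsi lam y * M y)).
  move=> x0; apply: (@le_integrable _ _ _ mu _ _ _ (EFin \o (fun y => prim S x * (spsi lam y * M y)))) => //.
  - by apply/measurable_EFinP; apply: cts_measurable.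
  - move=> y; rewrite /= in_itv /= andbT => y0; rewrite lee_fin -mulrA [`|prim S (Order.min x y) * _|]normrM [`|prim S x * _|]normrM ler_wpM2r //.
    have m0 : 0 <= Order.min x y by rewrite le_min x0.
    by rewrite !ger0_norm ?prim_S_ge0 // prim_S_le // ge_min lexx.
  - by apply: integrable_scale.
have tot : \int[mu]_(y in Rp) (spsi lam y * M y) = lam^-1.
  apply: lim_oo_unique (integrable_lim_oo c1 i1) _ => e e0.
  have [X X0 hX] := lim0 (lam * e) (mulr_gt0 l0 e0); exists X => // y Xy.
  rewrite prim_spsiM ?(le_trans X0 Xy) // (_ : _ - _ = - (lam^-1 * spi lam y)); last by ring.
  by rewrite normrN normrM gtr0_norm ?invr_gt0 // ler_pdivrMl // -[spi lam y]subr0 hX.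
have tail x : 0 <= x -> lam * \int[mu]_(y in `]x, +oo[) (spsi lam y * M y) = spi lam x.
  by move=> x0; rewrite -integrable_tail // RintegralE_prim // tot prim_spsiM //; field.
have [c c0 pc] : exists2 c, 0 < c & spsi lam c != 0.
  apply: contrapT => nex.
  have z x : 0 <= x -> spsi lam x = 0.
    rewrite le_eqVlt => /orP[/eqP <-|x0]; first exact: spsi0.
    by apply/eqP/negP => /negP px; apply: nex; exists x.
  have [X X0 /(_ X (lexx _))] := lim0 2^-1 (ltac:(by rewrite invr_gt0)).
  rewrite -(der0_eq X0 (f := spi lam)).
    by rewrite spi0 subr0 normr1 leNgt invf_lt1 // ltr1n.
  by move=> x /andP[x0 _]; apply: der_eq (der_spi lam x) _; rewrite z // mulr0.
split.
- by apply: cts_measurable (cts_spsi lam).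
- exact: i2.
- have g0 x : 0 <= x -> 0 <= spsi lam x ^+ 2 * M x by move=> _; rewrite mulr_ge0 ?sqr_ge0 // ltW.
  have [x x0 px] : exists2 x, 0 <= x & 0 < prim (fun y => spsi lam y ^+ 2 * M y) x.
    by apply: prim_some_gt0 c0 _ _ => //; rewrite mulf_neq0 ?expf_neq0 // gt_eqF.
  apply: lt_le_trans px _; have [l ll [<- hl]] := integrable_norm_lim c2 i2.
  apply: le_trans (le_trans _ (hl x x0)) _.
    by rewrite le_eqVlt; apply/orP; left; apply/eqP/eq_prim => // y /andP[y0 _]; rewrite ger0_norm // g0.
  rewrite le_eqVlt; apply/orP; left; apply/eqP/eq_Rintegral => y; rewrite inE /= in_itv /= andbT => y0.
  by rewrite ger0_norm // g0.
- exact: iG.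
- move=> x x0.
  have /eqP := integrable_tail (iG x x0) x0; rewrite subr_eq => /eqP ->.
  have csM := ctsM (ctsM cs (cts_spsi lam)) cM.
  rewrite (_ : \int[mu]_(y in `[0, x]) _ = prim (fun y => prim S y * spsi lam y * M y) x); last first.
    rewrite -(@RintegralE_prim _ (fun y => prim S y * spsi lam y * M y) x x0).
    apply: eq_Rintegral => y; rewrite inE /= in_itv /= => /andP[_ yx].
    by rewrite min_r.
  rewrite (_ : \int[mu]_(y in `]x, +oo[) _ = prim S x * \int[mu]_(y in `]x, +oo[) (spsi lam y * M y)); last first.
    rewrite -RintegralZl //.
      apply: eq_Rintegral => y; rewrite inE /= in_itv /= andbT => /ltW xy.
      by rewrite min_l // mulrA.
    apply: integrableS i1 => // y /=; rewrite !in_itv /= !andbT => /ltW; exact: le_trans.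
  rewrite mulrDr mulrCA tail //.
  rewrite -(primZ lam csM x0).
  (* Integration by parts: in the derivative of [psi - prim S * pi] the terms [S * pi] cancel and
     [lam * prim S * psi * M] remains. *)
  have := @der_prim_eq _ (fun y => spsi lam y - prim S y * spi lam y) (fun y => lam * (prim S y * spsi lam y * M y)) x x0 (ctsZ _ csM).
  rewrite spsi0 prim0 mul0r subrr add0r => <-; first by ring.
  move=> y _; apply: der_eq (derB (der_spsi lam y) (derM (der_prim y cS) (der_spi lam y))) _.
  by ring.
Qed.

Lemma string_eig_conds lam : string_eig lam ->
  [/\ 0 < lam, mu.-integrable Rp (EFin \o (fun y => spsi lam y ^+ 2 * M y)),
  mu.-integrable Rp (EFin \o (fun y => spsi lam y * M y)) & lim_oo (spi lam) 0].
Proof.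
move=> [phi [mphi i2 pos iG eqn]].
have s1 : 0 < prim S 1 by exact: prim_S_gt0.
have mM : measurable_fun Rp M by apply: cts_measurable.
have i1 : mu.-integrable Rp (EFin \o (fun y => phi y * M y)).
  have [C C0 hC] := cts_bounded cM (@ler01 R).
  have iexp : mu.-integrable Rp (EFin \o (fun y => expR (- y))).
    apply: (@bounded_integrable _ _ 1); first exact: cts_exp (ctsN (@cts_id R)).
    move=> x x0; rewrite -(@eq_prim _ (fun y => expR (- y))) //; last first.
      by move=> y _; rewrite ger0_norm // ltW // expR_gt0.
    have := @der_prim_eq _ (fun y => - expR (- y)) (fun y => expR (- y)) x x0 (cts_exp (ctsN (@cts_id R))).
    rewrite oppr0 expR0 => h.
    have := expR_gt0 (- x); have : - expR (- x) = -1 + prim (fun y => expR (- y)) x; last by lra.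
    apply: h => y _; apply: der_eq (derN (der_exp (derN (der_id y)))) _.
    by rewrite mulN1r opprK.
  (* An integrable majorant of [|phi| M]. On [[0, 1]] use [|phi| <= phi^2 + 1], with
     [C * expR 1 * expR (- y)] dominating [M] there; beyond 1 the kernel at [x = 1] is the constant
     [prim S 1], so the last term equals [|phi| M]. *)
  pose k y := phi y ^+ 2 * M y + (C * expR 1 * expR (- y) + (prim S 1)^-1 * `|prim S (Order.min 1 y) * phi y * M y|).
  apply: (@le_integrable _ _ _ mu _ _ _ (EFin \o k)) => //.
  - by apply/measurable_EFinP; exact: measurable_funM.
  - move=> y; rewrite /= in_itv /= andbT => y0; rewrite lee_fin.
    apply: le_trans _ (ler_norm _); rewrite /k normrM (gtr0_norm (M0 y)).
    have p2 := sqr_ge0 (phi y).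
    have h1 : 0 <= phi y ^+ 2 * M y by rewrite mulr_ge0 // ltW.
    have h2 : 0 <= C * expR 1 * expR (- y) by rewrite !mulr_ge0 ?expR_ge0 // ltW.
    have h3 : 0 <= (prim S 1)^-1 * `|prim S (Order.min 1 y) * phi y * M y|.
      by rewrite mulr_ge0 // invr_ge0 ltW.
    set z3 := (prim S 1)^-1 * _ in h3 *.
    have [y1|/ltW y1] := leP y 1.
      have : M y <= C * expR 1 * expR (- y).
        rewrite -mulrA -expRD; have := hC y; rewrite y0 y1 => /(_ isT); rewrite gtr0_norm // => h.
        by apply: (le_trans h); rewrite ler_peMr ?(ltW C0) // ge1_expR // subr_ge0.
      have : `|phi y| * M y <= (phi y ^+ 2 + 1) * M y.
        rewrite ler_pM2r // -(real_normK (num_real _)).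
        by have := sqr_ge0 (`|phi y| - 1); have := normr_ge0 (phi y); nra.
      by rewrite mulrDl mul1r; lra.
    have -> : `|phi y| * M y = z3.
      rewrite /z3 min_l // !normrM (gtr0_norm s1) (gtr0_norm (M0 y)); field.
      by rewrite gt_eqF.
    by lra.
  - apply: integrable_add => //; apply: integrable_add => //; apply: integrable_scale => //.
    by apply: integrable_norm; exact: iG.
pose Q x := \int[mu]_(y in `[0, x]) (phi y * M y).
pose A x := \int[mu]_(y in `[0, x]) (prim S y * phi y * M y).
pose Qoo := \int[mu]_(y in Rp) (phi y * M y).
have iA x : 0 <= x -> mu.-integrable `[0, x] (EFin \o (fun y => prim S y * phi y * M y)).
  move=> x0; apply: (@eq_integrable _ _ _ mu _ _ (EFin \o (fun y => prim S (Order.min x y) * phi y * M y))) => //.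
    by move=> y; rewrite inE /= in_itv /= => /andP[_ yx]; rewrite min_r.
  apply: integrableS (iG x x0) => // y /=; rewrite !in_itv /= andbT; by case/andP.
have iQ x : 0 <= x -> mu.-integrable `[0, x] (EFin \o (fun y => phi y * M y)).
  by move=> x0; apply: integrableS i1 => // y /=; rewrite !in_itv /= andbT; case/andP.
have formula x : 0 <= x -> phi x = lam * (A x + prim S x * (Qoo - Q x)).
  move=> x0; rewrite eqn //; congr (_ * _).
  have /eqP := integrable_tail (iG x x0) x0; rewrite subr_eq => /eqP ->.
  have -> : \int[mu]_(y in `[0, x]) (prim S (Order.min x y) * phi y * M y) = A x.
    apply: eq_Rintegral => y; rewrite inE /= in_itv /= => /andP[_ yx].
    by rewrite min_r.
  have -> : \int[mu]_(y in `]x, +oo[) (prim S (Order.min x y) * phi y * M y) =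
      prim S x * \int[mu]_(y in `]x, +oo[) (phi y * M y).
    rewrite -RintegralZl //.
      apply: eq_Rintegral => y; rewrite inE /= in_itv /= andbT => /ltW xy.
      by rewrite min_l // mulrA.
    apply: integrableS i1 => // y /=; rewrite !in_itv /= !andbT => /ltW; exact: le_trans.
  by rewrite -integrable_tail // addrC.
(* A priori [phi] is only measurable. The formula expresses it through indefinite integrals, so it
   is continuous, and then the integrands are continuous and the integrals differentiable. *)
have cAQ : cts (fun x => A `|x|) /\ cts (fun x => Q `|x|).
  by split; apply: cts_hat => n n0; apply: parameterized_integral_continuous => //; [exact: iA|exact: iQ].
case: cAQ => cA cQ.
pose phh x := phi `|x|.
have cphi : cts phh.
  apply: (@eq_cts _ (fun x => lam * (A `|x| + prim S `|x| * (Qoo - Q `|x|)))).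
    by move=> x; rewrite /phh formula.
  apply: ctsZ; apply: ctsD => //; apply: ctsM; last exact: ctsB (cts_cst _) cQ.
  by apply: cts_comp cs; exact: cts_norm (@cts_id R).
have cP := ctsM cphi cM; have csP := ctsM (ctsM cs cphi) cM.
have eQ x : 0 <= x -> Q x = prim (fun y => phh y * M y) x.
  move=> x0; rewrite -RintegralE_prim //; apply: eq_Rintegral => y.
  by rewrite inE /= in_itv /= => /andP[y0 _]; rewrite /phh ger0_norm.
have eA x : 0 <= x -> A x = prim (fun y => prim S y * phh y * M y) x.
  move=> x0; rewrite -RintegralE_prim //; apply: eq_Rintegral => y.
  by rewrite inE /= in_itv /= => /andP[y0 _]; rewrite /phh ger0_norm.
(* [W] is the tail [lam * int_x^oo phi M] and [U] is [phi]. They solve the string equation with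
   [U 0 = 0], so they are [W 0] times [spsi] and [spi]; the factor is nonzero because [phi] has
   positive norm. *)
pose W x := lam * (Qoo - prim (fun y => phh y * M y) x).
pose U x := lam * prim (fun y => prim S y * phh y * M y) x + prim S x * W x.
have eU x : 0 <= x -> phi x = U x.
  by move=> x0; rewrite formula // eA // eQ // /U /W; ring.
have dW x : der W x (- lam * (phh x * M x)).
  by apply: der_eq (derZ _ (derB (der_cst _ _) (der_prim x cP))) _; ring.
have dU x : der U x (S x * W x).
  apply: der_eq (derD (derZ _ (der_prim x csP)) (derM (der_prim x cS) (dW x))) _; ring.
have W0 : W 0 = lam * Qoo by rewrite /W prim0 subr0.
have U0 : U 0 = 0 by rewrite /U !prim0 mulr0 mul0r addr0.
have dW' x : 0 <= x -> der W x (- lam * M x * U x).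
  by move=> x0; apply: der_eq (dW x) _; rewrite -eU // /phh ger0_norm //; ring.
have eqs := string_unique U0 (fun x _ => dU x) dW'.
have k0 : W 0 != 0.
  apply/eqP => k0; move: pos; rewrite (_ : \int[mu]_(y in Rp) _ = 0) ?ltxx //.
  rewrite -[RHS](mul0r (\int[mu]_(y in Rp) (phi y ^+ 2 * M y))) -RintegralZl //.
  apply: eq_Rintegral => y.
  rewrite inE /= in_itv /= andbT => y0; have [e _] := eqs y y0.
  by rewrite eU // e k0 mul0r expr0n /= !mul0r.
have limW : lim_oo W 0.
  move=> e e0; have l1 : 0 < `|lam| + 1 by rewrite ltr_wpDl.
  have i1' : mu.-integrable Rp (EFin \o (fun y => phh y * M y)).
    apply: eq_integrable i1 => // y; rewrite inE /= in_itv /= andbT => y0.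
    by rewrite /phh ger0_norm.
  have eQoo : Qoo = \int[mu]_(y in Rp) (phh y * M y).
    by apply: eq_Rintegral => y; rewrite inE /= in_itv /= andbT => y0; rewrite /phh ger0_norm.
  have [X X0 hX] := integrable_lim_oo cP i1' (divr_gt0 e0 l1); exists X => // x Xx.
  rewrite subr0 /W normrM distrC eQoo; have := hX x Xx; set z := `|_ - _|.
  rewrite ler_pdivlMr // => h; apply: le_trans h; rewrite mulrC ler_wpM2l // ?lerDl //.
  exact: normr_ge0.
have limpi : lim_oo (spi lam) 0.
  move=> e e0; have k1 : 0 < `|W 0| by rewrite normr_gt0.
  have [X X0 hX] := limW _ (mulr_gt0 k1 e0); exists X => // x Xx.
  have := hX x Xx; have [_ ->] := eqs x (le_trans X0 Xx).
  by rewrite !subr0 normrM ler_pM2l.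
have l0 : 0 < lam.
  rewrite ltNge; apply/negP => l0.
  have [X X0 /(_ X (lexx _))] := limpi 2^-1 (ltac:(by rewrite invr_gt0)).
  have := spsi_spi_nonpos l0 X0; rewrite subr0 => h1 h2.
  have := ler_norm (spi lam X); have : (2^-1 : R) < 1 by rewrite invf_lt1 // ltr1n.
  by lra.
split => //.
- apply: (@eq_integrable _ _ _ mu _ _ (EFin \o (fun y => (W 0)^-1 ^+ 2 * (phi y ^+ 2 * M y)))) => //.
    move=> y; rewrite inE /= in_itv /= andbT => y0; have [e _] := eqs y y0.
    by rewrite eU // e; congr EFin; field.
  by apply: integrable_scale.
- apply: (@eq_integrable _ _ _ mu _ _ (EFin \o (fun y => (W 0)^-1 * (phi y * M y)))) => //.
    move=> y; rewrite inE /= in_itv /= andbT => y0; have [e _] := eqs y y0.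
    by rewrite eU // e; congr EFin; field.
  by apply: integrable_scale.
Qed.

End krein_string.

(** * First zeros and sign changes *)

Section first_zero.
Context {R : realType}.
Implicit Types (f : R -> R) (x y z a b l : R).

Lemma first_zero f a b : cts f -> a <= b -> 0 < f a -> f b <= 0 ->
  exists z, [/\ a < z <= b, f z = 0 & forall y, a <= y < z -> 0 < f y].
Proof.
move=> cf ab fa fb.
pose A := [set z | a <= z <= b /\ f z <= 0].
have Ab : A b by rewrite /A /= ab lexx.
have lbA : lbound A a by move=> z [/andP[]].
have hi : has_inf A by split; [exists b|exists a].
set z := inf A.
have az : a <= z by apply: lb_le_inf => //; exists b.
have zb : z <= b by apply: (ge_inf (proj2 hi)).
have pos y : a <= y < z -> 0 < f y.
  move=> /andP[ay yz]; rewrite ltNge; apply/negP => fy.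
  have : z <= y.
    by apply: (ge_inf (proj2 hi)); split=> //; rewrite ay (le_trans (ltW yz)).
  by rewrite leNgt yz.
have fz : f z <= 0.
  rewrite leNgt; apply/negP => fz.
  have := @ctsP _ _ cf z => /cvgrPdist_lt /(_ _ fz) /nbhs_ballP [e /= e0 he].
  have [t At tz] := inf_adherent e0 hi.
  have zt : z <= t by apply: (ge_inf (proj2 hi)).
  have := he t; rewrite /ball /= ltr_norml => /(_ _).
  have -> : - e < z - t < e by apply/andP; split; rewrite -/z in tz; lra.
  move=> /(_ isT); rewrite ltr_norml => /andP[_ h].
  by case: At => _; lra.
exists z; have az' : a < z.
  by rewrite lt_neqAle az andbT; apply/eqP => e; move: fz; rewrite -e leNgt fa.
split => //; first by rewrite az' zb.
apply/eqP; rewrite eq_le fz /= leNgt; apply/negP => fz'.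
have [|c] := IVT (v := f z / 2) az (cts_within (A := `[a, z]%classic) cf) _.
  by rewrite ge_min le_max; apply/andP; split; apply/orP; [right|left]; lra.
rewrite in_itv /= => /andP[ac cz] fc.
have : c < z by rewrite lt_neqAle cz andbT; apply/eqP => e; move: fc; rewrite e; lra.
by move=> cz'; have := pos c; rewrite ac cz' => /(_ isT); lra.
Qed.

Lemma der_neg_after f z l : der f z l -> l < 0 -> f z <= 0 ->
  forall e : R, 0 < e -> exists2 y, z < y < z + e & f y < 0.
Proof.
move=> [[d1 d2]] l0 fz e e0.
have : h^-1 *: (f (h *: 1 + z) - f z) @[h --> 0^'] --> l by rewrite -d2; exact: d1.
move=> /cvgrPdist_lt /(_ (- l)); rewrite oppr_gt0 => /(_ l0) [r /= r0 hr].
pose h : R := Num.min r e / 2.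
have h0 : 0 < h by rewrite divr_gt0 // lt_min r0.
have hm : h < Num.min r e by rewrite /h ltr_pdivrMr // ltr_pMr ?ltr1n // lt_min r0.
move: (hm); rewrite lt_min => /andP[hr' he].
have := hr h; rewrite /ball /= sub0r normrN gtr0_norm // => /(_ hr').
rewrite gt_eqF // => /(_ isT); rewrite ltr_norml opprK => /andP[q _].
have {q} : h^-1 * (f (h + z) - f z) < 0.
  by move: q; rewrite /GRing.scale /= mulr1; lra.
rewrite pmulr_rlt0 ?invr_gt0 // => q.
exists (h + z); last by lra.
by apply/andP; split; lra.
Qed.

End first_zero.

(** * Monotonicity and continuity in the spectral parameter *)

Section string_comparison.
Context {R : realType}.
Implicit Types (x y lam nu : R).
Variables (S M : R -> R).
Hypotheses (cS : cts S) (cM : cts M) (S0 : forall x, 0 < S x) (M0 : forall x, 0 < M x).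

Local Notation psi := (spsi S M).
Local Notation pi_ := (spi S M).

Lemma spsi_ge0 lam x : 0 <= x -> (forall y, 0 <= y < x -> 0 <= pi_ lam y) -> 0 <= psi lam x.
Proof.
move=> x0 pos; have [->|xN0] := eqVneq x 0; first by rewrite spsi0.
have pos' y : 0 <= y <= x -> 0 <= pi_ lam y.
  move=> /andP[y0 yx]; have [yx'|] := ltP y x; first by apply: pos; rewrite y0.
  move=> xy; have -> : y = x by apply/eqP; rewrite eq_le yx.
  rewrite leNgt; apply/negP => neg.
  have := @ctsP _ _ (cts_spi cS cM lam) x => /cvgrPdist_lt /(_ (- pi_ lam x)).
  rewrite oppr_gt0 => /(_ neg) /nbhs_ballP [e /= e0 he].
  pose h := Num.min x e / 2.
  have x0' : 0 < x by rewrite lt_neqAle eq_sym xN0.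
  have h0 : 0 < h by rewrite divr_gt0 // lt_min x0'.
  have hm : h < Num.min x e by rewrite /h ltr_pdivrMr // ltr_pMr ?ltr1n // lt_min x0'.
  move: (hm); rewrite lt_min => /andP[hx he'].
  have := he (x - h); rewrite /ball /= opprB addrCA subrr addr0 gtr0_norm // => /(_ he').
  have := pos (x - h); have -> : 0 <= x - h < x by apply/andP; split; lra.
  by move=> /(_ isT) h1; rewrite ltr_norml => /andP[h2 _]; lra.
have := der_ge0_le x0 (fun y _ => der_spsi cS cM lam y); rewrite spsi0 //; apply=> y yx.
by rewrite mulr_ge0 ?pos' // ltW.
Qed.

Lemma spsi_gt0 lam x : 0 < x -> (forall y, 0 <= y < x -> 0 < pi_ lam y) -> 0 < psi lam x.
Proof.
move=> x0 pos.
have ge0 y : 0 <= y <= x -> 0 <= psi lam y.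
  move=> /andP[y0 yx]; apply: spsi_ge0 => // z /andP[z0 zy]; apply/ltW/pos.
  by rewrite z0 (lt_le_trans zy).
rewrite lt_neqAle ge0 ?(ltW x0) ?lexx // andbT; apply/eqP => e.
have x2 : 0 < x / 2 by rewrite divr_gt0.
have [c /andP[c0 cx]] := mean_value (ltW x2) (fun y _ => der_spsi cS cM lam y).
rewrite spsi0 // !subr0 => h.
have c1 : c < x by lra.
have : 0 < psi lam (x / 2) by rewrite h !mulr_gt0 // pos // c0.
have h2 : x / 2 <= x by lra.
have : psi lam (x / 2) <= psi lam x.
  have [d /andP[d0 dx] hd] := mean_value h2 (fun y _ => der_spsi cS cM lam y).
  have [dx'|] := ltP d x; last first.
    move=> xd; have ed : d = x by apply/eqP; rewrite eq_le dx.
    have : 0 <= pi_ lam x.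
      rewrite leNgt; apply/negP => neg.
      have [z [/andP[z0 zx] fz _]] := first_zero (cts_spi cS cM lam) (ltW x0) (ltac:(by rewrite spi0)) (ltW neg).
      have : z != x by apply/eqP => ez; move: neg; rewrite -ez fz ltxx.
      move=> zNx; have zx' : z < x by rewrite lt_neqAle zNx.
      by have := pos z; rewrite (ltW z0) zx' fz ltxx => /(_ isT).
    move=> px; have : 0 <= psi lam x - psi lam (x / 2); last by lra.
    by rewrite hd ed !mulr_ge0 // ?(ltW (S0 _)) //; lra.
  have : 0 <= psi lam x - psi lam (x / 2); last by lra.
  have pd : 0 < pi_ lam d by apply: pos; rewrite dx' andbT; lra.
  by rewrite hd !mulr_ge0 ?(ltW (S0 _)) ?(ltW pd) //; lra.
by rewrite -e; lra.
Qed.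

Lemma spi_nonincr lam x y : 0 <= lam -> 0 <= x -> x <= y ->
  (forall z, 0 <= z < y -> 0 <= pi_ lam z) -> pi_ lam y <= pi_ lam x.
Proof.
move=> l0 x0 xy pos.
apply: (der_le0_ge xy (fun z _ => der_spi cS cM lam z)) => z /andP[xz zy].
rewrite !mulNr oppr_le0 mulr_ge0 // ?mulr_ge0 // ?(ltW (M0 _)) //.
apply: spsi_ge0 => [|t /andP[t0 tz]]; first exact: le_trans xz.
by apply: pos; rewrite t0 (lt_le_trans tz).
Qed.

(** Sturm comparison. The Wronskian [w] has derivative [(lam - nu) * M * psi nu * psi lam >= 0],
    whereas at a first zero of [pi_ nu] it would equal [- psi nu * pi_ lam < 0]. Hence [pi_ nu]
    stays positive, and the quotient [pi_ nu / pi_ lam] is nondecreasing from 1. *)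
Lemma spi_antitone nu lam x : 0 <= nu -> nu <= lam -> 0 <= x ->
  (forall y, 0 <= y <= x -> 0 < pi_ lam y) -> pi_ lam x <= pi_ nu x.
Proof.
move=> nu0 nl x0 pos.
pose w y := pi_ nu y * psi lam y - psi nu y * pi_ lam y.
have dw y : der w y ((lam - nu) * M y * psi nu y * psi lam y).
  apply: der_eq (derB (derM (der_spi cS cM nu y) (der_spsi cS cM lam y))
    (derM (der_spsi cS cM nu y) (der_spi cS cM lam y))) _; ring.
have w0 : w 0 = 0 by rewrite /w !spsi0 // mulr0 mul0r subrr.
have p2 y : 0 <= y <= x -> 0 <= psi lam y.
  move=> /andP[y0 yx]; apply: spsi_ge0 => // z /andP[z0 zy]; apply/ltW/pos.
  by rewrite z0 (le_trans (ltW zy)).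
have key y : 0 <= y <= x -> (forall z, 0 <= z < y -> 0 < pi_ nu z) -> 0 <= w y.
  move=> /andP[y0 yx] pz; have := der_ge0_le y0 (fun z _ => dw z); rewrite w0; apply=> z /andP[z0 zy].
  rewrite mulr_ge0 // ?p2 ?z0 ?(le_trans zy) // mulr_ge0 //.
    by rewrite mulr_ge0 ?subr_ge0 // ltW.
  by apply: spsi_ge0 => // t /andP[t0 tz]; apply/ltW/pz; rewrite t0 (lt_le_trans tz).
have pos1 y : 0 <= y <= x -> 0 < pi_ nu y.
  move=> /andP[y0 yx]; rewrite ltNge; apply/negP => neg.
  have [z [/andP[z0 zy] fz pz]] := first_zero (cts_spi cS cM nu) y0 (ltac:(by rewrite spi0)) neg.
  have zx : 0 <= z <= x by rewrite ltW // (le_trans zy).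
  have := key z zx pz; rewrite /w fz mul0r sub0r oppr_ge0 leNgt mulr_gt0 ?pos //.
  exact: spsi_gt0.
have dP y : 0 <= y <= x -> der (fun y => pi_ nu y * (pi_ lam y)^-1) y
    (M y * (nu * w y + (lam - nu) * psi lam y * pi_ nu y) / pi_ lam y ^+ 2).
  move=> yx; have pN : pi_ lam y != 0 by rewrite gt_eqF // pos.
  apply: der_eq (derM (der_spi cS cM nu y) (der_inv pN (der_spi cS cM lam y))) _.
  by rewrite /w; field.
have := der_ge0_le x0 dP; rewrite !spi0 // invr1 mul1r => h.
have : 1 <= pi_ nu x / pi_ lam x.
  apply: h => y yx; rewrite mulr_ge0 // ?invr_ge0 ?sqr_ge0 // mulr_ge0 ?(ltW (M0 _)) //.
  have [y0 yx'] := andP yx.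
  rewrite addr_ge0 //.
    rewrite mulr_ge0 // key // => z /andP[z0 zy]; apply: pos1.
    by rewrite z0 (le_trans (ltW zy)).
  by rewrite mulr_ge0 ?(ltW (pos1 _ _)) // mulr_ge0 ?p2 // subr_ge0.
by rewrite ler_pdivlMr ?mul1r // pos // x0 lexx.
Qed.

Lemma string_lam_continuous lam x (e : R) : 0 <= x -> 0 < e ->
  exists2 d : R, 0 < d & forall nu, `|nu - lam| <= d ->
    forall y, 0 <= y <= x -> `|psi nu y - psi lam y| <= e /\ `|pi_ nu y - pi_ lam y| <= e.
Proof.
move=> x0 e0.
have [CS CS0 hS] := cts_bounded cS x0; have [CM CM0 hM] := cts_bounded cM x0.
have [D1 D10 hD1] := cts_bounded (cts_spsi cS cM lam) x0.
have [D2 D20 hD2] := cts_bounded (cts_spi cS cM lam) x0.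
pose C := CS + (`|lam| + 1) * CM; pose D := D1 + D2.
have C0 : 0 < C by rewrite /C addr_gt0 // mulr_gt0 // ltr_wpDl.
pose K := 8 * D ^+ 2 * (x + 1) * expR ((4 * C + 1) * x).
have Dp : 0 < D by rewrite /D addr_gt0.
have K0 : 0 < K by rewrite /K !mulr_gt0 ?expR_gt0 ?exprn_gt0 // ltr_wpDl.
pose d := Num.min 1 (e / (CM * (K + 1))).
have d0 : 0 < d by rewrite /d lt_min ltr01 divr_gt0 // mulr_gt0 // addr_gt0.
exists d => // nu hd y yx.
have d1 : d <= 1 by rewrite /d ge_min lexx.
have d2 : d * CM * (K + 1) <= e.
  by rewrite -mulrA -ler_pdivlMr ?mulr_gt0 ?addr_gt0 // /d ge_min lexx orbT.
have nuN : `|nu| <= `|lam| + 1.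
  by have := ler_normD (nu - lam) lam; rewrite subrK; lra.
have st := @system_stability _ (fun=> 0) S (fun x => - nu * M x) (fun=> 0)
  (fun=> 0) S (fun x => - lam * M x) (fun=> 0) (psi nu) (pi_ nu) (psi lam) (pi_ lam)
  x C D (d * CM) x0 (ltW C0).
have {st} := st _ _ _ _ _ _ _ _ _ _ _ y yx.
have Dg : 0 <= D by rewrite /D; lra.
have dCM : 0 <= d * CM by rewrite mulr_ge0 // ltW.
move=> /(_ Dg dCM) st.
have : (psi nu y - psi lam y) ^+ 2 + (pi_ nu y - pi_ lam y) ^+ 2 <=
    8 * (d * CM * D) ^+ 2 * y * expR ((4 * C + 1) * y).
  apply: st.
  - move=> z zx; rewrite normr0 normrM normrN; split => //.
    + exact: ltW.
    + by apply: le_trans (hS z zx) _; rewrite /C lerDl mulr_ge0 ?(ltW CM0) // addr_ge0.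
    + apply: le_trans (_ : (`|lam| + 1) * CM <= _); last by rewrite /C lerDr ltW.
      by apply: ler_pM => //; exact: hM.
    + exact: ltW.
  - by move=> z zx; have := hD1 z zx; have := hD2 z zx; rewrite /D; split; lra.
  - move=> z zx; rewrite !subrr normr0; split => //.
    rewrite -mulrBl normrM -opprD normrN.
    by apply: ler_pM => //; exact: hM.
  - by move=> z _; apply: der_eq (der_spsi cS cM nu z) _; ring.
  - by move=> z _; apply: der_eq (der_spi cS cM nu z) _; ring.
  - by move=> z _; apply: der_eq (der_spsi cS cM lam z) _; ring.
  - by move=> z _; apply: der_eq (der_spi cS cM lam z) _; ring.
  - by rewrite !spsi0.
  - by rewrite !spi0.
have [y0 yx'] := andP yx.
have : 8 * (d * CM * D) ^+ 2 * y * expR ((4 * C + 1) * y) <= (d * CM) ^+ 2 * K.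
  rewrite /K (_ : 8 * (d * CM * D) ^+ 2 * y * _ = (d * CM) ^+ 2 * (8 * D ^+ 2 * y * expR ((4 * C + 1) * y))); last by ring.
  rewrite ler_wpM2l ?sqr_ge0 // ler_pM ?expR_ge0 //.
  - by rewrite mulr_ge0 // mulr_ge0 // sqr_ge0.
  - by rewrite ler_wpM2l ?mulr_ge0 ?sqr_ge0 //; lra.
  - by rewrite ler_expR ler_pM2l //; lra.
have : (d * CM) ^+ 2 * K <= e ^+ 2.
  apply: le_trans (_ : (d * CM * (K + 1)) ^+ 2 <= _).
    rewrite [X in _ <= X]exprMn ler_wpM2l ?sqr_ge0 //.
    by have := sqr_ge0 K; rewrite sqrrD1; lra.
  by rewrite ler_sqr ?nnegrE ?mulr_ge0 ?(ltW e0) //; lra.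
move=> h1 h2 h3.
have sq z : z ^+ 2 <= e ^+ 2 -> `|z| <= e.
  by move=> h; rewrite -ler_sqr ?nnegrE ?(ltW e0) // real_normK ?num_real.
have := sqr_ge0 (psi nu y - psi lam y); have := sqr_ge0 (pi_ nu y - pi_ lam y) => h4 h5.
by split; apply: sq; clear -h1 h2 h3 h4 h5; lra.
Qed.

End string_comparison.

(** * Existence and location of the lowest eigenvalue *)

Section string_spectrum.
Context {R : realType}.
Implicit Types (x y lam nu : R).
Local Notation mu := (@lebesgue_measure R).
Local Notation Rp := (`[0, +oo[%classic : set R).
Variables (S M : R -> R).
Hypotheses (cS : cts S) (cM : cts M) (S0 : forall x, 0 < S x) (M0 : forall x, 0 < M x).

Local Notation psi := (spsi S M).
Local Notation pi_ := (spi S M).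

Lemma der_exp_scale (k a : R) x : a != 0 -> der (fun y => k / a * expR (a * y)) x (k * expR (a * x)).
Proof.
move=> a0; apply: der_eq (derZ _ (der_exp (derZ _ (der_id _)))) _.
by rewrite mulr1; field.
Qed.

(** While [pi_] is positive it is nonincreasing, so [psi' = S pi] lets [psi] grow at most like
    [expR (al * x)]. Against [M], of order [expR (- ga * y)] with [ga > al], this is integrable, so
    beyond [x1] the function [pi_] loses only an explicit exponentially small amount. *)
Lemma string_tail (C al ga : R) nu x1 x : 0 < al -> al < ga -> 0 < C -> 0 <= nu -> 0 <= x1 -> x1 <= x ->
  (forall y, x1 <= y -> S y <= C * expR (al * y)) ->
  (forall y, x1 <= y -> M y <= C * expR (- ga * y)) ->
  (forall y, 0 <= y < x -> 0 < pi_ nu y) ->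
  psi nu x <= psi nu x1 + pi_ nu x1 * (C / al * expR (al * x)) /\
  pi_ nu x1 - nu * (psi nu x1 * (C / ga * expR (- ga * x1)) +
    pi_ nu x1 * (C ^+ 2 / (al * (ga - al)) * expR (- (ga - al) * x1))) <= pi_ nu x.
Proof.
move=> al0 alga C0 nu0 x10 x1x hS hM pos.
have ga0 : 0 < ga := lt_trans al0 alga.
have ka0 : 0 < ga - al by rewrite subr_gt0.
have pge y : 0 <= y <= x -> 0 <= psi nu y.
  move=> /andP[y0 yx]; apply: spsi_ge0 => // z /andP[z0 zy]; apply/ltW/pos.
  by rewrite z0 (lt_le_trans zy).
have pmono y : x1 <= y <= x -> pi_ nu y <= pi_ nu x1.
  move=> /andP[y0 yx]; apply: spi_nonincr => // z /andP[z0 zy]; apply/ltW/pos.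
  by rewrite z0 (lt_le_trans zy).
have p1 : 0 <= pi_ nu x1.
  have [x1x'|] := ltP x1 x; first by apply/ltW/pos; rewrite x10.
  move=> xx1; have e : x1 = x by apply/eqP; rewrite eq_le x1x.
  rewrite leNgt; apply/negP => neg.
  have [z [/andP[z0 zx] fz _]] := first_zero (cts_spi cS cM nu) x10 (ltac:(by rewrite spi0)) (ltW neg).
  have zNx : z != x by apply/eqP => ez; move: neg; rewrite e -ez fz ltxx.
  by have := pos z; rewrite (ltW z0) lt_neqAle zNx -e zx fz ltxx => /(_ isT).
have up y : x1 <= y <= x -> psi nu y <= psi nu x1 + pi_ nu x1 * (C / al * expR (al * y)).
  move=> /andP[x1y yx].
  have := der_le x1y (fun z _ => der_spsi cS cM nu z)
    (fun z _ => derZ (pi_ nu x1) (der_exp_scale C z (lt0r_neq0 al0))).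
  have q0 : 0 <= pi_ nu x1 * (C / al * expR (al * x1)).
    by rewrite !mulr_ge0 ?expR_ge0 ?invr_ge0 // ltW.
  move=> h; have : psi nu y - psi nu x1 <= pi_ nu x1 * (C / al * expR (al * y)) - pi_ nu x1 * (C / al * expR (al * x1)); last by lra.
  apply: h => z /andP[x1z zy].
  have zx : x1 <= z <= x by rewrite x1z (le_trans zy).
  rewrite [X in _ <= X]mulrC.
  apply: (@le_trans _ _ (S z * pi_ nu x1)); first by rewrite ler_pM2l // pmono.
  by rewrite ler_wpM2r // hS.
split; first by apply: up; rewrite x1x lexx.
pose a1 := psi nu x1 * C; pose a2 := pi_ nu x1 * C ^+ 2 / al.
pose G y := - nu * (a1 / (- ga) * expR (- ga * y) + a2 / (- (ga - al)) * expR (- (ga - al) * y)).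
have dG y : der G y (- nu * (a1 * expR (- ga * y) + a2 * expR (- (ga - al) * y))).
  by apply: derZ; apply: derD; apply: der_exp_scale; rewrite oppr_eq0 gt_eqF.
have := der_le x1x (fun z _ => dG z) (fun z _ => der_spi cS cM nu z).
have eG y : G y = nu * (psi nu x1 * (C / ga * expR (- ga * y)) +
    pi_ nu x1 * (C ^+ 2 / (al * (ga - al)) * expR (- (ga - al) * y))).
  by rewrite /G /a1 /a2; field; rewrite !gt_eqF.
rewrite !eG; set q := nu * (_ + _); set q1 := nu * (_ + _) => h.
have q0 : 0 <= q.
  have x1p : 0 <= psi nu x1 by apply: pge; rewrite x10 x1x.
  rewrite /q mulr_ge0 // addr_ge0 //.
    by rewrite !mulr_ge0 ?expR_ge0 ?invr_ge0 // ltW.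
  by rewrite mulr_ge0 // mulr_ge0 ?expR_ge0 // divr_ge0 ?sqr_ge0 // mulr_ge0 // ltW.
suff : q - q1 <= pi_ nu x - pi_ nu x1 by lra.
apply: h => z zx; have [x1z zx'] := andP zx.
rewrite -mulrA ler_wnM2l ?oppr_le0 //.
apply: (@le_trans _ _ (C * expR (- ga * z) * (psi nu x1 + pi_ nu x1 * (C / al * expR (al * z))))).
  apply: ler_pM => //; [exact: ltW|by apply: pge; rewrite (le_trans x10)|exact: hM|exact: up].
rewrite le_eqVlt; apply/orP; left; apply/eqP.
have -> : - (ga - al) * z = - ga * z + al * z by ring.
by rewrite /a1 /a2 expRD; field; rewrite gt_eqF.
Qed.

Lemma spi_le1 nu x : 0 <= nu -> 0 <= x -> (forall y, 0 <= y < x -> 0 < pi_ nu y) -> pi_ nu x <= 1.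
Proof.
move=> nu0 x0 pos; rewrite -(spi0 cS cM nu); apply: spi_nonincr => // z zx.
by apply/ltW/pos.
Qed.

Lemma no_eig_below lam (c : R) nu : 0 < c -> (forall x, 0 <= x -> c <= pi_ lam x) -> nu <= lam ->
  ~ string_eig S M nu.
Proof.
move=> c0 hc nl /(string_eig_conds cS cM S0 M0) [nu0 _ _ lim0].
have c2 : 0 < c / 2 by rewrite divr_gt0.
have [X X0 /(_ X (lexx _))] := lim0 (c / 2) c2.
have : pi_ lam X <= pi_ nu X.
  apply: spi_antitone => //; first exact: ltW.
  by move=> y /andP[y0 _]; exact: lt_le_trans (hc y y0).
have := hc X X0; rewrite subr0 => h1 h2; have := ler_norm (pi_ nu X); lra.
Qed.

Lemma spi_vanishes : exists2 lam, 0 < lam & exists2 x, 0 <= x & pi_ lam x <= 0.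
Proof.
have half0 : 0 < 2^-1 :> R by rewrite invr_gt0.
have half1 : 2^-1 <= 1 :> R by rewrite invf_le1 // ler1n.
have s0 : 0 < prim S 2^-1 by apply: prim_S_gt0.
have [c /andP[c0 c1] ec] := mean_value half1 (fun y _ => der_prim y cM).
have m0 : 0 < prim M 1 - prim M 2^-1 by rewrite ec mulr_gt0 // subr_gt0 invf_lt1 // ltr1n.
(* If [pi_] stayed positive, then [psi] at 1/2 would be at least [pi_ * prim S] there, and on
   [[1/2, 1]] the loss of [pi_] at least [lam] times this times the mass of [M]. This [lam] makes
   the loss equal to the value of [pi_] at 1/2. *)
pose lam := (prim S 2^-1 * (prim M 1 - prim M 2^-1))^-1.
have l0 : 0 < lam by rewrite invr_gt0 mulr_gt0.
exists lam => //; apply: contrapT => nex.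
have pos y : 0 <= y -> 0 < pi_ lam y.
  by move=> y0; rewrite ltNge; apply/negP => py; apply: nex; exists y.
have mono x y : 0 <= x -> x <= y -> pi_ lam y <= pi_ lam x.
  by move=> x0 xy; apply: spi_nonincr => //; [exact: ltW|move=> z /andP[z0 _]; exact/ltW/pos].
have h1 : pi_ lam 2^-1 * prim S 2^-1 <= psi lam 2^-1.
  have := der_le (ltW half0) (fun z _ => derZ (pi_ lam 2^-1) (der_prim z cS)) (fun z _ => der_spsi cS cM lam z).
  rewrite spsi0 // prim0 mulr0 !subr0; apply=> z /andP[z0 z1].
  by rewrite mulrC ler_pM2l // mono.
have h2 : pi_ lam 1 - pi_ lam 2^-1 <= - lam * psi lam 2^-1 * prim M 1 - - lam * psi lam 2^-1 * prim M 2^-1.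
  apply: (der_le half1 (fun z _ => der_spi cS cM lam z) (fun z _ => derZ (- lam * psi lam 2^-1) (der_prim z cM))).
  move=> z /andP[z0 z1]; rewrite !mulNr lerN2 -!mulrA ler_pM2l // mulrC ler_pM2l //.
  apply: (der_ge0_le z0 (fun t _ => der_spsi cS cM lam t)) => t /andP[t0 _].
  by rewrite mulr_ge0 ?(ltW (S0 _)) // ltW // pos // (le_trans _ t0) // ltW.
have h3 : lam * (pi_ lam 2^-1 * prim S 2^-1) * (prim M 1 - prim M 2^-1) = pi_ lam 2^-1.
  by rewrite /lam; field; rewrite !gt_eqF.
have h4 : lam * (pi_ lam 2^-1 * prim S 2^-1) * (prim M 1 - prim M 2^-1) <= lam * psi lam 2^-1 * (prim M 1 - prim M 2^-1).
  by rewrite ler_pM2r // ler_pM2l.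
have := pos 1 ler01; lra.
Qed.

Lemma expR_le1 x : x <= 0 -> expR x <= 1.
Proof. by move=> x0; rewrite -expR0 ler_expR. Qed.

Lemma exp_decay_le (B k e : R) : 0 <= B -> 0 < k -> 0 < e ->
  exists2 X : R, 0 <= X & forall x, X <= x -> B * expR (- k * x) <= e.
Proof.
move=> B0 k0 e0; exists (B / (e * k)); first by rewrite divr_ge0 // mulr_ge0 // ltW.
move=> x; rewrite ler_pdivrMr ?mulr_gt0 // => h.
rewrite mulNr expRN ler_pdivrMr ?expR_gt0 //; apply: le_trans (_ : e * (1 + k * x) <= _).
  by rewrite mulrDr mulr1 mulrA; apply: (le_trans h); lra.
by rewrite ler_pM2l // expR_ge1Dx.
Qed.

Section existence.
Variables (C al ga : R).
Hypotheses (al0 : 0 < al) (alga : al < ga) (C0 : 0 < C).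
Hypothesis hS : forall y, 0 <= y -> S y <= C * expR (al * y).
Hypothesis hM : forall y, 0 <= y -> M y <= C * expR (- ga * y).

Let ga0 : 0 < ga := lt_trans al0 alga.
Let ka := ga - al.
Let ka0 : 0 < ka. Proof. by rewrite subr_gt0. Qed.
Let K := C ^+ 2 / (al * ga) + C ^+ 2 / (al * ka).
Let K0 : 0 < K. Proof. by rewrite addr_gt0 // divr_gt0 ?exprn_gt0 ?mulr_gt0. Qed.

(** The bounds [psi <= C / al * expR (al * x)] and [pi_ <= 1] remove the dependence on the data at
    [x1], so one [x1] serves all [nu] in a bounded range. *)
Lemma string_tail_uniform nu x1 x : 0 <= nu -> 0 <= x1 -> x1 <= x ->
  (forall y, 0 <= y < x -> 0 < pi_ nu y) -> pi_ nu x1 - nu * K * expR (- ka * x1) <= pi_ nu x.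
Proof.
move=> nu0 x10 x1x pos.
have pos1 y : 0 <= y < x1 -> 0 < pi_ nu y.
  by move=> /andP[y0 yx]; apply: pos; rewrite y0 (lt_le_trans yx).
have hS1 y : x1 <= y -> S y <= C * expR (al * y) by move=> h; apply: hS; exact: le_trans h.
have hM1 y : x1 <= y -> M y <= C * expR (- ga * y) by move=> h; apply: hM; exact: le_trans h.
have [_] := string_tail al0 alga C0 nu0 x10 x1x hS1 hM1 pos.
apply: le_trans; rewrite lerB // -[nu * K * _]mulrA ler_wpM2l // /K mulrDl lerD //.
  have [] := string_tail al0 alga C0 nu0 (lexx 0) x10 hS hM pos1.
  rewrite spsi0 // spi0 // add0r mul1r => h _.
  have : psi nu x1 * (C / ga * expR (- ga * x1)) <= C / al * expR (al * x1) * (C / ga * expR (- ga * x1)).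
    by rewrite ler_wpM2r // !mulr_ge0 ?expR_ge0 ?invr_ge0 // ltW.
  move=> /le_trans; apply; rewrite le_eqVlt; apply/orP; left; apply/eqP.
  have -> : - ka * x1 = - ga * x1 + al * x1 by rewrite /ka; ring.
  by rewrite expRD; field; rewrite !gt_eqF.
rewrite ler_piMl ?spi_le1 // mulr_ge0 ?expR_ge0 // divr_ge0 ?sqr_ge0 // mulr_ge0 // ltW //.
Qed.

Lemma spi_lam0 x : 0 <= x -> pi_ 0 x = 1.
Proof.
move=> x0; rewrite -(spi0 cS cM 0); apply/esym/(der0_eq x0) => y _.
by apply: der_eq (der_spi cS cM 0 y) _; ring.
Qed.

(** The first zero is transversal: [psi > 0] there, so [pi_' = - nu M psi < 0]. A strictly negative
    value, unlike a zero, survives a small change of [nu]. *)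
Lemma spi_first_zero_neg nu x : 0 < nu -> 0 <= x -> pi_ nu x <= 0 -> exists2 t, 0 <= t & pi_ nu t < 0.
Proof.
move=> nu0 x0 px.
have [z [/andP[z0 zx] fz pz]] := first_zero (cts_spi cS cM nu) x0 (ltac:(by rewrite spi0)) px.
have zN : - nu * M z * psi nu z < 0.
  by rewrite !mulNr oppr_lt0 !mulr_gt0 // spsi_gt0.
have fz0 : pi_ nu z <= 0 by rewrite fz.
have [t /andP[zt _] ft] := der_neg_after (der_spi cS cM nu z) zN fz0 ltr01.
by exists t => //; rewrite ltW // (lt_trans z0).
Qed.

(** Letting the end point of [string_tail] go to infinity, where [pi_] vanishes, bounds [pi_ x] by
    the loss terms. For large [x] the one in [pi_ x] is absorbed, and
    [psi' = S pi_ <= ga / 4 * psi]. Thus [psi] grows at most like [expR (ga / 4 * x)] and [psi^2 M]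
    decays like [expR (- ga / 2 * x)]. *)
Lemma decaying_square_integrable lam : 0 < lam -> (forall x, 0 <= x -> 0 < pi_ lam x) ->
  lim_oo (pi_ lam) 0 -> mu.-integrable Rp (EFin \o (fun y => psi lam y ^+ 2 * M y)).
Proof.
move=> l0 pos lim0; pose K2 := C ^+ 2 / (al * ka).
have K20 : 0 < K2 by rewrite divr_gt0 ?exprn_gt0 ?mulr_gt0.
have pge x : 0 <= x -> 0 <= psi lam x.
  by move=> x0; apply: spsi_ge0 => // y /andP[y0 _]; exact/ltW/pos.
have bnd x : 0 <= x -> pi_ lam x <= lam * (psi lam x * (C / ga * expR (- ga * x)) + pi_ lam x * (K2 * expR (- ka * x))).
  move=> x0; rewrite -subr_le0; apply/ler_addgt0Pr => e e0; rewrite add0r.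
  have [Y Y0 hY] := lim0 e e0; pose y := x + Y.
  have xy : x <= y by rewrite lerDl.
  have hS1 z : x <= z -> S z <= C * expR (al * z) by move=> h; apply: hS; exact: le_trans h.
  have hM1 z : x <= z -> M z <= C * expR (- ga * z) by move=> h; apply: hM; exact: le_trans h.
  have [_] := string_tail al0 alga C0 (ltW l0) x0 xy hS1 hM1 (fun z hz => pos z (proj1 (andP hz))).
  move=> /le_trans; apply; have := hY y; rewrite /y lerDr x0 subr0 => /(_ isT).
  by apply: le_trans; exact: ler_norm.
have [X1 X10 hX1] := exp_decay_le (mulr_ge0 (ltW l0) (ltW K20)) ka0 (ltac:(by rewrite invr_gt0) : (0 : R) < 2^-1).
have B0 : 0 <= 2 * lam * (C ^+ 2 / ga) by rewrite !mulr_ge0 ?sqr_ge0 ?invr_ge0 // ltW.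
have th0 : 0 < ga / 4 by rewrite divr_gt0.
have [X2 X20 hX2] := exp_decay_le B0 ka0 th0.
pose X := X1 + X2; have X0 : 0 <= X by rewrite addr_ge0.
have slope x : X <= x -> S x * pi_ lam x <= ga / 4 * psi lam x.
  move=> Xx; have x0 := le_trans X0 Xx.
  have h1 := hX1 x (le_trans (ltac:(by rewrite lerDl) : X1 <= X) Xx).
  have h2 := hX2 x (le_trans (ltac:(by rewrite lerDr) : X2 <= X) Xx).
  have px := pos x x0; have qx := pge x x0.
  have h3 : pi_ lam x <= 2 * lam * (psi lam x * (C / ga * expR (- ga * x))).
    have := bnd x x0; rewrite mulrDr.
    have : lam * (pi_ lam x * (K2 * expR (- ka * x))) <= pi_ lam x * 2^-1.
      by rewrite mulrCA ler_pM2l // mulrA.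
    lra.
  apply: le_trans (_ : C * expR (al * x) * (2 * lam * (psi lam x * (C / ga * expR (- ga * x)))) <= _).
    by apply: ler_pM; rewrite ?(ltW (S0 _)) ?(ltW px) ?hS.
  have -> : C * expR (al * x) * (2 * lam * (psi lam x * (C / ga * expR (- ga * x)))) =
      2 * lam * (C ^+ 2 / ga) * expR (- ka * x) * psi lam x.
    have -> : - ka * x = - ga * x + al * x by rewrite /ka; ring.
    by rewrite expRD; field; rewrite !gt_eqF.
  by rewrite ler_wpM2r.
have grow x : X <= x -> psi lam x <= psi lam X * expR (ga / 4 * x).
  move=> Xx; have dexp y : der (fun z => psi lam z * expR (- (ga / 4 * z))) y
     (S y * pi_ lam y * expR (- (ga / 4 * y)) + psi lam y * (- (ga / 4 * 1) * expR (- (ga / 4 * y)))).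
    exact: derM (der_spsi cS cM lam y) (der_exp (derN (derZ _ (der_id _)))).
  have := der_le0_ge Xx (fun z _ => dexp z) => h.
  have {h} : psi lam x * expR (- (ga / 4 * x)) <= psi lam X * expR (- (ga / 4 * X)).
    apply: h => z /andP[Xz _]; rewrite mulr1 mulrA -mulrDl mulr_le0_ge0 ?expR_ge0 //.
    by have := slope z Xz; lra.
  rewrite expRN ler_pdivrMr ?expR_gt0 // => /le_trans; apply; rewrite ler_wpM2r ?expR_ge0 //.
  by rewrite ler_piMr ?pge // expR_le1 // oppr_le0 mulr_ge0 // ltW.
have cg := ctsM (cts_sqr (cts_spsi cS cM lam)) cM.
have cn := cts_norm cg.
pose B := psi lam X ^+ 2 * C.
have B00 : 0 <= B by rewrite mulr_ge0 ?sqr_ge0 // ltW.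
have g2 : 0 < ga / 2 by rewrite divr_gt0.
apply: (@bounded_integrable _ _ (prim (fun y => `|psi lam y ^+ 2 * M y|) X + B / (ga / 2))) => // x x0.
have [xX|/ltW Xx] := leP x X.
  apply: (le_trans (prim_monotone cn _ x0 xX)) => //.
  by rewrite lerDl divr_ge0 // ltW.
have := der_le Xx (fun z _ => der_prim z cn) (fun z _ => @der_exp_scale B (- (ga / 2)) z (ltac:(by rewrite oppr_eq0 gt_eqF))).
move=> h; have {h} : prim (fun y => `|psi lam y ^+ 2 * M y|) x - prim (fun y => `|psi lam y ^+ 2 * M y|) X <=
   B / - (ga / 2) * expR (- (ga / 2) * x) - B / - (ga / 2) * expR (- (ga / 2) * X).
  apply: h => z /andP[Xz _]; have z0 := le_trans X0 Xz.
  rewrite ger0_norm; last by apply: mulr_ge0; [exact: sqr_ge0|exact: ltW].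
  apply: le_trans (_ : (psi lam X * expR (ga / 4 * z)) ^+ 2 * (C * expR (- ga * z)) <= _).
    apply: ler_pM; rewrite ?sqr_ge0 ?(ltW (M0 _)) ?hM //.
    have pz := pge z z0; have gz := grow z Xz.
    by rewrite ler_sqr ?nnegrE // (le_trans pz gz).
  rewrite le_eqVlt; apply/orP; left; apply/eqP.
  have -> : - (ga / 2) * z = ga / 4 * z + ga / 4 * z + - ga * z by field.
  by rewrite !expRD /B; ring.
have e1 : expR (- (ga / 2) * X) <= 1 by rewrite expR_le1 // mulNr oppr_le0 mulr_ge0 // ltW.
have Bg : 0 <= B / (ga / 2) by rewrite divr_ge0 // ltW.
have : B / (ga / 2) * expR (- (ga / 2) * X) <= B / (ga / 2) by rewrite ler_piMr.
have : 0 <= B / (ga / 2) * expR (- (ga / 2) * x) by rewrite mulr_ge0 // expR_ge0.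
have -> : B / - (ga / 2) = - (B / (ga / 2)) by rewrite invrN mulrN.
lra.
Qed.

(** The eigenvalue is the supremum [ls] of the parameters for which [pi_] is positive on the whole
    half-line. Positivity persists at [ls], since a zero would produce a stable negative value. The
    limit of [pi_ ls] is 0: a positive limit would, by the uniform tail bound, keep [pi_] positive
    for slightly larger parameters. *)
Lemma string_eig_exists lam x0 : 0 < lam -> 0 <= x0 -> pi_ lam x0 <= 0 ->
  exists2 nu, 0 < nu <= lam & string_eig S M nu.
Proof.
move=> l0 x00 px0.
pose A := [set nu | 0 <= nu <= lam /\ forall x, 0 <= x -> 0 < pi_ nu x].
have A0 : A 0.
  by split; [rewrite lexx ltW|move=> x x1; rewrite spi_lam0].
have ubA : ubound A lam by move=> nu [/andP[]].
have hs : has_sup A by split; [exists 0|exists lam].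
set ls := sup A.
have ls0 : 0 <= ls by apply: (ub_le_sup (proj2 hs)).
have lsl : ls <= lam by apply: ge_sup; [exists 0|].
have pos x : 0 <= x -> 0 < pi_ ls x.
  move=> x1; rewrite ltNge; apply/negP => px.
  have lsp : 0 < ls.
    by rewrite lt_neqAle ls0 andbT; apply/eqP => e; move: px; rewrite -e spi_lam0 // ler10.
  have [t t0 ft] := spi_first_zero_neg lsp x1 px.
  have e0 : 0 < - pi_ ls t / 2 by rewrite divr_gt0 // oppr_gt0.
  have [d d0 hd] := string_lam_continuous cS cM ls t0 e0.
  have [nu An nus] := sup_adherent d0 hs.
  have nul : nu <= ls by apply: (ub_le_sup (proj2 hs)).
  have nud : `|nu - ls| <= d by rewrite -/ls in nus; rewrite ler_norml; apply/andP; split; lra.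
  have [_] := hd nu nud t (ltac:(by rewrite t0 lexx)).
  by have := proj2 An t t0; rewrite ler_norml => h /andP[_ h2]; lra.
have lsl' : ls < lam.
  by rewrite lt_neqAle lsl andbT; apply/eqP => e; have := pos x0 x00; rewrite e ltNge px0.
have [||l limN [lub lle]] := @monotone_lim_oo _ (fun x => - pi_ ls x) 0.
- move=> x y x1 xy; rewrite lerN2; apply: spi_nonincr => // z /andP[z0 _]; exact/ltW/pos.
- by move=> x x1; rewrite oppr_le0 ltW // pos.
have [lz|lneg] := eqVneq l 0; last first.
  exfalso; pose el := - l.
  have el0 : 0 < el by rewrite oppr_gt0 lt_neqAle lneg.
  have pel x : 0 <= x -> el <= pi_ ls x by move=> /lub; rewrite /el; lra.
  have el4 : 0 < el / 4 by rewrite divr_gt0.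
  have [x1 x10 /(_ x1 (lexx _)) hx1] := exp_decay_le (mulr_ge0 (ltW l0) (ltW K0)) ka0 el4.
  have [d d0 hd] := string_lam_continuous cS cM ls x10 el4.
  pose h := Num.min d (lam - ls).
  have h0 : 0 < h by rewrite lt_min d0 subr_gt0.
  pose nu := ls + h.
  have nul : nu <= lam by rewrite /nu -lerBrDl ge_min lexx orbT.
  have nu0 : 0 <= nu by rewrite addr_ge0 // ltW.
  have nud : `|nu - ls| <= d by rewrite /nu addrC addKr gtr0_norm // ge_min lexx.
  have p1 y : 0 <= y <= x1 -> el / 2 < pi_ nu y.
    move=> yx; have [_] := hd nu nud y yx; rewrite ler_norml => /andP[h1 _].
    by have := pel y (proj1 (andP yx)); lra.
  suff An : A nu.
    by have := ub_le_sup (proj2 hs) An; rewrite -/ls /nu; lra.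
  split; first by rewrite nu0.
  move=> x xx0; rewrite ltNge; apply/negP => px.
  have [z [/andP[z0 zx] fz pz]] := first_zero (cts_spi cS cM nu) xx0 (ltac:(by rewrite spi0)) px.
  have x1z : x1 <= z.
    rewrite leNgt; apply/negP => zx1; have := p1 z; rewrite fz (ltW z0) (ltW zx1) => /(_ isT); lra.
  have := string_tail_uniform nu0 x10 x1z pz; rewrite fz.
  have := p1 x1; rewrite x10 lexx => /(_ isT).
  have : nu * K * expR (- ka * x1) <= lam * K * expR (- ka * x1).
    by rewrite ler_wpM2r ?expR_ge0 // ler_pM2r.
  by lra.
have lim0 : lim_oo (pi_ ls) 0.
  move=> e e0; have [X X0 hX] := limN e e0; exists X => // x Xx.
  by have := hX x Xx; rewrite lz !subr0 normrN.
have lsp : 0 < ls.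
  rewrite lt_neqAle ls0 andbT; apply/eqP => e.
  have := lub 0 (lexx 0); rewrite lz.
  have [X X0 /(_ X (lexx _))] := lim0 2^-1 (ltac:(by rewrite invr_gt0)).
  by rewrite -e spi_lam0 // subr0 normr1 leNgt invf_lt1 // ltr1n.
exists ls; first by rewrite lsp.
apply: string_eig_of => //; first exact: decaying_square_integrable.
apply: (@bounded_integrable _ _ (ls^-1)) => [|x xx0]; first exact: ctsM (cts_spsi cS cM ls) cM.
rewrite -(@eq_prim _ (fun y => psi ls y * M y)) //; last first.
  move=> y /andP[y0 _]; rewrite ger0_norm // mulr_ge0 ?(ltW (M0 _)) //.
  by apply: spsi_ge0 => // z /andP[z0 _]; exact/ltW/pos.
rewrite prim_spsiM ?gt_eqF // ler_piMr ?invr_ge0 //.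
by have := pos x xx0; lra.
Qed.

End existence.

End string_spectrum.

(** * The Airy system *)

(* [twu] and [tww] solve u' = c B u + w, w' = (t + m - c^2 B^2) u - c B w: then u'/u is the
   Riccati diffusion and the noise only enters through the continuous path B. *)
HB.lock Definition twu (R : realType) (c m : R) (B : R -> R) : R -> R :=
  sol1 (fun t => c * B t) (fun=> 1) (fun t => t + m - (c * B t) ^+ 2) (fun t => - (c * B t)).
HB.lock Definition tww (R : realType) (c m : R) (B : R -> R) : R -> R :=
  sol2 (fun t => c * B t) (fun=> 1) (fun t => t + m - (c * B t) ^+ 2) (fun t => - (c * B t)).

Section airy_system.
Context {R : realType}.
Implicit Types (t s m x y : R).
Variables (c : R) (B : R -> R).
Hypothesis cB : cts B.

Local Notation u := (twu c ^~ B).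
Local Notation w := (tww c ^~ B).

Let ccB := ctsZ c cB.

Lemma cts_airy_potential m : cts (fun t => t + m - (c * B t) ^+ 2).
Proof. by apply: ctsB (cts_sqr ccB); exact: ctsD (@cts_id R) (cts_cst _). Qed.

Lemma der_twu m t : der (u m) t (c * B t * u m t + w m t).
Proof.
rewrite twu.unlock tww.unlock.
apply: der_eq (der_sol1 ccB (cts_cst 1) (cts_airy_potential m) (ctsN ccB) t) _.
by rewrite mul1r.
Qed.

Lemma der_tww m t : der (w m) t ((t + m - (c * B t) ^+ 2) * u m t - c * B t * w m t).
Proof.
rewrite twu.unlock tww.unlock.
apply: der_eq (der_sol2 ccB (cts_cst 1) (cts_airy_potential m) (ctsN ccB) t) _.
by rewrite mulNr.
Qed.

Lemma twu0 m : u m 0 = 0.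
Proof. rewrite twu.unlock; exact: sol1_0 ccB (cts_cst 1) (cts_airy_potential m) (ctsN ccB). Qed.

Lemma tww0 m : w m 0 = 1.
Proof. rewrite tww.unlock; exact: sol2_0 ccB (cts_cst 1) (cts_airy_potential m) (ctsN ccB). Qed.

Lemma cts_twu m : cts (u m).
Proof. exact: der_cts (der_twu m). Qed.

Lemma cts_tww m : cts (w m).
Proof. exact: der_cts (der_tww m). Qed.

(** For [K] large, [(u^2 + w^2) expR (K t)] is nondecreasing and starts at 1, so [u] and [w] have no
    common zero. *)
Lemma tw_nonzero m t : 0 <= t -> u m t = 0 -> w m t != 0.
Proof.
move=> t0 ut; apply/eqP => wt.
have [C1 C10 h1] := cts_bounded ccB t0.
have [C2 C20 h2] := cts_bounded (cts_airy_potential m) t0.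
pose K := 2 * C1 + C2 + 1.
pose E y := (u m y ^+ 2 + w m y ^+ 2) * expR (K * y).
have dE y : der E y ((2 * u m y * (c * B y * u m y + w m y) +
   2 * w m y * ((y + m - (c * B y) ^+ 2) * u m y - c * B y * w m y)) * expR (K * y) +
   (u m y ^+ 2 + w m y ^+ 2) * (K * 1 * expR (K * y))).
  apply: derM; last exact: der_exp (derZ _ (der_id _)).
  by apply: derD; apply: der_sqr; [exact: der_twu|exact: der_tww].
have := der_ge0_le t0 (fun y _ => dE y); rewrite /E ut wt twu0 tww0 mulr0 expR0 !expr0n /= !add0r expr1n !mulr1 mul0r.
move=> h; suff: (1 : R) <= 0 by rewrite ler10.
apply: h => y yt; have := h1 y yt; have := h2 y yt.
set a := c * B y; set b := y + m - _ => hb ha.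
rewrite mulrA -mulrDl mulr_ge0 ?expR_ge0 //.
set p := u m y; set q := w m y.
have [a1 a2] := andP (ltac:(by rewrite -ler_norml) : - C1 <= a <= C1).
have [b1 b2] := andP (ltac:(by rewrite -ler_norml) : - C2 <= b <= C2).
have := sqr_ge0 (p + q); have := sqr_ge0 (p - q).
have := mulr_ge0 (ltac:(lra) : 0 <= C1 + a) (sqr_ge0 p).
have := mulr_ge0 (ltac:(lra) : 0 <= C1 - a) (sqr_ge0 q).
have := mulr_ge0 (ltac:(lra) : 0 <= C2 + b) (sqr_ge0 (p + q)).
have := mulr_ge0 (ltac:(lra) : 0 <= C2 - b) (sqr_ge0 (p - q)).
have := sqr_ge0 p; have := sqr_ge0 q.
by rewrite /K; nra.
Qed.

(** A zero of [u] is transversal, because [u' = w] there and [w] does not vanish. Extinction is thus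
    an open condition, stable under perturbation and visible at rational times. *)
Lemma twu_nonpos_neg m t : 0 < t -> u m t <= 0 -> exists2 s, 0 < s & u m s < 0.
Proof.
move=> t0; rewrite le_eqVlt => /orP[/eqP ut|]; last by exists t.
have := tw_nonzero (ltW t0) ut; rewrite neq_lt => /orP[neg|pos].
  have d : der (u m) t (w m t) by apply: der_eq (der_twu m t) _; rewrite ut mulr0 add0r.
  have ut0 : u m t <= 0 by rewrite ut.
  have [y /andP[ty _] uy] := der_neg_after d neg ut0 ltr01.
  by exists y => //; exact: lt_trans ty.
(* Here [u] crosses upwards and is negative just before [t]; reflection about [t] reduces this to
   the other case. *)
have d : der (fun y => u m (2 * t - y)) t (- w m t).
  have du : der (u m) (2 * t - t) (w m t).
    by have -> : 2 * t - t = t by [ring]; apply: der_eq (der_twu m t) _; rewrite ut mulr0 add0r.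
  by apply: der_eq (der_comp (derB (der_cst (2 * t) t) (der_id t)) du) _; ring.
have wN : - w m t < 0 by rewrite oppr_lt0.
have ut0 : u m (2 * t - t) <= 0 by have -> : 2 * t - t = t by [ring]; rewrite ut.
have [y /andP[ty yt] uy] := der_neg_after (f := fun y => u m (2 * t - y)) d wN ut0 t0.
by exists (2 * t - y) => //; lra.
Qed.

Lemma twu_pos_near0 m : exists2 t, 0 < t & forall s, 0 < s <= t ->
  [/\ 0 < u m s, u m s <= 2 * s, 2^-1 <= w m s & w m s <= 2].
Proof.
have w1 := @ctsP _ _ (cts_tww m) 0; rewrite /= in w1.
have half : 0 < 2^-1 :> R by rewrite invr_gt0.
have four : 0 < 4^-1 :> R by rewrite invr_gt0.
have := w1 => /cvgrPdist_le /(_ _ half) /nbhs_ballP [e1 /= e10 he1].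
have cuw := ctsD (ctsM ccB (cts_twu m)) (cts_tww m).
have := @ctsP _ _ cuw 0 => /cvgrPdist_le /(_ _ half) /nbhs_ballP [e2 /= e20 he2].
pose t := Num.min e1 e2 / 2.
have t0 : 0 < t by rewrite divr_gt0 // lt_min e10.
have [te1 te2] : t < e1 /\ t < e2.
  apply/andP; rewrite -lt_min /t ltr_pdivrMr // ltr_pMr ?ltr1n // lt_min e10 //.
exists t => // s /andP[s0 st].
have b1 y : 0 <= y <= t -> 2^-1 <= w m y /\ w m y <= 2.
  move=> /andP[y0 yt]; have := he1 y; rewrite /ball /= sub0r normrN ger0_norm // => /(_ (le_lt_trans yt te1)).
  by rewrite tww0 ler_norml => /andP[h1 h2]; split; lra.
have b2 y : 0 <= y <= t -> 2^-1 <= c * B y * u m y + w m y /\ c * B y * u m y + w m y <= 2.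
  move=> /andP[y0 yt]; have := he2 y; rewrite /ball /= sub0r normrN ger0_norm // => /(_ (le_lt_trans yt te2)).
  by rewrite tww0 twu0 mulr0 add0r ler_norml => /andP[h1 h2]; split; lra.
have [y /andP[y0 ys]] := mean_value (ltW s0) (fun y _ => der_twu m y).
rewrite twu0 !subr0 => ->.
have [h1 h2] := b2 y (ltac:(by rewrite y0 (le_trans ys))).
have [h3 h4] := b1 s (ltac:(by rewrite (ltW s0))).
split => //; first by rewrite mulr_gt0 // (lt_le_trans half).
by rewrite ler_wpM2r // ltW.
Qed.

Lemma tw_wronskian m m' t : der (fun t => w m t * u m' t - w m' t * u m t) t ((m - m') * u m t * u m' t).
Proof.
apply: der_eq (derB (derM (der_tww m t) (der_twu m' t)) (derM (der_tww m' t) (der_twu m t))) _.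
ring.
Qed.

Lemma tw_wronskian_mono m m' s t : m' < m -> 0 <= s -> s <= t ->
  (forall y, s <= y <= t -> 0 <= u m y /\ 0 <= u m' y) ->
  w m s * u m' s - w m' s * u m s <= w m t * u m' t - w m' t * u m t.
Proof.
move=> mm s0 st pos.
apply: (der_ge0_le st (fun y _ => tw_wronskian m m' y)) => y /pos [h1 h2].
by rewrite mulr_ge0 // mulr_ge0 // subr_ge0 ltW.
Qed.

Lemma tw_wronskian_gt0 m m' t : m' < m -> 0 < t ->
  (forall y, 0 < y < t -> 0 < u m y /\ 0 < u m' y) ->
  0 < w m t * u m' t - w m' t * u m t.
Proof.
move=> mm t0 pos.
have pos' y : 0 <= y <= t -> 0 <= u m y /\ 0 <= u m' y.
  move=> /andP[y0 yt]; have [->|yN0] := eqVneq y 0; first by rewrite !twu0.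
  have y0' : 0 < y by rewrite lt_neqAle eq_sym yN0.
  have [yt'|ty] := ltP y t; first by have [] := pos y (ltac:(by rewrite y0')); split; exact: ltW.
  have -> : y = t by apply/eqP; rewrite eq_le yt.
  suff key k : (forall y, 0 < y < t -> 0 < u k y) -> 0 <= u k t.
    by split; apply: key => z /pos [].
  move=> pk; rewrite leNgt; apply/negP => neg.
  have t2 : 0 < t / 2 by rewrite divr_gt0.
  have pt2 : 0 < u k (t / 2) by apply: pk; rewrite t2; lra.
  have [z [/andP[z0 zt] uz _]] := first_zero (cts_twu k) (ltac:(lra) : t / 2 <= t) pt2 (ltW neg).
  have zt' : z < t.
    by rewrite lt_neqAle zt andbT; apply/eqP => e; move: neg; rewrite -e uz ltxx.
  by have := pk z; rewrite (lt_trans t2 z0) zt' uz ltxx => /(_ isT).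
pose W y := w m y * u m' y - w m' y * u m y.
have W0 : W 0 = 0 by rewrite /W !twu0 !mulr0 subrr.
(* The strict increase of the Wronskian is taken from the middle third, away from 0 where both
   solutions vanish and from [t] where positivity is not assumed. *)
have t3 : 0 < t / 3 by rewrite divr_gt0.
have t32 : t / 3 <= 2 * (t / 3) by lra.
have t2t : 2 * (t / 3) <= t by lra.
have h1 : W 0 <= W (t / 3).
  by apply: tw_wronskian_mono => //; [exact: ltW|move=> y /andP[y0 yt]; apply: pos'; rewrite y0; lra].
have h2 : W (2 * (t / 3)) <= W t.
  by apply: tw_wronskian_mono => //; [lra|move=> y /andP[y0 yt]; apply: pos'; apply/andP; split; lra].
have [y /andP[y0 yt] e] := mean_value t32 (fun y _ => tw_wronskian m m' y).
have [p1 p2] := pos y (ltac:(by apply/andP; split; lra)).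
have h3 : 0 < W (2 * (t / 3)) - W (t / 3).
  by rewrite /W e !mulr_gt0 // subr_gt0 //; lra.
by rewrite -/(W t); lra.
Qed.

(** Sturm comparison: up to a first zero of [u m] the quotient [u m / u m'] would be nondecreasing
    and positive, so it cannot reach 0. *)
Lemma twu_pos_mono m m' : m' < m -> (forall t, 0 < t -> 0 < u m' t) -> forall t, 0 < t -> 0 < u m t.
Proof.
move=> mm pos t t0; rewrite ltNge; apply/negP => ut.
have [s s0 hs] := twu_pos_near0 m.
have us y : 0 < y <= s -> 0 < u m y by move=> /hs [].
have st : s <= t.
  by rewrite leNgt; apply/negP => ts; have := us t; rewrite t0 (ltW ts) ltNge ut => /(_ isT).
have us0 : 0 < u m s by apply: us; rewrite s0 lexx.
have [z [/andP[sz zt] uz pz]] := first_zero (cts_twu m) st us0 ut.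
have z0 : 0 < z := lt_trans s0 sz.
have pall y : 0 < y < z -> 0 < u m y.
  move=> /andP[y0 yz]; have [ys|/ltW sy] := leP y s; first by apply: us; rewrite y0.
  by apply: pz; rewrite sy.
have dr y : s <= y <= z -> der (fun y => u m y * (u m' y)^-1) y
    ((w m y * u m' y - w m' y * u m y) / u m' y ^+ 2).
  move=> /andP[sy _]; have uN : u m' y != 0 by rewrite gt_eqF // pos // (lt_le_trans s0).
  by apply: der_eq (derM (der_twu m y) (der_inv uN (der_twu m' y))) _; field.
have := der_ge0_le (ltW sz) dr; rewrite uz mul0r => h.
have : u m s / u m' s <= 0.
  apply: h => y /andP[sy yz]; rewrite mulr_ge0 ?invr_ge0 ?sqr_ge0 // ltW //.
  have y0 : 0 < y := lt_le_trans s0 sy.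
  apply: tw_wronskian_gt0 => // x /andP[x0 xy].
  by split; [apply: pall; rewrite x0 (lt_le_trans xy)|exact: pos].
by rewrite leNgt divr_gt0 // pos.
Qed.

(* A positive solution at a smaller parameter forces unbounded growth at a larger one:
   otherwise V/U would decrease linearly to a negative value. *)
Lemma twu_increases m m' (T : R) : m' < m -> (forall t, 0 < t -> 0 < u m' t) ->
  exists2 N, T <= N & 0 < c * B N * u m N + w m N.
Proof.
move=> mm pos; apply: contrapT => nex.
have posm := twu_pos_mono mm pos.
pose T1 := Num.max T 1.
have T11 : 1 <= T1 by rewrite le_max lexx orbT.
have T10 : 0 < T1 by rewrite (lt_le_trans ltr01).
have dec t : T1 <= t -> u m t <= u m T1.
  move=> Tt; apply: (der_le0_ge Tt (fun y _ => der_twu m y)) => y /andP[Ty _].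
  rewrite leNgt; apply/negP => h; apply: nex; exists y => //.
  by apply: le_trans Ty; rewrite le_max lexx.
pose W y := w m y * u m' y - w m' y * u m y.
have WT : 0 < W T1 by apply: tw_wronskian_gt0 => // y /andP[y0 _]; split; [exact: posm|exact: pos].
have Wm t : T1 <= t -> W T1 <= W t.
  move=> Tt; apply: tw_wronskian_mono => //; first exact: ltW.
  by move=> y /andP[Ty _]; have y0 := lt_le_trans T10 Ty; split; apply/ltW; [exact: posm|exact: pos].
pose k := W T1 / u m T1 ^+ 2.
have uT := posm T1 T10.
have k0 : 0 < k by rewrite divr_gt0 // exprn_gt0.
pose r y := u m' y * (u m y)^-1.
have dr y : T1 <= y -> der r y (- W y / u m y ^+ 2).
  move=> Ty; have uN : u m y != 0 by rewrite gt_eqF // posm // (lt_le_trans T10).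
  by apply: der_eq (derM (der_twu m' y) (der_inv uN (der_twu m y))) _; rewrite /W; field.
pose t := T1 + r T1 / k.
have r0 : 0 < r T1 by rewrite divr_gt0 // pos.
have Tt : T1 <= t by rewrite lerDl divr_ge0 // ltW.
have := der_le Tt (fun y hy => dr y (proj1 (andP hy))) (fun y _ => derZ (- k) (der_id y)).
move=> h; have {h} : r t - r T1 <= - k * t - - k * T1.
  apply: h => y /andP[Ty _]; rewrite mulr1 mulNr lerN2 /k.
  have y0 := lt_le_trans T10 Ty; have uy := posm y y0.
  apply: ler_pM; rewrite ?(ltW WT) ?Wm //; first by rewrite invr_ge0 sqr_ge0.
  by rewrite lef_pV2 ?posrE ?exprn_gt0 // ler_sqr ?nnegrE ?(ltW uy) ?(ltW uT) // dec.
have -> : - k * t - - k * T1 = - r T1 by rewrite /t; field; rewrite gt_eqF.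
have t0 := lt_le_trans T10 Tt.
have : 0 < r t by rewrite divr_gt0 ?pos ?posm.
lra.
Qed.

End airy_system.

(** * Survival of the diffusion as positivity of u *)

Section survival.
Context {R : realType}.
Implicit Types (t s m x y : R).
Local Notation mu := (@lebesgue_measure R).

Lemma Rintegral_der (F h : R -> R) x y : x <= y -> (forall t, x <= t <= y -> der F t (h t)) ->
  {within `[x, y], continuous h} -> \int[mu]_(t in `[x, y]) h t = F y - F x.
Proof.
rewrite le_eqVlt => /orP[/eqP <- _ _|xy dF ch]; first by rewrite set_itv1 Rintegral_set1 subrr.
rewrite /Rintegral (continuous_FTC2 (F := F) xy ch) //.
  split.
  - by move=> t; rewrite in_itv /= => /andP[xt ty]; have [d] := dF t (ltac:(by rewrite !ltW)); exact: ex_derive.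
  - by apply: cvg_at_right_filter; apply: der_continuous (dF x _); rewrite lexx ltW.
  - by apply: cvg_at_left_filter; apply: der_continuous (dF y _); rewrite lexx ltW.
move=> t; rewrite in_itv /= => /andP[xt ty]; have [d] := dF t (ltac:(by rewrite !ltW)).
by rewrite derive1E; exact: derive_val.
Qed.

Lemma der_Rintegral (z h : R -> R) x t : x < t -> (forall y, x <= y -> {for y, continuous h}) ->
  (forall y, x <= y -> z y = z x + \int[mu]_(s in `[x, y]) h s) -> der z t (h t).
Proof.
move=> xt ch ez.
apply: (@near_eq_der _ (fun y => z x + \int[mu]_(s in `[x, y]) h s)).
  near=> y; apply/esym/ez; apply: ltW; near: y; exact: lt_nbhsr.
apply: (@der_eq _ _ _ (0 + h t)); last by rewrite add0r.
apply: derD (der_cst _ _) _.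
have tu : t < t + 1 by rewrite ltrDl.
have ih : mu.-integrable `[x, t + 1] (EFin \o h).
  apply: continuous_compact_integrable; first exact: segment_compact.
  by apply/continuous_in_subspaceT => y; rewrite inE /= in_itv /= => /andP[xy _]; exact: ch.
have [dF eF] := continuous_FTC1 (a := BLeft x) tu ih xt (ch t (ltW xt)).
by split; apply: (@is_derive_eq _ _ _ _ _ _ _ _ (derivableP dF)); rewrite -eF derive1E.
Unshelve. all: by end_near. Qed.

Lemma bounded_near_cont (f : R -> R) a b : a <= b -> (forall y, a <= y <= b -> {for y, continuous f}) ->
  exists2 Q : R, 0 < Q & forall y, a <= y <= b -> `|f y| <= Q.
Proof.
move=> ab cf.
have cw : {within `[a, b], continuous (fun y => `|f y|)}.
  apply/continuous_in_subspaceT => y; rewrite inE /= in_itv /= => /cf h.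
  by apply: continuous_comp; [exact: h|exact: norm_continuous].
have [q _ hq] := EVT_max ab cw.
exists (`|f q| + 1); first by rewrite ltr_wpDl.
by move=> y yab; rewrite (le_trans (hq y _)) ?in_itv // lerDl.
Qed.

Lemma riccati_drift_cont (q : R -> R) m t : {for t, continuous q} ->
  {for t, continuous (fun t : R => t + m - q t ^+ 2)}.
Proof.
move=> cq; apply: continuousB; last first.
  by apply: cvgM; exact: cq.
exact: (@ctsP _ _ (ctsD (@cts_id R) (cts_cst m)) t).
Qed.

Variables (beta m : R) (f : R -> R).
Hypothesis cf : {within `[0, +oo[, continuous f}.
Let c := noise_coef beta.
Let B x := f `|x|.
Let cB : cts B := within_Rp_hat cf.
Local Notation u := (twu c m B).
Local Notation w := (tww c m B).

(** The diffusion is [q = u' / u = w / u + c B]. Its part [w / u] is differentiable along every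
    path, so the integral equation follows from the fundamental theorem alone. *)
Lemma tw_survives_of : (forall t, 0 < t -> 0 < u t) -> TW_survives beta m f.
Proof.
move=> pos; pose z t := w t * (u t)^-1; pose q t := z t + c * B t.
have dz t : 0 < t -> der z t (t + m - q t ^+ 2).
  move=> t0; have uN : u t != 0 by rewrite gt_eqF // pos.
  apply: der_eq (derM (der_tww c cB m t) (der_inv uN (der_twu c cB m t))) _.
  by rewrite /q /z; field.
have cq t : 0 < t -> {for t, continuous q}.
  move=> t0; apply: continuousD; first exact: der_continuous (dz t t0).
  exact: (@ctsP _ _ (ctsZ c cB) t).
exists q; split.
- by move=> t; rewrite in_itv /= andbT; exact: cq.
- move=> x0 x x00 x0x.
  rewrite (@Rintegral_der z) //.
  + have -> : f x = B x by rewrite /B ger0_norm // (le_trans (ltW x00)).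
    have -> : f x0 = B x0 by rewrite /B gtr0_norm.
    by rewrite /q -/c; ring.
  + by move=> t /andP[t0 _]; apply: dz; exact: lt_le_trans t0.
  + apply/continuous_in_subspaceT => t; rewrite inE /= in_itv /= => /andP[t0 _].
    have t0' := lt_le_trans x00 t0.
    exact: riccati_drift_cont (cq t t0').
apply/cvgryPge => A.
have [t1 t10 h1] := twu_pos_near0 c cB m.
have [C C0 hC] := cts_bounded (ctsZ c cB) (ltW t10).
(* [u t <= 2 * t] and [w t >= 1/2] give [w / u >= 1 / (4 * t)], so [t < 1 / (4 * D)] yields
   [w / u >= D]; the term [C] absorbs the noise. *)
pose D := 1 + `|A| + C.
have D0 : 0 < D by rewrite /D -addrA ltr_pwDl // addr_ge0 // ltW.
have t2 : 0 < Num.min t1 (4 * D)^-1 by rewrite lt_min t10 invr_gt0 mulr_gt0.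
near=> t.
have t0 : 0 < t by near: t; exact: nbhs_right_gt.
have : t < Num.min t1 (4 * D)^-1 by near: t; exact: nbhs_right_lt.
rewrite lt_min => /andP[tt1 tD].
have [ut ut2 w1 _] := h1 t (ltac:(by rewrite t0 ltW)).
have := hC t (ltac:(by rewrite !ltW)); rewrite ler_norml => /andP[hB _].
rewrite /q /z.
have : D <= w t / u t.
  rewrite ler_pdivlMr //; apply: (le_trans _ w1).
  apply: le_trans (_ : D * (2 * (4 * D)^-1) <= _).
    by rewrite ler_pM2l //; lra.
  by rewrite le_eqVlt; apply/orP; left; apply/eqP; field; rewrite gt_eqF.
by rewrite /D; have := ler_norm A; lra.
Unshelve. all: by end_near. Qed.

(** The point is that [q] must be the logarithmic derivative of [u], that is [F = w - z u] vanishes.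
    Although [F' = - q F] is linear, [q] blows up at 0 and the equation cannot be started there; the
    identification near 0 goes through reciprocals. *)
Lemma tw_survives_pos : TW_survives beta m f -> forall t, 0 < t -> 0 < u t.
Proof.
move=> [q [cq eq qoo]].
pose z t := q t - c * B t.
have cq' t : 0 < t -> {for t, continuous q} by move=> t0; apply: cq; rewrite in_itv /= t0.
have dz t : 0 < t -> der z t (t + m - q t ^+ 2).
  move=> t0; have t2 : 0 < t / 2 by rewrite divr_gt0.
  apply: (@der_Rintegral z (fun t => t + m - q t ^+ 2) (t / 2)); first by lra.
    move=> y hy; have y0 := lt_le_trans t2 hy.
    exact: riccati_drift_cont (cq' y y0).
  move=> y hy; have y0 := lt_le_trans t2 hy.
  rewrite /z (eq _ y t2 hy) /B ![`|_|]gtr0_norm // -/c; ring.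
pose F t := w t - z t * u t.
have dF t : 0 < t -> der F t (- q t * F t).
  move=> t0; apply: der_eq (derB (der_tww c cB m t) (derM (dz t t0) (der_twu c cB m t))) _.
  by rewrite /F /z; ring.
have [t1 t10 h1] := twu_pos_near0 c cB m.
have [C C0 hC] := cts_bounded (ctsZ c cB) (ltW t10).
have large (A : R) : exists2 t, 0 < t <= t1 & forall s, 0 < s <= t -> A <= z s.
  move/cvgryPge: qoo => /(_ (A + C)) [e /= e0 he].
  pose t := Num.min t1 (e / 2).
  have t0 : 0 < t by rewrite lt_min t10 divr_gt0.
  exists t; first by rewrite t0 ge_min lexx.
  move=> s /andP[s0]; rewrite le_min => /andP[st1 se].
  have := he s; rewrite /ball /= sub0r normrN gtr0_norm // => /(_ (ltac:(lra)) s0) h.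
  have := hC s (ltac:(by rewrite (ltW s0))); rewrite ler_norml => /andP[_ hB].
  by rewrite /z; lra.
have [t2 /andP[t20 t21] z1] := large 1.
(* g = 1/z and gu = u/w solve the same Riccati equation, regular at 0, with the same value at 0 *)
pose g t := (z t)^-1; pose gu t := u t * (w t)^-1; pose h t := g t - gu t.
pose L t := 2 * (c * B t) + ((c * B t) ^+ 2 - (t + m)) * (g t + gu t).
have dh t : 0 < t <= t2 -> der h t (L t * h t).
  move=> tt; have [t0 tt2] := andP tt.
  have zt := z1 t tt; have [_ _ wt _] := h1 t (ltac:(by rewrite t0 (le_trans tt2))).
  have zN : z t != 0 by rewrite gt_eqF // (lt_le_trans ltr01).
  have wN : w t != 0 by rewrite gt_eqF // (lt_le_trans _ wt) // invr_gt0.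
  apply: der_eq (derB (der_inv zN (dz t t0)) (derM (der_twu c cB m t) (der_inv wN (der_tww c cB m t)))) _.
  have qz : q t = z t + c * B t by rewrite /z; ring.
  by rewrite qz /L /h /g /gu; field; rewrite zN wN.
pose Lam := 2 * C + (C ^+ 2 + (t1 + `|m|)) * (1 + 4 * t1).
have hL t : 0 < t <= t2 -> `|L t| <= Lam.
  move=> tt; have [t0 tt2] := andP tt.
  have zt := z1 t tt; have [ut ut2 wt _] := h1 t (ltac:(by rewrite t0 (le_trans tt2))).
  have cBt := hC t (ltac:(by rewrite (ltW t0) (le_trans tt2))).
  have tt1 := le_trans tt2 t21.
  have g1 : 0 <= g t <= 1.
    by rewrite invr_ge0 (le_trans ler01) //= invf_le1 // (lt_le_trans ltr01).
  have gu1 : 0 <= gu t <= 4 * t1.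
    have w0 : 0 < w t by rewrite (lt_le_trans _ wt) // invr_gt0.
    apply/andP; split; first by rewrite divr_ge0 ?(ltW ut) ?(ltW w0).
    rewrite ler_pdivrMr //; apply: (le_trans ut2); nra.
  rewrite /L; apply: (le_trans (ler_normD _ _)); apply: lerD.
    by rewrite normrM ger0_norm // ler_pM2l.
  rewrite normrM; apply: ler_pM => //.
    apply: (le_trans (ler_normB _ _)); apply: lerD.
      by rewrite normrX ler_sqr ?nnegrE // ltW.
    apply: (le_trans (ler_normD _ _)); apply: lerD => //.
    by rewrite gtr0_norm.
  by rewrite ger0_norm; lra.
have h0 : h t2 = 0.
  (* [|L| <= Lam] makes [h^2] times this exponential nonincreasing; letting [s] go to 0, where [g]
     and [gu] both vanish, forces [h t2 = 0]. *)
  have mono s : 0 < s <= t2 -> h t2 ^+ 2 * expR (- (2 * Lam) * t2) <= h s ^+ 2 * expR (- (2 * Lam) * s).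
    move=> /andP[s0 st].
    have dd y : s <= y <= t2 -> der (fun y => h y ^+ 2 * expR (- (2 * Lam) * y)) y
      (2 * h y * (L y * h y) * expR (- (2 * Lam) * y) + h y ^+ 2 * (- (2 * Lam) * 1 * expR (- (2 * Lam) * y))).
      move=> /andP[sy yt]; apply: derM; last exact: der_exp (derZ _ (der_id _)).
      by apply: der_sqr; apply: dh; rewrite yt andbT (lt_le_trans s0).
    apply: (der_le0_ge st dd) => y /andP[sy yt].
    have := hL y (ltac:(by rewrite yt andbT (lt_le_trans s0))); rewrite ler_norml => /andP[_ hl].
    rewrite (_ : _ + _ = - (2 * (Lam - L y) * h y ^+ 2) * expR (- (2 * Lam) * y)); last by ring.
    rewrite mulr_le0_ge0 ?expR_ge0 // oppr_le0.
    by apply: mulr_ge0 (sqr_ge0 _); rewrite mulr_ge0 // subr_ge0.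
  apply/eqP; rewrite -sqrf_eq0 eq_le sqr_ge0 andbT.
  have Lam0 : 0 <= Lam by apply: le_trans (hL t2 _); rewrite ?normr_ge0 // t20 lexx.
  suff: h t2 ^+ 2 * expR (- (2 * Lam) * t2) <= 0.
    by rewrite pmulr_lle0 ?expR_gt0.
  apply/ler_addgt0Pr => e e0; rewrite add0r.
  pose e1 := Num.min 1 e.
  have e10 : 0 < e1 by rewrite lt_min ltr01.
  have [t3 /andP[t30 t31] z3] := large (2 / e1).
  pose s := Num.min t2 (Num.min t3 (e1 / 8)).
  have s0 : 0 < s by rewrite !lt_min t20 t30 divr_gt0.
  have [st2 st3 se] : [/\ s <= t2, s <= t3 & s <= e1 / 8].
    by rewrite /s !ge_min !lexx !orbT.
  apply: (le_trans (mono s (ltac:(by rewrite s0)))).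
  have hs : `|h s| <= e1.
    have zs := z3 s (ltac:(by rewrite s0)).
    have [us us2 ws _] := h1 s (ltac:(by rewrite s0 (le_trans st2))).
    have z0 : 0 < z s by apply: lt_le_trans zs; rewrite divr_gt0.
    have w0 : 0 < w s by rewrite (lt_le_trans _ ws) // invr_gt0.
    have gs : 0 <= g s <= e1 / 2.
      rewrite invr_ge0 (ltW z0) /= -[e1 / 2]invrK lef_pV2 ?posrE ?invr_gt0 ?divr_gt0 //.
      by rewrite invf_div.
    have gus : 0 <= gu s <= e1 / 2.
      apply/andP; split; first by rewrite divr_ge0 ?(ltW us) ?(ltW w0).
      by rewrite ler_pdivrMr //; apply: (le_trans us2); nra.
    by rewrite ler_norml /h; apply/andP; split; lra.
  apply: le_trans (_ : e1 ^+ 2 * 1 <= _).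
    apply: ler_pM; rewrite ?sqr_ge0 ?expR_ge0 //.
      by rewrite -(real_normK (num_real (h s))) ler_sqr ?nnegrE ?(ltW e10).
    by rewrite expR_le1 // mulNr oppr_le0 mulr_ge0 ?(ltW s0) // mulr_ge0.
  rewrite mulr1 expr2; apply: le_trans (_ : 1 * e1 <= _).
    by rewrite ler_pM2r // ge_min lexx.
  by rewrite mul1r ge_min lexx orbT.
have F2 : F t2 = 0.
  have zt := z1 t2 (ltac:(by rewrite t20 lexx)).
  have [_ _ wt _] := h1 t2 (ltac:(by rewrite t20 t21)).
  have zN : z t2 != 0 by rewrite gt_eqF // (lt_le_trans ltr01).
  have wN : w t2 != 0 by rewrite gt_eqF // (lt_le_trans _ wt) // invr_gt0.
  have -> : F t2 = h t2 * z t2 * w t2 by rewrite /F /h /g /gu; field; rewrite zN wN.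
  by rewrite h0 !mul0r.
have u2 : 0 < u t2 by have [] := h1 t2 (ltac:(by rewrite t20 t21)).
move=> t t0; have [tt2|/ltW t2t] := leP t t2.
  by have [] := h1 t (ltac:(by rewrite t0 (le_trans tt2))).
have [Q Q0 hQ] := bounded_near_cont t2t (fun y hy => cq' y (lt_le_trans t20 (proj1 (andP hy)))).
(* Past [t2] the function [q] is bounded by [Q] on the segment, so the linear equation keeps [F] at
   0; then [u' = q u] keeps [u] away from 0. *)
have F0 y : t2 <= y <= t -> F y = 0.
  move=> /andP[ty yt]; apply/eqP; rewrite -sqrf_eq0 eq_le sqr_ge0 andbT.
  have dd x : t2 <= x <= y -> der (fun y => F y ^+ 2 * expR (- (2 * Q) * y)) x
      (2 * F x * (- q x * F x) * expR (- (2 * Q) * x) + F x ^+ 2 * (- (2 * Q) * 1 * expR (- (2 * Q) * x))).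
    move=> /andP[sx xy]; apply: derM; last exact: der_exp (derZ _ (der_id _)).
    by apply: der_sqr; apply: dF; exact: lt_le_trans sx.
  have := der_le0_ge ty dd; rewrite F2 expr0n /= mul0r => hh.
  rewrite -(@pmulr_lle0 _ (expR (- (2 * Q) * y))) ?expR_gt0 //.
  apply: hh => x /andP[sx xy].
  have := hQ x (ltac:(by rewrite sx (le_trans xy))); rewrite ler_norml => /andP[hl _].
  rewrite (_ : _ + _ = - (2 * (Q + q x) * F x ^+ 2) * expR (- (2 * Q) * x)); last by ring.
  rewrite mulr_le0_ge0 ?expR_ge0 // oppr_le0.
  by apply: mulr_ge0 (sqr_ge0 _); rewrite mulr_ge0 //; lra.
have du y : t2 <= y <= t -> der u y (q y * u y).
  move=> yt; apply: der_eq (der_twu c cB m y) _.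
  have : F y = 0 := F0 y yt; rewrite /F => hh.
  have -> : w y = z y * u y by lra.
  by rewrite /z; ring.
have mono y : t2 <= y <= t -> u t2 ^+ 2 * expR (2 * Q * t2) <= u y ^+ 2 * expR (2 * Q * y).
  move=> /andP[ty yt].
  have dd x : t2 <= x <= y -> der (fun y => u y ^+ 2 * expR (2 * Q * y)) x
      (2 * u x * (q x * u x) * expR (2 * Q * x) + u x ^+ 2 * (2 * Q * 1 * expR (2 * Q * x))).
    move=> /andP[sx xy]; apply: derM; last exact: der_exp (derZ _ (der_id _)).
    by apply: der_sqr; apply: du; rewrite sx (le_trans xy).
  apply: (der_ge0_le ty dd) => x /andP[sx xy].
  have := hQ x (ltac:(by rewrite sx (le_trans xy))); rewrite ler_norml => /andP[hl _].
  rewrite (_ : _ + _ = 2 * (Q + q x) * u x ^+ 2 * expR (2 * Q * x)); last by ring.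
  apply: mulr_ge0 (expR_ge0 _).
  by apply: mulr_ge0 (sqr_ge0 _); rewrite mulr_ge0 //; lra.
apply: (nonvanishing_gt0 t2t _ _ u2); first exact: cts_within (cts_twu c cB m).
move=> y yt; apply/eqP => uy; have := mono y yt; rewrite uy expr0n /= mul0r leNgt.
by rewrite mulr_gt0 ?exprn_gt0 ?expR_gt0.
Qed.

End survival.

(** * The soft-edge scaling limit *)

Section exponential_bounds.
Context {R : realType}.
Implicit Types x y : R.

Lemma expR_quad_bound x : `|x| <= 2^-1 -> 0 <= expR x - 1 - x <= 2 * x ^+ 2.
Proof.
rewrite ler_norml => /andP[x1 x2]; have := expR_ge1Dx x => h1.
apply/andP; split; first by lra.
have h2 := expR_ge1Dx (- x); have e0 := expR_gt0 x.
have : (1 - x) * expR x <= 1.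
  have : expR (- x) * expR x = 1 by rewrite -expRD addNr expR0.
  have : (1 - x) * expR x <= expR (- x) * expR x by rewrite ler_pM2r.
  lra.
have : 0 <= x ^+ 2 * (1 - 2 * x) by rewrite mulr_ge0 ?sqr_ge0 //; lra.
move=> h3 h4; rewrite -(@ler_pM2l _ (1 - x)); last by lra.
nra.
Qed.

Lemma expR_dist1 x : `|x| <= 2^-1 -> `|expR x - 1| <= 2 * `|x|.
Proof.
move=> h; have /andP[h1 h2] := expR_quad_bound h.
have : 2 * x ^+ 2 <= `|x|.
  rewrite -(real_normK (num_real x)) expr2; have := normr_ge0 x; nra.
move=> h3; have -> : expR x - 1 = (expR x - 1 - x) + x by ring.
by rewrite (le_trans (ler_normD _ _)) // ger0_norm //; lra.
Qed.

(** With [p = expR (y / 2)] and [q = expR (- (y / 2))], [p * q = 1] turns the left side into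
    [(p - q)^2 - y^2 = r * (2 * y + r)], where [r = p - q - y] is of order [y^2]. Cubic accuracy
    thus follows from second-order bounds. *)
Lemma expR_cosh_bound y : `|y| <= 2^-1 -> `|expR y + expR (- y) - 2 - y ^+ 2| <= 2 * `|y| ^+ 3.
Proof.
move=> hy; have hy2 : `|y / 2| <= 2^-1 by rewrite normrM [`|2^-1|]gtr0_norm ?invr_gt0 //; have := normr_ge0 y; lra.
have hy2N : `|- (y / 2)| <= 2^-1 by rewrite normrN.
have /andP[a1 a2] := expR_quad_bound hy2; have /andP[b1 b2] := expR_quad_bound hy2N.
set p := expR (y / 2) in a1 a2; set q := expR (- (y / 2)) in b1 b2.
have pq : p * q = 1 by rewrite /p /q -expRD subrr expR0.
have -> : expR y = p ^+ 2 by rewrite /p expr2 -expRD -splitr.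
have -> : expR (- y) = q ^+ 2.
  by rewrite /q expr2 -expRD; congr expR; field.
pose r := p - q - y.
have -> : p ^+ 2 + q ^+ 2 - 2 - y ^+ 2 = r * (2 * y + r).
  rewrite (_ : r * _ = p ^+ 2 + q ^+ 2 - 2 * (p * q) - y ^+ 2); last by rewrite /r; ring.
  by rewrite pq mulr1.
have hr : `|r| <= y ^+ 2 / 2.
  rewrite sqrrN in b2; rewrite exprMn exprVn in a2 b2.
  by rewrite ler_norml /r; apply/andP; split; lra.
rewrite normrM exprS.
have y0 := normr_ge0 y; have y2 : y ^+ 2 = `|y| ^+ 2 by rewrite real_normK ?num_real.
rewrite y2 in hr.
have : `|2 * y + r| <= 4 * `|y|.
  rewrite (le_trans (ler_normD _ _)) // normrM [`|2|]gtr0_norm //.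
  by rewrite expr2 in hr; nra.
move=> h; have r0 := normr_ge0 r.
apply: le_trans (_ : `|y| ^+ 2 / 2 * (4 * `|y|) <= _); first exact: ler_pM.
by rewrite le_eqVlt; apply/orP; left; apply/eqP; field.
Qed.

Lemma expR_sum_le y : expR y + expR (- y) <= 2 * expR (2 * y ^+ 2).
Proof.
have [h|h] := leP `|y| 2^-1.
  have /andP[_ a] := expR_quad_bound h.
  have hN : `|- y| <= 2^-1 by rewrite normrN.
  have /andP[_ b] := expR_quad_bound hN; rewrite sqrrN in b.
  by have := expR_ge1Dx (2 * y ^+ 2); lra.
have h2 : `|y| <= 2 * y ^+ 2.
  by rewrite -(real_normK (num_real y)) expr2; have := normr_ge0 y; nra.
have a : expR y <= expR (2 * y ^+ 2) by rewrite ler_expR (le_trans (ler_norm _)).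
have b : expR (- y) <= expR (2 * y ^+ 2) by rewrite ler_expR (le_trans (ler_norm _)) // normrN.
lra.
Qed.

Lemma expRN_le_quartic x : 0 < x -> expR (- x) <= 256 / x ^+ 4.
Proof.
move=> x0; have h := expR_ge1Dx (x / 4).
have e : expR x = expR (x / 4) ^+ 4.
  by rewrite -expRM_natl; congr expR; field.
rewrite expRN e -[256 / _]invrK lef_pV2 ?posrE ?invr_gt0 ?divr_gt0 ?exprn_gt0 ?expR_gt0 //.
rewrite invf_div; have -> : x ^+ 4 / 256 = (x / 4) ^+ 4 by field.
by rewrite lerXn2r ?nnegrE ?expR_ge0 ?divr_ge0 ?(ltW x0) //; lra.
Qed.

End exponential_bounds.

(** * The rescaled string in the soft-edge window *)

Section scaling.
Context {R : realType}.
Implicit Types (x y t d m : R).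
Variables (c : R) (B : R -> R).
Hypothesis cB : cts B.

(* With d = eta^(-1/6): dens_s, dens_m at a = 2 sqrt eta - 2/beta for the path d B(x/d^2), and the
   spectral parameter eta - m eta^(2/3). *)
Definition scaled_S d x : R := expR ((2 / d ^+ 3 - c ^+ 2 / 2) * x + c * (d * B (x / d ^+ 2))).
Definition scaled_M d x : R := expR (- (2 / d ^+ 3 - c ^+ 2 / 2 + 1) * x - c * (d * B (x / d ^+ 2))).
Definition scaled_lam m d : R := (1 - m * d ^+ 2) / d ^+ 6.

Let cSB d : cts (fun x => c * (d * B (x / d ^+ 2))).
Proof.
apply: ctsZ; apply: ctsZ; apply: cts_comp cB.
by apply: (@eq_cts _ (fun x => (d ^+ 2)^-1 * x)) (ctsZ _ (@cts_id R)) => x; rewrite mulrC.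
Qed.

Lemma cts_scaled_S d : cts (scaled_S d).
Proof. by apply: cts_exp; apply: ctsD (cSB d); exact: ctsZ (@cts_id R). Qed.

Lemma cts_scaled_M d : cts (scaled_M d).
Proof. by apply: cts_exp; apply: ctsB (cSB d); exact: ctsZ (@cts_id R). Qed.

Lemma scaled_S_gt0 d x : 0 < scaled_S d x. Proof. exact: expR_gt0. Qed.
Lemma scaled_M_gt0 d x : 0 < scaled_M d x. Proof. exact: expR_gt0. Qed.

Local Notation psi m d := (spsi (scaled_S d) (scaled_M d) (scaled_lam m d)).
Local Notation pi_ m d := (spi (scaled_S d) (scaled_M d) (scaled_lam m d)).

(* The soft-edge window: x = d^2 t, with the leading exponential growth of psi and pi divided out. *)
Definition scaled_u m d t := d ^- 2 * expR (- (t / d)) * psi m d (d ^+ 2 * t).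
Definition scaled_v m d t := d * expR (t / d - c ^+ 2 / 2 * d ^+ 2 * t) * pi_ m d (d ^+ 2 * t).
(** [scaled_u] and [scaled_v] agree to leading order, and only their difference divided by [d] has a
    separate limit; it plays the part of the quasi-derivative [w]. *)
Definition scaled_w m d t := (scaled_v m d t - scaled_u m d t) / d.

Let E d t := expR (c * B t * d).
Let G d t := expR (- (d ^+ 2 * t)).

Lemma der_scaled_u m d t : 0 < d ->
  der (scaled_u m d) t ((E d t - 1) / d * scaled_u m d t + E d t * scaled_w m d t).
Proof.
move=> d0; have dN : d != 0 by rewrite gt_eqF.
have dpsi : der (fun t => psi m d (d ^+ 2 * t)) t (d ^+ 2 * 1 * (scaled_S d (d ^+ 2 * t) * pi_ m d (d ^+ 2 * t))).
  exact: der_comp (derZ _ (der_id t)) (der_spsi (cts_scaled_S d) (cts_scaled_M d) _ _).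
have dexp : der (fun t => expR (- (t / d))) t (- (1 / d) * expR (- (t / d))).
  apply: der_exp; apply: derN; apply: (@eq_der _ (fun t => d^-1 * t)); first by move=> y; rewrite mulrC.
  by apply: der_eq (derZ _ (der_id t)) _; rewrite mulrC.
apply: der_eq (derM (derZ (d ^- 2) dexp) dpsi) _.
have eS : scaled_S d (d ^+ 2 * t) * expR (- (t / d)) = expR (t / d - c ^+ 2 / 2 * d ^+ 2 * t) * E d t.
  rewrite /scaled_S /E -!expRD.
  have -> : d ^+ 2 * t / d ^+ 2 = t by field.
  by congr expR; field.
rewrite /scaled_w /scaled_v /scaled_u.
rewrite (_ : d ^- 2 * _ * (d ^+ 2 * 1 * _) = (scaled_S d (d ^+ 2 * t) * expR (- (t / d))) * pi_ m d (d ^+ 2 * t)); last by field.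
by rewrite eS; field.
Qed.

Lemma der_scaled_w m d t : 0 < d ->
  der (scaled_w m d) t (((2 - E d t - (1 - m * d ^+ 2) * (G d t / E d t)) / d ^+ 2 - c ^+ 2 / 2 * d) * scaled_u m d t
    + ((1 - E d t) / d - c ^+ 2 / 2 * d ^+ 2) * scaled_w m d t).
Proof.
move=> d0; have dN : d != 0 by rewrite gt_eqF.
have dpi : der (fun t => pi_ m d (d ^+ 2 * t)) t
    (d ^+ 2 * 1 * (- scaled_lam m d * scaled_M d (d ^+ 2 * t) * psi m d (d ^+ 2 * t))).
  exact: der_comp (derZ _ (der_id t)) (der_spi (cts_scaled_S d) (cts_scaled_M d) _ _).
have dexp : der (fun t => expR (t / d - c ^+ 2 / 2 * d ^+ 2 * t)) t
    ((d^-1 - c ^+ 2 / 2 * d ^+ 2) * expR (t / d - c ^+ 2 / 2 * d ^+ 2 * t)).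
  apply: (@eq_der _ (fun t => expR ((d^-1 - c ^+ 2 / 2 * d ^+ 2) * t))).
    by move=> y; congr expR; ring.
  have -> : t / d - c ^+ 2 / 2 * d ^+ 2 * t = (d^-1 - c ^+ 2 / 2 * d ^+ 2) * t by ring.
  by apply: der_eq (der_exp (derZ _ (der_id t))) _; rewrite mulr1.
have dv := derM (derZ d dexp) dpi.
apply: (@eq_der _ (fun t => d^-1 * (scaled_v m d t - scaled_u m d t))).
  by move=> y; rewrite /scaled_w mulrC.
apply: der_eq (derZ _ (derB dv (der_scaled_u m t d0))) _.
have eM : expR (t / d - c ^+ 2 / 2 * d ^+ 2 * t) * scaled_M d (d ^+ 2 * t) = expR (- (t / d)) * (G d t / E d t).
  rewrite /scaled_M /G /E -expRN -!expRD.
  have -> : d ^+ 2 * t / d ^+ 2 = t by field.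
  by congr expR; field.
rewrite /scaled_lam.
rewrite (_ : d * _ * (d ^+ 2 * 1 * _) = - (d ^+ 3 * ((1 - m * d ^+ 2) / d ^+ 6)) *
   (expR (t / d - c ^+ 2 / 2 * d ^+ 2 * t) * scaled_M d (d ^+ 2 * t)) * psi m d (d ^+ 2 * t)); last by ring.
rewrite eM /scaled_w /scaled_v /scaled_u.
have EN : E d t != 0 by rewrite gt_eqF // expR_gt0.
by field; rewrite EN dN.
Qed.

Lemma scaled_u0 m d : scaled_u m d 0 = 0.
Proof. by rewrite /scaled_u mulr0 spsi0 ?mulr0 //; [exact: cts_scaled_S|exact: cts_scaled_M]. Qed.

Lemma scaled_w0 m d : 0 < d -> scaled_w m d 0 = 1.
Proof.
move=> d0; rewrite /scaled_w scaled_u0 /scaled_v !mulr0 mul0r subrr expR0 spi0.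
- by rewrite subr0 !mulr1 divff // gt_eqF.
- exact: cts_scaled_S.
- exact: cts_scaled_M.
Qed.

(* The differences are those between the coefficients of the system solved by scaled_u, scaled_w and
   the coefficients of the system solved by twu, tww. *)
Lemma scaled_coef_bound m (N b : R) : 0 <= N -> 0 <= b -> exists2 K : R, 0 <= K &
  forall d t, 0 < d -> d <= 1 -> d * b <= 2^-1 -> 0 <= t <= N -> `|c * B t| <= b ->
  [/\ `|(E d t - 1) / d - c * B t| <= K * d, `|E d t - 1| <= K * d,
      `|(2 - E d t - (1 - m * d ^+ 2) * (G d t / E d t)) / d ^+ 2 - c ^+ 2 / 2 * d
         - (t + m - (c * B t) ^+ 2)| <= K * d &
      `|(1 - E d t) / d - c ^+ 2 / 2 * d ^+ 2 - - (c * B t)| <= K * d].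
Proof.
move=> N0 b0.
pose K := 2 * b ^+ 2 + 2 * b + c ^+ 2 / 2 + 2 * b ^+ 3 + (2 * N ^+ 2 + 4 * N * b) + `|m| * (2 * N + 2 * b).
have c2 := sqr_ge0 c; have b2 := sqr_ge0 b.
have b3 : 0 <= b ^+ 3 by rewrite exprn_ge0.
have N2 := sqr_ge0 N; have Nb := mulr_ge0 N0 b0; have m0 := normr_ge0 m.
have mN : 0 <= `|m| * (2 * N + 2 * b) by rewrite mulr_ge0 //; lra.
exists K; first by rewrite /K; lra.
move=> d t d0 d1 db tN hb.
have dN : d != 0 by rewrite gt_eqF.
set z := c * B t in hb *; pose y := z * d.
have hy : `|y| <= d * b by rewrite /y normrM (gtr0_norm d0) mulrC ler_pM2l.
have hy2 : `|y| <= 2^-1 := le_trans hy db.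
have y2 : y ^+ 2 <= d ^+ 2 * b ^+ 2.
  by rewrite -exprMn -(real_normK (num_real y)) ler_sqr ?nnegrE // mulr_ge0 // ltW.
have y3 : `|y| ^+ 3 <= d ^+ 3 * b ^+ 3.
  by rewrite -exprMn lerXn2r ?nnegrE // mulr_ge0 // ltW.
have /andP[q1 q2] := expR_quad_bound hy2.
have e1 := expR_dist1 hy2; have ch := expR_cosh_bound hy2.
have hyN : `|- y| <= 2^-1 by rewrite normrN.
have e1N := expR_dist1 hyN; rewrite normrN in e1N.
have EE : E d t = expR y by [].
have EV : (E d t)^-1 = expR (- y) by rewrite expRN.
rewrite EV EE in q1 q2 e1 ch *.
have A1 : `|(expR y - 1) / d - z| <= 2 * b ^+ 2 * d.
  have -> : (expR y - 1) / d - z = (expR y - 1 - y) / d by rewrite /y; field.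
  rewrite normrM normfV (gtr0_norm d0) ger0_norm // ler_pdivrMr //.
  apply: (le_trans q2); rewrite (_ : 2 * b ^+ 2 * d * d = 2 * (d ^+ 2 * b ^+ 2)); last by ring.
  by rewrite ler_pM2l.
have dK k : k <= K -> k * d <= K * d by rewrite ler_pM2r.
have d2 : d ^+ 2 <= d by rewrite expr2 ler_piMl // ltW.
split.
- by apply: (le_trans A1); apply: dK; rewrite /K; lra.
- apply: (le_trans e1); apply: le_trans (_ : 2 * b * d <= _); last by apply: dK; rewrite /K; lra.
  by rewrite -mulrA ler_pM2l // [b * d]mulrC.
- have [t0 tN'] := andP tN.
  set g := G d t.
  have g1 : 0 <= 1 - g <= d ^+ 2 * t.
    have := expR_ge1Dx (- (d ^+ 2 * t)); rewrite -/(G d t) -/g => h.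
    have : g <= 1 by rewrite expR_le1 // oppr_le0 mulr_ge0 ?sqr_ge0.
    by move=> h'; apply/andP; split; lra.
  have g2 : `|(1 - g) / d ^+ 2 - t| <= d ^+ 2 * t ^+ 2.
    (* 1 - s <= e^{-s} <= 1 - s + s^2 for s >= 0 *)
    have s0 : 0 <= d ^+ 2 * t by rewrite mulr_ge0 ?sqr_ge0.
    have h : g <= 1 - d ^+ 2 * t + (d ^+ 2 * t) ^+ 2.
      set s := d ^+ 2 * t in s0 *.
      have eg : g * expR s = 1 by rewrite /g /G -expRD addNr expR0.
      have := expR_ge1Dx s => hs.
      have gp : 0 < g by exact: expR_gt0.
      have : g * (1 + s) <= 1 by rewrite -[X in _ <= X]eg ler_pM2l.
      have : 0 <= s ^+ 3 by rewrite exprn_ge0.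
      by move=> s3 h1; rewrite -(@ler_pM2r _ (1 + s)) //; nra.
    have -> : (1 - g) / d ^+ 2 - t = (1 - g - d ^+ 2 * t) / d ^+ 2 by field.
    rewrite normrM normfV [`|d ^+ 2|]ger0_norm ?sqr_ge0 // ler_pdivrMr ?exprn_gt0 //.
    have -> : d ^+ 2 * t ^+ 2 * d ^+ 2 = (d ^+ 2 * t) ^+ 2 by ring.
    have := sqr_ge0 (d ^+ 2 * t); have /andP[_ h1] := g1 => h2.
    by rewrite ler_norml; apply/andP; split; lra.
  set eN := expR (- y).
  (* Four errors: the cubic remainder of [expR y + expR (- y)], the remainder of [1 - G] beyond
     [d^2 t] together with the factor [eN], the [m] term, and the drift. *)
  rewrite (_ : _ - (t + m - z ^+ 2) = - (expR y + eN - 2 - y ^+ 2) / d ^+ 2 +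
      (eN * ((1 - g) / d ^+ 2 - t) + (eN - 1) * t) + m * (g * eN - 1) - c ^+ 2 / 2 * d); last first.
    by rewrite /y; field.
  have eN2 : 0 < eN <= 2.
    rewrite expR_gt0 /=; move: e1N; rewrite -/eN ler_norml => /andP[_ h].
    by have := le_trans hy db; lra.
  have P1 : `|- (expR y + eN - 2 - y ^+ 2) / d ^+ 2| <= 2 * b ^+ 3 * d.
    rewrite normrM normrN normfV [`|d ^+ 2|]ger0_norm ?sqr_ge0 // ler_pdivrMr ?exprn_gt0 //.
    apply: (le_trans ch); rewrite (_ : 2 * b ^+ 3 * d * d ^+ 2 = 2 * (d ^+ 3 * b ^+ 3)); last by ring.
    by rewrite ler_pM2l.
  have eNd : `|eN - 1| <= 2 * b * d.
    by apply: (le_trans e1N); rewrite -mulrA ler_pM2l // [b * d]mulrC.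
  have P2 : `|eN * ((1 - g) / d ^+ 2 - t) + (eN - 1) * t| <= (2 * N ^+ 2 + 4 * N * b) * d.
    apply: (le_trans (ler_normD _ _)); rewrite !normrM (ger0_norm t0) (gtr0_norm (proj1 (andP eN2))) [X in _ <= X]mulrDl.
    apply: lerD.
      apply: le_trans (_ : 2 * (d ^+ 2 * t ^+ 2) <= _).
        by apply: ler_pM => //; [exact: ltW (proj1 (andP eN2))|exact: proj2 (andP eN2)].
      rewrite -mulrA ler_pM2l // mulrC; apply: ler_pM; rewrite ?sqr_ge0 //.
      by rewrite ler_sqr.
    apply: le_trans (_ : (2 * b * d) * N <= _); first by apply: ler_pM.
    by have := mulr_ge0 Nb (ltW d0); lra.
  have P3 : `|m * (g * eN - 1)| <= `|m| * (2 * N + 2 * b) * d.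
    rewrite normrM -mulrA ler_wpM2l //.
    have -> : g * eN - 1 = (g - 1) * eN + (eN - 1) by ring.
    apply: (le_trans (ler_normD _ _)); rewrite [X in _ <= X]mulrDl; apply: lerD; last exact: eNd.
    rewrite normrM (gtr0_norm (proj1 (andP eN2))) distrC ger0_norm ?(proj1 (andP g1)) // mulrC -mulrA.
    apply: ler_pM; rewrite ?(ltW (proj1 (andP eN2))) ?(proj1 (andP g1)) ?(proj2 (andP eN2)) //.
    apply: (le_trans (proj2 (andP g1))); rewrite mulrC; apply: ler_pM; rewrite ?sqr_ge0 //.
  have P4 : `|c ^+ 2 / 2 * d| = c ^+ 2 / 2 * d by rewrite ger0_norm // mulr_ge0 ?divr_ge0 // ltW.
  apply: (le_trans (ler_normB _ _)); rewrite P4.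
  have := ler_normD (- (expR y + eN - 2 - y ^+ 2) / d ^+ 2 + (eN * ((1 - g) / d ^+ 2 - t) + (eN - 1) * t)) (m * (g * eN - 1)).
  have := ler_normD (- (expR y + eN - 2 - y ^+ 2) / d ^+ 2) (eN * ((1 - g) / d ^+ 2 - t) + (eN - 1) * t).
  have := mulr_ge0 b2 (ltW d0); have := mulr_ge0 b0 (ltW d0).
  by rewrite /K; lra.
- have -> : (1 - expR y) / d - c ^+ 2 / 2 * d ^+ 2 - - z = - ((expR y - 1) / d - z) - c ^+ 2 / 2 * d ^+ 2 by ring.
  apply: (le_trans (ler_normB _ _)); rewrite normrN.
  have -> : `|c ^+ 2 / 2 * d ^+ 2| = c ^+ 2 / 2 * d ^+ 2 by rewrite ger0_norm // mulr_ge0 ?divr_ge0 // ?sqr_ge0.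
  have : c ^+ 2 / 2 * d ^+ 2 <= c ^+ 2 / 2 * d by rewrite ler_wpM2l // divr_ge0.
  have : (2 * b ^+ 2 + c ^+ 2 / 2) * d <= K * d by apply: dK; rewrite /K; lra.
  by lra.
Qed.

Lemma scaled_cvg m (N e : R) : 0 <= N -> 0 < e -> exists2 d0 : R, 0 < d0 & forall d, 0 < d -> d <= d0 ->
  forall t, 0 <= t <= N -> `|scaled_u m d t - twu c m B t| <= e /\ `|scaled_w m d t - tww c m B t| <= e.
Proof.
move=> N0 e0.
have [b b0 hb] := cts_bounded (ctsZ c cB) N0.
have [K K0 hK] := scaled_coef_bound m N0 (ltW b0).
have [D1 D10 hD1] := cts_bounded (cts_twu c cB m) N0.
have [D2 D20 hD2] := cts_bounded (cts_tww c cB m) N0.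
have [P P0 hP] := cts_bounded (cts_airy_potential c cB m) N0.
pose C := b + 1 + P + K; pose D := D1 + D2.
have C0 : 0 <= C by rewrite /C; lra.
have D0 : 0 < D by rewrite /D; lra.
pose Q := 8 * D ^+ 2 * (N + 1) * expR ((4 * C + 1) * N) * K ^+ 2.
have Q0 : 0 <= Q.
  rewrite /Q mulr_ge0 ?sqr_ge0 // mulr_ge0 ?expR_ge0 // mulr_ge0 ?addr_ge0 // mulr_ge0 //.
  exact: sqr_ge0.
(* [d <= 1 / (2 * b)] gives the hypothesis [d * b <= 1/2] of the coefficient bounds, and
   [d <= e / (Q + 1)] brings the squared distance, at most [d ^+ 2 * Q], below [e ^+ 2]. *)
pose d0 := Num.min 1 (Num.min ((2 * b)^-1) (e / (Q + 1))).
have d00 : 0 < d0 by rewrite !lt_min ltr01 invr_gt0 mulr_gt0 //= divr_gt0 // ltr_wpDl.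
exists d0 => // d dp dd0 t tN.
have [d1 db de] : [/\ d <= 1, d <= (2 * b)^-1 & d <= e / (Q + 1)].
  by split; apply: (le_trans dd0); rewrite /d0 !ge_min !lexx ?orbT.
have db2 : d * b <= 2^-1.
  have : d * b <= (2 * b)^-1 * b by rewrite ler_pM2r.
  by move=> /le_trans; apply; rewrite le_eqVlt; apply/orP; left; apply/eqP; field; rewrite gt_eqF.
have Kd : 0 <= K * d by rewrite mulr_ge0 // ltW.
have KdK : K * d <= K by rewrite ler_piMr.
have st := @system_stability _ (fun t => (E d t - 1) / d) (E d)
  (fun t => (2 - E d t - (1 - m * d ^+ 2) * (G d t / E d t)) / d ^+ 2 - c ^+ 2 / 2 * d)
  (fun t => (1 - E d t) / d - c ^+ 2 / 2 * d ^+ 2)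
  (fun t => c * B t) (fun=> 1) (fun t => t + m - (c * B t) ^+ 2) (fun t => - (c * B t))
  (scaled_u m d) (scaled_w m d) (twu c m B) (tww c m B) N C D (K * d) N0 C0 (ltW D0) Kd.
have : (scaled_u m d t - twu c m B t) ^+ 2 + (scaled_w m d t - tww c m B t) ^+ 2 <=
    8 * (K * d * D) ^+ 2 * t * expR ((4 * C + 1) * t).
  have close x (x1 x2 k : R) : `|x1 - x2| <= k -> `|x1| <= `|x2| + k.
    by move=> h; have := ler_normD (x1 - x2) x2; rewrite subrK; lra.
  apply: st.
  - move=> x xN; have hbx := hb x xN; have [h1 h2 h3 h4] := hK d x dp d1 db2 xN hbx.
    have := close x _ _ _ h1; have := close x _ _ _ h2; have := close x _ _ _ h3; have := close x _ _ _ h4.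
    rewrite normrN normr1; have := hP x xN.
    by move=> p1 p2 p3 p4 p5; rewrite /C; split; lra.
  - by move=> x xN; have := hD1 x xN; have := hD2 x xN; rewrite /D; split; lra.
  - by move=> x xN; exact: hK d x dp d1 db2 xN (hb x xN).
  - by move=> x xN; exact: der_scaled_u.
  - by move=> x xN; exact: der_scaled_w.
  - by move=> x xN; apply: der_eq (der_twu c cB m x) _; rewrite mul1r.
  - by move=> x xN; apply: der_eq (der_tww c cB m x) _; rewrite mulNr.
  - by rewrite scaled_u0 twu0.
  - by rewrite scaled_w0 // tww0.
  - exact: tN.
have [t0 tN'] := andP tN.
have : 8 * (K * d * D) ^+ 2 * t * expR ((4 * C + 1) * t) <= d ^+ 2 * Q.
  rewrite (_ : d ^+ 2 * Q = 8 * (K * d * D) ^+ 2 * (N + 1) * expR ((4 * C + 1) * N)); last by rewrite /Q; ring.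
  apply: ler_pM; rewrite ?expR_ge0 //.
  - by rewrite mulr_ge0 // mulr_ge0 // sqr_ge0.
  - rewrite ler_wpM2l //; last by lra.
    by apply: mulr_ge0 (sqr_ge0 _).
  - by rewrite ler_expR ler_wpM2l //; lra.
have : d ^+ 2 * Q <= e ^+ 2.
  move: de; rewrite ler_pdivlMr ?ltr_wpDl // => de.
  apply: le_trans (_ : (d * (Q + 1)) ^+ 2 <= _).
    rewrite exprMn ler_wpM2l ?sqr_ge0 // sqrrD1; have := sqr_ge0 Q; lra.
  by rewrite ler_sqr ?nnegrE ?(ltW e0) // mulr_ge0 ?(ltW dp) // addr_ge0.
move=> h1 h2 h3.
have sq (z : R) : z ^+ 2 <= e ^+ 2 -> `|z| <= e.
  by move=> h; rewrite -ler_sqr ?nnegrE ?(ltW e0) // real_normK ?num_real.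
have := sqr_ge0 (scaled_u m d t - twu c m B t); have := sqr_ge0 (scaled_w m d t - tww c m B t) => h4 h5.
by split; apply: sq; clear -h1 h2 h3 h4 h5; lra.
Qed.

(** As long as [pi_] is positive, [psi] and hence [scaled_u] are nonnegative; this contradicts the
    convergence of [scaled_u] to a negative value at [t1]. *)
Lemma scaled_spi_vanishes m t1 : 0 < t1 -> twu c m B t1 < 0 ->
  exists2 d0 : R, 0 < d0 & forall d, 0 < d -> d <= d0 -> exists2 x, 0 <= x & pi_ m d x <= 0.
Proof.
move=> t10 ut; have e0 : 0 < - twu c m B t1 / 2 by rewrite divr_gt0 // oppr_gt0.
have [d0 d00 h] := scaled_cvg m (ltW t10) e0; exists d0 => // d dp dd.
apply: contrapT => nex.
have [+ _] := h d dp dd t1 (ltac:(by rewrite lexx ltW)).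
rewrite ler_norml => /andP[_ h1].
have : 0 <= scaled_u m d t1; last by lra.
rewrite /scaled_u mulr_ge0 //; first by rewrite mulr_ge0 ?expR_ge0 // invr_ge0 sqr_ge0.
apply: spsi_ge0; [exact: cts_scaled_S|exact: cts_scaled_M|exact: scaled_S_gt0| |].
  by rewrite mulr_ge0 ?sqr_ge0 // ltW.
move=> y /andP[y0 _]; rewrite leNgt; apply/negP => py; apply: nex; exists y => //.
exact: ltW.
Qed.

End scaling.

(** * Barriers for the string equation *)

Section barrier.
Context {R : realType}.
Implicit Types (x y : R).
Variables (S M : R -> R) (lam : R).
Hypotheses (cS : cts S) (cM : cts M) (S0 : forall x, 0 < S x).

(* With k = - rho' - lam M - S rho^2 >= 0, the product (pi - rho psi) psi has derivative
   k psi^2 + S (pi - rho psi)^2. *)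
Lemma string_barrier (rho rho' : R -> R) x0 x1 :
  (forall x, x0 <= x <= x1 -> der rho x (rho' x)) ->
  (forall x, x0 <= x <= x1 -> lam * M x + S x * rho x ^+ 2 <= - rho' x) ->
  0 < spsi S M lam x0 -> rho x0 * spsi S M lam x0 < spi S M lam x0 ->
  forall x, x0 <= x <= x1 ->
    0 < spsi S M lam x /\ rho x * spsi S M lam x < spi S M lam x.
Proof.
move=> dr hr p0 b0.
pose f x := spi S M lam x - rho x * spsi S M lam x.
have df x : x0 <= x <= x1 -> der f x (- lam * M x * spsi S M lam x -
    (rho' x * spsi S M lam x + rho x * (S x * spi S M lam x))).
  by move=> xx; exact: derB (der_spi cS cM lam x) (derM (dr x xx) (der_spsi cS cM lam x)).
have prod x : x0 <= x <= x1 -> f x0 * spsi S M lam x0 <= f x * spsi S M lam x.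
  move=> /andP[h1 h2].
  have dp y : x0 <= y <= x -> der (fun y => f y * spsi S M lam y) y
     ((- rho' y - lam * M y - S y * rho y ^+ 2) * spsi S M lam y ^+ 2 + S y * f y ^+ 2).
    move=> /andP[y1 y2]; have yx : x0 <= y <= x1 by rewrite y1 (le_trans y2).
    by apply: der_eq (derM (df y yx) (der_spsi cS cM lam y)) _; rewrite /f; ring.
  apply: (der_ge0_le h1 dp) => y /andP[y1 y2].
  have := hr y (ltac:(by rewrite y1 (le_trans y2))) => h.
  rewrite addr_ge0 // mulr_ge0 ?sqr_ge0 //; [lra|exact: ltW].
have f0 : 0 < f x0 by rewrite subr_gt0.
(* The product is nondecreasing and starts positive, so it never vanishes; hence neither factor can
   change sign. *)
have pos x : x0 <= x <= x1 -> 0 < f x * spsi S M lam x.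
  by move=> xx; apply: lt_le_trans (prod x xx); rewrite mulr_gt0.
move=> x xx; have [h1 h2] := andP xx; split.
  apply: (@nonvanishing_gt0 _ (spsi S M lam) x0 x h1) => //.
    exact: cts_within (cts_spsi cS cM lam).
  move=> y /andP[y1 y2]; apply/eqP => e.
  by have := pos y (ltac:(by rewrite y1 (le_trans y2))); rewrite e mulr0 ltxx.
rewrite -subr_gt0 -/(f x).
apply: (@nonvanishing_gt0 _ f x0 x h1) => //.
  apply: (@der_within _ f _ x0 x) => y /andP[y1 y2]; apply: df.
  by rewrite y1 (le_trans y2).
move=> y /andP[y1 y2]; apply/eqP => e.
by have := pos y (ltac:(by rewrite y1 (le_trans y2))); rewrite e mul0r ltxx.
Qed.

End barrier.

(** * Path growth and the explicit barrier *)

Section tame_paths.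
Context {R : realType}.
Implicit Types (x y s t d m : R).

(** The growth bound controls the noise against the drift for [x >= d^-2], the oscillation bound
    controls the smoothing of the barrier below that point. Integer powers replace the exponents 3/4
    and 1/2. *)
Definition tame (B : R -> R) := (forall e : R, 0 < e -> exists T : R, forall t, T <= t -> B t ^+ 4 <= e * t ^+ 3) /\
  (forall e : R, 0 < e -> exists T : R, forall t s, T <= t -> t <= s <= t + 1 -> (B s - B t) ^+ 2 <= e * t).

Variables (c : R) (B : R -> R).
Hypotheses (cB : cts B) (tB : tame B).

Local Notation psi m d := (spsi (scaled_S c B d) (scaled_M c B d) (scaled_lam m d)).
Local Notation pi_ m d := (spi (scaled_S c B d) (scaled_M c B d) (scaled_lam m d)).
Local Notation a_ d := (2 / d ^+ 3 - c ^+ 2 / 2).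

(** With [t = y / d^2], the bound [B^4 <= e t^3] gives [(d B)^4 <= e y^3 / d^2], at most [e y^4]
    once [y >= d^-2]; [e] is chosen for the slope 1/16. *)
Lemma tame_linear : exists2 T : R, 0 <= T & forall d y, 0 < d -> d ^- 2 <= y -> T * d ^+ 2 <= y ->
  `|c * (d * B (y / d ^+ 2))| <= y / 16.
Proof.
have [g1 _] := tB.
have c4 : 0 <= c ^+ 4 by rewrite exprn_even_ge0.
pose e := (16 ^+ 4 * (c ^+ 4 + 1))^-1.
have e0 : 0 < e by rewrite invr_gt0 mulr_gt0 ?exprn_gt0 // ltr_wpDl.
have [T hT] := g1 e e0.
exists (Num.max 0 T); first by rewrite le_max lexx.
move=> d y d0 dy Ty; have d20 : 0 < d ^+ 2 by rewrite exprn_gt0.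
have y0 : 0 < y by apply: lt_le_trans dy; rewrite invr_gt0.
have : T <= y / d ^+ 2.
  by rewrite ler_pdivlMr // (le_trans _ Ty) // ler_pM2r // le_max lexx orbT.
move=> /hT hB.
have h4 : `|c * (d * B (y / d ^+ 2))| ^+ 4 <= (y / 16) ^+ 4.
  rewrite -normrX ger0_norm ?exprn_even_ge0 // !exprMn.
  apply: le_trans (_ : c ^+ 4 * (d ^+ 4 * (e * (y / d ^+ 2) ^+ 3)) <= _).
    by rewrite ler_wpM2l // ler_wpM2l // exprn_ge0 // ltW.
  have -> : c ^+ 4 * (d ^+ 4 * (e * (y / d ^+ 2) ^+ 3)) = (c ^+ 4 * e) * (y ^+ 3 * d ^- 2).
    by field; rewrite gt_eqF.
  have -> : y ^+ 4 * 16^-1 ^+ 4 = (16^-1 ^+ 4) * (y ^+ 3 * y) by ring.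
  apply: ler_pM.
  - by rewrite mulr_ge0 // ltW.
  - by rewrite mulr_ge0 ?exprn_ge0 ?(ltW y0) // invr_ge0 ltW.
  - rewrite /e ler_pdivrMr ?mulr_gt0 ?exprn_gt0 ?ltr_wpDl // mulrA -exprMn mulVf // expr1n mul1r.
    by lra.
  - by rewrite ler_pM2l // exprn_gt0.
by rewrite -(@ler_pXn2r _ 4) ?nnegrE ?divr_ge0 ?(ltW y0).
Qed.

(** Moving the exponents by 1/16 absorbs the noise and leaves [ga - al = 7/8 > 0], as the existence
    of an eigenvalue requires; the factor [expR C] covers the initial segment. *)
Lemma scaled_good_string d : 0 < d -> 1 <= a_ d -> exists C al ga : R,
  [/\ 0 < al, al < ga, 0 < C, (forall y, 0 <= y -> scaled_S c B d y <= C * expR (al * y)) &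
    (forall y, 0 <= y -> scaled_M c B d y <= C * expR (- ga * y))].
Proof.
move=> d0 a1; have [T T0 hT] := tame_linear.
have d20 : 0 < d ^+ 2 by rewrite exprn_gt0.
pose X := d ^- 2 + T * d ^+ 2.
have X0 : 0 <= X by rewrite addr_ge0 ?invr_ge0 ?mulr_ge0 // ltW.
have cbd : cts (fun x => c * (d * B (x / d ^+ 2))).
  apply: ctsZ; apply: ctsZ; apply: cts_comp cB.
  by apply: (@eq_cts _ (fun x => (d ^+ 2)^-1 * x)) (ctsZ _ (@cts_id R)) => x; rewrite mulrC.
have [C C0 hC] := cts_bounded cbd X0.
have bnd y : 0 <= y -> `|c * (d * B (y / d ^+ 2))| <= C + y / 16.
  move=> y0; have [yX|/ltW Xy] := leP y X.
    by rewrite (le_trans (hC y _)) ?y0 // lerDl divr_ge0.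
  rewrite (le_trans (hT d y d0 _ _)) //.
  - by apply: le_trans Xy; rewrite lerDl mulr_ge0 // ltW.
  - by apply: le_trans Xy; rewrite lerDr invr_ge0 ltW.
  - by rewrite lerDr ltW.
exists (expR C), (a_ d + 16^-1), (a_ d + 1 - 16^-1).
split.
- by lra.
- by lra.
- exact: expR_gt0.
- move=> y y0; rewrite -expRD ler_expR; have := ler_norm (c * (d * B (y / d ^+ 2))); have := bnd y y0.
  by lra.
- move=> y y0; rewrite -expRD ler_expR; have := ler_norm (- (c * (d * B (y / d ^+ 2)))); have := bnd y y0.
  by rewrite normrN; lra.
Qed.

Definition window_avg t := prim B (t + 1) - prim B t.

Lemma der_window_avg t : der window_avg t (B (t + 1) - B t).
Proof.
apply: derB (der_prim t cB).
apply: der_eq (der_comp (derD (der_id t) (der_cst 1 t)) (der_prim (t + 1) cB)) _.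
by rewrite addr0 mul1r.
Qed.

Lemma window_avg_mean t : exists2 s, t <= s <= t + 1 & window_avg t = B s.
Proof.
have [s hs e] := mean_value (ltac:(by rewrite lerDl) : t <= t + 1) (fun y _ => der_prim y cB).
by exists s => //; rewrite /window_avg e addrC addKr mulr1.
Qed.

Lemma sqrt_scaled_lam_le m d : 0 < d -> Num.sqrt (scaled_lam m d) <= (1 + `|m| * d ^+ 2) / d ^+ 3.
Proof.
move=> d0; have d3 : 0 < d ^+ 3 by rewrite exprn_gt0.
have md : 0 <= `|m| * d ^+ 2 by rewrite mulr_ge0 ?sqr_ge0.
have q0 : 0 <= (1 + `|m| * d ^+ 2) / d ^+ 3 by rewrite divr_ge0 ?(ltW d3) //; lra.
rewrite -[X in _ <= X](ger0_norm q0) -sqrtr_sqr ler_sqrt ?sqr_ge0 //.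
rewrite /scaled_lam expr_div_n -exprM ler_pM2r ?invr_gt0 ?exprn_gt0 //.
have : - m * d ^+ 2 <= `|m| * d ^+ 2 by rewrite ler_wpM2r ?sqr_ge0 // -normrN ler_norm.
by rewrite [1 + `|m| * _]addrC sqrrD1; have := sqr_ge0 (`|m| * d ^+ 2); lra.
Qed.

Section barrier_estimate.
Variables (m N d : R).
Hypotheses (N1 : 1 <= N) (Nbig : 10 * (2 * `|m| + c ^+ 2) <= N).
Hypothesis osc : forall t s, N <= t -> t <= s <= t + 1 -> c ^+ 2 * (B s - B t) ^+ 2 <= t / 100.
Hypotheses (d0 : 0 < d) (d1 : d <= 1) (cd : c ^+ 2 * d ^+ 3 <= 10^-1) (lamd : 0 <= scaled_lam m d).

Let L : R := Num.sqrt (scaled_lam m d).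
(** Twice the oscillation bound [sqrt N / 10] at time [N], so that the lowering outweighs the error
    of smoothing where the barrier is entered. *)
Let sigma : R := Num.sqrt N / 5.

(* The approximate Riccati solution sqrt lam e^(-(a+1/2)x - c b(x)), with the path smoothed over a window
   so that it is differentiable, and lowered by sigma to make it a strict barrier. *)
Definition barrier x := L * expR (- (a_ d + 2^-1) * x - c * (d * window_avg (x / d ^+ 2)) - d * sigma).

Lemma osc_le t s : N <= t -> t <= s <= t + 1 -> `|c * (B s - B t)| <= Num.sqrt t / 10.
Proof.
move=> Nt ts; have t0 : 0 <= t := le_trans (le_trans ler01 N1) Nt.
have h := osc Nt ts.
rewrite -(@ler_pXn2r _ 2) ?nnegrE ?divr_ge0 ?sqrtr_ge0 // real_normK ?num_real //.
rewrite exprMn (le_trans h) // expr_div_n sqr_sqrtr // (_ : 10 ^+ 2 = 100) //; ring.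
Qed.

(** At the equilibrium [rho^2 = lam M / S] the two terms on the left are equal. If [rho] differs
    from it by a factor [expR phi], their sum is [L expR (- x/2) (expR phi + expR (- phi)) rho].
    Since [phi^2 <= 9 x / 100], a decay [expR (- 8 x / 25)] survives, and it pays for the drift, for
    [m] and for the oscillation. *)
Lemma barrier_le x : d ^+ 2 * N <= x -> x <= d ^- 2 ->
  der barrier x (- (a_ d + 2^-1 + c * (B (x / d ^+ 2 + 1) - B (x / d ^+ 2)) / d) * barrier x) /\
  scaled_lam m d * scaled_M c B d x + scaled_S c B d x * barrier x ^+ 2
    <= - (- (a_ d + 2^-1 + c * (B (x / d ^+ 2 + 1) - B (x / d ^+ 2)) / d) * barrier x).
Proof.
move=> x1 x2; have d2 : 0 < d ^+ 2 by rewrite exprn_gt0.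
have dN : d != 0 by rewrite gt_eqF.
set t := x / d ^+ 2.
have ex : x = d ^+ 2 * t by rewrite /t; field.
have Nt : N <= t by rewrite ler_pdivlMr // mulrC.
have t1 : 1 <= t := le_trans N1 Nt.
have t0 : 0 <= t by lra.
split.
  rewrite /barrier.
  apply: der_eq (derZ L (der_exp (derB (derB (derZ _ (der_id x)) (derZ c (derZ d
    (der_comp (_ : der (fun y => y / d ^+ 2) x (d ^+ 2)^-1) (der_window_avg _))))) (der_cst _ _)))) _.
    apply: (@eq_der _ (fun y => (d ^+ 2)^-1 * y)); first by move=> y; rewrite mulrC.
    by apply: der_eq (derZ _ (der_id x)) _; rewrite mulr1.
  rewrite -/t subr0 mulr1; field; exact: dN.
pose r : R := Num.sqrt t.
have r2 : r ^+ 2 = t by rewrite sqr_sqrtr.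
have r0 : 0 <= r := sqrtr_ge0 _.
have r1 : 1 <= r by rewrite -(@ler_pXn2r _ 2) ?nnegrE // r2 expr1n.
(* The upper end [x <= d^-2] of the barrier region enters here: it means [t <= d^-4]. *)
have dr1 : d ^+ 2 * r <= 1.
  have dr0 : 0 <= d ^+ 2 * r := mulr_ge0 (ltW d2) r0.
  rewrite -(@ler_pXn2r _ 2) ?nnegrE // exprMn r2 expr1n.
  move: x2; rewrite ex -[_ ^- 2]mul1r ler_pdivlMr // => h.
  by rewrite (_ : _ * t = d ^+ 2 * t * d ^+ 2) //; ring.
have [s ts es] := window_avg_mean t.
have o1 := osc_le Nt ts.
have o2 := osc_le Nt (ltac:(by rewrite lerDl ler01 lexx) : t <= t + 1 <= t + 1).
rewrite -/r in o1 o2.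
have sr : 0 <= sigma <= r / 5.
  by rewrite /sigma divr_ge0 ?sqrtr_ge0 //= ler_pM2r ?invr_gt0 // ler_wsqrtr.
pose phi := d * (- (c * (B s - B t)) - sigma).
(* Oscillation [r / 10] plus lowering at most [r / 5] is [3 r / 10], whose square is [9 t / 100]. *)
have phi2 : phi ^+ 2 <= 9 / 100 * x.
  rewrite /phi exprMn ex (_ : 9 / 100 * (d ^+ 2 * t) = d ^+ 2 * (9 / 100 * t)); last by ring.
  rewrite ler_pM2l // (_ : 9 / 100 * t = (3 / 10 * r) ^+ 2); last by rewrite exprMn r2; field.
  move: o1; rewrite ler_norml => /andP[p1 p2].
  have q1 : - (3 / 10 * r) <= - (c * (B s - B t)) - sigma by lra.
  have q2 : - (c * (B s - B t)) - sigma <= 3 / 10 * r by lra.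
  set z := _ - sigma in q1 q2 *.
  have z1 : 0 <= 3 / 10 * r - z by lra.
  have z2 : 0 <= 3 / 10 * r + z by lra.
  by rewrite -subr_ge0 subr_sqr mulr_ge0.
have L0 : 0 <= L := sqrtr_ge0 _.
have L2 : L ^+ 2 = scaled_lam m d by rewrite sqr_sqrtr.
have b0 : 0 <= barrier x by rewrite mulr_ge0 ?expR_ge0.
have e1 : scaled_lam m d * scaled_M c B d x = L * expR (- (x / 2)) * expR (- phi) * barrier x.
  rewrite -L2 /scaled_M /barrier -/t es expr2.
  rewrite (_ : L * expR (- (x / 2)) * expR (- phi) * (L * expR _) =
    L * L * (expR (- (x / 2)) * expR (- phi) * expR (- (a_ d + 2^-1) * x - c * (d * B s) - d * sigma))); last by ring.
  by rewrite -!expRD; congr (_ * expR _); rewrite /phi; field.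
have e2 : scaled_S c B d x * barrier x ^+ 2 = L * expR (- (x / 2)) * expR phi * barrier x.
  rewrite expr2 mulrA; congr (_ * _).
  rewrite /scaled_S /barrier -/t es mulrCA -mulrA -!expRD; congr (_ * expR _); rewrite /phi; field.
  exact: dN.
rewrite e1 e2 -mulrDl mulNr opprK ler_wpM2r //.
have -> : L * expR (- (x / 2)) * expR (- phi) + L * expR (- (x / 2)) * expR phi =
   L * (expR (- (x / 2)) * (expR phi + expR (- phi))) by ring.
have x0 : 0 <= x by rewrite ex mulr_ge0 // ltW.
have h1 : expR (- (x / 2)) * (expR phi + expR (- phi)) <= 2 / (1 + 8 / 25 * x).
  apply: le_trans (_ : expR (- (x / 2)) * (2 * expR (2 * phi ^+ 2)) <= _).
    by rewrite ler_wpM2l ?expR_ge0 // expR_sum_le.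
  rewrite mulrCA ler_pM2l // -expRD; apply: le_trans (_ : expR (- (8 / 25 * x)) <= _).
    by rewrite ler_expR; lra.
  rewrite expRN lef_pV2 ?posrE ?expR_gt0 //; first exact: expR_ge1Dx.
  by lra.
have h2 := sqrt_scaled_lam_le m d0; rewrite -/L in h2.
have D0 : 0 < 1 + 8 / 25 * x by lra.
apply: le_trans (_ : (1 + `|m| * d ^+ 2) / d ^+ 3 * (2 / (1 + 8 / 25 * x)) <= _).
  by apply: ler_pM => //; rewrite mulr_ge0 ?expR_ge0 // addr_ge0 ?expR_ge0.
apply: le_trans (_ : 2 / d ^+ 3 - c ^+ 2 / 2 - r / 10 / d <= _); last first.
  move: o2; rewrite ler_norml => /andP[p1 _].
  have : - (r / 10) / d <= c * (B (t + 1) - B t) / d by rewrite ler_pM2r ?invr_gt0.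
  rewrite mulNr; lra.
rewrite (_ : _ * (2 / _) = (2 * (1 + `|m| * d ^+ 2)) / (d ^+ 3 * (1 + 8 / 25 * x))); last first.
  by move: D0; set D := 1 + 8 / 25 * x => D0; field; rewrite dN gt_eqF.
rewrite ler_pdivrMr ?mulr_gt0 ?exprn_gt0 //.
rewrite (_ : _ * (d ^+ 3 * _) = (2 - c ^+ 2 * d ^+ 3 / 2 - d ^+ 2 * r / 10) * (1 + 8 / 25 * x)); last by field.
have c20 := sqr_ge0 c; have m0 := normr_ge0 m; have Nb := Nbig; have cd' := cd.
have dd : c ^+ 2 * d ^+ 3 / 2 <= c ^+ 2 * d ^+ 2 / 2.
  by rewrite ler_pM2r ?invr_gt0 // ler_wpM2l // [d ^+ 3]exprS ler_piMl // ltW.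
(* The available gain is [2 * 8/25 = 64/100] times [x]. The product of the losses with [8/25 * x]
   takes at most [15/100 * 8/25 = 48/1000], so 59/100 may be spent on the first-order losses; [Nbig]
   and [r <= t] make them fit. *)
have key : 2 * `|m| + c ^+ 2 / 2 + r / 10 <= 59 / 100 * t.
  have : r <= t by rewrite -r2 expr2; nra.
  by lra.
have : d ^+ 2 * (2 * `|m| + c ^+ 2 / 2 + r / 10) <= d ^+ 2 * (59 / 100 * t) by rewrite ler_pM2l.
have A1 : c ^+ 2 * d ^+ 3 / 2 + d ^+ 2 * r / 10 <= 15 / 100 by lra.
have : (c ^+ 2 * d ^+ 3 / 2 + d ^+ 2 * r / 10) * (8 / 25 * x) <= 15 / 100 * (8 / 25 * x).
  by rewrite ler_wpM2r //; lra.
have -> : d ^+ 2 * (59 / 100 * t) = 59 / 100 * x by rewrite ex; ring.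
lra.
Qed.

End barrier_estimate.

End tame_paths.

(** * Entering the barrier at the end of the window *)

Section positivity.
Context {R : realType}.
Implicit Types (x y s t d m : R).
Variables (c : R) (B : R -> R).
Hypotheses (cB : cts B) (tB : tame B).

Local Notation psi m d := (spsi (scaled_S c B d) (scaled_M c B d) (scaled_lam m d)).
Local Notation pi_ m d := (spi (scaled_S c B d) (scaled_M c B d) (scaled_lam m d)).
Local Notation a_ d := (2 / d ^+ 3 - c ^+ 2 / 2).

Let cS d := cts_scaled_S c cB d.
Let cM d := cts_scaled_M c cB d.

Lemma small_d_bound (k e : R) : 0 <= k -> 0 < e ->
  exists2 d0 : R, 0 < d0 & forall d, 0 < d -> d <= d0 -> d * k <= e.
Proof.
move=> k0 e0; have k1 : 0 < k + 1 by rewrite ltr_wpDl.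
exists (e / (k + 1)); first by rewrite divr_gt0.
move=> d dp; rewrite ler_pdivlMr // => h; apply: le_trans h.
by rewrite ler_pM2l // lerDl.
Qed.

(** In the window [pi_] has the sign of [scaled_u + d * scaled_w]: near 0 the second term is
    positive, further on the first is bounded below. At [N] the leading orders of [pi_] and of the
    barrier cancel, and the comparison is decided at order [d] by the sign of [k * u + w]. *)
Lemma scaled_start m N : 0 < N -> (forall t, 0 < t -> 0 < twu c m B t) ->
  0 < (c * window_avg B N + Num.sqrt N / 5) * twu c m B N + tww c m B N ->
  exists2 d0 : R, 0 < d0 & forall d, 0 < d -> d <= d0 ->
   [/\ forall x, 0 <= x <= d ^+ 2 * N -> 0 < pi_ m d x, 0 < psi m d (d ^+ 2 * N) &
     barrier c B m N d (d ^+ 2 * N) * psi m d (d ^+ 2 * N) < pi_ m d (d ^+ 2 * N)].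
Proof.
move=> N0 pos; set k := c * _ + _ => kap0.
pose kap := k * twu c m B N + tww c m B N.
have uN := pos N N0.
have [t1 t10 h1] := twu_pos_near0 c cB m.
pose t2 := Num.min t1 N.
have t20 : 0 < t2 by rewrite lt_min t10.
have t2N : t2 <= N by rewrite ge_min lexx orbT.
have t21 : t2 <= t1 by rewrite ge_min lexx.
have [p /andP[p1 p2] pmin] : exists2 p, t2 <= p <= N & forall t, t2 <= t <= N -> twu c m B p <= twu c m B t.
  have [p + hp] := EVT_min t2N (cts_within (A := `[t2, N]%classic) (cts_twu c cB m)).
  by rewrite in_itv /= => pp; exists p => // t tt; apply: hp; rewrite in_itv.
pose ul := twu c m B p.
have ul0 : 0 < ul by apply: pos; exact: lt_le_trans p1.
have [W W0 hW] := cts_bounded (cts_tww c cB m) (ltW N0).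
(* [1/8] keeps [scaled_w] positive where [w >= 1/2], [ul / 4] keeps [scaled_u] positive beyond [t2],
   and the last bound preserves the sign of [k * u + w]. *)
pose e := Num.min (8^-1) (Num.min (ul / 4) (kap / (4 * (`|k| + 1)))).
have k10 : 0 < 4 * (`|k| + 1) by rewrite mulr_gt0 // ltr_wpDl.
have e0 : 0 < e by rewrite !lt_min invr_gt0 ltr0n !divr_gt0.
have [e8 eul ek] : [/\ e <= 8^-1, e <= ul / 4 & e * (4 * (`|k| + 1)) <= kap].
  by rewrite -ler_pdivlMr // /e !ge_min !lexx !orbT.
have [d1 d10 cv] := scaled_cvg c cB m (ltW N0) e0.
have [d2 d20 hd2] := small_d_bound (ltW (ltr_wpDl (ltW W0) ltr01)) (ltac:(by rewrite divr_gt0) : 0 < ul / 4).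
pose K' := 2 * k ^+ 2 + 2 * `|m|.
have K'0 : 0 <= K' by rewrite addr_ge0 // mulr_ge0 ?sqr_ge0.
have uN1 : 0 <= twu c m B N + 1 by rewrite addr_ge0 // ltW.
have [d3 d30 hd3] := small_d_bound (mulr_ge0 K'0 uN1) (ltac:(by rewrite divr_gt0) : 0 < kap / 4).
have [d4 d40 hd4] := small_d_bound (normr_ge0 k) (ltac:(by rewrite invr_gt0) : (0 : R) < 2^-1).
exists (Num.min 1 (Num.min d1 (Num.min d2 (Num.min d3 d4)))); first by rewrite !lt_min ltr01 d10 d20 d30.
move=> d dp; rewrite !le_min => /andP[dle1 /andP[dd1 /andP[dd2 /andP[dd3 dd4]]]].
have {}hd2 := hd2 d dp dd2; have {}hd3 := hd3 d dp dd3; have {}hd4 := hd4 d dp dd4.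
have {}cv := cv d dp dd1.
have dN : d != 0 by rewrite gt_eqF.
have dsq : 0 < d ^+ 2 by rewrite exprn_gt0.
have vE t : scaled_v c B m d t = scaled_u c B m d t + d * scaled_w c B m d t.
  by rewrite /scaled_w; field.
have ppos x : 0 <= x <= d ^+ 2 * N -> 0 < pi_ m d x.
  move=> /andP[x0 xN]; rewrite ltNge; apply/negP => px.
  have [z [/andP[z0 zx] fz pz]] := first_zero (cts_spi (cS d) (cM d) _) x0 (ltac:(by rewrite spi0)) px.
  pose t := z / d ^+ 2.
  have ez : d ^+ 2 * t = z by rewrite /t; field.
  have t0 : 0 < t by rewrite divr_gt0.
  have tN : t <= N by rewrite ler_pdivrMr // mulrC (le_trans zx).
  have v0 : scaled_v c B m d t = 0 by rewrite /scaled_v ez fz mulr0.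
  have [cu cw] := cv t (ltac:(by rewrite (ltW t0))).
  move: cu cw; rewrite !ler_norml => /andP[cu _] /andP[cw _].
  have [tt2|/ltW t2t] := leP t t2.
    have u0 : 0 <= scaled_u c B m d t.
      rewrite /scaled_u ez; apply: mulr_ge0; first by rewrite mulr_ge0 ?expR_ge0 // invr_ge0 ltW.
      apply: (spsi_ge0 (cS d) (cM d) (scaled_S_gt0 c B d) (ltW z0)) => y yz.
      exact/ltW/pz.
    have [_ _ w1 _] := h1 t (ltac:(by rewrite t0 (le_trans tt2))).
    have : 0 < d * scaled_w c B m d t by rewrite mulr_gt0 //; lra.
    by rewrite vE in v0; lra.
  have := pmin t (ltac:(by rewrite t2t)) => um.
  have := hW t (ltac:(by rewrite (ltW t0))); rewrite ler_norml => /andP[w1 _].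
  have : - (d * (W + 1)) <= d * scaled_w c B m d t by rewrite -mulrN ler_pM2l //; lra.
  by rewrite vE in v0; rewrite -/ul in um; lra.
have [cu cw] := cv N (ltac:(by rewrite (ltW N0) lexx)).
move: cu cw; rewrite !ler_norml => /andP[cu1 cu2] /andP[cw _].
have ulN : ul <= twu c m B N by apply: pmin; rewrite t2N lexx.
have uu0 : 0 < scaled_u c B m d N by lra.
split => //.
  move: uu0; rewrite /scaled_u pmulr_rgt0 // mulr_gt0 ?expR_gt0 // invr_gt0 //.
pose L : R := Num.sqrt (scaled_lam m d).
(* The barrier in window units: [scaled_v - th * scaled_u] is a positive multiple of
   [pi_ - barrier * psi], and [1 - th] is at least [d * k] up to order [d ^+ 2]. *)
pose th := d ^+ 3 * L * expR (- (d ^+ 2 * N / 2) - d * k).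
have thE : scaled_v c B m d N - th * scaled_u c B m d N =
    d * expR (N / d - c ^+ 2 / 2 * d ^+ 2 * N) *
    (pi_ m d (d ^+ 2 * N) - barrier c B m N d (d ^+ 2 * N) * psi m d (d ^+ 2 * N)).
  rewrite /scaled_v mulrBr; congr (_ - _); rewrite /scaled_u /barrier /th -/L.
  have -> : d ^+ 2 * N / d ^+ 2 = N by field.
  rewrite (_ : d ^+ 3 * L * expR _ * _ = d * L * (expR (- (d ^+ 2 * N / 2) - d * k) * expR (- (N / d))) * psi m d (d ^+ 2 * N)); last by field.
  rewrite (_ : d * expR _ * _ = d * L * (expR (N / d - c ^+ 2 / 2 * d ^+ 2 * N) *
    expR (- (a_ d + 2^-1) * (d ^+ 2 * N) - c * (d * window_avg B N) - d * (Num.sqrt N / 5))) * psi m d (d ^+ 2 * N)); last by ring.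
  by rewrite -!expRD; congr (_ * expR _ * _); rewrite /k; field.
suff : 0 < scaled_v c B m d N - th * scaled_u c B m d N.
  by rewrite thE pmulr_rgt0 ?mulr_gt0 ?expR_gt0 // subr_gt0.
have dk : `|- (d * k)| <= 2^-1 by rewrite normrN normrM gtr0_norm.
have /andP[_ q2] := expR_quad_bound dk.
have L0 : 0 <= L := sqrtr_ge0 _.
have L1 : d ^+ 3 * L <= 1 + `|m| * d ^+ 2.
  have := sqrt_scaled_lam_le m dp; rewrite -/L ler_pdivlMr ?exprn_gt0 //.
  by rewrite mulrC.
have m0 : 0 <= `|m| * d ^+ 2 by rewrite mulr_ge0 ?sqr_ge0.
have th1 : th <= (1 + `|m| * d ^+ 2) * (1 - d * k + 2 * (d * k) ^+ 2).
  rewrite /th; apply: ler_pM; rewrite ?expR_ge0 ?mulr_ge0 ?exprn_ge0 ?(ltW dp) //.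
  rewrite sqrrN in q2; apply: le_trans (_ : expR (- (d * k)) <= _); last by lra.
  by rewrite ler_expR gerDr oppr_le0 divr_ge0 // mulr_ge0 // ltW.
have small : 1 - d * k + 2 * (d * k) ^+ 2 <= 2.
  move: dk; rewrite ler_norml => /andP[b1 b2]; set z := d * k in b1 b2 *.
  by nra.
have th2 : d * k - d ^+ 2 * K' <= 1 - th.
  have : `|m| * d ^+ 2 * (1 - d * k + 2 * (d * k) ^+ 2) <= `|m| * d ^+ 2 * 2 by rewrite ler_wpM2l.
  rewrite mulrDl mul1r in th1; rewrite /K'.
  have -> : d ^+ 2 * (2 * k ^+ 2 + 2 * `|m|) = 2 * (d * k) ^+ 2 + `|m| * d ^+ 2 * 2 by ring.
  by lra.
rewrite vE; set U := scaled_u c B m d N in cu1 cu2 uu0 *; set V := scaled_w c B m d N in cw *.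
have -> : U + d * V - th * U = (1 - th) * U + d * V by ring.
apply: lt_le_trans (_ : (d * k - d ^+ 2 * K') * U + d * V <= _); last by rewrite lerD2r ler_pM2r.
have -> : (d * k - d ^+ 2 * K') * U + d * V = d * (k * U + V - d * K' * U) by ring.
rewrite mulr_gt0 //.
have a1 : k * twu c m B N - `|k| * e <= k * U.
  have : - (`|k| * e) <= k * (U - twu c m B N).
    have : `|k * (U - twu c m B N)| <= `|k| * e.
      by rewrite normrM ler_wpM2l // ler_norml; apply/andP; split; lra.
    by rewrite ler_norml => /andP[].
  by rewrite mulrBr; lra.
have a2 : d * K' * U <= kap / 4.
  apply: le_trans hd3; rewrite [X in _ <= X]mulrA ler_wpM2l //; first by rewrite mulr_ge0 // ltW.
  by have : (8^-1 : R) <= 1 by [rewrite invf_le1 // ler1n]; lra.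
have a3 : e * (4 * (`|k| + 1)) = 4 * (`|k| * e) + 4 * e by ring.
rewrite a3 in ek; rewrite /kap in ek a2 *.
have kp : 0 < kap := kap0; rewrite /kap in kp.
by lra.
Qed.

End positivity.

(** * Positivity on the whole half-line *)

Section positivity_all.
Context {R : realType}.
Implicit Types (x y s t d m : R).
Variables (c : R) (B : R -> R).
Hypotheses (cB : cts B) (tB : tame B).

Local Notation psi m d := (spsi (scaled_S c B d) (scaled_M c B d) (scaled_lam m d)).
Local Notation pi_ m d := (spi (scaled_S c B d) (scaled_M c B d) (scaled_lam m d)).
Local Notation a_ d := (2 / d ^+ 3 - c ^+ 2 / 2).

Let cS d := cts_scaled_S c cB d.
Let cM d := cts_scaled_M c cB d.

Lemma scaled_lam_gt0 m d : 0 < d -> `|m| * d ^+ 2 <= 2^-1 -> 0 < scaled_lam m d.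
Proof.
move=> d0 h; rewrite divr_gt0 ?exprn_gt0 //.
have : m * d ^+ 2 <= `|m| * d ^+ 2 by rewrite ler_wpM2r ?sqr_ge0 // ler_norm.
by lra.
Qed.

(** From [x1 = d^-2] on, [string_tail] applies with [ga - al = 7/8]. Its two loss terms are each at
    most [pi_ x1 / 4]: the one in [psi x1] through the barrier inequality, the other because an
    exponential in [d^-2] beats the powers of [1 / d]. *)
Lemma scaled_tail m N T d : 0 < d -> d <= 100^-1 -> `|m| * d ^+ 2 <= 2^-1 -> 1 <= a_ d ->
  (forall y, d ^- 2 <= y -> T * d ^+ 2 <= y -> `|c * (d * B (y / d ^+ 2))| <= y / 16) ->
  T * d ^+ 2 <= d ^- 2 -> d ^+ 3 * (Num.sqrt N / 5) <= 16^-1 ->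
  (forall x, 0 <= x <= d ^- 2 -> 0 < pi_ m d x) -> 0 < psi m d (d ^- 2) ->
  barrier c B m N d (d ^- 2) * psi m d (d ^- 2) < pi_ m d (d ^- 2) ->
  exists2 k : R, 0 < k & forall x, 0 <= x -> k <= pi_ m d x.
Proof.
move=> d0 d100 md a1 lin Td dsig pos ps0 bar.
set x1 := d ^- 2 in lin Td pos ps0 bar *.
have dN : d != 0 by rewrite gt_eqF.
have d2 : 0 < d ^+ 2 by rewrite exprn_gt0.
have dle1 : d <= 1 by apply: (le_trans d100); rewrite invf_le1 // ler1n.
have x10 : 0 < x1 by rewrite invr_gt0.
have x11 : 1 <= x1 by rewrite -invr1 lef_pV2 ?posrE // expr2 mulr_ile1 // ltW.
have l0 := scaled_lam_gt0 d0 md.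
pose lam := scaled_lam m d; pose L : R := Num.sqrt lam.
have Lp : 0 < L by rewrite sqrtr_gt0.
have L0 := ltW Lp.
have L2 : L ^+ 2 = lam by rewrite sqr_sqrtr // ltW.
have L1 : L <= 2 / d ^+ 3.
  apply: (le_trans (sqrt_scaled_lam_le m d0)).
  by rewrite ler_pM2r ?invr_gt0 ?exprn_gt0 //; lra.
have pi1 : 0 < pi_ m d x1 by apply: pos; rewrite lexx ltW.
have lin' y : x1 <= y -> `|c * (d * B (y / d ^+ 2))| <= y / 16.
  by move=> h; apply: lin => //; exact: le_trans h.
have hS y : x1 <= y -> scaled_S c B d y <= 1 * expR ((a_ d + 16^-1) * y).
  move=> h; rewrite mul1r ler_expR; have := ler_norm (c * (d * B (y / d ^+ 2))); have := lin' y h.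
  by lra.
have hM y : x1 <= y -> scaled_M c B d y <= 1 * expR (- (a_ d + 1 - 16^-1) * y).
  move=> h; rewrite mul1r ler_expR; have := ler_norm (- (c * (d * B (y / d ^+ 2)))); have := lin' y h.
  by rewrite normrN; lra.
set al := a_ d + 16^-1 in hS; set ga := a_ d + 1 - 16^-1 in hM.
have al1 : 1 <= al by rewrite /al; lra.
have al0 : 0 < al by lra.
have alga : al < ga by rewrite /al /ga; lra.
have ka : ga - al = 7 / 8 by rewrite /al /ga; field.
pose rho := barrier c B m N d x1.
(* The quartic bound on the exponential contributes [d ^+ 8], which leaves [d ^+ 5] against
   [L <= 2 / d ^+ 3]; the constants require [d <= 1/100]. *)
have E1 : L * expR (- (x1 / 4)) <= 4^-1.
  have h := expRN_le_quartic (ltac:(by rewrite divr_gt0) : 0 < x1 / 4).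
  apply: le_trans (_ : 2 / d ^+ 3 * (256 / (x1 / 4) ^+ 4) <= _); first by apply: ler_pM; rewrite ?expR_ge0.
  rewrite (_ : 2 / d ^+ 3 * _ = 2 * ((256 * d) ^+ 2 * d ^+ 3)); last by rewrite /x1; field.
  have h1 : (256 * d) ^+ 2 <= 3 ^+ 2.
    by rewrite ler_sqr ?nnegrE ?mulr_ge0 ?(ltW d0) //; lra.
  have h2 : d ^+ 3 <= 100^-1.
    by apply: le_trans d100; rewrite exprS ler_piMr ?(ltW d0) // expr2 mulr_ile1 // ltW.
  have : (256 * d) ^+ 2 * d ^+ 3 <= 3 ^+ 2 * 100^-1.
    by apply: ler_pM; rewrite ?sqr_ge0 ?exprn_ge0 ?(ltW d0).
  by lra.
have E2 : lam * expR (- (7 / 8 * x1)) * (8 / 7) <= 4^-1.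
  have h := expRN_le_quartic (ltac:(by rewrite mulr_gt0 // divr_gt0) : 0 < 7 / 8 * x1).
  apply: le_trans (_ : (2 / d ^+ 3) ^+ 2 * (256 / (7 / 8 * x1) ^+ 4) * (8 / 7) <= _).
    rewrite ler_pM2r ?divr_gt0 //; apply: ler_pM; rewrite ?expR_ge0 ?(ltW l0) // -L2.
    by rewrite ler_sqr ?nnegrE // divr_ge0 ?exprn_ge0 // ltW.
  rewrite (_ : (2 / d ^+ 3) ^+ 2 * _ * _ = 4 * (8 / 7) ^+ 5 * (16 * d) ^+ 2); last by rewrite /x1; field.
  have h1 : (16 * d) ^+ 2 <= 6^-1 ^+ 2.
    by rewrite ler_sqr ?nnegrE ?mulr_ge0 ?(ltW d0) //; lra.
  have : (8 / 7 : R) ^+ 5 <= 2 by lra.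
  have : 4 * (8 / 7) ^+ 5 * (16 * d) ^+ 2 <= 4 * (8 / 7) ^+ 5 * 6^-1 ^+ 2.
    by rewrite ler_wpM2l // mulr_ge0 // exprn_ge0 // divr_ge0.
  by lra.
have rho0 : 0 < rho by rewrite /rho /barrier mulr_gt0 ?expR_gt0.
(* The exponent 15/16 exceeds [1/4 + 1/2] by 3/16. The averaged noise takes at most 2/16 of [x1],
   because [y <= x1 + 1 <= 2 * x1], and [d * sigma] at most 1/16. *)
have E3 : lam * expR (- ga * x1) <= L * expR (- (x1 / 4)) * rho.
  rewrite -L2 expr2 -2!mulrA ler_pM2l // /rho /barrier -/lam -/L mulrCA ler_pM2l // -expRD ler_expR.
  have [s /andP[s1 s2] es] := window_avg_mean cB (x1 / d ^+ 2).
  pose y := d ^+ 2 * s.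
  have ey : y / d ^+ 2 = s by rewrite /y; field.
  have y1 : x1 <= y by rewrite /y mulrC -ler_pdivrMr.
  have y2 : y <= x1 + 1.
    have : y <= d ^+ 2 * (x1 / d ^+ 2 + 1) by rewrite ler_pM2l.
    rewrite mulrDr mulr1 mulrCA divff ?gt_eqF // mulr1 => h; apply: (le_trans h).
    by rewrite lerD2l expr2 mulr_ile1 // ltW.
  have := lin' y y1; rewrite ey -es => hW.
  have := ler_norm (c * (d * window_avg B (x1 / d ^+ 2))) => hW2.
  have : d * (Num.sqrt N / 5) <= x1 / 16.
    rewrite -(@ler_pM2l _ (d ^+ 2)) // mulrA -exprSr (le_trans dsig) //.
    by rewrite /x1 mulrA divff ?gt_eqF // mul1r.
  by rewrite /ga; lra.
have low x : x1 <= x -> (forall y, 0 <= y < x -> 0 < pi_ m d y) -> pi_ m d x1 / 2 <= pi_ m d x.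
  move=> x1x posx.
  have [_] := string_tail (cS d) (cM d) (scaled_S_gt0 c B d) (scaled_M_gt0 c B d) al0 alga ltr01 (ltW l0) (ltW x10) x1x hS hM posx.
  apply: le_trans; rewrite -/lam ka.
  have t1 : lam * (psi m d x1 * (1 / ga * expR (- ga * x1))) <= pi_ m d x1 / 4.
    apply: le_trans (_ : lam * expR (- ga * x1) * psi m d x1 <= _).
      rewrite (_ : lam * (_ * _) = (1 / ga) * (lam * expR (- ga * x1) * psi m d x1)); last by ring.
      rewrite ler_piMl // ?div1r ?invf_le1 //; try lra.
      by apply: mulr_ge0 (ltW ps0); apply: mulr_ge0 (expR_ge0 _); exact: ltW.
    apply: le_trans (_ : L * expR (- (x1 / 4)) * rho * psi m d x1 <= _); first by rewrite ler_pM2r.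
    rewrite -[_ * rho * _]mulrA [pi_ m d x1 / 4]mulrC; apply: ler_pM E1 (ltW bar).
      exact: mulr_ge0 L0 (expR_ge0 _).
    exact: mulr_ge0 (ltW rho0) (ltW ps0).
  have t2 : lam * (pi_ m d x1 * (1 ^+ 2 / (al * (7 / 8)) * expR (- (7 / 8) * x1))) <= pi_ m d x1 / 4.
    rewrite mulNr (_ : lam * (_ * _) = pi_ m d x1 * (al^-1 * (lam * expR (- (7 / 8 * x1)) * (8 / 7)))); last by field; rewrite gt_eqF.
    rewrite ler_pM2l //; apply: le_trans E2; rewrite ler_piMl ?invf_le1 //.
    apply: mulr_ge0; last by rewrite divr_ge0.
    by apply: mulr_ge0 (expR_ge0 _); exact: ltW.
  by rewrite mulrDr; lra.
exists (pi_ m d x1 / 2); first by rewrite divr_gt0.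
have posall x : 0 <= x -> 0 < pi_ m d x.
  move=> x0; rewrite ltNge; apply/negP => px.
  have [z [/andP[z0 zx] fz pz]] := first_zero (cts_spi (cS d) (cM d) _) x0 (ltac:(by rewrite spi0)) px.
  have x1z : x1 <= z.
    by rewrite leNgt; apply/negP => zx1; have := pos z; rewrite fz (ltW z0) (ltW zx1) ltxx => /(_ isT).
  by have := low z x1z pz; rewrite fz; lra.
move=> x x0; have [xx1|/ltW x1x] := leP x x1; last by apply: low => // y /andP[y0 _]; exact: posall.
apply: le_trans (_ : pi_ m d x1 <= _); first by lra.
apply: (spi_nonincr (cS d) (cM d) (scaled_S_gt0 c B d) (scaled_M_gt0 c B d) (ltW l0) x0 xx1) => y /andP[y0 _].
exact/ltW/posall.
Qed.

Lemma scaled_positive m m' : m' < m -> (forall t, 0 < t -> 0 < twu c m' B t) ->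
  exists2 d0 : R, 0 < d0 & forall d, 0 < d -> d <= d0 ->
    exists2 k : R, 0 < k & forall x, 0 <= x -> k <= pi_ m d x.
Proof.
move=> mm pos.
have posm := twu_pos_mono cB mm pos.
have [T T0 lin] := tame_linear c tB.
have [_ g2] := tB.
have c20 := sqr_ge0 c; have m0 := normr_ge0 m.
pose e2 := (100 * (c ^+ 2 + 1))^-1.
have e20 : 0 < e2 by rewrite invr_gt0 mulr_gt0 // ltr_wpDl.
have [T2 hT2] := g2 e2 e20.
have [N NT up] := twu_increases cB (T2 + `|T2| + 1 + 10 * (2 * `|m| + c ^+ 2)) mm pos.
have T2n := ler_norm (- T2); rewrite normrN in T2n.
have T2p := normr_ge0 T2.
have N1 : 1 <= N by lra.
have N0 : 0 < N by lra.
have Nbig : 10 * (2 * `|m| + c ^+ 2) <= N by lra.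
have NT2 : T2 <= N by lra.
have osc t s : N <= t -> t <= s <= t + 1 -> c ^+ 2 * (B s - B t) ^+ 2 <= t / 100.
  move=> Nt ts; have t0 : 0 <= t by lra.
  have h := hT2 t s (le_trans NT2 Nt) ts.
  apply: le_trans (_ : c ^+ 2 * (e2 * t) <= _); first by rewrite ler_wpM2l.
  rewrite mulrA mulrC ler_wpM2l // /e2 ler_pdivrMr ?mulr_gt0 ?ltr_wpDl // mulrA mulVf // mul1r.
  by lra.
pose sig : R := Num.sqrt N / 5.
have sig0 : 0 <= sig by rewrite divr_ge0 // sqrtr_ge0.
(* At [N] the derivative [c B u + w] is positive. Replacing [B N] by the window average costs at
   most [sqrt N / 10], less than the lowering [sqrt N / 5]. *)
have start0 : 0 < (c * window_avg B N + Num.sqrt N / 5) * twu c m B N + tww c m B N.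
  have uN := posm N N0.
  have [s hs es] := window_avg_mean cB N.
  have := osc_le N1 osc (lexx N) hs; rewrite es ler_norml => /andP[p1 _].
  have sq0 : 0 < Num.sqrt N by rewrite sqrtr_gt0.
  have : 0 < (c * B s + Num.sqrt N / 5 - c * B N) * twu c m B N.
    by rewrite mulr_gt0 //; rewrite mulrBr in p1; lra.
  by rewrite mulrBl; lra.
have [ds ds0 hds] := scaled_start cB N0 posm start0.
(* The single condition [d * k <= 1] delivers all the smallness conditions below, each coming from
   one term of [k]. *)
pose k := 100 + 2 * `|m| + 10 * c ^+ 2 + T + N + 16 * sig.
have k0 : 0 <= k by rewrite /k; lra.
have [dk dk0 hdk] := small_d_bound k0 ltr01.
exists (Num.min ds dk); first by rewrite lt_min ds0.
move=> d d0; rewrite le_min => /andP[dds /(hdk d d0) dk1].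
have dpos := ltW d0.
have dc : 0 <= d * c ^+ 2 by rewrite mulr_ge0.
have dm : 0 <= d * `|m| by rewrite mulr_ge0.
have dT : 0 <= d * T by rewrite mulr_ge0.
have dNN : 0 <= d * N by rewrite mulr_ge0 // ltW.
have dsig : 0 <= d * sig by rewrite mulr_ge0.
have [[d100 md1 cd1] [dT1 dN1 ds1]] :
    [/\ d <= 100^-1, `|m| * d <= 2^-1 & c ^+ 2 * d <= 10^-1] /\ [/\ d * T <= 1, d * N <= 1 & d * sig <= 16^-1].
  by rewrite /k in dk1; clear -dk1 dc dm dT dNN dsig dpos; split; split; lra.
have dle1 : d <= 1 by apply: (le_trans d100); rewrite invf_le1 // ler1n.
have d2le : d ^+ 2 <= d by rewrite expr2 ler_piMl.
have d3le : d ^+ 3 <= d by rewrite exprS ler_piMr // (le_trans d2le).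
have d4le : d ^+ 4 <= d by rewrite exprS ler_piMr // (le_trans d3le).
have md : `|m| * d ^+ 2 <= 2^-1.
  by apply: le_trans (_ : `|m| * d <= _); [rewrite ler_wpM2l|].
have cd : c ^+ 2 * d ^+ 3 <= 10^-1.
  by apply: le_trans (_ : c ^+ 2 * d <= _); [rewrite ler_wpM2l|].
have d3 : 0 < d ^+ 3 by rewrite exprn_gt0.
have d2p : 0 < d ^+ 2 by rewrite exprn_gt0.
have a1 : 1 <= a_ d.
  by rewrite lerBrDr ler_pdivlMr // mulrDl mul1r; clear -d3le dle1 cd dk1; lra.
have small X : 0 <= X -> d * X <= 1 -> X * d ^+ 2 <= d ^- 2.
  move=> X0 dX; rewrite -[d ^- 2]mul1r ler_pdivlMr // -mulrA -exprD.
  by apply: le_trans (_ : X * d <= _); [rewrite ler_wpM2l|rewrite mulrC].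
have NN : d ^+ 2 * N <= d ^- 2 by rewrite mulrC; apply: small => //; exact: ltW.
have TT : T * d ^+ 2 <= d ^- 2 by apply: small.
have ss : d ^+ 3 * (Num.sqrt N / 5) <= 16^-1.
  by apply: le_trans (_ : d * sig <= _); [rewrite ler_wpM2r|].
have [p1 p2 p3] := hds d d0 dds.
have lam0 := ltW (scaled_lam_gt0 d0 md).
have bl y (hy : d ^+ 2 * N <= y <= d ^- 2) :=
  barrier_le cB N1 Nbig osc d0 dle1 cd lam0 (proj1 (andP hy)) (proj2 (andP hy)).
have bar := string_barrier (cS d) (cM d) (scaled_S_gt0 c B d)
  (fun y hy => proj1 (bl y hy)) (fun y hy => proj2 (bl y hy)) p2 p3.
have [q1 q2] := bar (d ^- 2) (ltac:(by rewrite NN lexx)).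
have pos1 x : 0 <= x <= d ^- 2 -> 0 < pi_ m d x.
  move=> /andP[x0 x1]; have [xN|/ltW Nx] := leP x (d ^+ 2 * N); first by apply: p1; rewrite x0.
  have [r1 r2] := bar x (ltac:(by rewrite Nx)); apply: le_lt_trans r2.
  apply: mulr_ge0 (ltW r1); apply: mulr_ge0 (expR_ge0 _); exact: sqrtr_ge0.
exact: (scaled_tail d0 d100 md a1 (fun y => lin d y d0) TT ss pos1 q1 q2).
Qed.

End positivity_all.

(** * From the string to the random operator *)

Section scaled_spectrum.
Context {R : realType}.
Implicit Types (x y t d m lam : R).
Local Notation mu := (@lebesgue_measure R).
Local Notation Rp := (`[0, +oo[%classic : set R).

(** The eigenvalue relation sees a path only on the half-line, so the path may be replaced by its
    even extension. *)
Lemma is_eigenvalueE (beta a lam : R) (f g : R -> R) : (forall x, 0 <= x -> f x = g x) ->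
  is_eigenvalue beta a f lam <-> string_eig (dens_s beta a g) (dens_m beta a g) lam.
Proof.
move=> fg.
have em y : 0 <= y -> dens_m beta a f y = dens_m beta a g y by move=> y0; rewrite /dens_m fg.
have es x : 0 <= x -> scale_fun beta a f x = prim (dens_s beta a g) x.
  move=> x0; rewrite -RintegralE_prim //; apply: eq_Rintegral => y.
  by rewrite inE /= in_itv /= => /andP[y0 _]; rewrite /dens_s fg.
have eG phi x y : 0 <= x -> 0 <= y ->
    G_integrand beta a f phi x y = prim (dens_s beta a g) (Order.min x y) * phi y * dens_m beta a g y.
  by move=> x0 y0; rewrite /G_integrand em // es // le_min x0.
have e2 phi : {in Rp, (fun y => (phi y ^+ 2 * dens_m beta a f y)%:E) =1
    (fun y => (phi y ^+ 2 * dens_m beta a g y)%:E)}.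
  by move=> y; rewrite inE /= in_itv /= andbT => y0; rewrite em.
have e3 phi x : 0 <= x -> {in Rp, (fun y => (G_integrand beta a f phi x y)%:E) =1
    (fun y => (prim (dens_s beta a g) (Order.min x y) * phi y * dens_m beta a g y)%:E)}.
  by move=> x0 y; rewrite inE /= in_itv /= andbT => y0; rewrite eG.
have i2 phi : \int[mu]_(y in Rp) (phi y ^+ 2 * dens_m beta a f y) =
    \int[mu]_(y in Rp) (phi y ^+ 2 * dens_m beta a g y).
  by apply: eq_Rintegral => y; rewrite inE /= in_itv /= andbT => y0; rewrite em.
have i3 phi x : 0 <= x -> \int[mu]_(y in Rp) G_integrand beta a f phi x y =
    \int[mu]_(y in Rp) (prim (dens_s beta a g) (Order.min x y) * phi y * dens_m beta a g y).
  by move=> x0; apply: eq_Rintegral => y; rewrite inE /= in_itv /= andbT => y0; rewrite eG.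
split=> -[phi [h1 h2 h3 h4 h5]]; exists phi; split.
- exact: h1.
- by apply: eq_integrable h2 => // y yp; exact: e2.
- by rewrite -i2.
- by move=> x x0; apply: eq_integrable (h4 x x0) => // y yp; exact: e3.
- by move=> x x0; rewrite -i3 // h5.
- exact: h1.
- by apply: eq_integrable h2 => // y yp; apply/esym/e2.
- by rewrite i2.
- by move=> x x0; apply: eq_integrable (h4 x x0) => // y yp; apply/esym/e3.
- by move=> x x0; rewrite i3 // h5.
Qed.

Variables (beta : R) (f : R -> R).
Hypotheses (beta0 : 0 < beta) (cf : {within Rp, continuous f}).
Let c := noise_coef beta.
Let B x := f `|x|.
Let cB : cts B := within_Rp_hat cf.

Definition rescaled_path d x := d * f (x / d ^+ 2).

Lemma noise_coef_sq : c ^+ 2 / 2 = 2 / beta.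
Proof.
rewrite /c /noise_coef expr_div_n sqr_sqrtr ?ltW //; field.
by rewrite gt_eqF.
Qed.

Lemma rescaled_eigE d lam : 0 < d ->
  is_eigenvalue beta (2 / d ^+ 3 - 2 / beta) (rescaled_path d) lam <->
  string_eig (scaled_S c B d) (scaled_M c B d) lam.
Proof.
move=> d0; have d2 : 0 < d ^+ 2 by rewrite exprn_gt0.
have -> : scaled_S c B d = dens_s beta (2 / d ^+ 3 - 2 / beta) (fun x => d * B (x / d ^+ 2)).
  by apply/funext => x; rewrite /scaled_S /dens_s noise_coef_sq.
have -> : scaled_M c B d = dens_m beta (2 / d ^+ 3 - 2 / beta) (fun x => d * B (x / d ^+ 2)).
  by apply/funext => x; rewrite /scaled_M /dens_m noise_coef_sq.
apply: is_eigenvalueE => x x0; rewrite /rescaled_path /B ger0_norm //.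
by rewrite divr_ge0 // ltW.
Qed.

Let Lam d := Lambda0 beta (2 / d ^+ 3 - 2 / beta) (rescaled_path d).
Let cS d := cts_scaled_S c cB d.
Let cM d := cts_scaled_M c cB d.
Let S0 d := scaled_S_gt0 c B d.
Let M0 d := scaled_M_gt0 c B d.

Lemma rescaled_eig_gt0 d lam : 0 < d ->
  is_eigenvalue beta (2 / d ^+ 3 - 2 / beta) (rescaled_path d) lam -> 0 < lam.
Proof.
by move=> d0 /(rescaled_eigE _ d0) /(string_eig_conds (cS d) (cM d) (@S0 d) (@M0 d)) [].
Qed.

Hypothesis tB : tame B.

Lemma small_d_drift m : exists2 d0 : R, 0 < d0 & forall d, 0 < d -> d <= d0 ->
  1 <= 2 / d ^+ 3 - c ^+ 2 / 2 /\ `|m| * d ^+ 2 <= 2^-1.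
Proof.
have c20 := sqr_ge0 c; have m0 := normr_ge0 m.
have k0 : 0 <= 1 + c ^+ 2 + 2 * `|m| by lra.
have [d0 d00 hd] := small_d_bound k0 ltr01.
exists d0 => // d dp /(hd d dp).
have dc : 0 <= d * c ^+ 2 by rewrite mulr_ge0 // ltW.
have dm : 0 <= d * `|m| by rewrite mulr_ge0 // ltW.
rewrite !mulrDr => h.
have dle1 : d <= 1 by lra.
have d2le : d ^+ 2 <= d by rewrite expr2 ler_piMl // ltW.
have d3le : d ^+ 3 <= d by rewrite exprS ler_piMr ?(ltW dp) // (le_trans d2le).
split.
  rewrite lerBrDr ler_pdivlMr ?exprn_gt0 // mulrDl mul1r.
  have : c ^+ 2 * d ^+ 3 <= c ^+ 2 * d by rewrite ler_wpM2l.
  lra.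
have : `|m| * d ^+ 2 <= `|m| * d by rewrite ler_wpM2l.
lra.
Qed.

Lemma rescaled_eig_le m d x : 0 < d -> 1 <= 2 / d ^+ 3 - c ^+ 2 / 2 -> 0 < m -> 0 <= x ->
  spi (scaled_S c B d) (scaled_M c B d) m x <= 0 ->
  exists2 nu, 0 < nu <= m & is_eigenvalue beta (2 / d ^+ 3 - 2 / beta) (rescaled_path d) nu.
Proof.
move=> d0 a1 m0 x0 px.
have [C [al [ga [al0 alga C0 hS hM]]]] := scaled_good_string cB tB d0 a1.
have [nu nuin e] := string_eig_exists (cS d) (cM d) (@S0 d) (@M0 d) al0 alga C0 hS hM m0 x0 px.
by exists nu; [|exact: (rescaled_eigE nu d0).2].
Qed.

Lemma Lambda0_eventually_le m t1 : 0 < t1 -> twu c m B t1 < 0 ->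
  exists2 d0 : R, 0 < d0 & forall d, 0 < d -> d <= d0 -> Lam d <= scaled_lam m d.
Proof.
move=> t10 ut.
have [d1 d10 h1] := scaled_spi_vanishes cB t10 ut.
have [d2 d20 h2] := small_d_drift m.
exists (Num.min d1 d2); first by rewrite lt_min d10.
move=> d dp; rewrite le_min => /andP[dd1 dd2].
have [x x0 px] := h1 d dp dd1; have [a1 md] := h2 d dp dd2.
have [nu /andP[_ nul] e] := rescaled_eig_le dp a1 (scaled_lam_gt0 dp md) x0 px.
apply: le_trans nul; apply: ge_inf => //.
by exists 0 => y /(rescaled_eig_gt0 dp) /ltW.
Qed.

(** The intermediate [m1] makes the inequality strict: no eigenvalue lies below [scaled_lam m1 d],
    which exceeds [scaled_lam m d]. An eigenvalue has to be exhibited as well, since [inf] of the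
    empty set is 0. *)
Lemma Lambda0_eventually_gt m m' : m' < m -> (forall t, 0 < t -> 0 < twu c m' B t) ->
  exists2 d0 : R, 0 < d0 & forall d, 0 < d -> d <= d0 -> scaled_lam m d < Lam d.
Proof.
move=> mm pos; pose m1 := (m + m') / 2.
have m1m : m1 < m by rewrite /m1; lra.
have m'm1 : m' < m1 by rewrite /m1; lra.
have [d1 d10 h1] := scaled_positive cB tB m'm1 pos.
have [d2 d20 h2] := small_d_drift m.
exists (Num.min d1 d2); first by rewrite lt_min d10.
move=> d dp; rewrite le_min => /andP[dd1 dd2].
have [k k0 hk] := h1 d dp dd1; have [a1 _] := h2 d dp dd2.
apply: lt_le_trans (_ : scaled_lam m1 d <= _).
  rewrite /scaled_lam ltr_pM2r ?invr_gt0 ?exprn_gt0 //.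
  by rewrite ltrD2l ltrN2 ltr_pM2r // exprn_gt0.
apply: lb_le_inf.
  have [l l0 [x x0 px]] := spi_vanishes (cS d) (cM d) (@S0 d) (@M0 d).
  by have [nu _ e] := rescaled_eig_le dp a1 l0 x0 px; exists nu.
move=> nu /(rescaled_eigE _ dp) e; rewrite leNgt; apply/negP => nul.
exact: (no_eig_below (cS d) (cM d) (@S0 d) (@M0 d) k0 hk (ltW nul) e).
Qed.

End scaled_spectrum.

(** * Measurability of path functionals *)

Section riemann_sums.
Context {R : realType}.
Implicit Types (h : R -> R) (x y t a b e : R).

Lemma uniformly_cts h a b e : cts h -> 0 < e ->
  exists2 d : R, 0 < d & forall x y, a <= x <= b -> `|x - y| <= d -> `|h x - h y| <= e.
Proof.
move=> ch e0.
have /compact_near_coveringP cov := @segment_compact R a b.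
pose P (d x : R) := forall y, `|x - y| <= d -> `|h x - h y| <= e.
have : \forall d \near (0 : R)^'+, `[a, b]%classic `<=` P d.
  apply: cov => x _.
  have e2 : 0 < e / 2 by rewrite divr_gt0.
  have := @ctsP _ _ ch x => /cvgrPdist_lt /(_ _ e2) /nbhs_ballP [r /= r0 hr].
  have r2 : 0 < r / 2 by rewrite divr_gt0.
  exists (ball x (r / 2), [set d | d < r / 2]) => /=.
    by split; [exact: nbhsx_ballx|exact: nbhs_right_lt].
  move=> [z d] /= [zx dr] y zy.
  have h1 := hr z; have h2 := hr y.
  rewrite /ball /= in zx h1 h2.
  have hz : `|h x - h z| < e / 2 by apply: h1; rewrite (lt_le_trans zx) //; lra.
  have hy : `|h x - h y| < e / 2.
    apply: h2; have := ler_distD z x y; lra.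
  have := ler_distD (h x) (h z) (h y); rewrite [`|h z - h x|]distrC; lra.
move=> [d /= d0 hd]; exists (d / 2); first by rewrite divr_gt0.
move=> x y xab; apply: (hd (d / 2) _ _ x).
- by rewrite /ball /= sub0r normrN gtr0_norm ?divr_gt0 //; lra.
- by rewrite /= divr_gt0.
- by rewrite /= in_itv.
Qed.

Definition riemann_sum h t n : R := \sum_(i < n.+1) (t / n.+1%:R) * h (t / n.+1%:R * i%:R).

Lemma riemann_sum_cvg h t : cts h -> 0 <= t -> riemann_sum h t n @[n --> \oo] --> prim h t.
Proof.
move=> ch t0; apply/cvgrPdist_le => e e0.
have t1 : 0 < t + 1 by rewrite ltr_wpDl.
have e1 : 0 < e / (t + 1) by rewrite divr_gt0.
have [d d0 hd] := uniformly_cts 0 t ch e1.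
have [N hN] : exists N : nat, t / d <= N%:R.
  by exists (Num.trunc (t / d)).+1; rewrite ltW // truncnS_gt.
exists N => // n /= Nn.
set s := t / n.+1%:R.
have s0 : 0 <= s by rewrite divr_ge0.
have sd : s <= d.
  rewrite ler_pdivrMr // mulrC -ler_pdivrMr // (le_trans hN) // ler_nat.
  exact: leqW.
have key j : (j <= n.+1)%N -> `|prim h (s * j%:R) - \sum_(i < j) s * h (s * i%:R)| <= j%:R * s * (e / (t + 1)).
  elim: j => [_|j IH jn]; first by rewrite big_ord0 mulr0 prim0 subrr normr0 !mul0r.
  rewrite big_ord_recr /=.
  have sj : s * j%:R <= s * j.+1%:R by rewrite ler_wpM2l // ler_nat.
  have sn : s * n.+1%:R = t by rewrite /s divfK // pnatr_eq0.
  have [x /andP[x1 x2] ex] := mean_value sj (fun y _ => der_prim y ch).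
  have step : s * j.+1%:R - s * j%:R = s by rewrite -mulrBr -natrB // subSnn mulr1.
  rewrite step in ex.
  have jt : 0 <= s * j%:R <= t by rewrite mulr_ge0 //= -sn ler_wpM2l // ler_nat ltnW.
  have := hd _ x jt; have -> : `|s * j%:R - x| <= d.
    by rewrite ler_norml; apply/andP; split; lra.
  move=> /(_ isT) hx.
  have -> : prim h (s * j.+1%:R) - (\sum_(i < j) s * h (s * i%:R) + s * h (s * j%:R)) =
     (prim h (s * j%:R) - \sum_(i < j) s * h (s * i%:R)) + s * (h x - h (s * j%:R)).
    by rewrite mulrBr [s * h x]mulrC -ex; ring.
  apply: (le_trans (ler_normD _ _)); rewrite -[j.+1]addn1 natrD !mulrDl mul1r.
  apply: lerD; first by apply: IH; exact: ltnW.
  by rewrite normrM ger0_norm // ler_wpM2l // distrC.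
have := key n.+1 (leqnn _); rewrite -/s.
have -> : s * n.+1%:R = t by rewrite /s divfK // pnatr_eq0.
move=> h1; apply: (le_trans h1).
have -> : n.+1%:R * s = t by rewrite mulrC /s divfK // pnatr_eq0.
by rewrite mulrCA ler_piMr ?(ltW e0) // ler_pdivrMr // mul1r; lra.
Qed.

End riemann_sums.

(** * Processes with continuous paths *)

Section processes.
Context {R : realType} {dd : measure_display} {T : measurableType dd}.
Implicit Types (X Y : T -> R -> R) (t : R).

(** Continuity of the paths makes integrals limits of Riemann sums, hence measurable. The class is
    therefore stable under [prim] and under Picard iteration, and contains the solutions of linear
    systems driven by such processes. *)
Definition proc X := (forall w, cts (X w)) /\ (forall t, 0 <= t -> measurable_fun [set: T] (fun w => X w t)).

Lemma proc_cst (h : R -> R) : cts h -> proc (fun=> h).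
Proof. by move=> ch; split=> // t _; exact: measurable_cst. Qed.

Lemma procD X Y : proc X -> proc Y -> proc (fun w t => X w t + Y w t).
Proof.
move=> [cX mX] [cY mY]; split=> [w|t t0]; first exact: ctsD.
by apply: measurable_funD; [exact: mX|exact: mY].
Qed.

Lemma procN X : proc X -> proc (fun w t => - X w t).
Proof.
move=> [cX mX]; split=> [w|t t0]; first exact: ctsN.
by apply: measurableT_comp => //; exact: mX.
Qed.

Lemma procM X Y : proc X -> proc Y -> proc (fun w t => X w t * Y w t).
Proof.
move=> [cX mX] [cY mY]; split=> [w|t t0]; first exact: ctsM.
by apply: measurable_funM; [exact: mX|exact: mY].
Qed.

Lemma proc_comp (g : R -> R) X : cts g -> proc X -> proc (fun w t => g (X w t)).
Proof.
move=> cg [cX mX]; split=> [w|t t0]; first exact: cts_comp.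
apply: measurableT_comp (mX t t0).
exact: cts_measurable.
Qed.

Lemma procZ (k : R) X : proc X -> proc (fun w t => k * X w t).
Proof. exact: (proc_comp (ctsZ k (@cts_id R))). Qed.

Lemma proc_sqr X : proc X -> proc (fun w t => X w t ^+ 2).
Proof. exact: (proc_comp (cts_sqr (@cts_id R))). Qed.

Lemma proc_exp X : proc X -> proc (fun w t => expR (X w t)).
Proof. exact: (proc_comp (cts_exp (@cts_id R))). Qed.

Lemma proc_norm X : proc X -> proc (fun w t => `|X w t|).
Proof. exact: (proc_comp (cts_norm (@cts_id R))). Qed.

Lemma proc_prim X : proc X -> proc (fun w => prim (X w)).
Proof.
move=> [cX mX]; split=> [w|t t0]; first exact: cts_prim.
apply: (@measurable_fun_cvg _ _ _ _ (fun n w => riemann_sum (X w) t n)).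
  move=> n; apply: measurable_sum => i; apply: measurable_funM => //.
  by apply: mX; rewrite mulr_ge0 // divr_ge0.
by move=> w _; exact: riemann_sum_cvg.
Qed.

Lemma proc_lin (a b X Y : T -> R -> R) : proc a -> proc b -> proc X -> proc Y ->
  proc (fun w t => a w t * X w t + b w t * Y w t).
Proof. by move=> pa pb pX pY; apply: procD; apply: procM. Qed.

Lemma proc_sol (al be ga de : T -> R -> R) : proc al -> proc be -> proc ga -> proc de ->
  proc (fun w => sol1 (al w) (be w) (ga w) (de w)) /\ proc (fun w => sol2 (al w) (be w) (ga w) (de w)).
Proof.
move=> pal pbe pga pde.
have pp n : proc (fun w => (picard (al w) (be w) (ga w) (de w) n).1) /\
    proc (fun w => (picard (al w) (be w) (ga w) (de w) n).2).
  elim: n => [|n [p1 p2]] /=; first by split; apply: proc_cst; exact: cts_cst.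
  by split; apply: proc_prim; exact: proc_lin.
have cv w := @sol_cvg R (al w) (be w) (ga w) (de w) (pal.1 w) (pbe.1 w) (pga.1 w) (pde.1 w).
have cs w := @cts_sol R (al w) (be w) (ga w) (de w) (pal.1 w) (pbe.1 w) (pga.1 w) (pde.1 w).
split; split=> [w|t t0].
- exact: (cs w).1.
- apply: (@measurable_fun_cvg _ _ _ _ (fun n w => series (fun k => (picard (al w) (be w) (ga w) (de w) k).1 t) n)).
    move=> n; rewrite /series /=.
    have -> : (fun w => \sum_(0 <= k < n) (picard (al w) (be w) (ga w) (de w) k).1 t) =
        (fun w => \sum_(k < n) (picard (al w) (be w) (ga w) (de w) k).1 t).
      by apply/funext => w; rewrite big_mkord.
    by apply: measurable_sum => i; exact: (pp i).1.2.
  by move=> w _; exact: (cv w t).1.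
- exact: (cs w).2.
- apply: (@measurable_fun_cvg _ _ _ _ (fun n w => series (fun k => (picard (al w) (be w) (ga w) (de w) k).2 t) n)).
    move=> n; rewrite /series /=.
    have -> : (fun w => \sum_(0 <= k < n) (picard (al w) (be w) (ga w) (de w) k).2 t) =
        (fun w => \sum_(k < n) (picard (al w) (be w) (ga w) (de w) k).2 t).
      by apply/funext => w; rewrite big_mkord.
    by apply: measurable_sum => i; exact: (pp i).2.2.
  by move=> w _; exact: (cv w t).2.
Qed.

Lemma proc_string (S M : T -> R -> R) lam : proc S -> proc M ->
  proc (fun w => spsi (S w) (M w) lam) /\ proc (fun w => spi (S w) (M w) lam).
Proof.
move=> pS pM; rewrite spsi.unlock spi.unlock.
by apply: proc_sol => //; [exact: proc_cst (cts_cst 0)|exact: procZ|exact: proc_cst (cts_cst 0)].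
Qed.

Lemma proc_tw (c m : R) (B : T -> R -> R) : proc B -> proc (fun w => twu c m (B w)).
Proof.
move=> pB; rewrite twu.unlock.
apply: (proc_sol (de := fun w t => - (c * B w t)) _ _ _ _).1.
- exact: procZ.
- exact: proc_cst (cts_cst 1).
- apply: procD; first by apply: proc_cst; exact: ctsD (@cts_id R) (cts_cst m).
  by apply: procN; apply: proc_sqr; exact: procZ.
- by apply: procN; exact: procZ.
Qed.

Lemma measurable_le_set (X Y : T -> R) : measurable_fun setT X -> measurable_fun setT Y ->
  measurable [set w | X w <= Y w].
Proof.
move=> mX mY; have -> : [set w | X w <= Y w] = (fun w => Y w - X w) @^-1` `[0, +oo[.
  by apply/seteqP; split=> w /=; rewrite in_itv /= andbT subr_ge0.
rewrite -[X in measurable X]setTI; apply: measurable_funB => //.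
Qed.

Lemma measurable_lt_set (X Y : T -> R) : measurable_fun setT X -> measurable_fun setT Y ->
  measurable [set w | X w < Y w].
Proof.
move=> mX mY; have -> : [set w | X w < Y w] = ~` [set w | Y w <= X w].
  by apply/seteqP; split=> w /=; rewrite ltNge => /negP.
by apply: measurableC; exact: measurable_le_set.
Qed.

Lemma measurable_forall (P : nat -> T -> Prop) : (forall n, measurable [set w | P n w]) ->
  measurable [set w | forall n, P n w].
Proof.
move=> mP; have -> : [set w | forall n, P n w] = \bigcap_n [set w | P n w].
  by apply/seteqP; split=> w /= h n; [move=> _; exact: h|exact: (h n I)].
exact: bigcap_measurable.
Qed.

Lemma measurable_exists (P : nat -> T -> Prop) : (forall n, measurable [set w | P n w]) ->
  measurable [set w | exists n, P n w].
Proof.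
move=> mP; have -> : [set w | exists n, P n w] = \bigcup_n [set w | P n w].
  by apply/seteqP; split=> w /= [n]; [exists n|move=> _; exists n].
exact: bigcup_measurable.
Qed.

End processes.

(** * Existence over a compact parameter set, and random limits *)

Section parametric_compactness.
Context {R : realType} {dd : measure_display} {T : measurableType dd}.

(** Compactness replaces the uncountable union: a common solution exists iff, for every [N], some
    point of a countable grid satisfies the first [N + 1] conditions up to [1 / (N + 1)]. *)
Lemma measurable_exists_segment (H : nat -> T -> R -> R) (a b : R) : a < b ->
  (forall n w, cts (H n w)) -> (forall n lam, measurable_fun setT (fun w => H n w lam)) ->
  measurable [set w | exists2 lam, a <= lam <= b & forall n, H n w lam <= 0].
Proof.
move=> ab cH mH.
pose q (i j : nat) : R := a + (b - a) * (i%:R / j.+1%:R).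
pose Q N w := exists j i : nat, (i <= j.+1)%N /\ forall n, (n <= N)%N -> H n w (q i j) <= N.+1%:R^-1.
have ba : 0 < b - a by rewrite subr_gt0.
suff -> : [set w | exists2 lam, a <= lam <= b & forall n, H n w lam <= 0] = [set w | forall N, Q N w].
  apply: measurable_forall => N; apply: measurable_exists => j; apply: measurable_exists => i.
  case: (leqP i j.+1) => ij; last first.
    by rewrite (_ : [set w | _] = set0) //; apply/seteqP; split=> w //= -[].
  rewrite (_ : [set w | _] = [set w | forall n, (n <= N)%N -> H n w (q i j) <= N.+1%:R^-1]); last first.
    by apply/seteqP; split=> w /=; [case|].
  apply: measurable_forall => n; case: (leqP n N) => nN; last first.
    by rewrite (_ : [set w | _] = setT) //; apply/seteqP; split=> w.
  rewrite (_ : [set w | _] = [set w | H n w (q i j) <= N.+1%:R^-1]); last first.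
    by apply/seteqP; split=> w /=; [apply|].
  by apply: measurable_le_set.
apply/seteqP; split=> w /=.
  move=> [lam /andP[la lb] hl] N.
  have [d d0 hd] : exists2 d : R, 0 < d & forall mu, `|mu - lam| <= d -> forall n, (n <= N)%N -> H n w mu <= N.+1%:R^-1.
    have e0 : 0 < N.+1%:R^-1 :> R by rewrite invr_gt0.
    elim: {1}N => [|k [d d0 hd]].
      have := @ctsP _ _ (cH 0%N w) lam => /cvgrPdist_le /(_ _ e0) /nbhs_ballP [r /= r0 hr].
      exists (r / 2); first by rewrite divr_gt0.
      move=> mu hmu n; rewrite leqn0 => /eqP ->; have := hr mu; rewrite /ball /= distrC => h.
      have /h : `|mu - lam| < r by lra.
      by rewrite ler_norml => /andP[h1 _]; have := hl 0%N; move: h1; move: (_^-1) => e; lra.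
    have := @ctsP _ _ (cH k.+1 w) lam => /cvgrPdist_le /(_ _ e0) /nbhs_ballP [r /= r0 hr].
    exists (Num.min d (r / 2)); first by rewrite lt_min d0 divr_gt0.
    move=> mu; rewrite le_min => /andP[h1 h2] n; rewrite leq_eqVlt => /orP[/eqP ->|].
      have := hr mu; rewrite /ball /= distrC => h.
      have /h : `|mu - lam| < r by lra.
      by rewrite ler_norml => /andP[h3 _]; have := hl k.+1; move: h3; move: (_^-1) => e; lra.
    by rewrite ltnS; exact: hd.
  have [j hj] : exists j : nat, (b - a) / d <= j%:R.
    by exists (Num.trunc ((b - a) / d)).+1; rewrite ltW // truncnS_gt.
  pose z := (lam - a) / (b - a) * j.+1%:R.
  have z0 : 0 <= z by rewrite mulr_ge0 // divr_ge0 ?subr_ge0 // ltW.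
  have zj : z <= j.+1%:R by rewrite ler_piMl // ler_pdivrMr // mul1r lerD2r.
  have /andP[t1 t2] := truncn_itv z0.
  exists j, (Num.trunc z); split.
    by rewrite -(ler_nat R) (le_trans t1).
  apply: hd; rewrite /q distrC.
  have -> : lam - (a + (b - a) * ((Num.trunc z)%:R / j.+1%:R)) = (b - a) / j.+1%:R * (z - (Num.trunc z)%:R).
    by rewrite /z; field; rewrite gt_eqF //= addrC natr1 pnatr_eq0.
  rewrite normrM ger0_norm; last by rewrite divr_ge0 // ltW.
  apply: le_trans (_ : (b - a) / j.+1%:R * 1 <= _).
    apply: ler_wpM2l; first by rewrite divr_ge0 // ltW.
    by rewrite ger0_norm ?subr_ge0 // lerBlDr addrC natr1 ltW.
  rewrite mulr1 ler_pdivrMr // mulrC -ler_pdivrMr //; apply: (le_trans hj).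
  by rewrite ler_nat.
move=> hQ; apply: contrapT => nex.
(* Without a common solution, every point has a neighbourhood on which one condition is violated by
   a fixed amount; compactness gives a single [N] for the whole segment, which contradicts the grid
   point of level [N]. *)
pose P (N : nat) (x : R) := exists2 n, (n <= N)%N & N.+1%:R^-1 < H n w x.
have /compact_near_coveringP cov := @segment_compact R a b.
have : \forall N \near \oo, `[a, b]%classic `<=` P N.
  apply: cov => x /=; rewrite in_itv /= => xab.
  have [n hn] : exists n, 0 < H n w x.
    apply: contrapT => nh; apply: nex; exists x => // n; rewrite leNgt; apply/negP => hn.
    by apply: nh; exists n.
  have h2 : 0 < H n w x / 2 by rewrite divr_gt0.
  have := @ctsP _ _ (cH n w) x => /cvgrPdist_le /(_ _ h2) nb.
  have [k hk] : exists k : nat, (H n w x / 2)^-1 <= k%:R.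
    by exists (Num.trunc (H n w x / 2)^-1).+1; rewrite ltW // truncnS_gt.
  exists ([set z | `|H n w x - H n w z| <= H n w x / 2], [set N | (maxn n k <= N)%N]).
    by split=> //=; exists (maxn n k).
  move=> [z N] /= [hz]; rewrite geq_max => /andP[nN kN]; exists n => //.
  move: hz; rewrite ler_norml => /andP[_ hz].
  apply: lt_le_trans (_ : H n w x / 2 <= _); last by lra.
  rewrite -[X in _ < X]invrK ltf_pV2 ?posrE ?invr_gt0 //; apply: (le_lt_trans hk).
  by rewrite ltr_nat ltnS.
move=> [N _ /(_ N (leqnn N)) hN].
have [j [i [ij hq]]] := hQ N.
have [|n nN] := hN (q i j).
  rewrite /= in_itv /= /q lerDl mulr_ge0 ?divr_ge0 ?(ltW ba) //=.
  rewrite -lerBrDl ler_piMr ?(ltW ba) // ler_pdivrMr // mul1r ler_nat //.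
by rewrite ltNge hq.
Qed.

Lemma proc_indic (D : set T) (X : T -> R -> R) : measurable D -> proc X -> proc (fun w t => \1_D w * X w t).
Proof.
move=> mD [cX mX]; split=> [w|t t0]; first exact: ctsZ.
by apply: measurable_funM; [exact: measurable_indic|exact: mX].
Qed.

(** A natural bound at the integers: countably many conditions, hence an event for a process. For
    nonnegative [h] this is finiteness of the total mass. *)
Definition finite_mass (h : R -> R) := exists K : nat, forall n : nat, prim h n%:R <= K%:R.

Lemma measurable_finite_mass (X : T -> R -> R) : proc X -> measurable [set w | finite_mass (X w)].
Proof.
move=> pX; apply: measurable_exists => K; apply: measurable_forall => n.
by apply: measurable_le_set => //; exact: (proc_prim pX).2.
Qed.

Lemma nat_ge_real (x : R) : exists n : nat, x <= n%:R.
Proof. by exists (Num.trunc x).+1; rewrite ltW // truncnS_gt. Qed.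

Lemma finite_mass_bound (h : R -> R) : cts h -> (forall t, 0 <= t -> 0 <= h t) -> finite_mass h ->
  exists K : nat, forall x, 0 <= x -> prim h x <= K%:R.
Proof.
move=> ch h0 [K hK]; exists K => x x0; have [n xn] := nat_ge_real x.
exact: le_trans (prim_monotone ch h0 x0 xn) (hK n).
Qed.

Lemma infinite_mass (h : R -> R) (x K : R) : cts h -> (forall t, 0 <= t -> 0 <= h t) ->
  ~ finite_mass h -> exists2 y, x <= y & K < prim h y.
Proof.
move=> ch h0 nf; apply: contrapT => nex; apply: nf.
have [k hk] := nat_ge_real K; exists k => n.
have [N hN] := nat_ge_real `|x|.
have le : prim h n%:R <= prim h (maxn n N)%:R by apply: prim_monotone => //; rewrite ler_nat leq_maxl.
apply: (le_trans le); apply: le_trans hk; rewrite leNgt; apply/negP => gt.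
apply: nex; exists (maxn n N)%:R => //; apply: (le_trans (ler_norm _)).
by apply: (le_trans hN); rewrite ler_nat leq_maxr.
Qed.

(** The limit exists only on an event. Multiplying by its indicator makes the sequence of integrals
    converge everywhere, so the limit can be taken as a measurable function. *)
Lemma measurable_mass_limit (X : T -> R -> R) (P : set T) : proc X -> measurable P ->
  (forall w, P w -> forall t, 0 <= t -> 0 <= X w t) ->
  exists2 L : T -> R, measurable_fun setT L &
    forall w, P w -> finite_mass (X w) ->
      lim_oo (prim (X w)) (L w) /\ forall x, 0 <= x -> prim (X w) x <= L w.
Proof.
move=> pX mP pos; pose D := P `&` [set w | finite_mass (X w)].
have mD : measurable D by apply: measurableI => //; exact: measurable_finite_mass.
have pY := proc_indic mD pX.
have lim w : exists l, [/\ prim (fun t => \1_D w * X w t) n%:R @[n --> \oo] --> l,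
    D w -> lim_oo (prim (X w)) l & D w -> forall x, 0 <= x -> prim (X w) x <= l].
  have [Dw|nD] := pselect (D w).
    have [Pw fw] := Dw.
    have [K hK] := finite_mass_bound (pX.1 w) (pos w Pw) fw.
    have [||l ll [hl _]] := @monotone_lim_oo _ (prim (X w)) K%:R.
    - by move=> x y x0 xy; apply: prim_monotone => //; [exact: pX.1|exact: pos].
    - by move=> x x0; exact: hK.
    exists l; split=> //; apply/cvgrPdist_le => e /ll [Z Z0 hZ].
    have [N hN] := nat_ge_real Z; exists N => // n /= Nn.
    have -> : (fun t => \1_D w * X w t) = X w.
      by apply/funext => t; rewrite indicE mem_set //= mul1r.
    by rewrite distrC; apply: hZ; apply: (le_trans hN); rewrite ler_nat.
  exists 0; split=> //; have -> : (fun t => \1_D w * X w t) = (fun=> 0).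
    by apply/funext => t; rewrite indicE memNset //= mul0r.
  apply: cvg_near_cst; apply: nearW => n.
  rewrite -[RHS](mul0r (prim (fun=> 0) n%:R)) -primZ //; last exact: cts_cst.
  by congr prim; apply/funext => t; rewrite mul0r.
have [L hL] := choice lim.
exists L.
  apply: (@measurable_fun_cvg _ _ _ _ (fun n w => prim (fun t => \1_D w * X w t) n%:R)).
    by move=> n; exact: (proc_prim pY).2.
  by move=> w _; have [] := hL w.
move=> w Pw fw; have Dw : D w by [].
by have [_ h1 h2] := hL w; split; [exact: h1|exact: h2].
Qed.

End parametric_compactness.

(** * Eigenvalue conditions closed in the spectral parameter *)

Section closed_conditions.
Context {R : realType}.
Implicit Types (x y p lam nu : R) (K n : nat).
Local Notation mu := (@lebesgue_measure R).
Local Notation Rp := (`[0, +oo[%classic : set R).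
Variables (S M : R -> R).
Hypotheses (cS : cts S) (cM : cts M) (S0 : forall x, 0 < S x) (M0 : forall x, 0 < M x).

Local Notation psi := (spsi S M).
Local Notation pi_ := (spi S M).

(* The condition lim pi = 0 is not closed in lam. It is replaced, for each of the possible integrability
   classes of S and M, by explicit bounds at the integers that are, so that the union over lam in a
   compact interval stays measurable. *)
Definition norm_density lam y := (psi lam y ^+ 2 + `|psi lam y|) * M y.
Definition norm_bounded lam K := forall n, prim (norm_density lam) n%:R <= K%:R.

Let cpsi lam := cts_spsi cS cM lam.
Let cpi lam := cts_spi cS cM lam.

Lemma cts_norm_density lam : cts (norm_density lam).
Proof. by apply: ctsM cM; apply: ctsD; [exact: cts_sqr|exact: cts_norm]. Qed.

Lemma norm_density_ge0 lam x : 0 <= norm_density lam x.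
Proof. by rewrite mulr_ge0 ?(ltW (M0 _)) // addr_ge0 // sqr_ge0. Qed.

Lemma lim_oo_ge (f : R -> R) l a x0 : lim_oo f l -> (forall x, x0 <= x -> a <= f x) -> a <= l.
Proof.
move=> fl h; apply/ler_addgt0Pr => e /fl [X X0 hX].
have := hX (Num.max X x0); rewrite le_max lexx => /(_ isT); rewrite ler_norml => /andP[_ h1].
by have := h (Num.max X x0); rewrite le_max lexx orbT => /(_ isT); lra.
Qed.

Lemma lim_oo_le (f : R -> R) l a x0 : lim_oo f l -> (forall x, x0 <= x -> f x <= a) -> l <= a.
Proof.
move=> fl h; rewrite -lerN2; apply: (@lim_oo_ge (fun x => - f x) _ _ x0).
  by move=> e /fl [X X0 hX]; exists X => // x /hX; rewrite -opprD normrN.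
by move=> x /h; rewrite lerN2.
Qed.

Lemma norm_bounded_prim lam K x : norm_bounded lam K -> 0 <= x -> prim (norm_density lam) x <= K%:R.
Proof.
move=> h x0; have [n xn] := nat_ge_real x.
exact: le_trans (prim_monotone (cts_norm_density lam) (fun t _ => norm_density_ge0 lam t) x0 xn) (h n).
Qed.

Lemma norm_bounded_diff lam K x y : norm_bounded lam K -> 0 <= x -> 0 <= y ->
  prim (norm_density lam) y - prim (norm_density lam) x <= K%:R.
Proof.
move=> h x0 y0; have := norm_bounded_prim h y0.
have : 0 <= prim (norm_density lam) x.
  by apply: prim_ge0 => // [|z _]; [exact: cts_norm_density|exact: norm_density_ge0].
lra.
Qed.

Lemma norm_bounded_integrable lam K : norm_bounded lam K ->
  mu.-integrable Rp (EFin \o (fun y => psi lam y ^+ 2 * M y)) /\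
  mu.-integrable Rp (EFin \o (fun y => psi lam y * M y)).
Proof.
move=> h; have c1 := ctsM (cpsi lam) cM; have c2 := ctsM (cts_sqr (cpsi lam)) cM.
have bnd (q : R -> R) : cts q -> (forall y, `|q y| <= norm_density lam y) ->
    mu.-integrable Rp (EFin \o q).
  move=> cq hq; apply: (@bounded_integrable _ _ K%:R) => // x x0.
  apply: le_trans (norm_bounded_prim h x0).
  have := prim_le (cts_norm cq) (cts_norm_density lam) x0 (fun y _ => hq y).
  by rewrite !prim0 !subr0.
split; apply: bnd => // y; rewrite normrM (gtr0_norm (M0 y)) ler_pM2r //.
  by rewrite ger0_norm ?sqr_ge0 // lerDl.
by rewrite lerDr sqr_ge0.
Qed.

Lemma eig_norm_bounded lam : string_eig S M lam -> exists K, norm_bounded lam K.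
Proof.
move=> /(string_eig_conds cS cM S0 M0) [l0 i2 i1 _].
have c1 := ctsM (cpsi lam) cM; have c2 := ctsM (cts_sqr (cpsi lam)) cM.
have [K1 _ h1] := integrable_bounded c1 i1; have [K2 _ h2] := integrable_bounded c2 i2.
have [K hK] := nat_ge_real (K1 + K2); exists K => n.
apply: (le_trans _ hK); rewrite [K1 + K2]addrC.
rewrite -(@eq_prim _ (fun y => `|psi lam y ^+ 2 * M y| + `|psi lam y * M y|)) //; last first.
  move=> y _; rewrite (ger0_norm (mulr_ge0 (sqr_ge0 _) (ltW (M0 y)))) normrM (gtr0_norm (M0 y)).
  by rewrite -mulrDl.
by rewrite primD //; [apply: lerD; [exact: h2|exact: h1]|exact: cts_norm|exact: cts_norm].
Qed.

Lemma string_eigP lam : 0 < lam ->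
  string_eig S M lam <-> (exists K, norm_bounded lam K) /\ lim_oo (pi_ lam) 0.
Proof.
move=> l0; split=> [e|[[K h] lim0]].
  by split; [exact: eig_norm_bounded|have [] := string_eig_conds cS cM S0 M0 e].
by have [i2 i1] := norm_bounded_integrable h; exact: string_eig_of.
Qed.

Lemma spi_diff lam x y : 0 < lam -> 0 <= x -> 0 <= y ->
  pi_ lam x - pi_ lam y = lam * (prim (fun z => psi lam z * M z) y - prim (fun z => psi lam z * M z) x).
Proof. by move=> l0 x0 y0; rewrite !prim_spsiM ?gt_eqF //; field; rewrite gt_eqF. Qed.

Lemma spi_converges lam K : 0 < lam -> norm_bounded lam K -> exists p, lim_oo (pi_ lam) p.
Proof.
move=> l0 h; have [_ i1] := norm_bounded_integrable h.
have c1 := ctsM (cpsi lam) cM.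
have lim1 := integrable_lim_oo c1 i1; set I := Rintegral _ _ _ in lim1.
exists (1 - lam * I) => e e0.
have [X X0 hX] := lim1 (e / lam) (divr_gt0 e0 l0); exists X => // x Xx.
have := hX x Xx; have x0 := le_trans X0 Xx.
have := spi_diff l0 (lexx 0) x0; rewrite spi0 // prim0 subr0 => e1.
have -> : pi_ lam x - (1 - lam * I) = - (lam * (prim (fun z => psi lam z * M z) x - I)) by rewrite mulrBr; lra.
by rewrite normrN normrM (gtr0_norm l0) ler_pdivlMr // mulrC.
Qed.

Lemma spi_bound lam K x : 0 < lam -> norm_bounded lam K -> 0 <= x -> `|pi_ lam x| <= 1 + lam * K%:R.
Proof.
move=> l0 h x0; have := spi_diff l0 (lexx 0) x0; rewrite spi0 // prim0 subr0 => e1.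
have -> : pi_ lam x = 1 - lam * prim (fun z => psi lam z * M z) x by lra.
apply: (le_trans (ler_normB _ _)); rewrite normr1 lerD2l normrM (gtr0_norm l0) ler_pM2l //.
apply: le_trans (norm_bounded_prim h x0); apply: prim_norm_le => //.
- exact: ctsM.
- exact: cts_norm_density.
- move=> y _; rewrite normrM (gtr0_norm (M0 y)) ler_pM2r // lerDr sqr_ge0 //.
Qed.

Lemma spi_lim_of_nat lam (tau : nat -> R) p : (forall n, `|pi_ lam n%:R| <= tau n) ->
  tau n @[n --> \oo] --> 0 -> lim_oo (pi_ lam) p -> p = 0.
Proof.
move=> ht t0 lp; apply/eqP; rewrite -normr_eq0 eq_le normr_ge0 andbT.
apply/ler_addgt0Pr => e e0; rewrite add0r.
have e2 : 0 < e / 2 by rewrite divr_gt0.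
have [X X0 hX] := lp _ e2.
move/cvgrPdist_le: t0 => /(_ _ e2) [N _ hN].
have [k hk] := nat_ge_real X.
have Xn : X <= (maxn N k)%:R by apply: (le_trans hk); rewrite ler_nat leq_maxr.
have := hN (maxn N k) (leq_maxl _ _); have := hX _ Xn; have := ht (maxn N k).
rewrite /= sub0r normrN => h1 h2 h3.
have := ler_normB (pi_ lam (maxn N k)%:R) (pi_ lam (maxn N k)%:R - p).
by rewrite opprB addrCA subrr addr0; have := ler_norm (tau (maxn N k)); lra.
Qed.

Section finite_speed.
Variable mo : R.
Hypotheses (lmo : lim_oo (prim M) mo) (umo : forall x, 0 <= x -> prim M x <= mo).

(** When [M] has finite mass, [pi_ x = lam * int_x^oo psi M] is small at a rate given by the tail of
    [M] and by [K]. The rate at the integers is closed in [lam], and since the tail vanishes it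
    forces the limit in return. *)
Lemma finite_speed_modulus lam K : 0 < lam -> norm_bounded lam K -> lim_oo (pi_ lam) 0 ->
  forall n, pi_ lam n%:R ^+ 2 <= lam ^+ 2 * K.+1%:R * (mo - prim M n%:R).
Proof.
move=> l0 h lim0 n; set x : R := n%:R; have x0 : 0 <= x by rewrite ler0n.
pose k : R := K.+1%:R; have k0 : 0 < k by rewrite ltr0n.
have kK : K%:R <= k by rewrite ler_nat.
pose tau := mo - prim M x; have tau0 : 0 <= tau by rewrite subr_ge0 umo.
have [->|pN0] := eqVneq (pi_ lam x) 0; first by rewrite expr0n /=; apply: mulr_ge0 tau0; exact: mulr_ge0 (sqr_ge0 _) (ltW k0).
pose P := `|pi_ lam x| / lam.
have P0 : 0 < P by rewrite divr_gt0 // normr_gt0.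
(* Cauchy-Schwarz through |psi| <= (e psi^2 + 1/e)/2 with the optimal e = P/k *)
pose e := P / k; have e0 : 0 < e by rewrite divr_gt0.
have key : P <= (e * k + tau / e) / 2.
  rewrite /P ler_pdivrMr //.
  have bnd y : x <= y -> `|pi_ lam x - pi_ lam y| <= lam * ((e * k + tau / e) / 2).
    move=> xy; have y0 := le_trans x0 xy.
    rewrite spi_diff // normrM (gtr0_norm l0) ler_pM2l //.
    have ch : cts (fun z => e / 2 * norm_density lam z + (2 * e)^-1 * M z).
      by apply: ctsD; apply: ctsZ => //; exact: cts_norm_density.
    have hh z : `|psi lam z * M z| <= e / 2 * norm_density lam z + (2 * e)^-1 * M z.
      rewrite normrM (gtr0_norm (M0 z)) /norm_density mulrA -mulrDl ler_pM2r // mulrDr.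
      have n0 := normr_ge0 (psi lam z).
      have : 0 <= (e * `|psi lam z| - 1) ^+ 2 / (2 * e) by rewrite divr_ge0 ?sqr_ge0 // mulr_ge0 // ltW.
      have -> : (e * `|psi lam z| - 1) ^+ 2 / (2 * e) = e / 2 * `|psi lam z| ^+ 2 - `|psi lam z| + (2 * e)^-1.
        by field; rewrite gt_eqF.
      rewrite real_normK ?num_real // => h1.
      have : 0 <= e / 2 * `|psi lam z| by rewrite mulr_ge0 // divr_ge0 // ltW.
      by lra.
    have c1 := ctsM (cpsi lam) cM.
    have l1 := prim_le c1 ch xy (fun z _ => le_trans (ler_norm _) (hh z)).
    have l2 := prim_le (ctsN c1) ch xy (fun z _ => le_trans (ler_norm _) (eq_ind _ (fun v => v <= _) (hh z) _ (esym (normrN _)))).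
    have eN z : 0 <= z -> prim (fun z => - (psi lam z * M z)) z = - prim (fun z => psi lam z * M z) z.
      move=> z0; rewrite -mulN1r -primZ //; congr prim; apply/funext => t; by rewrite mulN1r.
    have ed z : 0 <= z -> prim (fun z => e / 2 * norm_density lam z + (2 * e)^-1 * M z) z =
        e / 2 * prim (norm_density lam) z + (2 * e)^-1 * prim M z.
      move=> z0; have cd := cts_norm_density lam.
      by rewrite primD ?primZ //; apply: ctsZ.
    rewrite !ed // in l1 l2; rewrite !eN // in l2.
    have d1 := norm_bounded_diff h x0 y0; have d2 := umo y0.
    have d3 : e / 2 * (prim (norm_density lam) y - prim (norm_density lam) x) <= e / 2 * k.
      by apply: ler_wpM2l (le_trans d1 kK); rewrite divr_ge0 ?(ltW e0).
    have d4 : (2 * e)^-1 * (prim M y - prim M x) <= (2 * e)^-1 * tau.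
      apply: ler_wpM2l; first by rewrite invr_ge0 mulr_ge0 // ltW.
      by rewrite /tau lerD2r.
    have ee : (2 * e)^-1 * tau = tau / e / 2 by field; rewrite gt_eqF.
    by rewrite ler_norml; apply/andP; split; lra.
  have lim1 : lim_oo (fun y => `|pi_ lam x - pi_ lam y|) `|pi_ lam x|.
    move=> d /lim0 [X X0 hX]; exists X => // y /hX; rewrite subr0 => hy.
    apply: le_trans hy; have := ler_dist_dist (pi_ lam x - pi_ lam y) (pi_ lam x).
    by rewrite addrAC subrr add0r normrN.
  by rewrite mulrC; exact: lim_oo_le lim1 bnd.
have ek : e * k = P by rewrite /e divfK // gt_eqF.
rewrite ek in key.
have : P ^+ 2 <= k * tau.
  have h2 : P <= tau / e by lra.
  move: h2; rewrite ler_pdivlMr // /e mulrA ler_pdivrMr // -expr2 [k * _]mulrC //.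
rewrite /P expr_div_n real_normK ?num_real // ler_pdivrMr ?exprn_gt0 //.
by rewrite -/k -/tau; lra.
Qed.

Lemma finite_speed_vanish lam K : 0 < lam -> norm_bounded lam K ->
  (forall n, pi_ lam n%:R ^+ 2 <= lam ^+ 2 * K.+1%:R * (mo - prim M n%:R)) -> lim_oo (pi_ lam) 0.
Proof.
move=> l0 h hm; have [p lp] := spi_converges l0 h.
suff <- : p = 0 by [].
have lq : lim_oo (fun x => pi_ lam x ^+ 2) (p ^+ 2).
  move/lim_ooP: lp => lp; apply/lim_ooP.
  have -> : (fun x => pi_ lam x ^+ 2) = (fun x => pi_ lam x * pi_ lam x) by apply/funext => x; rewrite expr2.
  by rewrite expr2; exact: cvgM.
have : p ^+ 2 <= 0; last by move=> p2; apply/eqP; rewrite -sqrf_eq0 eq_le p2 sqr_ge0.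
apply/ler_addgt0Pr => e e0; rewrite add0r.
pose C := lam ^+ 2 * K.+1%:R; have C0 : 0 < C by rewrite mulr_gt0 ?exprn_gt0 // ltr0n.
have e2 : 0 < e / 2 by rewrite divr_gt0.
have [X X0 hX] := lq _ e2; have [Y Y0 hY] := lmo (divr_gt0 e2 C0).
have [k hk] := nat_ge_real (X + Y).
have Xk : X <= k%:R by lra.
have Yk : Y <= k%:R by lra.
have := hX _ Xk; have := hY _ Yk; have := hm k; rewrite -/C.
rewrite !ler_norml => h1 /andP[h2 _] /andP[h3 _].
have : C * (mo - prim M k%:R) <= e / 2.
  by rewrite mulrC -ler_pdivlMr //; lra.
lra.
Qed.

End finite_speed.

Section infinite_speed.
Hypothesis iM : ~ finite_mass M.
Variables (lam : R) (K : nat).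
Hypotheses (l0 : 0 < lam) (h : norm_bounded lam K).

(** Otherwise [k * M] would be dominated by [norm_density], whose mass is finite. *)
Lemma spsi_no_lower_bound X (k : R) : 0 <= X -> 0 < k -> ~ (forall x, X <= x -> k <= `|psi lam x|).
Proof.
move=> X0 k0 lb.
have [y Xy hy] := infinite_mass X (prim M X + (K%:R + 1) / k) cM (fun t _ => ltW (M0 t)) iM.
have := norm_bounded_diff h X0 (le_trans X0 Xy).
have := prim_le (ctsZ k cM) (cts_norm_density lam) Xy.
rewrite !primZ ?(le_trans X0 Xy) // => hh.
have : k * prim M y - k * prim M X <= prim (norm_density lam) y - prim (norm_density lam) X.
  apply: hh => z /andP[Xz _]; rewrite ler_pM2r //; apply: (le_trans (lb z Xz)).
  by rewrite lerDr sqr_ge0.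
have : (K%:R + 1) / k * k < (prim M y - prim M X) * k by rewrite ltr_pM2r //; lra.
by rewrite divfK ?gt_eqF //; lra.
Qed.

(** Here the limit is automatic: if [pi_] had a nonzero limit, [psi = int S pi_] would be unbounded
    in modulus, against the infinite mass of [M]. *)
Lemma infinite_scale_vanish : ~ finite_mass S -> lim_oo (pi_ lam) 0.
Proof.
move=> iS; have [p lp] := spi_converges l0 h.
have [p0|pN] := eqVneq p 0; first by rewrite p0 in lp.
exfalso; have pp : 0 < `|p| by rewrite normr_gt0.
have p2 : 0 < `|p| / 2 by rewrite divr_gt0.
have [X X0 hX] := lp _ p2.
have low x : X <= x -> `|p| ^+ 2 / 2 <= p * pi_ lam x.
  move=> /hX hx; have : `|p * (pi_ lam x - p)| <= `|p| * (`|p| / 2) by rewrite normrM ler_pM2l.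
  rewrite ler_norml => /andP[h1 _]; rewrite mulrBr -expr2 -(real_normK (num_real p)) in h1.
  by move: h1; rewrite mulrA -expr2; lra.
have [Y XY hY] := infinite_mass X (prim S X + 2 * (`|psi lam X| + 1) / `|p|) cS (fun t _ => ltW (S0 t)) iS.
have Y0 := le_trans X0 XY.
apply: (@spsi_no_lower_bound Y 1) => // x Yx; have Xx := le_trans XY Yx.
have := der_le Xx (fun z _ => derZ (`|p| ^+ 2 / 2) (der_prim z cS)) (fun z _ => derZ p (der_spsi cS cM lam z)).
move=> hh; have {hh} : `|p| ^+ 2 / 2 * prim S x - `|p| ^+ 2 / 2 * prim S X <= p * psi lam x - p * psi lam X.
  by apply: hh => z /andP[Xz _]; rewrite mulrCA mulrC ler_pM2l // low.
have SY : prim S Y <= prim S x by apply: prim_S_le.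
have : `|p| * (2 * (`|psi lam X| + 1) / `|p|) <= `|p| * (prim S x - prim S X) by rewrite ler_pM2l //; lra.
rewrite mulrC divfK ?gt_eqF // => h1.
have : `|p| * (2 * (`|psi lam X| + 1)) <= `|p| * (`|p| * (prim S x - prim S X)) by rewrite ler_pM2l.
have a1 := ler_norm (p * psi lam x); have a2 := ler_norm (- (p * psi lam X)).
rewrite normrN !normrM in a1 a2 => h2 h3.
have : `|p| * 1 <= `|p| * `|psi lam x| by rewrite expr2 in h3; lra.
by rewrite ler_pM2l.
Qed.

Section finite_scale.
Variable so : R.
Hypotheses (lso : lim_oo (prim S) so) (uso : forall x, 0 <= x -> prim S x <= so).

Let k0 : 0 < 1 + lam * K%:R.
Proof. by rewrite ltr_pwDl // mulr_ge0 ?(ltW l0) // ler0n. Qed.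

(** [pi_] is bounded and [S] has finite mass, so [psi] converges; a nonzero limit would be a lower
    bound for [|psi|]. *)
Lemma finite_scale_spsi_lim : lim_oo (psi lam) 0.
Proof.
have cSp := ctsM cS (cpi lam).
have iSp : mu.-integrable Rp (EFin \o (fun y => S y * pi_ lam y)).
  apply: (@bounded_integrable _ _ ((1 + lam * K%:R) * so)) => // x x0.
  apply: le_trans (_ : (1 + lam * K%:R) * prim S x <= _); last by rewrite ler_pM2l // uso.
  rewrite -primZ //; have := prim_le (cts_norm cSp) (ctsZ (1 + lam * K%:R) cS) x0.
  rewrite !prim0 !subr0; apply=> y /andP[y0 _].
  by rewrite normrM (gtr0_norm (S0 y)) mulrC ler_pM2r // spi_bound.
have lim1 := integrable_lim_oo cSp iSp; set l := Rintegral _ _ _ in lim1.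
have lpsi : lim_oo (psi lam) l.
  move=> e /lim1 [X X0 hX]; exists X => // x Xx; have x0 := le_trans X0 Xx.
  have := @der_prim_eq _ (psi lam) (fun y => S y * pi_ lam y) x x0 cSp (fun y _ => der_spsi cS cM lam y).
  by rewrite spsi0 // add0r => ->; exact: hX.
have [l00|lN] := eqVneq l 0; first by rewrite l00 in lpsi.
exfalso; have ll : 0 < `|l| / 2 by rewrite divr_gt0 // normr_gt0.
have [X X0 hX] := lpsi _ ll.
apply: (@spsi_no_lower_bound X (`|l| / 2)) => // x /hX hx.
have := ler_normB (psi lam x) (psi lam x - l); rewrite opprB addrCA subrr addr0; lra.
Qed.

Lemma finite_scale_spsi_le y : 0 <= y -> `|psi lam y| <= (1 + lam * K%:R) * (so - prim S y).
Proof.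
move=> y0.
have bnd x : y <= x -> `|psi lam y - psi lam x| <= (1 + lam * K%:R) * (so - prim S y).
  move=> yx; have x0 := le_trans y0 yx.
  have b z : y <= z <= x -> - ((1 + lam * K%:R) * S z) <= S z * pi_ lam z <= (1 + lam * K%:R) * S z.
    move=> /andP[yz _]; have := spi_bound l0 h (le_trans y0 yz); rewrite ler_norml => /andP[b1 b2].
    by rewrite -mulNr ![_ * S z]mulrC !ler_pM2l // b1.
  have l1 := der_le yx (fun z _ => der_spsi cS cM lam z) (fun z _ => derZ (1 + lam * K%:R) (der_prim z cS)) (fun z hz => proj2 (andP (b z hz))).
  have l2 := der_le yx (fun z _ => derN (derZ (1 + lam * K%:R) (der_prim z cS))) (fun z _ => der_spsi cS cM lam z) (fun z hz => proj1 (andP (b z hz))).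
  have : (1 + lam * K%:R) * (prim S x - prim S y) <= (1 + lam * K%:R) * (so - prim S y).
    by rewrite ler_pM2l // lerD2r uso.
  by rewrite ler_norml mulrBr => l3; apply/andP; split; lra.
have lim1 : lim_oo (fun x => `|psi lam y - psi lam x|) `|psi lam y|.
  move=> d /finite_scale_spsi_lim [X X0 hX]; exists X => // x /hX; rewrite subr0 => hx.
  apply: le_trans hx; have := ler_dist_dist (psi lam y - psi lam x) (psi lam y).
  by rewrite addrAC subrr add0r normrN.
exact: lim_oo_le lim1 bnd.
Qed.

(** The integrand [(s(oo) - s) dm] of Feller's boundary test at infinity. *)
Definition scale_tail y := (so - prim S y) * M y.

Lemma cts_scale_tail : cts scale_tail.
Proof. by apply: ctsM cM; exact: ctsB (cts_cst _) (cts_prim cS). Qed.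

Lemma scale_tail_ge0 y : 0 <= y -> 0 <= scale_tail y.
Proof. by move=> y0; rewrite mulr_ge0 ?(ltW (M0 _)) // subr_ge0 uso. Qed.

(** A nonzero limit [p] of [pi_] would give [|psi| >= |p| / 2 * (so - prim S)], and [psi] would not
    be integrable against [M]. *)
Lemma infinite_tail_vanish : ~ finite_mass scale_tail -> lim_oo (pi_ lam) 0.
Proof.
move=> iT; have [p lp] := spi_converges l0 h.
have [p0|pN] := eqVneq p 0; first by rewrite p0 in lp.
exfalso; have pp : 0 < `|p| by rewrite normr_gt0.
have p2 : 0 < `|p| / 2 by rewrite divr_gt0.
have [X X0 hX] := lp _ p2.
have low x : X <= x -> `|p| ^+ 2 / 2 <= p * pi_ lam x.
  move=> /hX hx; have : `|p * (pi_ lam x - p)| <= `|p| * (`|p| / 2) by rewrite normrM ler_pM2l.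
  rewrite ler_norml => /andP[h1 _]; rewrite mulrBr -expr2 -(real_normK (num_real p)) in h1.
  by move: h1; rewrite mulrA -expr2; lra.
have lb y : X <= y -> `|p| / 2 * (so - prim S y) <= `|psi lam y|.
  move=> Xy.
  have bnd x : y <= x -> `|p| ^+ 2 / 2 * (prim S x - prim S y) <= p * psi lam x - p * psi lam y.
    move=> yx; rewrite mulrBr.
    apply: (der_le yx (fun z _ => derZ (`|p| ^+ 2 / 2) (der_prim z cS)) (fun z _ => derZ p (der_spsi cS cM lam z))).
    by move=> z /andP[yz _]; rewrite mulrCA mulrC ler_pM2l // low // (le_trans Xy).
  have : 0 <= (- (p * psi lam y)) - `|p| ^+ 2 / 2 * (so - prim S y).
    apply: (@lim_oo_ge (fun x => (p * psi lam x - p * psi lam y) - `|p| ^+ 2 / 2 * (prim S x - prim S y)) _ _ y).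
      have := finite_scale_spsi_lim => /lim_ooP q1; have := lso => /lim_ooP q2; apply/lim_ooP.
      rewrite [X in _ --> X - _](_ : _ = p * 0 - p * psi lam y); last by rewrite mulr0 add0r.
      apply: cvgB; first by apply: cvgB (cvg_cst _); apply: cvgM q1; exact: cvg_cst.
      by apply: cvgM; [exact: cvg_cst|apply: cvgB q2 (cvg_cst _)].
    by move=> x yx; rewrite subr_ge0 bnd.
  have := ler_norm (- (p * psi lam y)); rewrite normrN normrM => h1 h2.
  by rewrite -(@ler_pM2l _ `|p|) //; rewrite expr2 in h2; lra.
have [Y XY hY] := infinite_mass X (prim scale_tail X + 2 * (K%:R + 1) / `|p|) cts_scale_tail scale_tail_ge0 iT.
have Y0 := le_trans X0 XY.
have := norm_bounded_diff h X0 Y0.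
have := prim_le (ctsZ (`|p| / 2) cts_scale_tail) (cts_norm_density lam) XY.
have cT := cts_scale_tail.
rewrite !primZ // => hh.
have : `|p| / 2 * prim scale_tail Y - `|p| / 2 * prim scale_tail X <= prim (norm_density lam) Y - prim (norm_density lam) X.
  apply: hh => z /andP[Xz _]; rewrite /scale_tail mulrA ler_pM2r //; apply: (le_trans (lb z Xz)).
  by rewrite lerDr sqr_ge0.
have : `|p| * (2 * (K%:R + 1) / `|p|) < `|p| * (prim scale_tail Y - prim scale_tail X) by rewrite ltr_pM2l //; lra.
rewrite mulrC divfK ?gt_eqF //; lra.
Qed.

Variable ro : R.
Hypotheses (lro : lim_oo (prim scale_tail) ro) (uro : forall x, 0 <= x -> prim scale_tail x <= ro).

(** [|psi|] is at most a constant times [so - prim S], so the tail of [scale_tail] bounds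
    [pi_ x = lam * int_x^oo psi M]. *)
Lemma finite_tail_modulus : lim_oo (pi_ lam) 0 ->
  forall n, `|pi_ lam n%:R| <= lam * (1 + lam * K%:R) * (ro - prim scale_tail n%:R).
Proof.
move=> lim0 n; set x : R := n%:R; have x0 : 0 <= x by rewrite ler0n.
have cT := cts_scale_tail.
have bnd y : x <= y -> `|pi_ lam x - pi_ lam y| <= lam * (1 + lam * K%:R) * (ro - prim scale_tail x).
  move=> xy; have y0 := le_trans x0 xy.
  rewrite spi_diff // normrM (gtr0_norm l0) -mulrA ler_pM2l //.
  apply: le_trans (_ : (1 + lam * K%:R) * (prim scale_tail y - prim scale_tail x) <= _); last first.
    by rewrite ler_pM2l // lerD2r uro.
  have c1 := ctsM (cpsi lam) cM.
  have b z : x <= z <= y -> - ((1 + lam * K%:R) * scale_tail z) <= psi lam z * M z <= (1 + lam * K%:R) * scale_tail z.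
    move=> /andP[xz _]; have := finite_scale_spsi_le (le_trans x0 xz); rewrite ler_norml => /andP[b1 b2].
    by rewrite /scale_tail mulrA -mulNr !ler_pM2r // b1.
  have l1 := der_le xy (fun z _ => der_prim z c1) (fun z _ => derZ (1 + lam * K%:R) (der_prim z cT)) (fun z hz => proj2 (andP (b z hz))).
  have l2 := der_le xy (fun z _ => derN (derZ (1 + lam * K%:R) (der_prim z cT))) (fun z _ => der_prim z c1) (fun z hz => proj1 (andP (b z hz))).
  by rewrite ler_norml mulrBr; apply/andP; split; lra.
have lim1 : lim_oo (fun y => `|pi_ lam x - pi_ lam y|) `|pi_ lam x|.
  move=> d /lim0 [X X0 hX]; exists X => // y /hX; rewrite subr0 => hy.
  apply: le_trans hy; have := ler_dist_dist (pi_ lam x - pi_ lam y) (pi_ lam x).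
  by rewrite addrAC subrr add0r normrN.
exact: lim_oo_le lim1 bnd.
Qed.

Lemma finite_tail_vanish :
  (forall n, `|pi_ lam n%:R| <= lam * (1 + lam * K%:R) * (ro - prim scale_tail n%:R)) -> lim_oo (pi_ lam) 0.
Proof.
move=> hm; have [p lp] := spi_converges l0 h.
suff <- : p = 0 by [].
apply: (@spi_lim_of_nat lam _ p hm _ lp).
rewrite -(mulr0 (lam * (1 + lam * K%:R))); apply: cvgM; first exact: cvg_cst.
apply/cvgrPdist_le => e /lro [X X0 hX]; have [N hN] := nat_ge_real X.
exists N => // n /= Nn; rewrite sub0r normrN distrC; apply: hX; apply: (le_trans hN).
by rewrite ler_nat.
Qed.

End finite_scale.

End infinite_speed.

End closed_conditions.

(** * Measurability of the lowest eigenvalue *)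

Section eigenvalue_events.
Context {R : realType}.
Implicit Types (x y lam nu c : R) (K n k : nat).

Lemma cts_of_le (h : R -> R) : (forall x e, 0 < e -> exists2 d, 0 < d &
  forall y, `|y - x| <= d -> `|h y - h x| <= e) -> cts h.
Proof.
move=> H; constructor=> x; apply/cvgrPdist_le => e e0; have [d d0 hd] := H x e e0.
exists d => // y; rewrite /ball /= distrC => yx; rewrite distrC; apply: hd; exact: ltW.
Qed.

Section lam_continuity.
Variables (S M : R -> R).
Hypotheses (cS : cts S) (cM : cts M) (S0 : forall x, 0 < S x) (M0 : forall x, 0 < M x).

Lemma cts_lam_spi x : 0 <= x -> cts (fun lam => spi S M lam x).
Proof.
move=> x0; apply: cts_of_le => lam e e0.
have [d d0 hd] := string_lam_continuous cS cM lam x0 e0; exists d => // nu /hd h.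
by apply: (h x _).2; rewrite x0 lexx.
Qed.

Lemma cts_lam_norm x : 0 <= x -> cts (fun lam => prim (norm_density S M lam) x).
Proof.
move=> x0; apply: cts_of_le => lam e e0.
have [D D0 hD] := cts_bounded (cts_spsi cS cM lam) x0.
have [C C0 hC] := cts_bounded cM x0.
pose L := (2 * D + 2) * C * x + 1.
have q0 : 0 <= (2 * D + 2) * C by apply: mulr_ge0 => //; lra.
have L0 : 0 < L by rewrite /L ltr_wpDl // mulr_ge0.
pose e1 := Num.min 1 (e / L).
have e10 : 0 < e1 by rewrite /e1 lt_min ltr01 divr_gt0.
have [d d0 hd] := string_lam_continuous cS cM lam x0 e10; exists d => // nu /hd h.
have cn mu := cts_norm_density cS cM mu.
have -> : prim (norm_density S M nu) x - prim (norm_density S M lam) x =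
    prim (fun y => norm_density S M nu y + (-1) * norm_density S M lam y) x.
  by rewrite primD ?primZ ?mulN1r //; exact: ctsZ.
have l1 : `|prim (fun y => norm_density S M nu y + (-1) * norm_density S M lam y) x| <=
    prim (fun=> (2 * D + 2) * C * e1) x.
  apply: prim_norm_le => //; first by apply: ctsD => //; exact: ctsZ.
    exact: cts_cst.
  move=> y yx; have [hy _] := h y yx.
  rewrite mulN1r /norm_density -mulrBl normrM.
  have e11 : e1 <= 1 by rewrite /e1 ge_min lexx.
  have hDy := hD y yx; have hCy := hC y yx.
  set u := spsi S M nu y in hy *; set v := spsi S M lam y in hy hDy *.
  have l2 : `|u ^+ 2 + `|u| - (v ^+ 2 + `|v|)| <= (2 * D + 2) * e1.
    have -> : u ^+ 2 + `|u| - (v ^+ 2 + `|v|) = (u - v) * (u + v) + (`|u| - `|v|) by ring.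
    apply: (le_trans (ler_normD _ _)).
    have uv : `|u + v| <= 2 * D + 1.
      have -> : u + v = (u - v) + (v + v) by ring.
      apply: (le_trans (ler_normD _ _)); have := ler_normD v v; lra.
    have t1 : `|(u - v) * (u + v)| <= e1 * (2 * D + 1) by rewrite normrM; exact: ler_pM.
    have t2 := le_trans (ler_dist_dist u v) hy.
    lra.
  have -> : (2 * D + 2) * C * e1 = (2 * D + 2) * e1 * C by ring.
  exact: ler_pM.
apply: (le_trans l1).
have -> : prim (fun=> (2 * D + 2) * C * e1) x = (2 * D + 2) * C * e1 * x.
  have -> : (fun=> (2 * D + 2) * C * e1) = (fun y : R => (2 * D + 2) * C * e1 * 1) by apply/funext => y; rewrite mulr1.
  rewrite primZ //; last exact: cts_cst.
  congr (_ * _); have := @der_prim_eq _ (fun y => y) (fun=> 1) x x0 (cts_cst 1) (fun y _ => der_id y).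
  by rewrite add0r.
have -> : (2 * D + 2) * C * e1 * x = e1 * ((2 * D + 2) * C * x) by ring.
apply: le_trans (_ : e / L * L <= _); last by rewrite divfK ?gt_eqF.
apply: ler_pM; [exact: ltW|exact: mulr_ge0| |by rewrite /L lerDl].
by rewrite /e1 ge_min lexx orbT.
Qed.

End lam_continuity.

Section measurable_eigenvalues.
Context {dd : measure_display} {T : measurableType dd}.
Variables (S M : T -> R -> R).
Hypotheses (pS : proc S) (pM : proc M) (S0 : forall w x, 0 < S w x) (M0 : forall w x, 0 < M w x).


(** The masses of [M], [S] and [scale_tail] sort the paths into measurable classes. On [D1] and on
    [E3] an explicit rate expresses the limit of [spi]; on all other paths the limit is automatic
    and [H2] is 0. *)
Lemma measurable_eig_below c : 0 < c ->
  measurable [set w | exists2 lam, 0 < lam < c & string_eig (S w) (M w) lam].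
Proof.
move=> c0.
pose D1 := [set w | finite_mass (M w)].
pose D2 := [set w | finite_mass (S w)].
have mD1 : measurable D1 by exact: measurable_finite_mass.
have mD2 : measurable D2 by exact: measurable_finite_mass.
have [mo mmo hmo] := measurable_mass_limit pM measurableT (fun w _ t _ => ltW (M0 w t)).
have [so mso hso] := measurable_mass_limit pS measurableT (fun w _ t _ => ltW (S0 w t)).
pose r w := scale_tail (S w) (M w) (so w).
have pr : proc r.
  apply: procM pM; apply: procD (procN (proc_prim pS)).
  by split=> [w|t _]; [exact: cts_cst|].
have r0 w : D2 w -> forall t, 0 <= t -> 0 <= r w t.
  by move=> Dw t t0; apply: scale_tail_ge0 => //; have [] := hso w I Dw.
have [ro mro hro] := measurable_mass_limit pr mD2 r0.
pose D3 := [set w | finite_mass (r w)].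
have mD3 : measurable D3 by exact: measurable_finite_mass.
pose E3 := ~` D1 `&` (D2 `&` D3).
have mE3 : measurable E3 by apply: measurableI; [exact: measurableC|exact: measurableI].
pose H1 K n w lam := prim (norm_density (S w) (M w) lam) n%:R - K%:R.
pose H2 K n w lam := \1_D1 w * (spi (S w) (M w) lam n%:R ^+ 2 - lam ^+ 2 * K.+1%:R * (mo w - prim (M w) n%:R))
   + \1_E3 w * (`|spi (S w) (M w) lam n%:R| - lam * (1 + lam * K%:R) * (ro w - prim (r w) n%:R)).
(* Even indices carry the norm bound, odd ones the rate, so that one sequence of conditions enters
   the compactness lemma. *)
pose H K n w lam := if odd n then H2 K n./2 w lam else H1 K n./2 w lam.
have HP K w lam : (forall n, H K n w lam <= 0) <-> (norm_bounded (S w) (M w) lam K) /\ (forall n, H2 K n w lam <= 0).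
  split=> [h|[h1 h2] n].
    split=> n; last by have := h n.*2.+1; rewrite /H /= odd_double /= uphalf_double.
    by have := h n.*2; rewrite /H odd_double doubleK /H1 subr_le0.
  by rewrite /H; case: ifP => _; [exact: h2|rewrite /H1 subr_le0; exact: h1].
have key K w lam : 0 < lam -> norm_bounded (S w) (M w) lam K ->
    (forall n, H2 K n w lam <= 0) <-> lim_oo (spi (S w) (M w) lam) 0.
  move=> l0 nb; have cSw := pS.1 w; have cMw := pM.1 w.
  rewrite /H2 !indicE.
  have [d1|d1] := pselect (D1 w).
    rewrite (mem_set d1) (memNset (_ : ~ E3 w)) /=; last by case.
    have [lm um] := hmo w I d1.
    split=> [h|h n].
      apply: (finite_speed_vanish cSw cMw (M0 w) lm l0 nb) => n.
      by have := h n; rewrite mul1r mul0r addr0 subr_le0.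
    rewrite mul1r mul0r addr0 subr_le0.
    exact: (finite_speed_modulus cSw cMw (M0 w) um l0 nb h).
  rewrite (memNset d1) /=.
  have [d2|d2] := pselect (D2 w); last first.
    rewrite (memNset (_ : ~ E3 w)); last by case=> _ [].
    split=> [_|_ n]; last by rewrite !mul0r addr0.
    exact: (infinite_scale_vanish cSw cMw (S0 w) (M0 w) d1 l0 nb d2).
  have [ls us] := hso w I d2.
  have [d3|d3] := pselect (D3 w); last first.
    rewrite (memNset (_ : ~ E3 w)); last by case=> _ [].
    split=> [_|_ n]; last by rewrite !mul0r addr0.
    exact: (infinite_tail_vanish cSw cMw (S0 w) (M0 w) d1 l0 nb ls us d3).
  rewrite (mem_set (_ : E3 w)) //=.
  have [lr ur] := hro w d2 d3.
  split=> [h|h n].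
    apply: (finite_tail_vanish cSw cMw (M0 w) l0 nb lr) => n.
    by have := h n; rewrite mul1r mul0r add0r subr_le0.
  rewrite mul1r mul0r add0r subr_le0.
  exact: (finite_tail_modulus cSw cMw (S0 w) (M0 w) d1 l0 nb us ur h).
have cH K n w : cts (H K n w).
  have cSw := pS.1 w; have cMw := pM.1 w.
  rewrite /H; case: (odd n); last first.
    by apply: ctsB (cts_cst _); apply: cts_lam_norm.
  have cp := @cts_lam_spi _ _ cSw cMw n./2%:R (ler0n _ _).
  have ci := @cts_id R.
  apply: ctsD; apply: ctsZ; apply: ctsB.
  - exact: cts_sqr.
  - by apply: ctsM (cts_cst _); apply: ctsM (cts_cst _); exact: cts_sqr.
  - exact: cts_norm.
  - apply: ctsM (cts_cst _); apply: ctsM => //; apply: ctsD (cts_cst _) _.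
    by apply: ctsM (cts_cst _).
have mH K n lam : measurable_fun setT (fun w => H K n w lam).
  have [p1 p2] := proc_string lam pS pM.
  have n0 : 0 <= n./2%:R :> R by [].
  rewrite /H; case: (odd n); last first.
    apply: measurable_funB => //.
    have pn : proc (fun w => norm_density (S w) (M w) lam).
      by apply: procM pM; apply: procD; [exact: proc_sqr|exact: proc_norm].
    exact: (proc_prim pn).2.
  apply: measurable_funD; apply: measurable_funM => //; apply: measurable_funB => //.
  - exact: (proc_sqr p2).2.
  - by apply: measurable_funM => //; apply: measurable_funB => //; exact: (proc_prim pM).2.
  - exact: (proc_norm p2).2.
  - by apply: measurable_funM => //; apply: measurable_funB => //; exact: (proc_prim pr).2.
(* The segments [[a k, c - a k]] exhaust the open interval from 0 to [c]; the shift by 3 keeps them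
   nondegenerate. *)
pose a k : R := c / k.+3%:R.
have a0 k : 0 < a k by rewrite divr_gt0.
have ak k : a k < c - a k.
  rewrite ltrBrDr -mulr2n -mulr_natr /a mulrAC ltr_pdivrMr // ltr_pM2l //.
  by rewrite ltr_nat.
rewrite (_ : [set w | _] = [set w | exists k K, exists2 lam, a k <= lam <= c - a k & forall n, H K n w lam <= 0]).
  apply: measurable_exists => k; apply: measurable_exists => K.
  by apply: measurable_exists_segment.
apply/seteqP; split=> w /=.
  move=> [lam /andP[l0 lc] /(string_eigP (pS.1 w) (pM.1 w) (S0 w) (M0 w) l0) [[K nb] lim]].
  have mn : 0 < Num.min lam (c - lam) by rewrite lt_min l0 subr_gt0.
  have [k hk] := nat_ge_real (c / Num.min lam (c - lam)).
  exists k, K, lam; last by apply/HP; split=> //; apply/key.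
  have : a k <= Num.min lam (c - lam).
    rewrite /a ler_pdivrMr // mulrC -ler_pdivrMr //; apply: (le_trans hk).
    by rewrite ler_nat -addn3 leq_addr.
  rewrite le_min => /andP[-> h2] /=; lra.
move=> [k [K [lam /andP[l1 l2] /HP [nb h]]]].
have l0 := lt_le_trans (a0 k) l1.
exists lam; first by rewrite l0 (le_lt_trans l2) // ltrBlDr ltrDl.
apply/(string_eigP (pS.1 w) (pM.1 w) (S0 w) (M0 w) l0); split; first by exists K.
by apply/(key K).
Qed.

End measurable_eigenvalues.

(** The event says that some eigenvalue exists and that, for some [n], none lies below
    [x + 1 / (n + 1)]. The first clause reflects that [inf] of the empty set is 0, which is not
    above the positive [x]. *)
Lemma measurable_Lambda0_gt {dd : measure_display} {T : measurableType dd} (f : T -> R -> R) (beta a x : R) :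
  proc (fun w t => f w `|t|) -> 0 < x -> measurable [set w | x < Lambda0 beta a (f w)].
Proof.
move=> pf x0; pose g (w : T) (t : R) := f w `|t|.
have pS : proc (fun w => dens_s beta a (g w)).
  apply: proc_exp; apply: procD; last exact: procZ.
  by apply: proc_cst; exact: ctsZ (@cts_id R).
have pM : proc (fun w => dens_m beta a (g w)).
  apply: proc_exp; apply: procD; last by apply: procN; exact: procZ.
  by apply: proc_cst; exact: ctsZ (@cts_id R).
have S0 w y : 0 < dens_s beta a (g w) y by exact: expR_gt0.
have M0 w y : 0 < dens_m beta a (g w) y by exact: expR_gt0.
pose Q c := [set w | exists2 lam, 0 < lam < c & string_eig (dens_s beta a (g w)) (dens_m beta a (g w)) lam].
have mQ c : 0 < c -> measurable (Q c) by move=> c0; exact: measurable_eig_below.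
have eE w lam : is_eigenvalue beta a (f w) lam <-> string_eig (dens_s beta a (g w)) (dens_m beta a (g w)) lam.
  by apply: is_eigenvalueE => y y0; rewrite /g ger0_norm.
have eg0 w lam : is_eigenvalue beta a (f w) lam -> 0 < lam.
  by move=> /(eE w lam).1 /(string_eig_conds (pS.1 w) (pM.1 w) (S0 w) (M0 w)) [].
have QE c w : Q c w <-> exists2 lam, lam < c & is_eigenvalue beta a (f w) lam.
  split=> [[lam /andP[l0 lc] e]|[lam lc e]]; first by exists lam => //; exact: (eE w lam).2.
  by exists lam; [rewrite lc (eg0 w lam e)|exact: (eE w lam).1].
rewrite (_ : [set w | _] = [set w | exists n, Q n.+1%:R w] `&` [set w | exists n, (~` Q (x + n.+1%:R^-1)) w]).
  apply: measurableI; apply: measurable_exists => n; first exact: mQ.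
  by apply: measurableC; apply: mQ; rewrite addr_gt0 // invr_gt0.
have lb w : has_lbound [set lam | is_eigenvalue beta a (f w) lam].
  by exists 0 => lam /eg0 /ltW.
apply/seteqP; split=> w /=; rewrite /Lambda0; set E := [set lam | _].
  move=> xL; have [nE|nE] := pselect (E !=set0); last first.
    by move: xL; rewrite inf_out ?ltNge ?(ltW x0) // => -[].
  split.
    have [lam le] := nE; have [n hn] := nat_ge_real lam.
    exists n; apply: (QE _ w).2.
    by exists lam => //; rewrite (le_lt_trans hn) // ltr_nat.
  have y0 : 0 < inf E - x by rewrite subr_gt0.
  have [n hn] := nat_ge_real (inf E - x)^-1.
  have nn : n.+1%:R^-1 <= inf E - x.
    rewrite -[leRHS]invrK lef_pV2 ?posrE ?invr_gt0 //; apply: (le_trans hn); by rewrite ler_nat.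
  exists n => /(QE _ w).1 [lam lx le]; have := ge_inf (lb w) le; rewrite -/E.
  by move: nn lx; move: (_^-1) => e; lra.
move=> [[n /(QE _ w).1 [lam _ le]] [k hk]].
apply: (@lt_le_trans _ _ (x + k.+1%:R^-1)); first by rewrite ltrDl invr_gt0.
apply: lb_le_inf; first by exists lam.
move=> nu en; rewrite leNgt; apply/negP => nx; apply: hk; apply: (QE _ w).2.
by exists nu.
Qed.

End eigenvalue_events.

(** * Brownian motion *)

Section law_uniqueness.
Context {R : realType} {d1 d2 d3 : measure_display} {T1 : measurableType d1} {T2 : measurableType d2}
  {U : measurableType d3}.

Lemma law_unique (P : probability T1 R) (Q : probability T2 R) (f : T1 -> U) (g : T2 -> U) (G : set (set U)) :
  measurable_fun setT f -> measurable_fun setT g -> G `<=` measurable -> G setT -> setI_closed G ->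
  (forall A, G A -> P (f @^-1` A) = Q (g @^-1` A)) ->
  forall A, <<s G >> A -> P (f @^-1` A) = Q (g @^-1` A).
Proof.
move=> mf mg Gm GT GI eqG A sA.
pose F : {mfun T1 >-> U} := HB.pack f (isMeasurableFun.Build _ _ _ _ _ mf).
pose H : {mfun T2 >-> U} := HB.pack g (isMeasurableFun.Build _ _ _ _ _ mg).
have -> : P (f @^-1` A) = distribution P F A by [].
have -> : Q (g @^-1` A) = distribution Q H A by [].
apply: (@g_sigma_algebra_measure_unique _ R U G Gm (fun=> setT)) => //.
  by apply/seteqP; split=> // x _; exists 0%N.
by move=> _; apply: (@le_lt_trans _ _ (distribution P F setT)) => //; rewrite probability_setT ltry.
Qed.

End law_uniqueness.

(** * Scaling of Gaussian laws *)

Section gaussian_scaling.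
Context {R : realType}.
Local Notation mu := (@lebesgue_measure R).
Implicit Types (s d x : R).

Lemma normal_pdf_scale s d x : 0 < s -> 0 < d -> normal_pdf 0 (d * s) (d * x) * d = normal_pdf 0 s x.
Proof.
move=> s0 d0; have ds0 : 0 < d * s by rewrite mulr_gt0.
rewrite !normal_pdfE ?gt_eqF // /normal_peak /normal_fun !subr0.
have -> : (d * s) ^+ 2 * pi *+ 2 = d ^+ 2 * (s ^+ 2 * pi *+ 2) by ring.
rewrite sqrtrM ?sqr_ge0 // sqrtr_sqr (gtr0_norm d0) invfM.
have -> : - (d * x) ^+ 2 / ((d * s) ^+ 2 *+ 2) = - x ^+ 2 / (s ^+ 2 *+ 2).
  by field; rewrite !gt_eqF.
have p0 : 0 < Num.sqrt (s ^+ 2 * pi *+ 2).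
  by rewrite sqrtr_gt0 pmulrn_rgt0 // mulr_gt0 ?exprn_gt0 // pi_gt0.
by field; rewrite !gt_eqF.
Qed.

(** A change of variables on closed half-lines, which together with the full space form a generating
    system stable under intersection. *)
Lemma normal_prob_scale s d (A : set R) : 0 < s -> 0 < d -> measurable A ->
  normal_prob 0 s ((fun x => d * x) @^-1` A) = normal_prob 0 (d * s) A.
Proof.
move=> s0 d0 mA; have ds0 : 0 < d * s by rewrite mulr_gt0.
have mF : measurable_fun [set: R] (fun x : R => d * x).
  by apply: cts_measurable => //; exact: ctsZ (@cts_id R).
pose m1 := pushforward (normal_prob 0 s) (fun x : R => d * x).
have dF : derive1 (fun x : R => d * x) = cst d.
  by apply/funext => z; rewrite derive1E derive_val /= /GRing.scale /= mulr1.
have eqI a : m1 `[d * a, +oo[%classic = normal_prob 0 (d * s) `[d * a, +oo[%classic.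
  rewrite /m1 /pushforward /normal_prob.
  have -> : (fun x : R => d * x) @^-1` `[d * a, +oo[%classic = `[a, +oo[%classic.
    by apply/seteqP; split=> x /=; rewrite !in_itv /= !andbT ler_pM2l.
  rewrite (@increasing_ge0_integration_by_substitutiony R (fun x : R => d * x)).
  - apply: eq_integral => x _; congr EFin.
    by rewrite /= dF -(normal_pdf_scale (x : R) s0 d0).
  - by move=> x y _ _ xy; rewrite ltr_pM2l.
  - by rewrite dF => x _; exact: cst_continuous.
  - by rewrite dF; apply: is_cvg_cst.
  - by rewrite dF; apply: is_cvg_cst.
  - split; first by move=> x _; exact: derivableM.
    by apply: cvg_at_right_filter; apply: (@ctsP _ _ (ctsZ d (@cts_id R))).
  - exact: gt0_cvgMry.
  - by apply: continuous_subspaceT => x; apply: continuous_normal_pdf; rewrite gt_eqF.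
  - by move=> x _; exact: normal_pdf_ge0.
have -> : normal_prob 0 (d * s) A = normal_prob 0 (d * s) (id @^-1` A) by [].
apply: (@law_unique R _ _ _ _ _ _ (normal_prob 0 s) (normal_prob 0 (d * s)) (fun x : R => d * x) id
  (setT |` @RGenCInfty.G R) mF (@measurable_id _ _ setT)).
- by move=> B [->|[x ->]] //; exact: measurable_itv.
- by left.
- move=> B C [->|[x ->]] [->|[y ->]]; rewrite ?setTI ?setIT; [by left|by right; exists y|by right; exists x|].
  right; exists (Num.max x y); apply/seteqP; split=> z /=; rewrite !in_itv /= !andbT ge_max.
    by case=> -> ->.
  by move=> /andP[].
- move=> B [->|[x ->]]; first by rewrite !preimage_setT !probability_setT.
  by have := eqI (d^-1 * x); rewrite mulVKf ?gt_eqF.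
have : (@RGenCInfty.G R).-sigma.-measurable A by rewrite -RGenCInfty.measurableE.
by apply: sub_sigma_algebra2 => B; right.
Qed.

End gaussian_scaling.

(** * Path space *)

Section path_space.
Variable R : realType.

(** Paths vanish at 0, so their increments on the dyadic grids determine them on the half-line. *)
Definition cpath : Type := {f : R -> R | cts f /\ f 0 = 0}.

HB.instance Definition _ := gen_eqMixin cpath.
HB.instance Definition _ := gen_choiceMixin cpath.
HB.instance Definition _ := isPointed.Build cpath (exist _ (fun=> 0) (conj (cts_cst 0) erefl)).

Definition dyadic (k i : nat) : R := i%:R / 2 ^+ k.

Definition path_incr k i (f : cpath) : R := sval f (dyadic k i.+1) - sval f (dyadic k i).

(** Only consecutive increments on one grid starting from 0: this is the form in which independence
    is given, so the probability of a box is a product. *)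
Definition path_box k n (A : nat -> set R) : set cpath :=
  [set f | forall i, (i < n)%N -> A i (path_incr k i f)].

Definition path_boxes k : set (set cpath) :=
  [set B | exists n A, (forall i, measurable (A i)) /\ B = path_box k n A].

(* The boxes of one level are stable under intersection, and the sigma-algebras they generate increase with
   the level: uniqueness of measures is applied within a level and then to the union of the levels. *)
Definition path_events : set (set cpath) := [set B | exists k, <<s path_boxes k >> B].

Definition path_space := g_sigma_algebraType path_events.

End path_space.

Arguments dyadic {R}.
Arguments path_incr {R}.
Arguments path_box {R}.
Arguments path_boxes {R}.
Arguments path_events {R}.

Section path_space_theory.
Context {R : realType}.
Implicit Types (k n i : nat) (f : cpath R) (t x : R).

Lemma path_boxesT k : path_boxes k [set: cpath R].
Proof. by exists 0%N, (fun=> setT); split=> //; apply/seteqP; split. Qed.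

Lemma path_boxesI k : setI_closed (@path_boxes R k).
Proof.
move=> _ _ [n [A [mA ->]]] [m [C [mC ->]]].
exists (maxn n m), (fun i => (if (i < n)%N then A i else setT) `&` (if (i < m)%N then C i else setT)); split.
  by move=> i; apply: measurableI; case: ifP.
apply/seteqP; split=> f /=.
  by move=> [fA fC] i _; split; case: ifP => // h; [exact: fA|exact: fC].
move=> h; split=> i im; have := h i; rewrite leq_max im ?orbT => /(_ isT) [].
  by [].
by [].
Qed.

Lemma measurable_path_incr k i :
  measurable_fun [set: g_sigma_algebraType (@path_boxes R k)] (path_incr k i).
Proof.
move=> _ Y mY; rewrite setTI; apply: sub_sigma_algebra.
exists i.+1, (fun j => if j == i then Y else setT); split; first by move=> j; case: ifP.
apply/seteqP; split=> f /=.
  by move=> fY j _; case: ifP => // /eqP ->.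
by move=> /(_ i (ltnSn i)); rewrite eqxx.
Qed.

Lemma dyadic_double k i : dyadic k.+1 i.*2 = dyadic k i :> R.
Proof. by rewrite /dyadic -muln2 natrM exprSr invfM mulrACA divff ?mulr1 // pnatr_eq0. Qed.

Lemma path_incr_refine k i f : path_incr k i f = path_incr k.+1 i.*2 f + path_incr k.+1 i.*2.+1 f.
Proof. by rewrite /path_incr -doubleS !dyadic_double; ring. Qed.

Lemma path_level_refine k : <<s path_boxes k >> `<=` <<s @path_boxes R k.+1 >>.
Proof.
apply: smallest_sub; first exact: smallest_sigma_algebra.
move=> _ [n [A [mA ->]]].
have -> : path_box k n A = \bigcap_(i in `I_n) (path_incr k i @^-1` A i) by apply/seteqP; split=> f /= h i; exact: h.
apply: (@bigcap_measurableType _ (g_sigma_algebraType (@path_boxes R k.+1))) => // i _.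
have mf : measurable_fun [set: g_sigma_algebraType (@path_boxes R k.+1)] (path_incr k i).
  rewrite (_ : path_incr k i = (fun f => path_incr k.+1 i.*2 f + path_incr k.+1 i.*2.+1 f)); last first.
    by apply/funext => f; exact: path_incr_refine.
  by apply: measurable_funD; exact: measurable_path_incr.
by rewrite -[X in _ X]setTI; exact: mf.
Qed.

Lemma path_level_le k n : (k <= n)%N -> <<s path_boxes k >> `<=` <<s @path_boxes R n >>.
Proof.
move=> /subnK <-; elim: (n - k)%N => [//|j IH].
exact: subset_trans IH (@path_level_refine _).
Qed.

Lemma path_eventsI : setI_closed (@path_events R).
Proof.
move=> A C [k sA] [n sC]; exists (maxn k n).
apply: (@measurableI _ (g_sigma_algebraType (@path_boxes R (maxn k n)))).
  exact: (path_level_le (leq_maxl _ _)).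
exact: (path_level_le (leq_maxr _ _)).
Qed.

Lemma path_eventsT : path_events [set: cpath R].
Proof. by exists 0%N; apply: sub_sigma_algebra; exact: path_boxesT. Qed.

Lemma measurable_incr k i : measurable_fun [set: path_space R] (path_incr k i).
Proof.
move=> _ Y mY; rewrite setTI; apply: sub_sigma_algebra; exists k.
by have := @measurable_path_incr k i measurableT Y mY; rewrite setTI.
Qed.

Lemma cpath_dyadic k i f : sval f (dyadic k i) = \sum_(j < i) path_incr k j f.
Proof.
elim: i => [|i IH]; first by rewrite big_ord0 /dyadic mul0r; have [_ ->] := svalP f.
by rewrite big_ord_recr /= -IH /path_incr addrCA subrr addr0.
Qed.

Lemma dyadic_trunc_cvg t : 0 <= t -> dyadic k (Num.trunc (t * 2 ^+ k)) @[k --> \oo] --> t.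
Proof.
move=> t0; apply/cvgrPdist_le => e e0.
have [N hN] := nat_ge_real e^-1.
exists N => // k /= Nk.
have p0 : 0 < 2 ^+ k :> R by rewrite exprn_gt0.
have /andP[h1 h2] := truncn_itv (mulr_ge0 t0 (ltW p0)).
rewrite /dyadic; set z : R := (Num.trunc _)%:R in h1 *.
have -> : t - z / 2 ^+ k = (t * 2 ^+ k - z) / 2 ^+ k by field; rewrite gt_eqF.
rewrite ger0_norm ?divr_ge0 ?subr_ge0 ?(ltW p0) // ler_pdivrMr //.
have : t * 2 ^+ k - z <= 1 by rewrite lerBlDr addrC natr1 ltW.
move=> h; apply: (le_trans h); rewrite mulrC -ler_pdivrMr // mul1r; apply: (le_trans hN).
by rewrite -natrX ler_nat (leq_trans Nk) // ltnW // ltn_expl.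
Qed.

(** A value at a dyadic point is a finite sum of increments, and by continuity the other values are
    limits of these. *)
Lemma proc_path : proc (fun f : path_space R => fun t => sval f `|t|).
Proof.
split=> [f|t t0]; first by have [cf _] := svalP f; exact: cts_comp (cts_norm (@cts_id R)) cf.
rewrite ger0_norm //.
apply: (@measurable_fun_cvg _ _ _ _ (fun k (f : path_space R) => sval f (dyadic k (Num.trunc (t * 2 ^+ k))))).
  move=> k; rewrite (_ : (fun f => _) = (fun f : path_space R => \sum_(j < Num.trunc (t * 2 ^+ k)) path_incr k j f)); last first.
    by apply/funext => f; exact: cpath_dyadic.
  by apply: measurable_sum => j; exact: measurable_incr.
move=> f _; have [cf _] := svalP f.
exact: (cvg_comp _ _ (dyadic_trunc_cvg t0) (@ctsP _ _ cf t)).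
Qed.

End path_space_theory.

(** * The law of Brownian motion and its scaling *)

Section brownian_law.
Context {R : realType} {d : measure_display} {T : measurableType d}.
Variable P : probability T R.
Implicit Types (b : R -> T -> R).

Lemma brownian_cpath b w : is_brownian_motion P b -> cts (fun x => b `|x| w) /\ b `|0 : R| w = 0.
Proof. by move=> [b0 cb _ _ _]; split; [exact: within_Rp_hat (cb w)|rewrite normr0]. Qed.

Definition brownian_path b (bm : is_brownian_motion P b) (w : T) : cpath R :=
  exist _ (fun x => b `|x| w) (brownian_cpath w bm).

Lemma brownian_box b (bm : is_brownian_motion P b) k n A : (forall i, measurable (A i)) ->
  P (brownian_path bm @^-1` path_box k n A) =
  \big[*%E/1%E]_(i < n) normal_prob 0 (Num.sqrt (dyadic k i.+1 - dyadic k i)) (A i).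
Proof.
move=> mA; have [_ _ _ gau ind] := bm.
have p0 : 0 < 2 ^+ k :> R by rewrite exprn_gt0.
have dy i : dyadic k i < dyadic k i.+1 :> R by rewrite /dyadic ltr_pM2r ?invr_gt0 // ltr_nat.
have dy0 i : 0 <= dyadic k i :> R by rewrite /dyadic divr_ge0 // ltW.
have -> : brownian_path bm @^-1` path_box k n A =
    \bigcap_(i in `I_n) [set w | b (dyadic k i.+1) w - b (dyadic k i) w \in A i].
  apply/seteqP; split=> w /= h i /h; rewrite /path_incr /= ?inE !ger0_norm //.
rewrite ind //; last first.
by apply: eq_bigr => i _; rewrite gau.
Qed.

Lemma measurable_incr_set b (bm : is_brownian_motion P b) k n A : (forall i, measurable (A i)) ->
  measurable (brownian_path bm @^-1` path_box k n A).
Proof.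
move=> mA; have [_ _ mb _ _] := bm.
have -> : brownian_path bm @^-1` path_box k n A =
  \bigcap_(i in `I_n) ((fun w => b `|dyadic k i.+1 : R| w - b `|dyadic k i : R| w) @^-1` A i).
  by apply/seteqP; split=> w /= h i; exact: h.
apply: bigcap_measurableType => // i _; rewrite -[X in measurable X]setTI.
by apply: measurable_funB => //.
Qed.

Lemma measurable_brownian_level b (bm : is_brownian_motion P b) k :
  @measurable_fun _ _ T (g_sigma_algebraType (@path_boxes R k)) setT (brownian_path bm).
Proof.
apply: (@measurability _ _ T (g_sigma_algebraType (@path_boxes R k)) setT (brownian_path bm) (@path_boxes R k)) => //.
by move=> _ [_ [n [A [mA ->]]] <-]; rewrite setTI; exact: measurable_incr_set.
Qed.

Lemma measurable_brownian_path b (bm : is_brownian_motion P b) :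
  @measurable_fun _ _ T (path_space R) setT (brownian_path bm).
Proof.
apply: (@measurability _ _ T (path_space R) setT (brownian_path bm) (@path_events R)) => //.
move=> _ [B [k sB] <-].
exact: (@measurable_brownian_level b bm k measurableT B sB).
Qed.

Lemma brownian_law b b' (bm : is_brownian_motion P b) (bm' : is_brownian_motion P b') (A : set (path_space R)) :
  measurable A -> P (brownian_path bm @^-1` A) = P (brownian_path bm' @^-1` A).
Proof.
move=> mA.
apply: (@law_unique R _ _ _ _ _ (path_space R) P P _ _ (@path_events R)
  (measurable_brownian_path bm) (measurable_brownian_path bm')) => //.
- by move=> B h; exact: sub_sigma_algebra.
- exact: path_eventsT.
- exact: path_eventsI.
move=> B [k sB].
have h := @law_unique R _ _ _ _ _ (g_sigma_algebraType (@path_boxes R k)) P P _ _ (@path_boxes R k)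
  (@measurable_brownian_level b bm k) (@measurable_brownian_level b' bm' k).
refine (h _ _ _ _ B sB).
- exact: sub_sigma_algebra.
- exact: path_boxesT.
- exact: path_boxesI.
by move=> _ [n [C [mC ->]]]; rewrite !brownian_box.
Qed.

Lemma brownian_rescaled b (r : R) : 0 < r -> is_brownian_motion P b ->
  is_brownian_motion P (fun t w => r * b (t / r ^+ 2) w).
Proof.
move=> r0 [b0 cb mb gau ind]; have r2 : 0 < r ^+ 2 by rewrite exprn_gt0.
have incE t s A : [set w | r * b (t / r ^+ 2) w - r * b (s / r ^+ 2) w \in A] =
    [set w | b (t / r ^+ 2) w - b (s / r ^+ 2) w \in (fun x : R => r * x) @^-1` A].
  by apply/seteqP; split=> w /=; rewrite !inE /= mulrBr.
have mr A : measurable A -> measurable ((fun x : R => r * x) @^-1` A).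
  move=> mA; rewrite -[X in measurable X]setTI.
  by apply: (cts_measurable _ (ctsZ r (@cts_id R))).
split.
- by move=> w; rewrite mul0r b0 mulr0.
- move=> w; have ch := within_Rp_hat (cb w).
  have c2 : cts (fun x => r * b `|x / r ^+ 2| w).
    apply: ctsZ; apply: (cts_comp _ ch).
    by apply: eq_cts (ctsZ (r ^+ 2)^-1 (@cts_id R)) => x; rewrite mulrC.
  apply: (@subspace_eq_continuous _ _ _ (fun x : R => r * b `|x / r ^+ 2| w)) (cts_within c2) => x.
  by rewrite inE /= in_itv /= andbT => x0; rewrite ger0_norm // divr_ge0 // ltW.
- by move=> t; apply: measurable_funM.
- move=> s t s0 st A mA; rewrite incE.
  have s0' : 0 <= s / r ^+ 2 by rewrite divr_ge0 // ltW.
  have st' : s / r ^+ 2 < t / r ^+ 2 by rewrite ltr_pM2r ?invr_gt0.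
  rewrite (gau _ _ s0' st' _ (mr A mA)).
  have q0 : 0 < (t - s) / r ^+ 2 by rewrite divr_gt0 // subr_gt0.
  have q1 : 0 < Num.sqrt ((t - s) / r ^+ 2) by rewrite sqrtr_gt0.
  rewrite -mulrBl (normal_prob_scale q1 r0 mA); congr (normal_prob 0 _ A).
  rewrite -{1}(gtr0_norm r0) -sqrtr_sqr -sqrtrM ?sqr_ge0 //; congr Num.sqrt.
  by field; rewrite gt_eqF.
- move=> n t A t0 tS mA.
  have := ind n (fun i => t i / r ^+ 2) (fun i => (fun x : R => r * x) @^-1` A i).
  rewrite divr_ge0 ?(ltW r2) // => /(_ isT) h.
  have -> : \bigcap_(i in `I_n) [set w | r * b (t i.+1 / r ^+ 2) w - r * b (t i / r ^+ 2) w \in A i] =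
    \bigcap_(i in `I_n) [set w | b (t i.+1 / r ^+ 2) w - b (t i / r ^+ 2) w \in (fun x : R => r * x) @^-1` A i].
    by apply: eq_bigcapr => i _; exact: incE.
  rewrite h.
  + by apply: eq_bigr => i _; rewrite incE.
  + by move=> i; rewrite ltr_pM2r ?invr_gt0.
  + by move=> i; exact: mr.
Qed.

End brownian_law.

(** * Events determined by a Brownian path *)

Section brownian_events.
Context {R : realType} {d : measure_display} {T : measurableType d}.

Lemma pos_rational_near (s e : R) : 0 < s -> 0 < e ->
  exists i j : nat, `|i.+1%:R / j.+1%:R - s| <= e.
Proof.
move=> s0 e0; have mn : 0 < Num.min s e by rewrite lt_min s0.
have [j hj] := nat_ge_real (Num.min s e)^-1.
have jm : j.+1%:R^-1 <= Num.min s e.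
  rewrite -[leRHS]invrK lef_pV2 ?posrE ?invr_gt0 //; apply: (le_trans hj).
  by rewrite ler_nat.
move: jm; rewrite le_min => /andP[js je].
have sj : 1 <= s * j.+1%:R by rewrite -ler_pdivrMr // mul1r.
have /andP[h1 h2] := truncn_itv (le_trans ler01 sj).
have t1 : (1 <= Num.trunc (s * j.+1%:R))%N.
  by have : (1 : R) < (Num.trunc (s * j.+1%:R)).+1%:R by [exact: le_lt_trans h2]; rewrite ltr1n ltnS.
exists (Num.trunc (s * j.+1%:R)).-1, j; rewrite prednK //.
have -> : (Num.trunc (s * j.+1%:R))%:R / j.+1%:R - s = - ((s * j.+1%:R - (Num.trunc (s * j.+1%:R))%:R) / j.+1%:R).
  by rewrite mulrBl mulfK ?pnatr_eq0 // opprB.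
rewrite normrN ger0_norm ?divr_ge0 ?subr_ge0 //; apply: le_trans je.
by rewrite ler_pdivrMr // mulVf ?pnatr_eq0 // lerBlDr addrC natr1 ltW.
Qed.

(** Survival is [u >= 0] at all positive rationals. The weak inequality suffices because a zero of
    [u] entails a negative value nearby, hence by continuity one at a rational time. *)
Lemma measurable_TW (f : T -> R -> R) (beta m : R) :
  (forall w, {within `[0, +oo[%classic, continuous (f w)}) -> proc (fun w t => f w `|t|) ->
  measurable [set w | TW_survives beta m (f w)].
Proof.
move=> cf pf; pose u w := twu (noise_coef beta) m (fun t => f w `|t|).
have pu : proc u by exact: proc_tw.
rewrite (_ : [set w | _] = [set w | forall i j : nat, 0 <= u w (i.+1%:R / j.+1%:R)]).
  apply: measurable_forall => i; apply: measurable_forall => j.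
  by apply: measurable_le_set => //; apply: pu.2.
apply/seteqP; split=> w /=.
  by move=> h i j; apply: ltW; apply: (tw_survives_pos (cf w) h); rewrite divr_gt0.
move=> h; apply: (tw_survives_of (cf w)) => t t0; rewrite ltNge; apply/negP => ut.
have [s s0 us] := twu_nonpos_neg (pf.1 w) t0 ut.
have us2 : 0 < - (u w s) / 2 by rewrite divr_gt0 // oppr_gt0.
have := @ctsP _ _ (pu.1 w) s => /cvgrPdist_le /(_ _ us2) /nbhs_ballP [r /= r0 hr].
have r2 : 0 < r / 2 by rewrite divr_gt0.
have [i [j ij]] := pos_rational_near s0 r2.
have := hr (i.+1%:R / j.+1%:R); rewrite /ball /= distrC => hh.
have /hh : `|i.+1%:R / j.+1%:R - s| < r by move: ij; move: (_ / _ : R) => q; lra.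
rewrite ler_norml => /andP[h1 _]; have := h i j; move: h1 us; rewrite -/(u w).
move: (u w _) => q; lra.
Qed.

Lemma eq_Lambda0 (beta a : R) (f g : R -> R) : (forall x, 0 <= x -> f x = g x) ->
  Lambda0 beta a f = Lambda0 beta a g.
Proof.
move=> fg; rewrite /Lambda0; apply: (congr1 inf); apply/funext => lam; apply/propext; split.
  by move=> /(is_eigenvalueE _ _ _ fg).1 h; apply: (is_eigenvalueE beta a lam (fun x _ => erefl (g x))).2.
by move=> /(is_eigenvalueE beta a lam (fun x _ => erefl (g x))).1 h; apply: (is_eigenvalueE beta a lam fg).2.
Qed.

Variables (P : probability T R) (b : R -> T -> R).
Hypothesis bm : is_brownian_motion P b.

Lemma proc_brownian : proc (fun w t => b `|t| w).
Proof. by have [_ cb mb _ _] := bm; split=> [w|t t0]; [exact: (@within_Rp_hat R (fun t => b t w))|exact: mb]. Qed.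

Lemma measurable_brownian_Lambda0 (beta a x : R) : 0 < x ->
  measurable [set w | x < Lambda0 beta a (fun t => b t w)].
Proof. by move=> x0; apply: (measurable_Lambda0_gt beta a _ x0); exact: proc_brownian. Qed.

Lemma measurable_brownian_TW (beta m : R) : measurable [set w | TW_survives beta m (fun t => b t w)].
Proof.
by apply: (@measurable_TW (fun w t => b t w)); [have [_ cb _ _ _] := bm|exact: proc_brownian].
Qed.

Lemma Lambda0_path_event (b' : R -> T -> R) (bm' : is_brownian_motion P b') (beta a x : R) :
  [set w | x < Lambda0 beta a (fun t => b' t w)] =
  brownian_path bm' @^-1` [set f : path_space R | x < Lambda0 beta a (sval f)].
Proof.
apply/seteqP; split=> w /=; rewrite (@eq_Lambda0 _ _ (fun x => b' `|x| w) (fun t => b' t w)) //.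
  by move=> t t0; rewrite ger0_norm.
by move=> t t0; rewrite ger0_norm.
Qed.

End brownian_events.

(** The rescaled path is again a Brownian motion, and the event is the preimage of one measurable
    set of paths; the identity holds in law for each [r], not path by path. *)
Lemma Lambda0_rescaled_law {R : realType} {d : measure_display} {T : measurableType d} (P : probability T R)
    (b : R -> T -> R) (beta a x r : R) : is_brownian_motion P b -> 0 < x -> 0 < r ->
  measurable [set w | x < Lambda0 beta a (rescaled_path (fun t => b t w) r)] /\
  P [set w | x < Lambda0 beta a (fun t => b t w)] =
  P [set w | x < Lambda0 beta a (rescaled_path (fun t => b t w) r)].
Proof.
move=> bm x0 r0; have bm' := brownian_rescaled r0 bm; split.
  exact (measurable_brownian_Lambda0 bm' beta a x0).
have e1 := Lambda0_path_event bm beta a x.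
have e2 : [set w | x < Lambda0 beta a (rescaled_path (fun t => b t w) r)] = _ := Lambda0_path_event bm' beta a x.
have mE := @measurable_Lambda0_gt _ _ _ (fun f : path_space R => sval f) beta a x proc_path x0.
exact (etrans (congr1 P e1) (etrans (brownian_law bm bm' mE) (esym (congr1 P e2)))).
Qed.

(** * Gaussian tails *)

Section gaussian_tail.
Context {R : realType}.
Local Notation mu := (@lebesgue_measure R).
Implicit Types (s x y : R).

(* Comparison with twice the standard deviation yields a Gaussian tail bound without computing an integral. *)
Lemma normal_pdf_le s x y : 0 < s -> 0 <= y -> y <= `|x| ->
  normal_pdf 0 s x <= 2 * expR (- (3 * y ^+ 2 / (8 * s ^+ 2))) * normal_pdf 0 (2 * s) x.
Proof.
move=> s0 y0 yx; have s2 : 0 < 2 * s by rewrite mulr_gt0.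
rewrite -(normal_pdf_scale _ s2 (_ : 0 < 2^-1)) ?invr_gt0 // mulKf //.
have := s0; rewrite lt0r => /andP[sN _].
rewrite !normal_pdfE // /normal_fun !subr0.
have p0 := normal_peak_ge0 s.
have -> : 2 * expR (- (3 * y ^+ 2 / (8 * s ^+ 2))) * (normal_peak s * expR (- (2^-1 * x) ^+ 2 / (s ^+ 2 *+ 2)) / 2) =
    normal_peak s * (expR (- (3 * y ^+ 2 / (8 * s ^+ 2))) * expR (- (2^-1 * x) ^+ 2 / (s ^+ 2 *+ 2))) by field.
apply: ler_wpM2l => //; rewrite -expRD ler_expR.
have -> : - x ^+ 2 / (s ^+ 2 *+ 2) = - (3 * x ^+ 2 / (8 * s ^+ 2)) + - (2^-1 * x) ^+ 2 / (s ^+ 2 *+ 2).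
  by field.
rewrite lerD2r lerN2 ler_pM2r ?invr_gt0 ?mulr_gt0 ?exprn_gt0 // ler_pM2l //.
by rewrite -(real_normK (num_real x)) lerXn2r // nnegrE.
Qed.

Lemma measurable_norm_gt y : measurable [set x : R | y < `|x|].
Proof.
apply: (measurable_lt_set (X := fun=> y) (Y := fun x : R => `|x|)) => //.
Qed.

Lemma normal_tail : exists2 C : R, 0 < C & forall s y, 0 < s -> 0 < y ->
  (normal_prob 0 s [set x : R | (y < `|x|)%R] <= (C * (s ^+ 2 / y ^+ 2) ^+ 4)%:E)%E.
Proof.
(* The 2 and the exponent [z = 3 y^2 / (8 s^2)] come from the comparison of densities, and
   [expR (- z) <= 256 / z^4]. *)
exists (2 * (256 * (8 / 3) ^+ 4)); first by rewrite !mulr_gt0 // exprn_gt0 // divr_gt0.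
move=> s y s0 y0; have s2 : 0 < 2 * s by rewrite mulr_gt0.
pose k : R := 2 * expR (- (3 * y ^+ 2 / (8 * s ^+ 2))).
have k0 : 0 <= k by rewrite mulr_ge0 // expR_ge0.
have mA := measurable_norm_gt y.
have mp (v : R) (D : set R) : measurable D -> measurable_fun D (EFin \o normal_pdf 0 v).
  by move=> mD; apply/measurable_EFinP; apply: measurable_funTS; exact: measurable_normal_pdf.
apply: (@le_trans _ _ (k%:E * \int[mu]_(x in [set x : R | (y < `|x|)%R]) (normal_pdf 0 (2 * s) x)%:E)%E).
  rewrite -ge0_integralZl_EFin //; first last.
  - exact: mp.
  - by move=> x _; rewrite lee_fin normal_pdf_ge0.
  apply: ge0_le_integral => //.
  - by move=> x _; rewrite lee_fin normal_pdf_ge0.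
  - exact: mp.
  - by apply: measurable_funeM; exact: mp.
  - by move=> x /= yx; rewrite -EFinM lee_fin; apply: normal_pdf_le => //; exact: ltW.
apply: (@le_trans _ _ (k%:E * 1)%E).
  apply: lee_wpmul2l; first by rewrite lee_fin.
  rewrite -(@probability_setT _ _ _ (normal_prob 0 (2 * s))).
  by apply: le_measure => //; rewrite inE.
rewrite mule1 lee_fin /k -[leRHS]mulrA ler_pM2l //.
have z0 : 0 < 3 * y ^+ 2 / (8 * s ^+ 2) by rewrite divr_gt0 // mulr_gt0 // exprn_gt0.
apply: (le_trans (expRN_le_quartic z0)).
rewrite le_eqVlt; apply/orP; left; apply/eqP; field.
by rewrite !gt_eqF.
Qed.

End gaussian_tail.

(** * Union bounds and the Borel-Cantelli lemma *)

Section union_bounds.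
Context {R : realType} {d : measure_display} {T : measurableType d}.
Variable P : probability T R.

Lemma nneseries_le (q : nat -> R) (K : R) : (forall n, 0 <= q n) -> (forall N, \sum_(0 <= n < N) q n <= K) ->
  (\sum_(n <oo) (q n)%:E <= K%:E)%E.
Proof.
move=> q0 qK; apply: lime_le.
  by apply: is_cvg_nneseries => n _ _; rewrite lee_fin.
by apply: nearW => N; rewrite sumEFin lee_fin.
Qed.

Lemma union_bound (E : nat -> set T) (q : nat -> R) (K : R) : (forall n, measurable (E n)) ->
  (forall n, (P (E n) <= (q n)%:E)%E) -> (forall N, \sum_(0 <= n < N) q n <= K) ->
  (P (\bigcup_n E n) <= K%:E)%E.
Proof.
move=> mE Eq qK.
have q0 n : 0 <= q n by rewrite -lee_fin (le_trans _ (Eq n)).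
apply: le_trans (nneseries_le q0 qK).
apply: (le_trans (measure_sigma_subadditive P mE _ (@subset_refl _ _))).
  exact: bigcup_measurable.
by apply: lee_nneseries => [n _ _|n _]; [exact: measure_ge0|exact: Eq].
Qed.

Lemma borel_cantelli (E : nat -> set T) (q : nat -> R) (K : R) : (forall n, measurable (E n)) ->
  (forall n, (P (E n) <= (q n)%:E)%E) -> (forall N, \sum_(0 <= n < N) q n <= K) ->
  P (lim_sup_set E) = 0%E.
Proof.
move=> mE Eq qK; apply: lim_sup_set_cvg0 => //.
have q0 n : 0 <= q n by rewrite -lee_fin (le_trans _ (Eq n)).
apply: (@le_lt_trans _ _ K%:E); last by rewrite ltry.
apply: le_trans (nneseries_le q0 qK).
by apply: lee_nneseries => [n _ _|n _]; [exact: measure_ge0|exact: Eq].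
Qed.

Lemma geometric_sum_le (r : R) N : 0 <= r -> r < 1 -> \sum_(0 <= n < N) r ^+ n <= (1 - r)^-1.
Proof.
move=> r0 r1; have r1' : 0 < 1 - r by rewrite subr_gt0.
rewrite -[leRHS]mul1r ler_pdivlMr //.
have -> : (\sum_(0 <= n < N) r ^+ n) * (1 - r) = 1 - r ^+ N.
  elim: N => [|N IH]; first by rewrite big_geq // mul0r expr0 subrr.
  by rewrite big_nat_recr //= mulrDl IH exprSr; ring.
by rewrite gerBl exprn_ge0.
Qed.

Lemma inverse_square_sum_le N : \sum_(0 <= n < N) (n.+1%:R ^+ 2)^-1 <= 2 :> R.
Proof.
case: N => [|N]; first by rewrite big_geq.
suff : \sum_(0 <= n < N.+1) (n.+1%:R ^+ 2)^-1 <= 2 - N.+1%:R^-1 :> R.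
  by move/le_trans; apply; rewrite gerBl invr_ge0.
elim: N => [|N IH]; first by rewrite big_nat1 expr1n invr1; lra.
rewrite big_nat_recr //=; apply: le_trans (lerD IH (lexx _)) _.
have z0 : 0 < N.+1%:R :> R by [].
have -> : N.+2%:R = N.+1%:R + 1 :> R by rewrite natr1.
move: (N.+1%:R : R) z0 => z z0; have z1 : 0 < z + 1 by lra.
rewrite -subr_ge0.
have -> : 2 - (z + 1)^-1 - (2 - z^-1 + ((z + 1) ^+ 2)^-1) = (z * (z + 1) ^+ 2)^-1.
  by field; rewrite !gt_eqF.
by rewrite invr_ge0 mulr_ge0 ?sqr_ge0 // ltW.
Qed.

End union_bounds.

(** * Dyadic chaining *)

Section dyadic_chaining.
Context {R : realType}.
Implicit Types (B : R -> R) (a y s t e : R) (k i n : nat).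

(** The series of ratio 4/5 sums to 5. The ratio exceeds [1 / sqrt 2], the factor by which Gaussian
    increments shrink under halving, so the exceedance probabilities can be summed over the
    levels. *)
Lemma dyadic_chaining B a y : cts B -> 0 <= y ->
  (forall k i, (i < 2 ^ k)%N -> `|B (a + dyadic k i.+1) - B (a + dyadic k i)| <= y * (4 / 5) ^+ k) ->
  forall s, a <= s <= a + 1 -> `|B s - B a| <= 5 * y.
Proof.
move=> cB y0 h.
have key k i : (i <= 2 ^ k)%N -> `|B (a + dyadic k i) - B a| <= y * \sum_(0 <= j < k.+1) (4 / 5) ^+ j.
  elim: k i => [|k IH] i.
    rewrite expn0 big_nat1 expr0 mulr1 leq_eqVlt => /orP[/eqP ->|].
      by have := h 0%N 0%N isT; rewrite expr0 mulr1 /dyadic mul0r addr0.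
    by rewrite ltnS leqn0 => /eqP ->; rewrite /dyadic mul0r addr0 subrr normr0.
  (* The index [i./2.*2] lies on the coarser grid and is [i] or one step before it. *)
  move=> ik; have j2 : (i./2 <= 2 ^ k)%N.
    by rewrite -(doubleK (2 ^ k)%N) half_leq // -muln2 -expnSr.
  have hj := IH _ j2; rewrite -dyadic_double in hj.
  rewrite big_nat_recr //= mulrDr; move: ik; rewrite -(odd_double_half i).
  have p0 : 0 <= y * (4 / 5) ^+ k.+1 by rewrite mulr_ge0 // exprn_ge0 // divr_ge0.
  case: (odd i) => /= ik; last by rewrite add0n; lra.
  rewrite add1n in ik *; have := h k.+1 _ ik => hi.
  have := ler_distD (B (a + dyadic k.+1 i./2.*2)) (B (a + dyadic k.+1 i./2.*2.+1)) (B a).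
  lra.
have sum5 k : y * \sum_(0 <= j < k.+1) (4 / 5) ^+ j <= 5 * y.
  rewrite mulrC ler_wpM2r //.
  rewrite [leRHS](_ : _ = (1 - 4 / 5)^-1); last by field.
  by apply: geometric_sum_le; lra.
move=> s /andP[as1 sa]; have t0 : 0 <= s - a by rewrite subr_ge0.
apply/ler_addgt0Pr => e e0.
have lim : B (a + dyadic k (Num.trunc ((s - a) * 2 ^+ k))) @[k --> \oo] --> B s.
  rewrite -[X in B X](_ : a + (s - a) = s); last by ring.
  have cc : cts (fun t => B (a + t)) by apply: (cts_comp _ cB); exact: ctsD (cts_cst a) (@cts_id R).
  exact: (cvg_comp _ _ (dyadic_trunc_cvg t0) (@ctsP _ _ cc (s - a))).
move/cvgrPdist_le: lim => /(_ _ e0) [k _ /(_ k (leqnn k)) /= hk].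
have p0 : 0 < 2 ^+ k :> R by rewrite exprn_gt0.
have tk : (Num.trunc ((s - a) * 2 ^+ k) <= 2 ^ k)%N.
  have /andP[h1 _] := truncn_itv (mulr_ge0 t0 (ltW p0)).
  rewrite -(ler_nat R) natrX (le_trans h1) // ler_piMl ?(ltW p0) //; lra.
have := key k _ tk; have := sum5 k.
have := ler_distD (B (a + dyadic k (Num.trunc ((s - a) * 2 ^+ k)))) (B s) (B a); lra.
Qed.

Lemma unit_oscillation B e n0 : 0 < e ->
  (forall n, (n0 <= n)%N -> forall s, n%:R <= s <= n%:R + 1 -> `|B s - B n%:R| <= 5 * Num.sqrt (e * n%:R)) ->
  forall t s, n0.+1%:R <= t -> t <= s <= t + 1 -> (B s - B t) ^+ 2 <= 450 * e * t.
Proof.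
move=> e0 h t s nt /andP[ts st]; have t0 : 0 <= t by rewrite (le_trans _ nt).
have t1 : 1 <= t by rewrite (le_trans _ nt) // ler1n.
have /andP[h1 h2] := truncn_itv t0; set n := Num.trunc t in h1 h2.
have nn : (n0 <= n)%N.
  by have : (n0.+1%:R : R) < n.+1%:R by [exact: le_lt_trans h2]; rewrite ltr_nat ltnS => /ltnW.
have eS : n.+1%:R = n%:R + 1 :> R by rewrite natr1.
have q x y : 0 <= x -> x <= y -> Num.sqrt (e * x) <= Num.sqrt (e * y).
  by move=> x0 xy; apply: ler_wsqrtr; rewrite ler_pM2l.
pose z := Num.sqrt (e * (2 * t)).
have z0 : 0 <= z by rewrite sqrtr_ge0.
have q1 : Num.sqrt (e * n%:R) <= z by apply: q => //; lra.
have q2 : Num.sqrt (e * n.+1%:R) <= z by apply: q => //; lra.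
have a1 : `|B t - B n%:R| <= 5 * z.
  by apply: le_trans (h n nn t _) _; [apply/andP; split; lra|rewrite ler_pM2l].
(* [s] may lie in the next unit interval, hence 10 instead of 5. In total 15, and
   [(15 * z) ^+ 2 = 450 * e * t]. *)
have a2 : `|B s - B n%:R| <= 10 * z.
  have [sn|ns] := leP s n.+1%:R.
    by apply: le_trans (h n nn s _) _; [apply/andP; split; lra|lra].
  have b1 : `|B s - B n.+1%:R| <= 5 * z.
    by apply: le_trans (h n.+1 (leqW nn) s _) _; [apply/andP; split; lra|rewrite ler_pM2l].
  have b2 : `|B n.+1%:R - B n%:R| <= 5 * z.
    by apply: le_trans (h n nn n.+1%:R _) _; [apply/andP; split; lra|rewrite ler_pM2l].
  have := ler_distD (B n.+1%:R) (B s) (B n%:R); lra.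
have a3 : `|B s - B t| <= 15 * z.
  have := ler_distD (B n%:R) (B s) (B t); rewrite [`|B n%:R - B t|]distrC; lra.
rewrite -(real_normK (num_real (B s - B t))).
apply: le_trans (_ : (15 * z) ^+ 2 <= _); first by rewrite lerXn2r // nnegrE mulr_ge0.
rewrite exprMn sqr_sqrtr; last by rewrite mulr_ge0 ?(ltW e0) // mulr_ge0.
rewrite le_eqVlt; apply/orP; left; apply/eqP; ring.
Qed.

(** The integer below [t] carries the bound and the oscillation adds [e^2 n^2 <= e^2 t^3]; the
    factor 8 is that of [(x + y)^4 <= 8 (x^4 + y^4)]. *)
Lemma quartic_growth B e n0 : 0 < e ->
  (forall t s, n0%:R <= t -> t <= s <= t + 1 -> (B s - B t) ^+ 2 <= e * t) ->
  (forall n, (n0 <= n)%N -> B n%:R ^+ 4 <= e * n%:R ^+ 3) ->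
  forall t, n0.+1%:R <= t -> B t ^+ 4 <= 8 * (e + e ^+ 2) * t ^+ 3.
Proof.
move=> e0 osc hn t nt; have t0 : 0 <= t by rewrite (le_trans _ nt).
have t1 : 1 <= t by rewrite (le_trans _ nt) // ler1n.
have /andP[h1 h2] := truncn_itv t0; set n := Num.trunc t in h1 h2.
have nn : (n0 <= n)%N.
  by have : (n0.+1%:R : R) < n.+1%:R by [exact: le_lt_trans h2]; rewrite ltr_nat ltnS => /ltnW.
have eS : n.+1%:R = n%:R + 1 :> R by rewrite natr1.
have a1 := hn n nn.
have a2 : (B t - B n%:R) ^+ 2 <= e * n%:R.
  by apply: osc; [rewrite ler_nat|apply/andP; split; lra].
have a3 : (B t - B n%:R) ^+ 4 <= e ^+ 2 * t ^+ 3.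
  have -> : (B t - B n%:R) ^+ 4 = ((B t - B n%:R) ^+ 2) ^+ 2 by rewrite -exprM.
  apply: le_trans (_ : (e * n%:R) ^+ 2 <= _).
    by rewrite lerXn2r ?nnegrE ?sqr_ge0 // mulr_ge0 // ltW.
  rewrite exprMn ler_pM2l ?exprn_gt0 //.
  apply: le_trans (_ : t ^+ 2 <= _); first by rewrite lerXn2r // nnegrE.
  by rewrite [t ^+ 3]exprS ler_peMl // exprn_ge0.
have a4 : e * n%:R ^+ 3 <= e * t ^+ 3 by rewrite ler_pM2l // lerXn2r // nnegrE.
have q (x y : R) : (x + y) ^+ 4 <= 8 * (x ^+ 4 + y ^+ 4).
  rewrite -subr_ge0.
  have -> : 8 * (x ^+ 4 + y ^+ 4) - (x + y) ^+ 4 =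
      4 * (x ^+ 2 - y ^+ 2) ^+ 2 + (x - y) ^+ 2 * ((x + y) ^+ 2 + 2 * (x ^+ 2 + y ^+ 2)) by ring.
  have s1 := sqr_ge0 x; have s2 := sqr_ge0 y; have s3 := sqr_ge0 (x + y).
  by apply: addr_ge0; apply: mulr_ge0; rewrite ?sqr_ge0 //; lra.
have := q (B n%:R) (B t - B n%:R); rewrite addrCA subrr addr0; lra.
Qed.

End dyadic_chaining.

(** * Almost sure growth of Brownian motion *)

Section brownian_growth.
Context {R : realType} {d : measure_display} {T : measurableType d}.
Variables (P : probability T R) (b : R -> T -> R).
Hypothesis bm : is_brownian_motion P b.
Implicit Types (e s t y : R) (k i n : nat).

Lemma not_lim_sup (E : nat -> set T) w : ~ lim_sup_set E w -> exists n0, forall n, (n0 <= n)%N -> ~ E n w.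
Proof.
move=> h; apply: contrapT => nex; apply: h => n _; apply: contrapT => ne; apply: nex; exists n => k nk Ek.
by apply: ne; exists k.
Qed.

Lemma measurable_incr_gt s t y : measurable [set w | y < `|b t w - b s w|].
Proof.
have [_ _ mb _ _] := bm; apply: (measurable_lt_set (X := fun=> y)) => //.
by apply: measurableT_comp => //; exact: measurable_funB.
Qed.

Lemma brownian_incr_tail : exists2 C : R, 0 < C & forall s t y, 0 <= s -> s < t -> 0 < y ->
  (P [set w | (y < `|b t w - b s w|)%R] <= (C * ((t - s) / y ^+ 2) ^+ 4)%:E)%E.
Proof.
have [C C0 hC] := @normal_tail R; exists C => // s t y s0 st y0.
have [_ _ _ gau _] := bm.
have -> : [set w | y < `|b t w - b s w|] = [set w | b t w - b s w \in [set x : R | y < `|x|]].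
  by apply/seteqP; split=> w /=; rewrite inE.
rewrite (gau _ _ s0 st _ (measurable_norm_gt y)).
have st0 : 0 < t - s by rewrite subr_gt0.
have q0 : 0 < Num.sqrt (t - s) by rewrite sqrtr_gt0.
by have := hC _ _ q0 y0; rewrite sqr_sqrtr // ltW.
Qed.

Lemma sum_if_lt (p : R) M N : 0 <= p -> \sum_(0 <= i < N) (if (i < M)%N then p else 0) <= M%:R * p.
Proof.
move=> p0.
have -> : \sum_(0 <= i < N) (if (i < M)%N then p else 0) = (minn N M)%:R * p.
  elim: N => [|N IH]; first by rewrite big_geq // min0n mul0r.
  rewrite big_nat_recr //= IH; case: ltnP => NM.
    by rewrite (minn_idPl NM) -natr1 mulrDl mul1r.
  by rewrite addr0 (minn_idPr (leqW NM)).
by rewrite ler_wpM2r // ler_nat geq_minr.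
Qed.

(** The thresholds decay as the chaining lemma asks. The index is [n.+1] because their scale
    vanishes at 0. *)
Definition osc_event e n : set T := \bigcup_k \bigcup_i
  (if (i < 2 ^ k)%N then
    [set w | Num.sqrt (e * n.+1%:R) * (4 / 5) ^+ k < `|b (n.+1%:R + dyadic k i.+1) w - b (n.+1%:R + dyadic k i) w|]
  else set0).

Lemma measurable_osc_event e n : measurable (osc_event e n).
Proof.
apply: bigcup_measurable => k _; apply: bigcup_measurable => i _; case: ifP => // _.
exact: measurable_incr_gt.
Qed.

Lemma osc_event_null e : 0 < e -> P (lim_sup_set (osc_event e)) = 0%E.
Proof.
move=> e0; have [C C0 hC] := brownian_incr_tail.
(* At level [k] there are [2 ^ k] increments; variance over squared threshold is of order
   [(1/2)^k / (16/25)^k = (25/32)^k], and the tail bound takes its fourth power. The ratio [rho] is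
   below 1. *)
pose rho : R := 2 * (25 / 32) ^+ 4.
have rho0 : 0 <= rho by rewrite /rho; lra.
have rho1 : rho < 1 by rewrite /rho; lra.
pose K : R := C / e ^+ 4 * (1 - rho)^-1.
have K0 : 0 <= K by rewrite mulr_ge0 ?divr_ge0 ?exprn_ge0 ?invr_ge0 ?subr_ge0 ?(ltW e0) ?(ltW C0) ?(ltW rho1).
apply: (@borel_cantelli _ _ _ P _ (fun n => K * (n.+1%:R ^+ 2)^-1) (K * 2)).
- exact: measurable_osc_event.
- move=> n; pose m : R := n.+1%:R; have m0 : 0 < m by [].
  have m1 : 1 <= m by rewrite ler1n.
  have em : 0 < e * m by rewrite mulr_gt0.
  pose D : R := C / (e * m) ^+ 4.
  have D0 : 0 <= D by rewrite divr_ge0 ?(ltW C0) // exprn_ge0 // ltW.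
  apply: (@union_bound _ _ _ P _ (fun k => D * rho ^+ k)).
  + move=> k; apply: bigcup_measurable => i _; case: ifP => // _.
    exact: measurable_incr_gt.
  + move=> k; pose p : R := D * (rho / 2) ^+ k.
    have p2 : 0 < 2 ^+ k :> R by rewrite exprn_gt0.
    have p0 : 0 <= p by rewrite mulr_ge0 // exprn_ge0 // divr_ge0.
    apply: (@union_bound _ _ _ P _ (fun i => if (i < 2 ^ k)%N then p else 0)).
    * by move=> i; case: ifP => // _; exact: measurable_incr_gt.
    * move=> i; case: ifP => // _; last by rewrite measure0.
      have dy0 : 0 <= m + dyadic k i by rewrite addr_ge0 ?(ltW m0) // divr_ge0 // ltW.
      have dS : dyadic k i.+1 - dyadic k i = (2 ^+ k)^-1 :> R.
        by rewrite /dyadic -mulrBl -natr1 addrAC subrr add0r mul1r.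
      have dlt : m + dyadic k i < m + dyadic k i.+1 by rewrite ltrD2l -subr_gt0 dS invr_gt0.
      have y0 : 0 < Num.sqrt (e * m) * (4 / 5) ^+ k by rewrite mulr_gt0 ?sqrtr_gt0 // exprn_gt0 // divr_gt0.
      apply: (le_trans (hC _ _ _ dy0 dlt y0)); rewrite lee_fin.
      have -> : m + dyadic k i.+1 - (m + dyadic k i) = (2 ^+ k)^-1.
        by rewrite -dS; ring.
      have sq : (Num.sqrt (e * m) * (4 / 5) ^+ k) ^+ 2 = e * m * (16 / 25) ^+ k.
        by rewrite exprMn sqr_sqrtr ?(ltW em) // -exprM mulnC exprM; congr (_ * _ ^+ k); field.
      have vE : (2 ^+ k)^-1 / (16 / 25) ^+ k = (25 / 32) ^+ k :> R.
        by rewrite -exprVn -expr_div_n; congr (_ ^+ k); field.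
      have -> : (2 ^+ k)^-1 / (Num.sqrt (e * m) * (4 / 5) ^+ k) ^+ 2 = (25 / 32) ^+ k / (e * m).
        by rewrite sq invfM mulrCA vE mulrC.
      have -> : p = D * ((25 / 32) ^+ k) ^+ 4.
        by rewrite /p -exprM mulnC exprM; congr (_ * _ ^+ k); rewrite /rho; field.
      by rewrite expr_div_n /D mulrA mulrAC.
    * move=> N; apply: (le_trans (sum_if_lt _ _ p0)).
      by rewrite natrX /p mulrCA -exprMn [2 * _]mulrC divfK.
  + move=> N; rewrite -mulr_sumr.
    apply: le_trans (_ : D * (1 - rho)^-1 <= _).
      by rewrite ler_wpM2l // geometric_sum_le.
    rewrite /D /K exprMn invfM mulrA -!mulrA ler_pM2l //.
    rewrite ler_wpM2l ?invr_ge0 ?exprn_ge0 ?(ltW e0) // mulrC ler_wpM2l ?invr_ge0 ?subr_ge0 ?(ltW rho1) //.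
    by rewrite lef_pV2 ?posrE ?exprn_gt0 // ler_weXn2l.
- move=> N; rewrite -mulr_sumr ler_wpM2l //; exact: inverse_square_sum_le.
Qed.

(** The threshold is the fourth root of [e n^3] at [n.+1]. The Gaussian bound turns it into a
    probability at most [C / (e^2 n^2)], which is summable. *)
Definition growth_event e n : set T := [set w | Num.sqrt (Num.sqrt (e * n.+1%:R ^+ 3)) < `|b n.+1%:R w - b 0 w|].

Lemma growth_event_null e : 0 < e -> P (lim_sup_set (growth_event e)) = 0%E.
Proof.
move=> e0; have [C C0 hC] := brownian_incr_tail.
pose K : R := C / e ^+ 2.
have K0 : 0 <= K by rewrite divr_ge0 ?exprn_ge0 // ltW.
apply: (@borel_cantelli _ _ _ P _ (fun n => K * (n.+1%:R ^+ 2)^-1) (K * 2)).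
- by move=> n; exact: measurable_incr_gt.
- move=> n; pose m : R := n.+1%:R; have m0 : 0 < m by [].
  have em : 0 < e * m ^+ 3 by rewrite mulr_gt0 // exprn_gt0.
  have y0 : 0 < Num.sqrt (Num.sqrt (e * m ^+ 3)) by rewrite !sqrtr_gt0.
  apply: (le_trans (hC 0 m _ (lexx 0) m0 y0)); rewrite lee_fin subr0 sqr_sqrtr ?sqrtr_ge0 //.
  have -> : (m / Num.sqrt (e * m ^+ 3)) ^+ 4 = m ^+ 4 / (e * m ^+ 3) ^+ 2.
    by rewrite expr_div_n (exprM (Num.sqrt _) 2 2) sqr_sqrtr // ltW.
  rewrite le_eqVlt; apply/orP; left; apply/eqP; rewrite /K -/m; field.
  by rewrite !gt_eqF.
- move=> N; rewrite -mulr_sumr ler_wpM2l //; exact: inverse_square_sum_le.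
Qed.

(** A countable family of values of [e] yields one null event outside which every path is tame. *)
Definition wild_event : set T := \bigcup_j
  (lim_sup_set (osc_event j.+1%:R^-1) `|` lim_sup_set (growth_event j.+1%:R^-1)).

Lemma measurable_lim_sup (E : nat -> set T) : (forall n, measurable (E n)) -> measurable (lim_sup_set E).
Proof.
by move=> mE; apply: bigcap_measurableType => n _; apply: bigcup_measurable => k _; exact: mE.
Qed.

Lemma wild_event_null : measurable wild_event /\ P wild_event = 0%E.
Proof.
have m1 e : measurable (lim_sup_set (osc_event e)) by apply: measurable_lim_sup; exact: measurable_osc_event.
have m2 e : measurable (lim_sup_set (growth_event e)) by apply: measurable_lim_sup => n; exact: measurable_incr_gt.
have mj j : measurable (lim_sup_set (osc_event j.+1%:R^-1) `|` lim_sup_set (growth_event j.+1%:R^-1)).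
  by apply: measurableU.
split; first by apply: bigcup_measurable.
apply/eqP; rewrite eq_le measure_ge0 andbT.
apply: (@union_bound _ _ _ P _ (fun=> 0)) => //; last by move=> N; rewrite big1.
move=> j; have j0 : 0 < j.+1%:R^-1 :> R by rewrite invr_gt0.
apply: (le_trans (measureU2 P (m1 _) (m2 _))).
have le0 (x : \bar R) : x = 0%E -> (x <= 0)%E by move=> ->.
rewrite -[leRHS]adde0; apply: leeD; apply: le0; [exact: osc_event_null|exact: growth_event_null].
Qed.

Lemma brownian_tame w : ~ wild_event w -> tame (fun x => b `|x| w).
Proof.
move=> nw; have [cB B0] := brownian_cpath w bm.
set B := fun x => b `|x| w in cB *.
have BE t : 0 <= t -> B t = b t w by move=> t0; rewrite /B ger0_norm.
have nj j : ~ lim_sup_set (osc_event j.+1%:R^-1) w /\ ~ lim_sup_set (growth_event j.+1%:R^-1) w.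
  by split=> h; apply: nw; exists j => //; [left|right].
have osc j : exists n0, forall t s, n0%:R <= t -> t <= s <= t + 1 -> (B s - B t) ^+ 2 <= 450 * j.+1%:R^-1 * t.
  have e0 : 0 < j.+1%:R^-1 :> R by rewrite invr_gt0.
  have [n0 h] := not_lim_sup (nj j).1; exists n0.+2.
  apply: (unit_oscillation e0) => -[//|n] nn; rewrite ltnS in nn.
  have hn := h n nn.
  have em : 0 <= j.+1%:R^-1 * n.+1%:R :> R by rewrite mulr_ge0 // ltW.
  apply: dyadic_chaining => //.
  move=> k i ik; have p2 : 0 < 2 ^+ k :> R by rewrite exprn_gt0.
  rewrite !BE ?addr_ge0 ?divr_ge0 ?(ltW p2) // leNgt; apply/negP => lt.
  by apply: hn; exists k => //; exists i => //; rewrite ik.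
have small e : 0 < e -> exists j : nat, j.+1%:R^-1 <= e.
  move=> e0; have [j hj] := nat_ge_real e^-1; exists j.
  by rewrite -[leRHS]invrK lef_pV2 ?posrE ?invr_gt0 //; apply: (le_trans hj); rewrite ler_nat.
have osce e : 0 < e -> exists n0, forall t s, n0%:R <= t -> t <= s <= t + 1 -> (B s - B t) ^+ 2 <= e * t.
  move=> e0; have [j hj] := small (e / 450) (divr_gt0 e0 (ltr0n _ 450)).
  have [n0 h] := osc j; exists n0 => t s nt ts; apply: (le_trans (h t s nt ts)).
  rewrite ler_wpM2r ?(le_trans _ nt) //.
  by move: hj; move: (_^-1) => x; lra.
split=> e e0; last first.
  by have [n0 h] := osce e e0; exists n0%:R.
pose e1 := Num.min 1 (e / 16).
(* With [x <= 1] and [x <= e / 16], [8 * (x + x ^+ 2) <= 16 * x <= e]. *)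
have e10 : 0 < e1 by rewrite lt_min ltr01 divr_gt0.
have [j hj] := small e1 e10; have j0 : 0 < j.+1%:R^-1 :> R by rewrite invr_gt0.
have [n1 h1] := osce _ e10; have [n2 h2] := not_lim_sup (nj j).2.
exists (maxn n1 n2.+1).+1%:R => t nt; have t0 : 0 <= t by rewrite (le_trans _ nt).
apply: le_trans (quartic_growth e10 _ _ nt) _.
- by move=> u s nu; apply: h1; apply: le_trans nu; rewrite ler_nat leq_maxl.
- move=> n; rewrite geq_max => /andP[_]; case: n => // n nn.
  apply: le_trans (_ : j.+1%:R^-1 * n.+1%:R ^+ 3 <= _); last by rewrite ler_pM2r ?exprn_gt0.
  have em : 0 <= j.+1%:R^-1 * n.+1%:R ^+ 3 :> R by rewrite mulr_ge0 ?exprn_ge0 // ltW.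
  have : `|B n.+1%:R| <= Num.sqrt (Num.sqrt (j.+1%:R^-1 * n.+1%:R ^+ 3)).
    have := h2 n nn; rewrite /growth_event /= -!BE // [B 0]B0 subr0 => /negP.
    by rewrite -leNgt.
  move=> h; rewrite -[B _ ^+ 4]ger0_norm; last by rewrite (exprM _ 2 2) sqr_ge0.
  rewrite normrX; apply: le_trans (_ : Num.sqrt (Num.sqrt (j.+1%:R^-1 * n.+1%:R ^+ 3)) ^+ 4 <= _).
    by rewrite lerXn2r ?nnegrE ?sqrtr_ge0.
  by rewrite (exprM (Num.sqrt _) 2 2) !sqr_sqrtr ?sqrtr_ge0.
rewrite ler_wpM2r ?exprn_ge0 //.
have q (x : R) : 0 < x -> x <= 1 -> x <= e / 16 -> 8 * (x + x ^+ 2) <= e by nra.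
by apply: q; rewrite ?e10 // ge_min lexx ?orbT.
Qed.

End brownian_growth.

(** * Convergence in distribution *)

Section probability_limits.
Context {R : realType} {d : measure_display} {T : measurableType d}.
Variable P : probability T R.

Lemma fine_probability_le (A C : set T) : measurable A -> measurable C -> A `<=` C -> fine (P A) <= fine (P C).
Proof.
move=> mA mC AC; apply: fine_le; rewrite ?fin_num_measure //.
by apply: le_measure; rewrite ?inE.
Qed.

(** The tail intersections [A k] increase to a set containing [G] up to the null set [W]. Continuity
    from below thus turns a path-dependent index into a single one, at the price of [e]. *)
Lemma eventually_in_probability (E : nat -> set T) (G W : set T) (e : R) : (forall n, measurable (E n)) ->
  measurable G -> measurable W -> P W = 0%E -> 0 < e ->
  (forall w, G w -> ~ W w -> exists k, forall n, (k <= n)%N -> E n w) ->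
  exists k, forall n, (k <= n)%N -> fine (P G) - e <= fine (P (E n)).
Proof.
move=> mE mG mW W0 e0 h.
pose A k := \bigcap_(n in [set n | (k <= n)%N]) E n.
have mA k : measurable (A k) by apply: bigcap_measurableType.
have ndA : nondecreasing_seq A.
  by move=> i j ij; apply/subsetPset => w Aw n /= jn; apply: Aw; exact: leq_trans jn.
have mU : measurable (\bigcup_k A k) by exact: bigcup_measurable.
have GU : fine (P G) <= fine (P (\bigcup_k A k)).
  apply: le_trans (_ : fine (P ((\bigcup_k A k) `|` W)) <= _).
    apply: fine_probability_le => //; first exact: measurableU.
    move=> w Gw; have [Ww|nW] := pselect (W w); [by right|left].
    by have [k hk] := h w Gw nW; exists k.
  apply: fine_le; rewrite ?fin_num_measure //; first exact: measurableU.
  by apply: (le_trans (measureU2 P mU mW)); rewrite [X in (_ + X)%E](W0 : _ = _) adde0.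
have cv := nondecreasing_cvg_mu (mu := P) mA mU ndA.
have : fine (P (A k)) @[k --> \oo] --> fine (P (\bigcup_k A k)).
  apply: fine_cvg; rewrite fineK ?fin_num_measure //; exact: cv.
move/cvgrPdist_le => /(_ e e0) [k _ /(_ k (leqnn k)) /=].
rewrite ler_norml => /andP[_ hk]; exists k => n kn.
have : fine (P (A k)) <= fine (P (E n)) by apply: fine_probability_le => // w; apply.
lra.
Qed.

End probability_limits.

(** * The parameter d = eta^(-1/6) *)

Section soft_edge_scaling.
Context {R : realType}.
Implicit Types (eta m L : R).

Lemma sixth_rootX eta n : 0 < eta -> (eta `^ 6^-1) ^+ n = eta `^ (n%:R / 6).
Proof. by move=> e0; rewrite -powR_mulrn ?powR_ge0 // -powRrM mulrC. Qed.

Lemma sixth_root eta : 0 < eta ->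
  [/\ (eta `^ 6^-1) ^+ 6 = eta, (eta `^ 6^-1) ^+ 3 = Num.sqrt eta & (eta `^ 6^-1) ^+ 4 = eta `^ (2 / 3)].
Proof.
move=> e0; rewrite !sixth_rootX //; split.
- by rewrite divff ?powRr1 ?(ltW e0) // pnatr_eq0.
- by rewrite -powR12_sqrt ?(ltW e0) //; congr (_ `^ _); field.
- by congr (_ `^ _); field.
Qed.

Lemma soft_edge_event eta s m L : 0 < s -> s ^+ 6 = eta -> s ^+ 4 = eta `^ (2 / 3) ->
  ((eta - L) / eta `^ (2 / 3) < m) = (scaled_lam m s^-1 < L).
Proof.
move=> s0 s6 s4; rewrite -s4 -{1}s6 ltr_pdivrMr ?exprn_gt0 //.
have -> : scaled_lam m s^-1 = s ^+ 6 - m * s ^+ 4 by rewrite /scaled_lam; field; rewrite gt_eqF.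
by rewrite ltrBlDr ltrBlDr addrC.
Qed.

End soft_edge_scaling.

(** * Squeezing the probabilities *)

Section convergence.
Context {R : realType} {d : measure_display} {T : measurableType d}.
Variables (P : probability T R) (b : R -> T -> R) (beta : R).
Hypotheses (beta0 : 0 < beta) (bm : is_brownian_motion P b).

Local Notation path w := (fun x => b x w).
Local Notation G m := [set w | TW_survives beta m (path w)].

Definition edge_event (m r : R) : set T :=
  [set w | scaled_lam m r < Lambda0 beta (2 / r ^+ 3 - 2 / beta) (rescaled_path (path w) r)].

Let cpath_w w : {within `[0, +oo[%classic, continuous (path w)}.
Proof. by have [_ cb _ _ _] := bm. Qed.

Lemma edge_event_eventually m m' w : m' < m -> G m' w -> ~ wild_event b w ->
  exists2 r0 : R, 0 < r0 & forall r, 0 < r -> r <= r0 -> edge_event m r w.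
Proof.
move=> mm Gw nW; have tB := brownian_tame bm nW.
have [r0 r00 h] := Lambda0_eventually_gt beta0 (@cpath_w w) tB mm (tw_survives_pos (@cpath_w w) Gw).
by exists r0 => // r p q; exact: (h r p q).
Qed.

Lemma edge_event_eventually_not m w : ~ G m w -> ~ wild_event b w ->
  exists2 r0 : R, 0 < r0 & forall r, 0 < r -> r <= r0 -> ~ edge_event m r w.
Proof.
move=> nG nW; have tB := brownian_tame bm nW.
have [t t0 ut] : exists2 t, 0 < t & twu (noise_coef beta) m (fun x => b `|x| w) t <= 0.
  apply: contrapT => nex; apply: nG; apply: (tw_survives_of (@cpath_w w)) => t t0.
  by rewrite ltNge; apply/negP => ut; apply: nex; exists t.
have [s s0 us] := twu_nonpos_neg (within_Rp_hat (@cpath_w w)) t0 ut.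
have [r0 r00 h] := Lambda0_eventually_le beta0 (@cpath_w w) tB s0 us.
by exists r0 => // r p q; rewrite /edge_event /= ltNge (h r p q).
Qed.

(** The lower bound comes from survival at some [m' < m], chosen by continuity within [e / 2]; the
    upper bound from extinction at [m] itself, through complements. *)
Lemma edge_probability_limit (m : R) (r : nat -> R) (e : R) :
  {for m, continuous (fun m : R => fine (P (G m)))} -> (forall n, 0 < r n) ->
  (forall r0 : R, 0 < r0 -> exists k, forall n, (k <= n)%N -> r n <= r0) ->
  (forall n, measurable (edge_event m (r n))) -> 0 < e ->
  exists k, forall n, (k <= n)%N -> `|fine (P (G m)) - fine (P (edge_event m (r n)))| <= e.
Proof.
move=> cG r0 rlim mE e0; have [mW W0] := wild_event_null bm.
have mG x : measurable (G x) by exact: (measurable_brownian_TW bm).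
have e2 : 0 < e / 2 by rewrite divr_gt0.
have [m' mm hm'] : exists2 m', m' < m & fine (P (G m)) - fine (P (G m')) <= e / 2.
  move/cvgrPdist_le: cG => /(_ _ e2) /nbhs_ballP [q /= q0 hq].
  exists (m - q / 2); first by rewrite gtrBl divr_gt0.
  have := hq (m - q / 2); rewrite /ball /= opprB addrCA subrr addr0 gtr0_norm ?divr_gt0 // => /(_ _).
  by move=> h; have := h ltac:(lra); rewrite ler_norml => /andP[].
have [k1 h1] := eventually_in_probability mE (mG m') mW W0 e2 (fun w Gw nW =>
  let: ex_intro2 q q0 hq := edge_event_eventually mm Gw nW in
  let: ex_intro k hk := rlim q q0 in
  ex_intro _ k (fun n kn => hq (r n) (r0 n) (hk n kn))).
have [k2 h2] := eventually_in_probability (fun n => measurableC (mE n)) (measurableC (mG m)) mW W0 e0 (fun w Gw nW =>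
  let: ex_intro2 q q0 hq := edge_event_eventually_not Gw nW in
  let: ex_intro k hk := rlim q q0 in
  ex_intro _ k (fun n kn => hq (r n) (r0 n) (hk n kn))).
exists (maxn k1 k2) => n; rewrite geq_max => /andP[n1 n2].
have fC (A : set T) : measurable A -> fine (P (~` A)) = 1 - fine (P A).
  move=> mA; rewrite probability_setC // fineB ?fin_num_measure //.
have := h1 n n1; have := h2 n n2; rewrite !fC // => l1 l2.
by rewrite ler_norml; apply/andP; split; lra.
Qed.

(** Smallness of [|m| d^2] makes [scaled_lam] positive, the range in which the events for [Lambda0]
    are known to be measurable. *)
Lemma soft_edge_law (m eta : R) : 0 < eta -> `|m| * (eta `^ 6^-1)^-1 ^+ 2 <= 2^-1 ->
  measurable (edge_event m (eta `^ 6^-1)^-1) /\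
  P [set w | (eta - Lambda0 beta (2 * Num.sqrt eta - 2 / beta) (path w)) / (eta `^ (2 / 3)) < m] =
  P (edge_event m (eta `^ 6^-1)^-1).
Proof.
move=> e0 small; have [s6 s3 s4] := sixth_root e0.
have s0 : 0 < eta `^ 6^-1 by exact: powR_gt0.
set s := eta `^ 6^-1 in s0 s3 s4 s6 small *.
have r0 : 0 < s^-1 by rewrite invr_gt0.
have x0 := scaled_lam_gt0 r0 small.
have [mE eqE] := Lambda0_rescaled_law beta (2 / s^-1 ^+ 3 - 2 / beta) bm x0 r0.
have aE : 2 * Num.sqrt eta - 2 / beta = 2 / s^-1 ^+ 3 - 2 / beta by rewrite -s3 exprVn invrK.
have eS : [set w | (eta - Lambda0 beta (2 * Num.sqrt eta - 2 / beta) (path w)) / (eta `^ (2 / 3)) < m] =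
    [set w | scaled_lam m s^-1 < Lambda0 beta (2 / s^-1 ^+ 3 - 2 / beta) (path w)].
  by rewrite aE; apply/funext => w; rewrite /mkset (soft_edge_event _ _ s0 s6 s4).
exact (conj mE (etrans (congr1 P eS) eqE)).
Qed.

Lemma sixth_root_small (r0 : R) : 0 < r0 -> forall eta, r0 ^- 6 <= eta -> 0 < eta /\ (eta `^ 6^-1)^-1 <= r0.
Proof.
move=> r00 eta h; have e0 : 0 < eta by apply: lt_le_trans h; rewrite invr_gt0 exprn_gt0.
split=> //; have [s6 _ _] := sixth_root e0.
have s0 : 0 < eta `^ 6^-1 by exact: powR_gt0.
rewrite -[leRHS]invrK lef_pV2 ?posrE ?invr_gt0 //.
by rewrite -(@ler_pXn2r _ 6) ?nnegrE ?invr_ge0 ?(ltW r00) ?(ltW s0) // s6 exprVn.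
Qed.

End convergence.

(* P(TW_beta < mu) = P[TW_survives beta mu (path)]; convergence in distribution
   is stated as convergence of P(X_eta < mu) at every continuity point mu of the
   limit distribution function. *)
Theorem theorem3 (R : realType) (d : measure_display) (T : measurableType d)
    (P : probability T R) (b : R -> T -> R) (beta : R) :
  0 < beta -> is_brownian_motion P b ->
  forall mu0 : R,
    {for mu0, continuous
       (fun m : R => fine (P [set w | TW_survives beta m (fun x => b x w)]))} ->
    (fun eta : R =>
       P [set w | (eta - Lambda0 beta (2 * Num.sqrt eta - 2 / beta) (fun x => b x w))
                  / (eta `^ (2 / 3)) < mu0])
      @ +oo
    --> P [set w | TW_survives beta mu0 (fun x => b x w)].
Proof.
move=> beta0 bm mu0 cG.
(* Up to [r1] the smallness condition of [soft_edge_law] holds, so that lemma applies to all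
   [eta >= r1 ^- 6]. *)
pose r1 : R := Num.min 1 (2 * (`|mu0| + 1))^-1.
have q0 : 0 < 2 * (`|mu0| + 1) by rewrite mulr_gt0 // ltr_wpDl.
have r10 : 0 < r1 by rewrite lt_min ltr01 invr_gt0.
have r1small r : 0 < r -> r <= r1 -> `|mu0| * r ^+ 2 <= 2^-1.
  move=> r0; rewrite le_min => /andP[rle1 rq].
  apply: le_trans (_ : (`|mu0| + 1) * r <= _).
    apply: ler_pM => //; first by rewrite exprn_ge0 // ltW.
      by rewrite lerDl.
    by rewrite expr2 ler_piMl // ltW.
  rewrite mulrC -ler_pdivlMr ?ltr_wpDl //; apply: (le_trans rq).
  by rewrite invfM.
have law eta : r1 ^- 6 <= eta -> measurable (edge_event b beta mu0 (eta `^ 6^-1)^-1) /\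
    P [set w | (eta - Lambda0 beta (2 * Num.sqrt eta - 2 / beta) (fun x => b x w)) / (eta `^ (2 / 3)) < mu0] =
    P (edge_event b beta mu0 (eta `^ 6^-1)^-1).
  move=> /(sixth_root_small r10) [e0 rr].
  have sm : `|mu0| * (eta `^ 6^-1)^-1 ^+ 2 <= 2^-1 by apply: r1small => //; rewrite invr_gt0 powR_gt0.
  exact (soft_edge_law beta bm e0 sm).
have mG := measurable_brownian_TW bm beta mu0.
rewrite -[X in _ --> X]fineK ?fin_num_measure //; apply: cvg_EFin.
  near=> eta; have [|mE ->] := law eta; first by near: eta; apply: nbhs_pinfty_ge; rewrite num_real.
  by rewrite fin_num_measure.
(* Continuity of measure works along sequences, so the limit at infinity is tested on an arbitrary
   sequence. *)
apply/cvg_pinftyP => u uoo.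
have ev (x : R) : exists k : nat, forall n, (k <= n)%N -> x <= u n.
  by move/cvgryPge: uoo => /(_ x) [k _ hk]; exists k => n kn; exact: hk.
have [N hN] := ev (r1 ^- 6).
apply/cvgrPdist_le => e e0.
(* The shift by [N] puts every index in the range where the events are measurable. *)
have [| | |k hk] := @edge_probability_limit R d T P b beta beta0 bm mu0 (fun n => (u (n + N)%N `^ 6^-1)^-1) e cG _ _ _ e0.
- by move=> n; rewrite invr_gt0 powR_gt0 //; have [] := sixth_root_small r10 (hN _ (leq_addl n N)).
- move=> r0 r00; have [k hk] := ev (r0 ^- 6); exists k => n kn.
  by have [] := sixth_root_small r00 (hk (n + N)%N (leq_trans kn (leq_addr _ _))).
- by move=> n; have [] := law _ (hN _ (leq_addl n N)).
exists (k + N)%N => // n /= kn; have Nn : (N <= n)%N := leq_trans (leq_addl k N) kn.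
have [_ ->] := law _ (hN n Nn).
by have := hk (n - N)%N; rewrite subnK //; apply; rewrite leq_subRL // addnC.
Unshelve. all: by end_near. Qed.
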